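(* Let $M$ be a complex manifold of complex dimension $n>1$, let $1\le p<n$, and let $\mathcal F$ be a locally Monge-Ampère complex foliation of $M$ whose leaves have complex dimension $n-p$ (that is, of complex codimension $p$). If every leaf of $\mathcal F$ is parabolic, then $\mathcal F$ is a holomorphic foliation.
   Context: A complex foliation of $M$ is a smooth ($C^\infty$) foliation of $M$ whose leaves are (immersed) complex submanifolds of $M$. Denote by $\mathcal T\subset T^{(1,0)}M$ the distribution of $(1,0)$-vectors tangent to the leaves. A complex foliation $\mathcal F$ of codimension $p$ is locally Monge-Ampère if every point $q\in M$ has an open neighborhood $U$ on which there is a smooth plurisubharmonic function $u:U\to\mathbf R$ with $(dd^cu)^{p+1}=0$ and $(dd^cu)^p\neq 0$ at every point of $U$, such that $\mathcal F|_U=\mathrm{Ann}(dd^cu)$, i.e. on $U$ the distribution $\mathcal T$ is the annihilator (kernel) of $dd^cu$: in local coordinates, $\sum_j a^j\partial_{z_j}\in\mathcal T$ iff $\sum_j a^j\,\partial^2u/\partial z_j\partial\bar z_k=0$ for all $k$. A leaf $L$ is parabolic if there is a holomorphic covering map $F:\mathbf C^{n-p}\to L$. The foliation $\mathcal F$ is called holomorphic if $\mathcal T$ is a holomorphic sub-bundle of $T^{(1,0)}M$. *)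

(* Defs.v *)
From HB Require Import structures.
From Stdlib Require Relation_Operators.
From mathcomp Require Import all_boot all_order all_fingroup all_algebra.
From mathcomp Require Import complex.
From mathcomp Require Import all_classical all_reals all_analysis.
Set Implicit Arguments.
Unset Strict Implicit.
Unset Printing Implicit Defensive.
Import Order.TTheory GRing.Theory Num.Theory.
Import numFieldNormedType.Exports.
Local Open Scope classical_set_scope.
Local Open Scope ring_scope.

(* R[i], registered as a numFieldType so that it inherits the topology and the
   norm that MathComp-Analysis puts on every such field. *)
Definition Cx (R : realType) : numFieldType := complex R.

Definition ofR {R : realType} (t : R) : Cx R := Complex t 0.

Definition iC {R : realType} : Cx R := Complex 0 1.

Section Calculus.
Variables (R : realType) (n : nat).
Local Notation C := (Cx R).
Local Notation V := 'rV[C]_n.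
Implicit Types (O : set V) (f u : V -> R) (v : V) (z : V).

(* V is C^n seen as R^(2n): v is an arbitrary real direction. *)
Definition rderiv v f z : R := derive1 (fun t : R => f (z + ofR t *: v)) 0.

Definition rderivable v f z : Prop :=
  derivable (fun t : R => f (z + ofR t *: v)) 0 1.

Definition iter_rderiv (vs : seq V) f : V -> R := foldr rderiv f vs.

(* Smoothness (C^oo) over the reals. *)
Definition smooth_on O f : Prop := forall (vs : seq V) z, O z ->
  {for z, continuous (iter_rderiv vs f)} /\
  (forall v, rderivable v (iter_rderiv vs f) z).

Definition smooth_map_on (m : nat) O (g : V -> 'rV[C]_m) : Prop :=
  forall j : 'I_m, smooth_on O (fun z => complex.Re (g z 0 j)) /\
                   smooth_on O (fun z => complex.Im (g z 0 j)).

(* Differentiability over C at every point of an open set. *)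
Definition holomorphic_on (W : normedModType C) O (g : V -> W) : Prop :=
  forall z, O z -> differentiable g z.

Definition cderiv v (g : V -> C) z : C :=
  Complex (rderiv v (fun y => complex.Re (g y)) z)
          (rderiv v (fun y => complex.Im (g y)) z).

(* Wirtinger derivatives; delta_mx 0 j and iC *: delta_mx 0 j are the
   directions of x_j and y_j, where z_j = x_j + i y_j. *)
Definition dz (j : 'I_n) (g : V -> C) z : C :=
  2^-1 * (cderiv (delta_mx 0 j) g z - iC * cderiv (iC *: delta_mx 0 j) g z).

Definition dzbar (j : 'I_n) (g : V -> C) z : C :=
  2^-1 * (cderiv (delta_mx 0 j) g z + iC * cderiv (iC *: delta_mx 0 j) g z).

Definition levi u (j k : 'I_n) z : C := dz j (dzbar k (fun y => ofR (u y))) z.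

(* Real alternating forms on the real vector space underlying V, as functions
   of k vectors. *)
Definition kform (k : nat) := ('I_k -> V) -> R.

Definition wedge (k l : nat) (a : kform k) (b : kform l) : kform (k + l) :=
  fun v : 'I_(k + l) -> V => ((k`! * l`!)%N%:R)^-1 *
    \sum_(s : 'S_(k + l)) (-1) ^+ s * a (fun i => v (s (lshift l i)))
                                    * b (fun j => v (s (rshift k j))).

Fixpoint wedge_pow (w : kform 2) (k : nat) : kform (k * 2) :=
  match k with
  | 0 => fun=> 1
  | k'.+1 => wedge w (@wedge_pow w k')
  end.

(* d^c u = - du o J = i (dbar - d) u, where J is multiplication by i. *)
Definition dc u z v : R := - rderiv (iC *: v) u z.

(* d alpha (X, Y) = X (alpha Y) - Y (alpha X) for constant vector fields. *)
Definition d1 (alpha : V -> V -> R) z : kform 2 := fun v : 'I_2 -> V =>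
  rderiv (v ord0) (fun y => alpha y (v ord_max)) z -
  rderiv (v ord_max) (fun y => alpha y (v ord0)) z.

Definition ddc u z : kform 2 := d1 (dc u) z.

(* Sub-mean value inequality on closed discs of complex lines.  Upper
   semicontinuity is left out: the functions considered are smooth. *)
Definition submean_on O u : Prop := forall z v : V,
  (forall t : C, `|t| <= 1 -> O (z + t *: v)) ->
  u z <= (2 * pi)^-1 *
    Rintegral lebesgue_measure `[0, 2 * pi]%classic
      (fun t : R => u (z + (Complex (cos t) (sin t) : C) *: v)).

Definition smooth_psh_on O u : Prop := smooth_on O u /\ submean_on O u.

End Calculus.

Arguments wedge_pow {R n} w k v.

(* Charts valued in C^n.  cinv matters only on the image of the chart.  They
   serve as holomorphic charts and, with C^n seen as R^(2n), as merely smooth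
   foliated charts. *)
Record chart (R : realType) (M : topologicalType) (n : nat) := Chart {
  cdom : set M;
  cmap : M -> 'rV[Cx R]_n;
  cinv : 'rV[Cx R]_n -> M }.

Section Charts.
Variables (R : realType) (M : topologicalType) (n : nat).
Implicit Types (c : chart R M n) (A : set (chart R M n)).

Definition is_chart c : Prop :=
  [/\ open (cdom c), open (cmap c @` cdom c),
      (forall y, cdom c y -> cinv c (cmap c y) = y),
      (forall y, cdom c y -> {for y, continuous (cmap c)}) &
      (forall z, (cmap c @` cdom c) z -> {for z, continuous (cinv c)})].

Definition overlap c c' : set 'rV[Cx R]_n := cmap c @` (cdom c `&` cdom c').

Definition hol_compatible c c' : Prop :=
  holomorphic_on (overlap c c') (cmap c' \o cinv c) /\
  holomorphic_on (overlap c' c) (cmap c \o cinv c').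

Definition smooth_compatible c c' : Prop :=
  smooth_map_on (overlap c c') (cmap c' \o cinv c) /\
  smooth_map_on (overlap c' c) (cmap c \o cinv c').

End Charts.

Record complexManifold (R : realType) (n : nat) := ComplexManifold {
  space :> topologicalType;
  atlas : set (chart R space n);
  space_hausdorff : hausdorff_space space;
  space_second_countable : @second_countable space;
  atlas_chart : forall c, atlas c -> is_chart c;
  atlas_cover : forall q : space, exists2 c, atlas c & cdom c q;
  atlas_compatible : forall c c', atlas c -> atlas c' -> hol_compatible c c' }.

Section Foliations.
Variables (R : realType) (n : nat) (M : complexManifold R n).
Local Notation C := (Cx R).

Definition hol_chart (c : chart R M n) : Prop :=
  is_chart c /\ (forall c', atlas c' -> hol_compatible c c').

Definition complex_submanifold (k : nat) (S : set M) : Prop :=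
  forall q, S q -> exists c : chart R M n,
    [/\ hol_chart c, cdom c q &
        forall y, cdom c y ->
          (S y <-> (forall i : 'I_n, (k <= i)%N -> cmap c y 0 i = 0))].

(* The model is C^k x C^(n-k): coordinates of index < k run along the plaques,
   those of index >= k are transverse to them. *)
Definition same_transverse (k : nat) (x y : 'rV[C]_n) : Prop :=
  forall i : 'I_n, (k <= i)%N -> x 0 i = y 0 i.

Definition plaque (k : nat) (c : chart R M n) (q : M) : set M :=
  [set y | cdom c y /\ same_transverse k (cmap c q) (cmap c y)].

(* A foliation is given by a smooth foliated atlas whose charts have polydiscs
   as images (balls for the max norm), so that plaques are connected.  The
   compatibility condition says that transverse coordinates are locally
   functions of one another.  Leaves are complex because plaques are. *)
Record complexFoliation (k : nat) := ComplexFoliation {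
  fatlas : set (chart R M n);
  fatlas_chart : forall c, fatlas c -> is_chart c;
  fatlas_cover : forall q : M, exists2 c, fatlas c & cdom c q;
  fatlas_smooth : forall c c', fatlas c -> atlas c' -> smooth_compatible c c';
  fatlas_polydisc : forall c, fatlas c ->
    exists (x : 'rV[C]_n) (r : C), 0 < r /\ cmap c @` cdom c = ball x r;
  fatlas_compatible : forall c c' q, fatlas c -> fatlas c' ->
    cdom c q -> cdom c' q ->
    exists W : set M,
      [/\ open W, W q, W `<=` cdom c `&` cdom c' &
          forall x y, W x -> W y -> same_transverse k (cmap c x) (cmap c y) ->
            same_transverse k (cmap c' x) (cmap c' y)];
  fatlas_complex : forall c q, fatlas c -> cdom c q ->
    complex_submanifold k (plaque k c q) }.

Section OneFoliation.
Variables (k : nat) (F : complexFoliation k).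

Definition same_plaque (x y : M) : Prop :=
  exists c, [/\ fatlas F c, cdom c x & plaque k c x y].

(* Points reached from q along a chain of plaques. *)
Definition leaf (q : M) : set M :=
  [set y | Relation_Operators.clos_refl_trans M same_plaque q y].

(* Open sets of the leaf topology, for which the leaves are immersed complex
   submanifolds: the trace on each plaque is relatively open. *)
Definition leaf_open (W : set M) : Prop :=
  forall c y, fatlas F c -> cdom c y -> W y ->
    exists O : set M, [/\ open O, O y & O `&` plaque k c y `<=` W].

(* In the coordinates c, a is the vector of components of an element of
   T^(1,0)M at q tangent to the leaf: the (1,0)-part of the real vector X has
   components X(z_j), and X is the image by a foliated chart of a direction v
   parallel to the plaques. *)
Definition tangent (c : chart R M n) (q : M) (a : 'rV[C]_n) : Prop :=
  exists e (v : 'rV[C]_n),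
    [/\ fatlas F e, cdom e q, same_transverse k v 0 &
        forall j, a 0 j = cderiv v (fun x => cmap c (cinv e x) 0 j) (cmap e q)].

Definition locally_monge_ampere (p : nat) : Prop :=
  forall q : M, exists (U : set M) (u : M -> R),
    [/\ open U, U q &
      forall c, atlas c ->
        smooth_psh_on (cmap c @` (U `&` cdom c)) (u \o cinv c) /\
        forall y, U y -> cdom c y ->
          [/\ (forall v, wedge_pow (ddc (u \o cinv c) (cmap c y)) p.+1 v = 0),
              (exists v, wedge_pow (ddc (u \o cinv c) (cmap c y)) p v <> 0) &
              (forall a : 'rV[C]_n, tangent c y a <->
                 (forall l : 'I_n,
                    \sum_j a 0 j * levi (u \o cinv c) j l (cmap c y) = 0))]].

(* Every point of B has a neighborhood W, open in the leaf topology and evenly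
   covered by f. *)
Definition leaf_covering (f : 'rV[C]_k -> M) (B : set M) : Prop :=
  forall y, B y -> exists (W : set M) (sheets : set (set 'rV[C]_k)),
    [/\ leaf_open W, W y, W `<=` B,
        f @^-1` W = \bigcup_(S in sheets) S &
        (forall S S', sheets S -> sheets S' -> S `&` S' !=set0 -> S = S') /\
        (forall S, sheets S ->
           [/\ open S, set_inj S f, f @` S = W &
               forall S', open S' -> S' `<=` S -> leaf_open (f @` S')])].

(* The inclusion of a leaf being a holomorphic immersion, a map into the leaf
   is holomorphic iff it is continuous for the leaf topology and holomorphic
   as a map into M. *)
Definition parabolic_leaf (q : M) : Prop :=
  exists f : 'rV[C]_k -> M,
    [/\ f @` setT = leaf q,
        (forall W, leaf_open W -> open (f @^-1` W)),
        (forall c, atlas c -> holomorphic_on (f @^-1` cdom c) (cmap c \o f)) &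
        leaf_covering f (leaf q)].

(* Near every point the tangent distribution has a holomorphic frame, namely
   the k rows of X. *)
Definition holomorphic_foliation : Prop :=
  forall (q : M) (c : chart R M n), atlas c -> cdom c q ->
    exists (W : set M) (X : 'rV[C]_n -> 'M[C]_(k, n)),
      [/\ open W, W q, W `<=` cdom c, holomorphic_on (cmap c @` W) X &
          forall y, W y -> row_free (X (cmap c y)) /\
            (forall a : 'rV[C]_n, tangent c y a <-> (a <= X (cmap c y))%MS)].

End OneFoliation.
End Foliations.

(* Main.v *)
From HB Require Import structures.
Require Import Defs.
From mathcomp Require Import all_boot all_order all_fingroup all_algebra.
From mathcomp Require Import complex ring lra.
From mathcomp Require Import all_classical all_reals all_analysis.
Set Implicit Arguments.
Unset Strict Implicit.
Unset Printing Implicit Defensive.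
Import Order.TTheory GRing.Theory Num.Theory.
Import numFieldNormedType.Exports.
Local Open Scope classical_set_scope.
Local Open Scope ring_scope.

(* The (1,0)-tangent spaces T of the leaves are the kernels of the Levi form
   U of the local potential u. Writing T locally as the row space of
   B + s(z) E with B, E constant, the foliation is holomorphic iff s is. The
   closedness of dd^c u gives that s is holomorphic along the leaves, and that
   the transverse antilinear endomorphism N(c) = (dbar_E)(c s), the twist,
   satisfies dbar N = - conj(A) N and dbar A = - conj(N) N along a leaf, with
   N H symmetric for the positive definite transverse form H = E U E^*. For a
   holomorphic section of T along the leaf this makes lambda = tr(conj(N) N) a
   nonnegative function with
     lambda (Laplacian lambda) - |grad lambda|^2 >= (8/p) lambda^3,
   i.e. lambda |dz|^2 has curvature bounded above by a negative constant. The
   function lambda does not depend on the local choices, so when the leaf is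
   covered by f : C^k -> L, taking the section d f (v) gives an entire function
   of the variable t along the line z + t v, which vanishes by Ahlfors' lemma.
   Hence N = 0 in the directions of the image of d f, which is all of T on a
   dense set because f is locally injective, so N = 0 and s is holomorphic. *)

(** * Real norms on complex normed spaces *)

(** The twist is antilinear, so its own trace depends on the frame; [conj(N) N] is linear, and its
    trace is unchanged by frames and charts. Symmetry of [N H] turns that trace into a squared norm,
    so it vanishes only with [N]. The curvature inequality is kept multiplied by lambda because
    lambda may have zeros, where its logarithm is meaningless; the maximum argument is run at a
    point where lambda is positive. Two obstacles shape the rest. Holomorphy is given as complex
    differentiability at each point, so Cauchy's formula must first make charts and leaf
    parametrizations smooth. And the covering of a leaf is only known to be locally injective:
    invertibility of its differential is obtained at points of maximal rank, one in each small ball,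
    and continuity extends the vanishing of [N] to the others. Positivity of the Levi form comes
    from the sub-mean value inequality, and the dimension of its kernel from the foliated charts,
    through a real dimension count. *)

Section RealNorm.
Variable R : realType.
Local Notation C := (Cx R).

Lemma ofR_rmorph_subproof : additive (@ofR R).
Proof. by move=> x y; rewrite /ofR; apply/eqP; rewrite eq_complex /= subrr !eqxx. Qed.
HB.instance Definition _ := GRing.isAdditive.Build R C (@ofR R) ofR_rmorph_subproof.
Lemma ofR_mult_subproof : multiplicative (@ofR R).
Proof.
split=> // x y; rewrite /ofR; apply/eqP; rewrite eq_complex /=.
by rewrite !mulr0 !mul0r subr0 addr0 !eqxx.
Qed.
HB.instance Definition _ :=
  GRing.isMultiplicative.Build R C (@ofR R) ofR_mult_subproof.

Definition cj : C -> C := @conjc R.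
HB.instance Definition _ := GRing.RMorphism.on cj.

Lemma cjK : involutive cj. Proof. exact: conjcK. Qed.
Lemma cj1 : cj 1 = 1. Proof. exact: rmorph1. Qed.
Lemma cjD x y : cj (x + y) = cj x + cj y. Proof. exact: rmorphD. Qed.
Lemma cjN x : cj (- x) = - cj x. Proof. exact: rmorphN. Qed.
Lemma cjM x y : cj (x * y) = cj x * cj y. Proof. exact: rmorphM. Qed.
Lemma cjV x : cj x^-1 = (cj x)^-1. Proof. exact: fmorphV. Qed.
Lemma cj_iC : cj iC = - iC.
Proof. by rewrite /cj /iC /=; apply/eqP; rewrite eq_complex /= oppr0 !eqxx. Qed.
Lemma cj_ofR t : cj (ofR t) = ofR t. Proof. by rewrite /cj /ofR /= oppr0. Qed.

Definition re (x : C) : R := complex.Re x.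
Definition im (x : C) : R := complex.Im x.

Lemma CP (x y : C) : re x = re y -> im x = im y -> x = y.
Proof. by case: x y => [a b] [c d] /= -> ->. Qed.

Lemma reD (x y : C) : re (x + y) = re x + re y. Proof. by case: x y => [? ?] []. Qed.
Lemma imD (x y : C) : im (x + y) = im x + im y. Proof. by case: x y => [? ?] []. Qed.
Lemma reN (x : C) : re (- x) = - re x. Proof. by case: x. Qed.
Lemma imN (x : C) : im (- x) = - im x. Proof. by case: x. Qed.
Lemma reM (x y : C) : re (x * y) = re x * re y - im x * im y.
Proof. by case: x y => [? ?] []. Qed.
Lemma imM (x y : C) : im (x * y) = re x * im y + im x * re y.
Proof. by case: x y => [? ?] []. Qed.
Lemma re_cj (x : C) : re (cj x) = re x. Proof. by case: x. Qed.
Lemma im_cj (x : C) : im (cj x) = - im x. Proof. by case: x. Qed.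
Lemma re_ofR (t : R) : re (ofR t) = t. Proof. by []. Qed.
Lemma im_ofR (t : R) : im (ofR t) = 0. Proof. by []. Qed.
Lemma re_Complex (a b : R) : re (Complex a b) = a. Proof. by []. Qed.
Lemma im_Complex (a b : R) : im (Complex a b) = b. Proof. by []. Qed.
Lemma re_iC : re (@iC R) = 0. Proof. by []. Qed.
Lemma im_iC : im (@iC R) = 1. Proof. by []. Qed.
Lemma re0 : re 0 = 0. Proof. by []. Qed.
Lemma im0 : im 0 = 0. Proof. by []. Qed.
Lemma re1 : re 1 = 1. Proof. by []. Qed.
Lemma im1 : im 1 = 0. Proof. by []. Qed.
Definition reimE := (reD, imD, reN, imN, reM, imM, re_cj, im_cj, re_ofR, im_ofR,
  re_Complex, im_Complex, re_iC, im_iC, re0, im0, re1, im1).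

Lemma iC2 : iC * iC = -1 :> C.
Proof. by apply: CP; rewrite !reimE; ring. Qed.

Lemma CRe (x : C) : x = ofR (re x) + iC * ofR (im x).
Proof. by apply: CP; rewrite !reimE; ring. Qed.

Lemma ofR_le (x y : R) : (ofR x <= ofR y) = (x <= y).
Proof. by rewrite /ofR lecE /= eqxx. Qed.
Lemma ofR_lt (x y : R) : (ofR x < ofR y) = (x < y).
Proof. by rewrite /ofR ltcE /= eqxx. Qed.

Lemma ge0_ofR (x : C) : 0 <= x -> x = ofR (re x).
Proof. by case: x => a b; rewrite lecE /= => /andP[/eqP -> _]. Qed.

(* The norms of the library on complex spaces are C-valued; [nr] is their real part. *)
Definition nr {W : normedModType C} (x : W) : R := re `|x|.

Lemma nrE (W : normedModType C) (x : W) : `|x| = ofR (nr x).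
Proof. by rewrite /nr; apply: ge0_ofR. Qed.
Lemma nr_le (W W' : normedModType C) (x : W) (y : W') :
  (`|x| <= `|y|) = (nr x <= nr y).
Proof. by rewrite !nrE ofR_le. Qed.
Lemma nr_ge0 (W : normedModType C) (x : W) : 0 <= nr x.
Proof. by rewrite -ofR_le -nrE raddf0. Qed.
Lemma nr0 (W : normedModType C) : nr (0 : W) = 0.
Proof. by rewrite /nr normr0. Qed.
Lemma nr_eq0 (W : normedModType C) (x : W) : (nr x == 0) = (x == 0).
Proof.
rewrite -(normr_eq0 x) nrE; apply/eqP/eqP => [->|/(congr1 re)] //.
Qed.
Lemma nr_gt0 (W : normedModType C) (x : W) : (0 < nr x) = (x != 0).
Proof. by rewrite lt_def nr_ge0 andbT nr_eq0. Qed.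
Lemma nrD (W : normedModType C) (x y : W) : nr (x + y) <= nr x + nr y.
Proof. by rewrite -ofR_le rmorphD /= -!nrE ler_normD. Qed.
Lemma nrN (W : normedModType C) (x : W) : nr (- x) = nr x.
Proof. by rewrite /nr normrN. Qed.
Lemma nrB (W : normedModType C) (x y : W) : nr (x - y) = nr (y - x).
Proof. by rewrite /nr distrC. Qed.
Lemma nrZ (W : normedModType C) (c : C) (x : W) : nr (c *: x) = nr c * nr x.
Proof. by rewrite /nr normrZ !nrE -rmorphM. Qed.
Lemma nrM (c d : C) : nr (c * d) = nr c * nr d.
Proof. exact: nrZ. Qed.
Lemma nr_sum (W : normedModType C) I (r : seq I) (P : pred I) (F : I -> W) :
  nr (\sum_(i <- r | P i) F i) <= \sum_(i <- r | P i) nr (F i).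
Proof.
elim/big_rec2: _ => [|i y1 y2 _ h]; first by rewrite nr0.
by apply: le_trans (nrD _ _) _; rewrite lerD2l.
Qed.
Lemma nr_sqrt (x : C) : nr x = Num.sqrt (re x ^+ 2 + im x ^+ 2).
Proof. by case: x. Qed.
Lemma nr_sqr (x : C) : nr x ^+ 2 = re x ^+ 2 + im x ^+ 2.
Proof. by rewrite nr_sqrt sqr_sqrtr // addr_ge0 // sqr_ge0. Qed.
Lemma nr_ofR (t : R) : nr (ofR t) = `|t|.
Proof. by rewrite nr_sqrt !reimE expr0n addr0 sqrtr_sqr. Qed.
Lemma nr_iC : nr (@iC R) = 1.
Proof. by rewrite nr_sqrt !reimE expr0n add0r expr1n sqrtr1. Qed.
Lemma nr_cj (x : C) : nr (cj x) = nr x.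
Proof. by rewrite !nr_sqrt !reimE sqrrN. Qed.
Lemma re_le_nr (x : C) : `|re x| <= nr x.
Proof.
rewrite nr_sqrt -sqrtr_sqr ler_sqrt ?addr_ge0 ?sqr_ge0 //.
by rewrite lerDl sqr_ge0.
Qed.
Lemma im_le_nr (x : C) : `|im x| <= nr x.
Proof.
rewrite nr_sqrt -sqrtr_sqr ler_sqrt ?addr_ge0 ?sqr_ge0 //.
by rewrite lerDr sqr_ge0.
Qed.
Lemma nr_le_reim (x : C) : nr x <= `|re x| + `|im x|.
Proof.
rewrite {1}(CRe x); apply: le_trans (nrD _ _) _.
by rewrite nrM nr_iC mul1r !nr_ofR.
Qed.

Lemma nbhs_nr (W : normedModType C) (z : W) (A : set W) :
  nbhs z A <-> exists2 d : R, 0 < d & forall w, nr (w - z) < d -> A w.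
Proof.
split.
  move/nbhs_ballP => [e /= e0 h]; exists (re e) => [|w hw].
    by rewrite -ofR_lt -ge0_ofR // ltW.
  apply: h; rewrite -ball_normE /ball_ /= nrE (ge0_ofR (ltW e0)) ofR_lt.
  by rewrite nrB.
move=> [d d0 h]; apply/nbhs_ballP; exists (ofR d) => /=; first by rewrite ofR_lt.
move=> w; rewrite -ball_normE /ball_ /= nrE ofR_lt nrB; exact: h.
Qed.

Lemma near_nr (W : normedModType C) (z : W) (d : R) : 0 < d ->
  \forall w \near z, nr (w - z) < d.
Proof. by move=> d0; apply/nbhs_nr; exists d. Qed.

Lemma cvg_nr (W : normedModType C) (T : Type) (F : set_system T) (f : T -> W) (l : W) :
  Filter F -> (f x @[x --> F] --> l) <->
  forall e : R, 0 < e -> \forall x \near F, nr (f x - l) < e.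
Proof.
move=> FF; split=> [h e e0|h].
  by apply: (h [set x | nr (x - l) < e]); apply/nbhs_nr; exists e.
by move=> A /nbhs_nr[e e0 he]; near=> x; apply: he; near: x; exact: h.
Unshelve. all: by end_near. Qed.

Lemma near_real (t e : R) : 0 < e -> \forall s \near t, `|s - t| < e.
Proof.
move=> e0; apply/nbhs_ballP; exists e => //= s.
by rewrite -ball_normE /ball_ /= distrC.
Qed.

Lemma cvg_ofR (t : R) : (ofR s : C) @[s --> t] --> (ofR t : C).
Proof.
apply/(@cvg_nr _ _ (nbhs t)) => e e0.
have := near_real t e0; apply: filterS => s hs.
by rewrite -raddfB nr_ofR.
Qed.
Lemma cvg_re (x : C) : re y @[y --> x] --> re x.
Proof.
apply/(@cvgrPdist_lt _ _ _ (nbhs x)) => e e0; have := near_nr x e0; apply: filterS => y.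
by apply: le_lt_trans; rewrite distrC -reN -reD; exact: re_le_nr.
Qed.
Lemma cvg_im (x : C) : im y @[y --> x] --> im x.
Proof.
apply/(@cvgrPdist_lt _ _ _ (nbhs x)) => e e0; have := near_nr x e0; apply: filterS => y.
by apply: le_lt_trans; rewrite distrC -imN -imD; exact: im_le_nr.
Qed.

Lemma cvg_reim (T : Type) (F : set_system T) (f : T -> C) (l : C) : Filter F ->
  (re (f x) @[x --> F] --> re l) -> (im (f x) @[x --> F] --> im l) ->
  f x @[x --> F] --> l.
Proof.
move=> FF /cvgrPdist_lt h1 /cvgrPdist_lt h2; apply/cvg_nr => e e0; near=> x.
apply: le_lt_trans (nr_le_reim _) _.
rewrite [e]splitr ltrD // !reimE distrC; near: x.
  by apply: h1; rewrite divr_gt0.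
by apply: h2; rewrite divr_gt0.
Unshelve. all: by end_near. Qed.

Lemma line_continuous (W : normedModType C) (z v : W) :
  continuous (fun t : R => z + ofR t *: v).
Proof.
move=> t; apply: cvgD; first exact: cvg_cst.
by apply: cvgZr_tmp; exact: cvg_ofR.
Qed.

Lemma nr_mx_entry m n (A : 'M[C]_(m, n)) i j : nr (A i j) <= nr A.
Proof.
rewrite -nr_le; have -> : `|A| = mx_norm A by [].
rewrite mx_normE -[leLHS]nngE num_le.
exact: (le_bigmax _ (fun i : 'I_m * 'I_n => `|A i.1 i.2|%:nng) (i, j)).
Qed.
Lemma nr_mx_le m n (A : 'M[C]_(m, n)) (e : R) : 0 <= e ->
  (forall i j, nr (A i j) <= e) -> nr A <= e.
Proof.
move=> e0 h; rewrite -ofR_le -nrE /Num.norm /= mx_normE.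
have e0' : 0 <= ofR e by rewrite ofR_le.
rewrite -[ofR e]/(NngNum e0')%:num num_le; apply/bigmax_leP; split => //= -[i j] _ /=.
by rewrite -num_le /= nrE ofR_le.
Qed.
End RealNorm.

(** * Real differential calculus *)

Section RealDerivatives.
Variable R : realType.
Local Notation C := (Cx R).

(** The increment form has no quotient, so it is harmless at [h = 0] and can be compared directly
    with norm estimates in [V]. *)
Lemma is_derive_eps (g : R -> R) (t d : R) :
  is_derive t 1 g d <->
  (forall e : R, 0 < e -> \forall h \near (0 : R), `|g (t + h) - g t - h * d| <= e * `|h|).
Proof.
split=> [[dg <-] e e0|h].
  have /cvgrPdist_le /(_ e e0) := dg.
  rewrite near_withinE; apply: filterS => h hh.
  have [->|h0] := eqVneq h 0; first by rewrite addr0 !subrr mul0r subrr normr0 mulr0.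
  have := hh h0; rewrite /= -[lim _]/('D_1 g t) [h *: 1]mulr1 (addrC h t).
  set q := 'D_1 g t; rewrite [_ *: _]mulrC => H.
  have -> : g (t + h) - g t - h * q = - h * (q - (g (t + h) - g t) / h) by field.
  by rewrite normrM normrN mulrC ler_wpM2r.
have cv : h^-1 *: (g (h *: 1 + t) - g t) @[h --> 0^'] --> d.
  apply/cvgrPdist_le => e e0; rewrite near_withinE.
  have := h e e0; apply: filterS => s hs s0.
  rewrite [s *: 1]mulr1 (addrC s t) [_ *: _]mulrC.
  move: hs; have -> : g (t + s) - g t - s * d = - s * (d - (g (t + s) - g t) / s) by field.
  by rewrite normrM normrN (mulrC e) ler_pM2l ?normr_gt0.
split; first by apply/cvg_ex; exists d.
exact: (cvg_lim _ cv).
Qed.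

Variable n : nat.
Local Notation V := 'rV[C]_n.
Implicit Types (f g : V -> R) (v z : V).

Lemma rderivP v f z d :
  (rderivable v f z /\ rderiv v f z = d) <->
  is_derive (0 : R) 1 (fun t : R => f (z + ofR t *: v)) d.
Proof.
rewrite /rderivable /rderiv derive1E; split=> [[h1 h2]|[h1 h2]]; split=> //.
Qed.

Lemma rderiv_eps v f z d :
  (rderivable v f z /\ rderiv v f z = d) <->
  (forall e : R, 0 < e -> \forall h \near (0 : R),
    `|f (z + ofR h *: v) - f z - h * d| <= e * `|h|).
Proof.
rewrite rderivP is_derive_eps; split=> h e e0; have := h e e0; apply: filterS => s.
  by rewrite add0r raddf0 scale0r addr0.
by rewrite add0r raddf0 scale0r addr0.
Qed.

Lemma rderivable_is v f z : rderivable v f z ->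
  is_derive (0 : R) 1 (fun t : R => f (z + ofR t *: v)) (rderiv v f z).
Proof. by move=> h; apply/rderivP. Qed.

Lemma rderiv_line v f z (t : R) : rderivable v f (z + ofR t *: v) ->
  is_derive t 1 (fun s : R => f (z + ofR s *: v)) (rderiv v f (z + ofR t *: v)).
Proof.
move=> /rderivable_is/is_derive_eps h; apply/is_derive_eps => e e0.
have := h e e0; apply: filterS => s.
by rewrite add0r raddf0 scale0r addr0 raddfD scalerDl addrA.
Qed.

Lemma near_rderiv v f g z : (\forall w \near z, f w = g w) ->
  rderivable v f z -> rderivable v g z /\ rderiv v g z = rderiv v f z.
Proof.
move=> /nbhs_nr[d d0 fg] df; apply/rderiv_eps => e e0.
have h := (rderiv_eps v f z _).1 (conj df erefl) e e0.
have gz : g z = f z by rewrite fg // subrr nr0.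
have /cvg_nr := @line_continuous R V z v 0.
move=> /(_ _ d0); move: h; apply: filterS2 => s h1 h2.
rewrite -fg ?gz //; move: h2; rewrite raddf0 scale0r addr0 //.
Qed.

(** The intermediate point is located only by its absolute value, which hides the sign of [t] from
    all later uses. *)
Lemma rderiv_mvt v f z (t : R) :
  (forall s : R, `|s| <= `|t| -> rderivable v f (z + ofR s *: v)) ->
  exists2 s : R, `|s| <= `|t| &
    f (z + ofR t *: v) - f z = t * rderiv v f (z + ofR s *: v).
Proof.
move=> H; pose g s := f (z + ofR s *: v).
have g0 : g 0 = f z by rewrite /g raddf0 scale0r addr0.
have Hd (s : R) : `|s| <= `|t| -> is_derive s 1 g (rderiv v f (z + ofR s *: v)).
  by move=> /H; exact: rderiv_line.
have Hc (s : R) : `|s| <= `|t| -> {for s, continuous g}.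
  by move=> /Hd[hd _]; apply: differentiable_continuous; apply/derivable1_diffP.
have [t0|t0] := lerP 0 t.
  have [s| |c] := @MVT_segment _ g (fun s => rderiv v f (z + ofR s *: v)) 0 t t0.
  - rewrite in_itv /= => /andP[s0 st]; apply: Hd.
    by rewrite !ger0_norm // ltW.
  - apply: continuous_in_subspaceT => s; rewrite inE /= in_itv /= => /andP[s0 st].
    by apply: Hc; rewrite !ger0_norm.
  rewrite in_itv /= subr0 -g0 mulrC => /andP[c0 ct] ->; exists c => //.
  by rewrite !ger0_norm.
have [s| |c] := @MVT_segment _ g (fun s => rderiv v f (z + ofR s *: v)) t 0 (ltW t0).
- rewrite in_itv /= => /andP[s0 st]; apply: Hd.
  by rewrite !ler0_norm ?lerN2 // ltW.
- apply: continuous_in_subspaceT => s; rewrite inE /= in_itv /= => /andP[s0 st].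
  by apply: Hc; rewrite !ler0_norm ?lerN2 // ltW.
rewrite in_itv /= sub0r => /andP[ct c0] h; exists c.
  by rewrite !ler0_norm ?lerN2 // ltW.
by rewrite -g0 -opprB h; ring.
Qed.

Definition comb (hs : seq R) (bs : seq V) : V :=
  \sum_(x <- zip hs bs) ofR x.1 *: x.2.
Definition dcomb f z (hs : seq R) (bs : seq V) : R :=
  \sum_(x <- zip hs bs) x.1 * rderiv x.2 f z.

(* Strict differentiability along finitely many directions, by telescoping
   the mean value theorem. *)
Lemma C1_strict (bs : seq V) f z :
  (forall b, b \in bs -> (\forall w \near z, rderivable b f w) /\
      {for z, continuous (rderiv b f)}) ->
  forall e : R, 0 < e -> exists2 d : R, 0 < d &
  forall z' hs, size hs = size bs -> nr (z' - z) < d ->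
    (forall h, h \in hs -> `|h| < d) ->
  `|f (z' + comb hs bs) - f z' - dcomb f z hs bs| <= e * \sum_(h <- hs) `|h|.
Proof.
elim: bs => [|b bs IH] H e e0.
  exists 1 => // z' [|] // _ _ _.
  by rewrite /comb /dcomb !big_nil addr0 !subrr normr0 mulr0.
have [|d1 d10 IHd] := IH _ e e0; first by move=> c cb; apply: H; rewrite inE cb orbT.
have [Hb Hcb] := H b (mem_head _ _).
have /nbhs_nr[d2 d20 Hd2] := Hb.
have /cvgrPdist_lt /(_ _ e0) /nbhs_nr[d3 d30 Hd3] : rderiv b f w @[w --> z] --> rderiv b f z by [].
(* The base point may move by [d] and then by less than [d * nr b] along [b]; the total is half the
   minimum, so all three neighbourhood conditions hold at the displaced point. *)
pose d := Num.min d1 (Num.min d2 d3) / (2 * (1 + nr b)).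
have b0 := nr_ge0 b.
have dd : d * (1 + nr b) * 2 = Num.min d1 (Num.min d2 d3) by rewrite /d; field; lra.
have d0 : 0 < d by rewrite /d divr_gt0 // ?lt_min ?d10 ?d20 // mulr_gt0 // ltr_pwDl.
have dM : d + d * nr b < Num.min d1 (Num.min d2 d3).
  by rewrite -dd; nra.
have dP (x : R) : x <= d + d * nr b -> [/\ x < d1, x < d2 & x < d3].
  move=> hx; have := le_lt_trans hx dM.
  by rewrite !lt_min => /and3P.
exists d => // z' [//|h hs] /= [Hs] Hz' Hh.
have hd : `|h| < d by apply: Hh; rewrite mem_head.
rewrite /comb /dcomb /= !big_cons /= addrA.
have bnd (s : R) : `|s| <= `|h| -> nr (z' + ofR s *: b - z) <= d + d * nr b.
  move=> sh; rewrite addrAC; apply: le_trans (nrD _ _) _.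
  rewrite lerD ?(ltW Hz') // nrZ nr_ofR ler_wpM2r ?nr_ge0 //.
  exact: le_trans sh (ltW hd).
have [s0 sh0|s sh Es] := @rderiv_mvt b f z' h.
  by apply: Hd2; have [] := dP _ (bnd s0 sh0).
have [_ _ /Hd3 Hr] := dP _ (bnd s sh).
have [zd1 _ _] := dP _ (bnd h (lexx _)).
have dd1 : d <= d1.
  have [|/ltW] // := dP d; by rewrite lerDl mulr_ge0 // ltW.
have Hh1 k : k \in hs -> `|k| < d1.
  by move=> kh; apply: lt_le_trans dd1; apply: Hh; rewrite inE kh orbT.
have := IHd (z' + ofR h *: b) hs Hs zd1 Hh1.
rewrite /comb /dcomb => I.
rewrite mulrDr; apply: le_trans (lerD (lexx (e * `|h|)) I).
set S := \sum_(x <- _) x.1 * _ in I *; set c := \sum_(x <- _) _ *: _ in I *.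
have -> : f (z' + ofR h *: b + c) - f z' - (h * rderiv b f z + S) =
  h * (rderiv b f (z' + ofR s *: b) - rderiv b f z) + (f (z' + ofR h *: b + c) - f (z' + ofR h *: b) - S).
  by rewrite mulrBr -Es; ring.
apply: le_trans (ler_normD _ _) _; rewrite lerD2r normrM mulrC.
by rewrite ler_wpM2r // distrC ltW.
Qed.

End RealDerivatives.

Lemma half_bound (R : realType) (K e : R) : 0 <= K -> 0 <= e ->
  K * (e / (2 * (1 + K))) <= e / 2.
Proof.
move=> K0 e0; rewrite mulrA ler_pdivrMr; last lra.
nra.
Qed.

Lemma mixed_difference (R : realType) (F F0 F1 F2 a b q e : R) : 0 < q ->
  `|F - F1 - F2 + F0 - q * a| <= e / 2 * q ->
  `|F - F2 - F1 + F0 - q * b| <= e / 2 * q -> `|b - a| <= e.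
Proof.
move=> q0; rewrite !ler_norml => /andP[h1 h2] /andP[h3 h4].
apply/andP; split; rewrite -(ler_pM2r q0); lra.
Qed.

(** * Fréchet differentiability, the chain rule along curves, symmetry of second derivatives *)

Section FirstOrder.
Variables (R : realType) (n : nat).
Local Notation C := (Cx R).
Local Notation V := 'rV[C]_n.
Implicit Types (f g : V -> R) (v w z : V) (O : set V).

Definition C1 O f := forall z v, O z ->
  rderivable v f z /\ {for z, continuous (rderiv v f)}.

Lemma C1_near O f z v : open O -> C1 O f -> O z ->
  (\forall w \near z, rderivable v f w) /\ {for z, continuous (rderiv v f)}.
Proof.
move=> Oo H Oz; split; last by have [] := H z v Oz.
by apply: filterS (open_nbhs_nbhs (conj Oo Oz)) => w Ow; have [] := H w v Ow.
Qed.

Lemma combZ (t : R) hs (bs : seq V) :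
  comb [seq t * h | h <- hs] bs = ofR t *: comb hs bs.
Proof.
rewrite /comb; elim: hs bs => [|h hs IH] [|b bs] /=; rewrite ?big_nil ?scaler0 //.
by rewrite !big_cons IH scalerDr scalerA -rmorphM.
Qed.
Lemma dcombZ f z (t : R) hs (bs : seq V) :
  dcomb f z [seq t * h | h <- hs] bs = t * dcomb f z hs bs.
Proof.
rewrite /dcomb; elim: hs bs => [|h hs IH] [|b bs] /=; rewrite ?big_nil ?mulr0 //.
by rewrite !big_cons IH mulrDr mulrA.
Qed.

(** Linearity in the direction is not built into [rderiv]. It comes from strict differentiability
    applied to the coefficient list scaled by a small [t]. *)
Lemma rderiv_comb O f z hs bs : open O -> C1 O f -> O z -> size hs = size bs ->
  rderivable (comb hs bs) f z /\ rderiv (comb hs bs) f z = dcomb f z hs bs.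
Proof.
move=> Oo H Oz shs; apply/rderiv_eps => e e0.
pose M := 1 + \sum_(h <- hs) `|h|.
have S0 : 0 <= \sum_(h <- hs) `|h| by rewrite sumr_ge0.
have M0 : 0 < M by rewrite ltr_pwDl.
have [d d0 Hd] := @C1_strict R n bs f z (fun b _ => C1_near b Oo H Oz) (e / M) (divr_gt0 e0 M0).
have := @near_real R 0 (d / M) (divr_gt0 d0 M0); apply: filterS => t; rewrite subr0 => ht.
have tM : `|t| * M < d by rewrite -ltr_pdivlMr.
have := Hd z [seq t * h | h <- hs]; rewrite size_map subrr nr0 => /(_ shs d0).
rewrite combZ dcombZ => /(_ _) H1; apply: le_trans (H1 _) _.
  move=> _ /mapP[h hhs ->]; rewrite normrM; apply: le_lt_trans tM.
  rewrite ler_wpM2l //; apply: ler_wpDl => //.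
  by rewrite (big_rem h) //= lerDl sumr_ge0.
rewrite big_map -mulrA ler_wpM2l ?(ltW e0) // mulrC ler_pdivrMr //.
rewrite (eq_bigr (fun h => `|t| * `|h|)) => [|h _]; last by rewrite normrM.
by rewrite -mulr_sumr ler_wpM2l // /M lerDr.
Qed.

Lemma rderivD_dir O f z v w : open O -> C1 O f -> O z ->
  rderiv (v + w) f z = rderiv v f z + rderiv w f z.
Proof.
move=> Oo H Oz; have [_] := @rderiv_comb O f z [:: 1; 1] [:: v; w] Oo H Oz erefl.
by rewrite /comb /dcomb /= !big_cons !big_nil /= !addr0 !mul1r rmorph1 !scale1r.
Qed.
Lemma rderivZ_dir O f z (a : R) v : open O -> C1 O f -> O z ->
  rderiv (ofR a *: v) f z = a * rderiv v f z.
Proof.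
move=> Oo H Oz; have [_] := @rderiv_comb O f z [:: a] [:: v] Oo H Oz erefl.
by rewrite /comb /dcomb /= !big_cons !big_nil /= !addr0.
Qed.

Definition rbasis : seq V := [seq delta_mx 0 j | j <- index_enum 'I_n] ++
  [seq iC *: delta_mx 0 j | j <- index_enum 'I_n].
Definition rcoord v : seq R := [seq re (v 0 j) | j <- index_enum 'I_n] ++
  [seq im (v 0 j) | j <- index_enum 'I_n].

Lemma size_rcoord v : size (rcoord v) = size rbasis.
Proof. by rewrite !size_cat !size_map. Qed.

Lemma zip_rcoord v : zip (rcoord v) rbasis =
  [seq (re (v 0 j), delta_mx 0 j) | j <- index_enum 'I_n] ++
  [seq (im (v 0 j), iC *: delta_mx 0 j) | j <- index_enum 'I_n].
Proof. by rewrite zip_cat ?size_map // !zip_map. Qed.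

Lemma comb_rcoord v : comb (rcoord v) rbasis = v.
Proof.
rewrite /comb zip_rcoord big_cat !big_map /= -big_split /=.
rewrite [RHS]row_sum_delta; apply: eq_bigr => j _.
by rewrite scalerA -scalerDl [in RHS](CRe (v 0 j)) mulrC.
Qed.

Lemma dcomb_rcoord f z v : dcomb f z (rcoord v) rbasis =
  \sum_j (re (v 0 j) * rderiv (delta_mx 0 j) f z +
          im (v 0 j) * rderiv (iC *: delta_mx 0 j) f z).
Proof. by rewrite /dcomb zip_rcoord big_cat !big_map /= -big_split. Qed.

Lemma rderiv_coord O f z v : open O -> C1 O f -> O z ->
  rderiv v f z = \sum_j (re (v 0 j) * rderiv (delta_mx 0 j) f z +
          im (v 0 j) * rderiv (iC *: delta_mx 0 j) f z).
Proof.
move=> Oo H Oz; rewrite -dcomb_rcoord -{1}(comb_rcoord v).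
by have [] := rderiv_comb Oo H Oz (size_rcoord v).
Qed.

Lemma sum_rcoord v : \sum_(h <- rcoord v) `|h| <= n%:R * 2 * nr v.
Proof.
rewrite /rcoord big_cat !big_map /= -big_split /=.
apply: (@le_trans _ _ (\sum_(j : 'I_n) 2 * nr v)).
  apply: ler_sum => j _; rewrite mulr_natl mulr2n.
  have := nr_mx_entry v 0 j; have := re_le_nr (v 0 j); have := im_le_nr (v 0 j).
  lra.
by rewrite sumr_const cardT size_enum_ord -[leLHS]mulr_natl mulrA.
Qed.

Lemma rcoord_le v h : h \in rcoord v -> `|h| <= nr v.
Proof.
rewrite mem_cat => /orP[] /mapP[j _ ->]; apply: le_trans (nr_mx_entry v 0 j).
  exact: re_le_nr.
exact: im_le_nr.
Qed.

Lemma C1_strict_at O f z : open O -> C1 O f -> O z ->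
  forall e : R, 0 < e -> exists2 d : R, 0 < d &
  forall x y, nr (x - z) < d -> nr (y - z) < d ->
  `|f x - f y - rderiv (x - y) f z| <= e * nr (x - y).
Proof.
move=> Oo H Oz e e0.
(* There are [2 n] real coordinates, each bounded by [nr]; the added 1 keeps [M] positive when
   [n = 0]. *)
pose M : R := 1 + n%:R * 2.
have M0 : 0 < M by rewrite ltr_pwDl // mulr_ge0.
have [d d0 Hd] := @C1_strict R n rbasis f z (fun b _ => C1_near b Oo H Oz) (e / M) (divr_gt0 e0 M0).
exists (d / 2); first by rewrite divr_gt0.
move=> x y xd yd; set h := x - y.
have hd : nr h < d.
  have -> : h = (x - z) - (y - z) by rewrite opprB addrA subrK.
  by apply: le_lt_trans (nrD _ _) _; rewrite nrN [d]splitr ltrD.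
have yd' : nr (y - z) < d by apply: lt_le_trans yd _; rewrite ler_pdivrMr // ler_pMr // ler1n.
have := Hd y (rcoord h); rewrite size_rcoord => /(_ erefl yd').
rewrite comb_rcoord /h (addrC y) subrK -/h => H1.
have -> : rderiv h f z = dcomb f z (rcoord h) rbasis.
  by rewrite dcomb_rcoord (rderiv_coord _ Oo H Oz).
apply: le_trans (H1 _) _ => [q /rcoord_le qh|]; first exact: le_lt_trans qh hd.
rewrite -mulrA ler_wpM2l ?(ltW e0) // mulrC ler_pdivrMr //.
apply: le_trans (sum_rcoord h) _.
by rewrite mulrC ler_wpM2l ?nr_ge0 // /M lerDr.
Qed.

Lemma frechet O f z : open O -> C1 O f -> O z -> forall e : R, 0 < e ->
  \forall h \near (0 : V), `|f (z + h) - f z - rderiv h f z| <= e * nr h.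
Proof.
move=> Oo H Oz e e0; have [d d0 Hd] := C1_strict_at Oo H Oz e0.
apply: filterS (near_nr (0 : V) d0) => h; rewrite subr0 => hd.
by have := Hd (z + h) z; rewrite (addrC z h) addrK subrr nr0; apply.
Qed.

Lemma rderiv_bound O f z : open O -> C1 O f -> O z ->
  exists2 K : R, 0 <= K & forall h, `|rderiv h f z| <= K * nr h.
Proof.
move=> Oo H Oz; exists (\sum_j (`|rderiv (delta_mx 0 j) f z| +
  `|rderiv (iC *: delta_mx 0 j) f z|)) => [|h].
  by rewrite sumr_ge0 // => j _; rewrite addr_ge0.
rewrite (rderiv_coord h Oo H Oz) mulr_suml; apply: le_trans (ler_norm_sum _ _ _) _.
apply: ler_sum => j _; apply: le_trans (ler_normD _ _) _.
have tm (a b : R) : `|a| <= nr h -> `|a * b| <= `|b| * nr h.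
  by move=> ah; rewrite normrM mulrC ler_wpM2l.
have h1 := tm _ (rderiv (delta_mx 0 j) f z) (le_trans (re_le_nr _) (nr_mx_entry h 0 j)).
have h2 := tm _ (rderiv (iC *: delta_mx 0 j) f z) (le_trans (im_le_nr _) (nr_mx_entry h 0 j)).
by rewrite mulrDl; exact: (lerD h1 h2).
Qed.

(** The velocity of a curve with real parameter in a space normed over the complex numbers, hence
    encoded by an estimate on [nr]. *)
Definition curve_d (c : R -> V) (t : R) (v : V) : Prop := forall e : R, 0 < e ->
  \forall h \near (0 : R), nr (c (t + h) - c t - ofR h *: v) <= e * `|h|.

Lemma curve_cvg c t v : curve_d c t v -> c (t + h) @[h --> (0 : R)] --> c t.
Proof.
move=> H; apply/(@cvg_nr _ _ _ (nbhs (0 : R))) => e e0.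
have K0 : 0 < 1 + nr v by rewrite ltr_pwDl // nr_ge0.
have := H 1 ltr01; have := near_real 0 (divr_gt0 e0 K0).
apply: filterS2 => h; rewrite subr0 mul1r ltr_pdivlMr // => h1 h2.
rewrite -[X in nr X](subrK (ofR h *: v)); apply: le_lt_trans (nrD _ _) _.
rewrite nrZ nr_ofR; lra.
Qed.

Lemma curve_chain O f c t v : open O -> C1 O f -> O (c t) -> curve_d c t v ->
  is_derive t 1 (f \o c) (rderiv v f (c t)).
Proof.
move=> Oo H Ot Hc; apply/is_derive_eps => e e0.
have [K K0 HK] := rderiv_bound Oo H Ot.
have e1 : 0 < e / (2 * (1 + nr v)) by rewrite divr_gt0 // mulr_gt0 // ltr_pwDl // nr_ge0.
(* The bound 1 keeps the increment of the curve comparable with [h]; the other term absorbs the norm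
   [K] of the differential of [f]. *)
have e2 : 0 < Num.min 1 (e / (2 * (1 + K))) by rewrite lt_min ltr01 divr_gt0 // mulr_gt0 // ltr_pwDl.
have /nbhs_nr[d d0 Hd] := frechet Oo H Ot e1.
have /cvg_nr /(_ d d0) := curve_cvg Hc; have := Hc _ e2.
apply: filterS2 => h h1 h2; have := Hd (c (t + h) - c t); rewrite subr0 (addrC (c t)) subrK => /(_ h2).
set k := c (t + h) - c t in h1 h2 * => h3.
have E : rderiv (k - ofR h *: v) f (c t) = rderiv k f (c t) - h * rderiv v f (c t).
  by rewrite -scaleNr -raddfN (rderivD_dir _ _ Oo H Ot) (rderivZ_dir _ _ Oo H Ot) mulNr.
have -> : (f \o c) (t + h) - (f \o c) t - h * rderiv v f (c t) =
   (f (c (t + h)) - f (c t) - rderiv k f (c t)) + rderiv (k - ofR h *: v) f (c t).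
  rewrite E /comp; move: (f _) (f _) (rderiv _ _ _) (h * _) => x1 x2 x3 x4; ring.
apply: le_trans (ler_normD _ _) _.
have h4 := HK (k - ofR h *: v).
have h5 : nr k <= (1 + nr v) * `|h|.
  rewrite -[k](subrK (ofR h *: v)); apply: le_trans (nrD _ _) _.
  rewrite nrZ nr_ofR mulrDl mul1r [nr v * _]mulrC lerD2r; apply: le_trans h1 _.
  by rewrite ler_piMl // ge_min lexx.
have h6 : e / (2 * (1 + nr v)) * nr k <= e / 2 * `|h|.
  rewrite -mulrA invfM -!mulrA; rewrite ler_wpM2l ?(ltW e0) // ler_wpM2l //.
  by rewrite mulrC ler_pdivrMr ?ltr_pwDl ?nr_ge0 // mulrC.
have h7 : K * nr (k - ofR h *: v) <= e / 2 * `|h|.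
  apply: le_trans (ler_wpM2l K0 h1) _; rewrite mulrA ler_wpM2r //.
  apply: le_trans (_ : K * (e / (2 * (1 + K))) <= _).
    by rewrite ler_wpM2l // ge_min lexx orbT.
  exact: half_bound (ltW e0).
rewrite [X in _ <= X * _]splitr mulrDl.
exact: (lerD (le_trans h3 h6) (le_trans h4 h7)).
Qed.

(** The mixed second difference of [f] over a parallelogram of sides [h v] and [h w] is symmetric in
    [v] and [w]. Two mean values show that it is [h ^+ 2] times either mixed derivative, up to
    [e / 2 * h ^+ 2]. *)
Lemma clairaut O f z v w : open O -> C1 O f ->
  (forall v, C1 O (rderiv v f)) -> O z ->
  rderiv v (rderiv w f) z = rderiv w (rderiv v f) z.
Proof.
move=> Oo H H2 Oz; apply/eqP; rewrite -subr_eq0 -normr_le0; apply/ler_addgt0Pl => e e0.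
rewrite addr0.
have e2 : 0 < e / 2 by rewrite divr_gt0.
have key v1 w1 : exists2 d : R, 0 < d & forall h : R, `|h| < d ->
  `|f (z + ofR h *: v1 + ofR h *: w1) - f (z + ofR h *: v1) - f (z + ofR h *: w1) + f z
   - h ^+ 2 * rderiv w1 (rderiv v1 f) z| <= e / 2 * h ^+ 2.
  have /nbhs_nr[d1 d10 Hd1] : \forall y \near z, O y by exact: open_nbhs_nbhs.
  have [_ Hc] := H2 v1 z w1 Oz.
  have /cvgrPdist_lt /(_ _ e2) /nbhs_nr[d2 d20 Hd2] :
    rderiv w1 (rderiv v1 f) y @[y --> z] --> rderiv w1 (rderiv v1 f) z by [].
  pose K := 1 + nr v1 + nr w1.
  have v0 := nr_ge0 v1. have w0 := nr_ge0 w1.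
  have K0 : 0 < K by rewrite /K; lra.
  have d0 : 0 < Num.min d1 d2 / K by rewrite divr_gt0 // lt_min d10.
  exists (Num.min d1 d2 / K) => // h; rewrite ltr_pdivlMr // lt_min => /andP[hd1 hd2].
  have bnd (s t : R) : `|s| <= `|h| -> `|t| <= `|h| ->
      nr (z + ofR s *: v1 + ofR t *: w1 - z) <= `|h| * K.
    move=> sh th; rewrite addrAC -addrA addrA [z + _]addrC addrK.
    apply: le_trans (nrD _ _) _; rewrite !nrZ !nr_ofR /K.
    have := ler_wpM2r v0 sh; have := ler_wpM2r w0 th; have := normr_ge0 h; lra.
  have inO (s t : R) : `|s| <= `|h| -> `|t| <= `|h| -> O (z + ofR s *: v1 + ofR t *: w1).
    by move=> sh th; apply: Hd1; apply: le_lt_trans (bnd _ _ sh th) hd1.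
  have inO0 (s : R) : `|s| <= `|h| -> O (z + ofR s *: v1).
    by move=> sh; have := inO s 0 sh; rewrite normr0 raddf0 scale0r addr0; apply.
  pose g y := f (y + ofR h *: w1) - f y.
  have Hg (s : R) : `|s| <= `|h| -> rderivable v1 g (z + ofR s *: v1) /\
     rderiv v1 g (z + ofR s *: v1) = rderiv v1 f (z + ofR s *: v1 + ofR h *: w1) - rderiv v1 f (z + ofR s *: v1).
    move=> sh; apply/rderivP.
    have /rderivable_is d1' := (H _ v1 (inO s h sh (lexx _))).1.
    have /rderivable_is d2' := (H _ v1 (inO0 s sh)).1.
    rewrite /g (_ : (fun t : R => _) = (fun t : R => f (z + ofR s *: v1 + ofR h *: w1 + ofR t *: v1)) -
      (fun t : R => f (z + ofR s *: v1 + ofR t *: v1))).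
      exact: is_deriveB.
    apply/funext => t /=.
    exact: (congr1 (fun x => f x - f _) (addrAC _ _ _)).
  have [s sh|s sh Es] := @rderiv_mvt _ _ v1 g z h; first by have [] := Hg s sh.
  have [_ Es'] := Hg s sh.
  have [t th|t th Et] := @rderiv_mvt _ _ w1 (rderiv v1 f) (z + ofR s *: v1) h.
    by have [] := H2 v1 _ w1 (inO s t sh th).
  have -> : f (z + ofR h *: v1 + ofR h *: w1) - f (z + ofR h *: v1) - f (z + ofR h *: w1) + f z =
    g (z + ofR h *: v1) - g z by rewrite /g; ring.
  rewrite Es Es' Et mulrA -expr2 -mulrBr normrM ger0_norm ?sqr_ge0 // mulrC.
  rewrite ler_wpM2r ?sqr_ge0 // distrC ltW //; apply: Hd2.
  exact: le_lt_trans (bnd _ _ sh th) hd2.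
have [d1 d10 H1] := key v w; have [d2 d20 H2'] := key w v.
pose h := Num.min d1 d2 / 2.
have h0 : 0 < h by rewrite divr_gt0 // lt_min d10.
have m0 : Num.min d1 d2 = 2 * h by rewrite /h; field.
have hm : `|h| < Num.min d1 d2 by rewrite gtr0_norm // m0; lra.
move: hm; rewrite lt_min => /andP[/H1 {}H1 /H2' {}H2'].
move: H1 H2'; rewrite [z + _ + _]addrAC.
by move: (f _) (f _) (f _) (f _) => F F1 F2 F0; apply: mixed_difference; rewrite exprn_gt0.
Qed.
End FirstOrder.

(** * Smooth functions: algebra and composition *)

Section Smooth.
Variables (R : realType).
Local Notation C := (Cx R).

Section Ck.
Variable n : nat.
Local Notation V := 'rV[C]_n.
Implicit Types (f g : V -> R) (v w z : V) (O : set V).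

(** [smooth_on] is indexed by lists of directions; the order [N] provides the induction that
    products, inverses and compositions call for. *)
Fixpoint Ck N O f : Prop := (forall z, O z -> {for z, continuous f}) /\
  if N is N'.+1 then (forall z v, O z -> rderivable v f z) /\
    (forall v, Ck N' O (rderiv v f)) else True.

Lemma smooth_rderiv O f v : smooth_on O f -> smooth_on O (rderiv v f).
Proof. by move=> H vs z Oz; have := H (rcons vs v) z Oz; rewrite /iter_rderiv foldr_rcons. Qed.

Lemma smoothP O f : smooth_on O f <-> forall N, Ck N O f.
Proof.
split=> [H N|].
  elim: N f H => [|N IH] f H /=; first by split=> // z Oz; have [] := H [::] z Oz.
  split; first by move=> z Oz; have [] := H [::] z Oz.
  split; first by move=> z v Oz; have [_] := H [::] z Oz; exact.
  by move=> v; apply: IH; exact: smooth_rderiv.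
move=> H vs; elim/last_ind: vs f H => [|vs v IH] f H z Oz.
  by have [h1 [h2 _]] := H 1; split; [exact: h1 | move=> v; exact: h2].
rewrite /iter_rderiv foldr_rcons; apply: IH => // N.
by have [_ [_]] := H N.+1; exact.
Qed.

Lemma CkS N O f : Ck N.+1 O f -> Ck N O f.
Proof.
elim: N f => [|N IH] f [h1 [h2 h3]]; split=> //; split=> // v.
by apply: IH; exact: h3.
Qed.

Lemma Ck_C1 N O f : Ck N.+1 O f -> C1 O f.
Proof.
move=> [h1 [h2 h3]] z v Oz; split; first exact: h2.
by have := h3 v; case: N {h3} => [|N] [h _]; exact: h.
Qed.

Lemma smooth_C1 O f : smooth_on O f -> C1 O f.
Proof. by move=> H z v Oz; split; [have [_] := H [::] z Oz | have [] := H [:: v] z Oz]. Qed.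

Lemma smooth_continuous O f z : smooth_on O f -> O z -> {for z, continuous f}.
Proof. by move=> H Oz; have [] := H [::] z Oz. Qed.

Lemma near_continuous f g z : (\forall w \near z, f w = g w) ->
  {for z, continuous f} -> {for z, continuous g}.
Proof.
move=> fg cf; have e : f z = g z := nbhs_singleton fg.
suff: g w @[w --> z] --> g z by [].
by rewrite -e; apply: cvg_trans cf; exact: near_eq_cvg fg.
Qed.

Lemma Ck_ext N O f g : open O -> (forall z, O z -> f z = g z) -> Ck N O f -> Ck N O g.
Proof.
move=> Oo; elim: N f g => [|N IH] f g fg /= [h1 h2].
  split=> // z Oz; apply: near_continuous (h1 _ Oz).
  by apply: filterS (open_nbhs_nbhs (conj Oo Oz)).
have nfg z : O z -> \forall w \near z, f w = g w.
  by move=> Oz; apply: filterS (open_nbhs_nbhs (conj Oo Oz)).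
split=> [z Oz|]; first exact: near_continuous (nfg _ Oz) (h1 _ Oz).
have [h3 h4] := h2; split=> [z v Oz|v].
  by have [] := near_rderiv (nfg _ Oz) (h3 z v Oz).
apply: (IH (rderiv v f)) => // z Oz.
by have [_] := near_rderiv (nfg _ Oz) (h3 z v Oz).
Qed.

Lemma smooth_sub O O' f : O' `<=` O -> smooth_on O f -> smooth_on O' f.
Proof. by move=> sO H vs z /sO; exact: H. Qed.

Lemma rderiv_cst v (c : R) z : rderivable v (fun=> c) z /\ rderiv v (fun=> c) z = 0.
Proof. by apply/rderivP; exact: is_derive_cst. Qed.

Lemma rderivDf v f g z : rderivable v f z -> rderivable v g z ->
  rderivable v (fun y => f y + g y) z /\
  rderiv v (fun y => f y + g y) z = rderiv v f z + rderiv v g z.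
Proof.
by move=> /rderivable_is ? /rderivable_is ?; apply/rderivP; exact: is_deriveD.
Qed.

Lemma rderivNf v f z : rderivable v f z ->
  rderivable v (fun y => - f y) z /\ rderiv v (fun y => - f y) z = - rderiv v f z.
Proof. by move=> /rderivable_is ?; apply/rderivP; exact: is_deriveN. Qed.

Lemma rderivMf v f g z : rderivable v f z -> rderivable v g z ->
  rderivable v (fun y => f y * g y) z /\
  rderiv v (fun y => f y * g y) z = rderiv v f z * g z + f z * rderiv v g z.
Proof.
move=> /rderivable_is df /rderivable_is dg; apply/rderivP.
have e (h : V -> R) : h (z + ofR 0 *: v) = h z by rewrite raddf0 scale0r addr0.
have h : is_derive (0 : R) 1 (fun t : R => f (z + ofR t *: v) * g (z + ofR t *: v)) _ := is_deriveM df dg.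
by apply: (is_derive_eq h); rewrite !e addrC mulrC.
Qed.

Lemma rderivVf v f z : f z != 0 -> rderivable v f z ->
  rderivable v (fun y => (f y)^-1) z /\
  rderiv v (fun y => (f y)^-1) z = - (f z)^-1 * (f z)^-1 * rderiv v f z.
Proof.
move=> f0 /rderivable_is df; apply/rderivP.
have e : f (z + ofR 0 *: v) = f z by rewrite raddf0 scale0r addr0.
have f0' : f (z + ofR 0 *: v) != 0 by rewrite e.
have h : is_derive (0 : R) 1 (fun t : R => (f (z + ofR t *: v))^-1) _ := is_deriveV f0' df.
by apply: (is_derive_eq h); rewrite e expr2 invfM mulNr.
Qed.

Lemma Ck_cst N O (c : R) : Ck N O (fun=> c).
Proof.
elim: N c => [|N IH] c; split=> //; try by move=> z _; exact: cst_continuous.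
split=> [z v _|v]; first by have [] := rderiv_cst v c z.
rewrite (_ : rderiv v _ = fun=> 0) //; apply/funext => z.
by have [] := rderiv_cst v c z.
Qed.

Lemma Ck_D N O f g : open O -> Ck N O f -> Ck N O g -> Ck N O (fun y => f y + g y).
Proof.
move=> Oo; elim: N f g => [|N IH] f g [f1 f2] [g1 g2].
  by split=> // z Oz; apply: continuousD; [exact: f1 | exact: g1].
have [f3 f4] := f2; have [g3 g4] := g2.
split=> [z Oz|]; first by apply: continuousD; [exact: f1 | exact: g1].
split=> [z v Oz|v]; first by have [] := rderivDf (f3 z v Oz) (g3 z v Oz).
apply: Ck_ext (IH _ _ (f4 v) (g4 v)) => // z Oz.
by have [_] := rderivDf (f3 z v Oz) (g3 z v Oz).
Qed.

Lemma Ck_M N O f g : open O -> Ck N O f -> Ck N O g -> Ck N O (fun y => f y * g y).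
Proof.
move=> Oo; elim: N f g => [|N IH] f g Hf Hg.
  have [f1 f2] := Hf; have [g1 g2] := Hg.
  by split=> // z Oz; apply: continuousM; [exact: f1 | exact: g1].
have [f1 [f3 f4]] := Hf; have [g1 [g3 g4]] := Hg.
split=> [z Oz|]; first by apply: continuousM; [exact: f1 | exact: g1].
split=> [z v Oz|v]; first by have [] := rderivMf (f3 z v Oz) (g3 z v Oz).
apply: Ck_ext (Ck_D Oo (IH _ _ (f4 v) (CkS Hg)) (IH _ _ (CkS Hf) (g4 v))) => // z Oz.
by have [_] := rderivMf (f3 z v Oz) (g3 z v Oz).
Qed.

Lemma Ck_N N O f : open O -> Ck N O f -> Ck N O (fun y => - f y).
Proof.
move=> Oo H; apply: Ck_ext (Ck_M Oo (Ck_cst N O (-1)) H) => // z _.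
by rewrite mulN1r.
Qed.

Lemma Ck_V N O f : open O -> (forall z, O z -> f z != 0) -> Ck N O f ->
  Ck N O (fun y => (f y)^-1).
Proof.
move=> Oo f0; elim: N => [|N IH] Hf.
  have [f1 _] := Hf; split=> // z Oz.
  by apply: (@cvgV R V (nbhs z)); [exact: f0 | exact: f1].
have [f1 [f3 f4]] := Hf.
have IHf := IH (CkS Hf).
split=> [z Oz|]; first by apply: (@cvgV R V (nbhs z)); [exact: f0 | exact: f1].
split=> [z v Oz|v]; first by have [] := rderivVf (f0 z Oz) (f3 z v Oz).
apply: Ck_ext (Ck_M Oo (Ck_M Oo (Ck_N Oo IHf) IHf) (f4 v)) => // z Oz.
by have [_] := rderivVf (f0 z Oz) (f3 z v Oz).
Qed.

Lemma Ck_sum N O I (r : seq I) (F : I -> V -> R) : open O ->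
  (forall i, Ck N O (F i)) -> Ck N O (fun y => \sum_(i <- r) F i y).
Proof.
move=> Oo H; elim: r => [|i r IH].
  by apply: Ck_ext (Ck_cst N O 0) => // z _; rewrite big_nil.
by apply: Ck_ext (Ck_D Oo (H i) IH) => // z _; rewrite big_cons.
Qed.
End Ck.

Section Composition.
Variables m n : nat.
Variables (O' : set 'rV[C]_m) (O : set 'rV[C]_n) (phi : 'rV[C]_m -> 'rV[C]_n).
Hypotheses (O'o : open O') (Oo : open O) (phiO : forall z, O' z -> O (phi z)).

(** The real differential of [phi] at [z], evaluated at [w]. *)
Definition dmap w z : 'rV[C]_n := \row_j cderiv w (fun y => phi y 0 j) z.

Lemma curve_dmap w z :
  (forall j, rderivable w (fun y => re (phi y 0 j)) z /\
             rderivable w (fun y => im (phi y 0 j)) z) ->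
  curve_d (fun t => phi (z + ofR t *: w)) 0 (dmap w z).
Proof.
move=> H e e0; have e2 : 0 < e / 2 by rewrite divr_gt0.
have /filter_forall : forall j : 'I_n, \forall h \near (0 : R),
  `|re (phi (z + ofR h *: w) 0 j) - re (phi z 0 j) - h * re (dmap w z 0 j)| <= e / 2 * `|h| /\
  `|im (phi (z + ofR h *: w) 0 j) - im (phi z 0 j) - h * im (dmap w z 0 j)| <= e / 2 * `|h|.
  move=> j; rewrite mxE; have [h1 h2] := H j.
  have k1 := (rderiv_eps w _ z _).1 (conj h1 erefl) _ e2.
  have k2 := (rderiv_eps w _ z _).1 (conj h2 erefl) _ e2.
  by move: k1 k2; apply: filterS2.
apply: filterS => h Hh; rewrite add0r raddf0 scale0r addr0.
apply: nr_mx_le => [|i j]; first by rewrite mulr_ge0 // ltW.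
rewrite ord1; have [h1 h2] := Hh j.
apply: le_trans (nr_le_reim _) _; rewrite [e]splitr mulrDl.
by apply: lerD; [move: h1 | move: h2]; rewrite !mxE !reimE !mul0r ?subr0 ?addr0.
Qed.

Lemma rderiv_chain w z (f : 'rV[C]_n -> R) : C1 O f -> O (phi z) ->
  (forall j, rderivable w (fun y => re (phi y 0 j)) z /\
             rderivable w (fun y => im (phi y 0 j)) z) ->
  rderivable w (f \o phi) z /\ rderiv w (f \o phi) z = rderiv (dmap w z) f (phi z).
Proof.
move=> H Oz Hphi; apply/rderivP.
have e0 : phi z = phi (z + ofR 0 *: w) by rewrite raddf0 scale0r addr0.
rewrite [in rderiv _ _ _]e0; apply: (curve_chain Oo H); first by rewrite -e0.
exact: curve_dmap.
Qed.

Hypothesis phi_smooth : smooth_map_on O' phi.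

Lemma smooth_map_rderivable w z : O' z ->
  (forall j, rderivable w (fun y => re (phi y 0 j)) z /\
             rderivable w (fun y => im (phi y 0 j)) z).
Proof.
move=> Oz j; have [h1 h2] := phi_smooth j.
have c1 : C1 O' _ := smooth_C1 h1; have c2 : C1 O' _ := smooth_C1 h2.
by split; [exact: (c1 z w Oz).1 | exact: (c2 z w Oz).1].
Qed.

Lemma smooth_map_continuous z : O' z -> {for z, continuous phi}.
Proof.
move=> Oz; suff: phi y @[y --> z] --> phi z by [].
apply/(@cvg_nr _ _ _ (nbhs z)) => e e0.
have e2 : 0 < e / 3 by rewrite divr_gt0.
have /filter_forall : forall j : 'I_n, \forall y \near z,
  `|re (phi z 0 j) - re (phi y 0 j)| < e / 3 /\ `|im (phi z 0 j) - im (phi y 0 j)| < e / 3.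
  move=> j; have [h1 h2] := phi_smooth j.
  have /cvgrPdist_lt /(_ _ e2) k1 : re (phi y 0 j) @[y --> z] --> re (phi z 0 j) by exact: smooth_continuous h1 Oz.
  have /cvgrPdist_lt /(_ _ e2) k2 : im (phi y 0 j) @[y --> z] --> im (phi z 0 j) by exact: smooth_continuous h2 Oz.
  by move: k1 k2; apply: filterS2.
apply: filterS => y Hy.
apply: (@le_lt_trans _ _ (e / 3 + e / 3)); last lra.
apply: nr_mx_le => [|i j]; first by rewrite addr_ge0 // ltW.
rewrite ord1; have [h1 h2] := Hy j.
apply: le_trans (nr_le_reim _) _.
by apply: lerD; rewrite !mxE !reimE distrC ltW.
Qed.

Lemma Ck_comp N (f : 'rV[C]_n -> R) : Ck N O f -> Ck N O' (f \o phi).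
Proof.
elim: N f => [|N IH] f Hf.
  split=> // z Oz; apply: continuous_comp; first exact: smooth_map_continuous.
  by have [h _] := Hf; apply: h; exact: phiO.
have [f1 [f3 f4]] := Hf.
have rd z w (Oz : O' z) := rderiv_chain (Ck_C1 Hf) (phiO Oz) (smooth_map_rderivable w Oz).
split=> [z Oz|].
  by apply: continuous_comp; [exact: smooth_map_continuous | apply: f1; exact: phiO].
split=> [z v Oz|v]; first by have [] := rd z v Oz.
(* The derivative in the moving direction [dmap v z] is expanded in the real basis, so that every
   factor is either a derivative of [phi] or a fixed function composed with [phi], to which the
   induction applies. *)
apply: (Ck_ext O'o (f := fun y => \sum_j (
   rderiv v (fun y => re (phi y 0 j)) y * (rderiv (delta_mx 0 j) f \o phi) y +
   rderiv v (fun y => im (phi y 0 j)) y * (rderiv (iC *: delta_mx 0 j) f \o phi) y))).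
  move=> z Oz; have [_ ->] := rd z v Oz.
  rewrite (rderiv_coord _ Oo (Ck_C1 Hf) (phiO Oz)); apply: eq_bigr => j _.
  by rewrite /dmap mxE.
apply: Ck_sum => // j; have [h1 h2] := phi_smooth j.
apply: Ck_D => //; apply: Ck_M => //.
- exact: (smoothP _ _).1 (smooth_rderiv v h1) N.
- exact: IH (f4 _).
- exact: (smoothP _ _).1 (smooth_rderiv v h2) N.
- exact: IH (f4 _).
Qed.
End Composition.
End Smooth.

(** * Wirtinger derivatives *)

Opaque rderiv rderivable smooth_on.

Section Wirtinger.
Variable R : realType.
Local Notation C := (Cx R).

Section OneSpace.
Variable n : nat.
Local Notation V := 'rV[C]_n.
Implicit Types (g h : V -> C) (v w z : V) (O : set V) (s t : C).

Variant csm O g : Prop :=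
  Csm of smooth_on O (fun z => re (g z)) & smooth_on O (fun z => im (g z)).

Lemma csm_ext O g h : open O -> (forall z, O z -> g z = h z) -> csm O g -> csm O h.
Proof.
move=> Oo gh [/smoothP h1 /smoothP h2]; split; apply/smoothP => N.
  by apply: Ck_ext (h1 N) => // z Oz; rewrite gh.
by apply: Ck_ext (h2 N) => // z Oz; rewrite gh.
Qed.
Lemma csm_sub O O' g : O' `<=` O -> csm O g -> csm O' g.
Proof. by move=> sO [h1 h2]; split; exact: smooth_sub sO _. Qed.
Lemma csm_cst O (c : C) : csm O (fun=> c).
Proof. by split; apply/smoothP => N; exact: Ck_cst. Qed.
Lemma csmD O g h : open O -> csm O g -> csm O h -> csm O (fun z => g z + h z).
Proof.
move=> Oo [/smoothP g1 /smoothP g2] [/smoothP h1 /smoothP h2]; split; apply/smoothP => N.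
  by apply: Ck_ext (Ck_D Oo (g1 N) (h1 N)) => // z _; rewrite reD.
by apply: Ck_ext (Ck_D Oo (g2 N) (h2 N)) => // z _; rewrite imD.
Qed.
Lemma csmM O g h : open O -> csm O g -> csm O h -> csm O (fun z => g z * h z).
Proof.
move=> Oo [/smoothP g1 /smoothP g2] [/smoothP h1 /smoothP h2]; split; apply/smoothP => N.
  apply: Ck_ext (Ck_D Oo (Ck_M Oo (g1 N) (h1 N)) (Ck_N Oo (Ck_M Oo (g2 N) (h2 N)))) => // z _.
  by rewrite reM.
apply: Ck_ext (Ck_D Oo (Ck_M Oo (g1 N) (h2 N)) (Ck_M Oo (g2 N) (h1 N))) => // z _.
by rewrite imM.
Qed.
Lemma csmN O g : open O -> csm O g -> csm O (fun z => - g z).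
Proof.
move=> Oo H; apply: csm_ext (csmM Oo (csm_cst O (-1)) H) => // z _.
by rewrite mulN1r.
Qed.
Lemma csm_cj O g : open O -> csm O g -> csm O (fun z => cj (g z)).
Proof.
move=> Oo [/smoothP g1 /smoothP g2]; split; apply/smoothP => N.
  by apply: Ck_ext (g1 N) => // z _; rewrite re_cj.
by apply: Ck_ext (Ck_N Oo (g2 N)) => // z _; rewrite im_cj.
Qed.
Lemma csm_ofR O (u : V -> R) : smooth_on O u -> csm O (fun z => ofR (u z)).
Proof. by move=> H; apply: Csm; [exact: H | apply/smoothP => N; exact: Ck_cst]. Qed.
Lemma csm_sum O I (r : seq I) (F : I -> V -> C) : open O ->
  (forall i, csm O (F i)) -> csm O (fun y => \sum_(i <- r) F i y).
Proof.
move=> Oo H; elim: r => [|i r IH].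
  by apply: csm_ext (csm_cst O 0) => // z _; rewrite big_nil.
by apply: csm_ext (csmD Oo (H i) IH) => // z _; rewrite big_cons.
Qed.
Lemma csm_prod O I (r : seq I) (F : I -> V -> C) : open O ->
  (forall i, csm O (F i)) -> csm O (fun y => \prod_(i <- r) F i y).
Proof.
move=> Oo H; elim: r => [|i r IH].
  by apply: csm_ext (csm_cst O 1) => // z _; rewrite big_nil.
by apply: csm_ext (csmM Oo (H i) IH) => // z _; rewrite big_cons.
Qed.

Lemma invC_nr (x : C) : x^-1 = cj x * ofR ((re x ^+ 2 + im x ^+ 2)^-1).
Proof.
have [->|x0] := eqVneq x 0; first by rewrite invr0 rmorph0 mul0r.
have q0 : re x ^+ 2 + im x ^+ 2 != 0 by rewrite -nr_sqr expf_neq0 // nr_eq0.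
apply: (mulfI x0); rewrite mulfV // mulrA.
have -> : x * cj x = ofR (re x ^+ 2 + im x ^+ 2) by apply: CP; rewrite !reimE; ring.
by rewrite -rmorphM mulfV.
Qed.

Lemma csmV O g : open O -> (forall z, O z -> g z != 0) -> csm O g -> csm O (fun z => (g z)^-1).
Proof.
move=> Oo g0 H; have [/smoothP g1 /smoothP g2] := H.
apply: (csm_ext (g := fun z => cj (g z) * ofR ((re (g z) * re (g z) + im (g z) * im (g z))^-1))) => //.
  by move=> z _; rewrite invC_nr !expr2.
apply: csmM => //; first exact: csm_cj.
apply: csm_ofR; apply/smoothP => N; apply: Ck_V => //.
  by move=> z Oz; rewrite -!expr2 -nr_sqr expf_neq0 // nr_eq0 g0.
by apply: Ck_D => //; apply: Ck_M.
Qed.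

Lemma csm_cderiv O g v : csm O g -> csm O (cderiv v g).
Proof. by move=> [h1 h2]; split; exact: smooth_rderiv. Qed.

Lemma csm_continuous O g z : csm O g -> O z -> {for z, continuous g}.
Proof.
move=> [h1 h2] Oz; suff: g y @[y --> z] --> g z by [].
apply: (@cvg_reim _ _ (nbhs z) g (g z)).
  exact: (@smooth_continuous _ _ O (fun y => re (g y)) z h1 Oz).
exact: (@smooth_continuous _ _ O (fun y => im (g y)) z h2 Oz).
Qed.

Lemma csm_rd O g z v : csm O g -> O z ->
  rderivable v (fun z => re (g z)) z /\ rderivable v (fun z => im (g z)) z.
Proof.
move=> [h1 h2] Oz; have c1 : C1 O _ := smooth_C1 h1; have c2 : C1 O _ := smooth_C1 h2.
by split; [exact: (c1 z v Oz).1 | exact: (c2 z v Oz).1].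
Qed.

Lemma re_cderiv v g z : re (cderiv v g z) = rderiv v (fun y => re (g y)) z. Proof. by []. Qed.
Lemma im_cderiv v g z : im (cderiv v g z) = rderiv v (fun y => im (g y)) z. Proof. by []. Qed.

Opaque cderiv.

Lemma near_cderiv O g h z v : csm O g -> O z -> (\forall w \near z, g w = h w) ->
  cderiv v h z = cderiv v g z.
Proof.
move=> H Oz gh; have [h1 h2] := csm_rd v H Oz.
have gh1 : \forall w \near z, re (g w) = re (h w) by apply: filterS gh => w ->.
have gh2 : \forall w \near z, im (g w) = im (h w) by apply: filterS gh => w ->.
have [_ e1] := near_rderiv gh1 h1; have [_ e2] := near_rderiv gh2 h2.
by apply: CP; rewrite !(re_cderiv, im_cderiv).
Qed.

Lemma cderiv_cst v (c : C) z : cderiv v (fun=> c) z = 0.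
Proof. by apply: CP; rewrite !(re_cderiv, im_cderiv); [have [] := rderiv_cst v (re c) z | have [] := rderiv_cst v (im c) z]. Qed.

Lemma cderivD O g h v z : csm O g -> csm O h -> O z ->
  cderiv v (fun y => g y + h y) z = cderiv v g z + cderiv v h z.
Proof.
move=> Hg Hh Oz; have [g1 g2] := csm_rd v Hg Oz; have [h1 h2] := csm_rd v Hh Oz.
apply: CP; rewrite !(reimE, re_cderiv, im_cderiv).
  by rewrite -(rderivDf g1 h1).2; congr (rderiv v _ z); apply/funext => y; rewrite reD.
by rewrite -(rderivDf g2 h2).2; congr (rderiv v _ z); apply/funext => y; rewrite imD.
Qed.

Lemma cderivM O g h v z : csm O g -> csm O h -> O z ->
  cderiv v (fun y => g y * h y) z = cderiv v g z * h z + g z * cderiv v h z.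
Proof.
move=> Hg Hh Oz; have [g1 g2] := csm_rd v Hg Oz; have [h1 h2] := csm_rd v Hh Oz.
have [a1 b1] := rderivMf g1 h1; have [a2 b2] := rderivMf g2 h2.
have [a3 b3] := rderivMf g1 h2; have [a4 b4] := rderivMf g2 h1.
have [a5 b5] := rderivNf a2.
have [_ e1] := rderivDf a1 a5; have [_ e2] := rderivDf a3 a4.
apply: CP; rewrite !(reimE, re_cderiv, im_cderiv).
  have -> : (fun y => re (g y * h y)) = (fun y => re (g y) * re (h y) + - (im (g y) * im (h y))).
    by apply/funext => y; rewrite reM.
  by rewrite e1 b5 b1 b2; ring.
have -> : (fun y => im (g y * h y)) = (fun y => re (g y) * im (h y) + im (g y) * re (h y)).
  by apply/funext => y; rewrite imM.
by rewrite e2 b3 b4; ring.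
Qed.

Lemma cderiv_cj O g v z : csm O g -> O z -> cderiv v (fun y => cj (g y)) z = cj (cderiv v g z).
Proof.
move=> Hg Oz; have [g1 g2] := csm_rd v Hg Oz.
apply: CP; rewrite !(reimE, re_cderiv, im_cderiv).
  by congr (rderiv v _ z); apply/funext => y; rewrite re_cj.
by rewrite -(rderivNf g2).2; congr (rderiv v _ z); apply/funext => y; rewrite im_cj.
Qed.

Lemma cderivD_dir O g v w z : open O -> csm O g -> O z ->
  cderiv (v + w) g z = cderiv v g z + cderiv w g z.
Proof.
move=> Oo [/smooth_C1 h1 /smooth_C1 h2] Oz.
apply: CP; rewrite !(reimE, re_cderiv, im_cderiv).
  exact: rderivD_dir Oo h1 Oz.
exact: rderivD_dir Oo h2 Oz.
Qed.
Lemma cderivZ_dir O g (a : R) v z : open O -> csm O g -> O z ->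
  cderiv (ofR a *: v) g z = ofR a * cderiv v g z.
Proof.
move=> Oo [/smooth_C1 h1 /smooth_C1 h2] Oz.
apply: CP; rewrite !(reimE, re_cderiv, im_cderiv) ?mul0r ?subr0 ?addr0.
  exact: rderivZ_dir Oo h1 Oz.
exact: rderivZ_dir Oo h2 Oz.
Qed.

Lemma cderivC O g v w z : open O -> csm O g -> O z ->
  cderiv v (cderiv w g) z = cderiv w (cderiv v g) z.
Proof.
move=> Oo [h1 h2] Oz.
have H1 y : C1 O (rderiv y (fun z => re (g z))) := smooth_C1 (smooth_rderiv y h1).
have H2 y : C1 O (rderiv y (fun z => im (g z))) := smooth_C1 (smooth_rderiv y h2).
have e1 := clairaut v w Oo (smooth_C1 h1) H1 Oz.
have e2 := clairaut v w Oo (smooth_C1 h2) H2 Oz.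
by apply: CP; [exact: e1 | exact: e2].
Qed.

(* [W (- iC)] is the derivative of type (1,0) in the direction v, [W iC] the one of type (0,1). *)
Definition W s v g z : C := 2^-1 * (cderiv v g z + s * cderiv (iC *: v) g z).

Lemma dzE j g z : dz j g z = W (- iC) (delta_mx 0 j) g z.
Proof. by rewrite /dz /W mulNr. Qed.

Lemma csmW O g s v : open O -> csm O g -> csm O (W s v g).
Proof.
move=> Oo H; apply: csmM => //; first exact: csm_cst.
apply: csmD => //; first exact: csm_cderiv.
by apply: csmM => //; [exact: csm_cst | exact: csm_cderiv].
Qed.

Lemma near_W O g h s z v : csm O g -> O z -> (\forall w \near z, g w = h w) ->
  W s v h z = W s v g z.
Proof. by move=> H Oz gh; rewrite /W !(near_cderiv _ H Oz gh). Qed.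

Lemma W_cst s v c z : W s v (fun=> c) z = 0.
Proof. by rewrite /W !cderiv_cst mulr0 addr0 mulr0. Qed.
Lemma W_add O g h s v z : csm O g -> csm O h -> O z ->
  W s v (fun y => g y + h y) z = W s v g z + W s v h z.
Proof.
move=> Hg Hh Oz; rewrite /W (cderivD v Hg Hh Oz) (cderivD (iC *: v) Hg Hh Oz).
move: (cderiv _ _ _) (cderiv _ _ _) (cderiv _ _ _) (cderiv _ _ _) => a b c d; ring.
Qed.
Lemma W_mul O g h s v z : csm O g -> csm O h -> O z ->
  W s v (fun y => g y * h y) z = W s v g z * h z + g z * W s v h z.
Proof.
move=> Hg Hh Oz; rewrite /W (cderivM v Hg Hh Oz) (cderivM (iC *: v) Hg Hh Oz).
move: (cderiv _ _ _) (cderiv _ _ _) (cderiv _ _ _) (cderiv _ _ _) (g z) (h z) => a b c d x y; ring.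
Qed.
Lemma W_cj O g s v z : csm O g -> O z ->
  W s v (fun y => cj (g y)) z = cj (W (cj s) v g z).
Proof.
move=> Hg Oz; rewrite /W (cderiv_cj v Hg Oz) (cderiv_cj (iC *: v) Hg Oz).
rewrite cjM cjD cjM cjK cjV.
by rewrite -[2]/(1 + 1) cjD cj1.
Qed.
Lemma W_opp O g s v z : csm O g -> O z -> W s v (fun y => - g y) z = - W s v g z.
Proof.
move=> Hg Oz; have := W_mul s v (csm_cst O (-1)) Hg Oz.
rewrite W_cst mul0r add0r mulN1r => <-.
by congr (W s v _ z); apply/funext => y; rewrite mulN1r.
Qed.
Lemma W_sum O I (r : seq I) (F : I -> V -> C) s v z : open O ->
  (forall i, csm O (F i)) -> O z ->
  W s v (fun y => \sum_(i <- r) F i y) z = \sum_(i <- r) W s v (F i) z.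
Proof.
move=> Oo H Oz; elim: r => [|i r IH].
  rewrite big_nil (_ : (fun y => _) = fun=> 0) ?W_cst //.
  by apply/funext => y; rewrite big_nil.
rewrite big_cons -IH -(W_add _ _ (H i) (csm_sum r Oo H) Oz); congr (W s v _ z).
by apply/funext => y; rewrite big_cons.
Qed.

Lemma WD_dir O g s v w z : open O -> csm O g -> O z ->
  W s (v + w) g z = W s v g z + W s w g z.
Proof.
move=> Oo H Oz; rewrite /W (cderivD_dir v w Oo H Oz) scalerDr.
rewrite (cderivD_dir (iC *: v) (iC *: w) Oo H Oz).
move: (cderiv _ _ _) (cderiv _ _ _) (cderiv _ _ _) (cderiv _ _ _) => a b c d; ring.
Qed.
Lemma cderivZc O g (c : C) v z : open O -> csm O g -> O z ->
  cderiv (c *: v) g z = ofR (re c) * cderiv v g z + ofR (im c) * cderiv (iC *: v) g z.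
Proof.
move=> Oo H Oz; rewrite {1}(CRe c) scalerDl [iC * _]mulrC -scalerA.
rewrite (cderivD_dir (ofR (re c) *: v) (ofR (im c) *: (iC *: v)) Oo H Oz).
by rewrite (cderivZ_dir (re c) v Oo H Oz) (cderivZ_dir (im c) (iC *: v) Oo H Oz).
Qed.
Lemma cderivii O g v z : open O -> csm O g -> O z ->
  cderiv (iC *: (iC *: v)) g z = - cderiv v g z.
Proof.
move=> Oo H Oz; rewrite scalerA iC2 -(_ : ofR (-1) = -1 :> C); last by rewrite rmorphN1.
by rewrite (cderivZ_dir (-1) v Oo H Oz) rmorphN1 mulN1r.
Qed.
Lemma Wd_Z O g (c : C) v z : open O -> csm O g -> O z ->
  W (- iC) (c *: v) g z = c * W (- iC) v g z.
Proof.
move=> Oo H Oz; rewrite /W (_ : iC *: (c *: v) = c *: (iC *: v)); last by rewrite !scalerA mulrC.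
rewrite (cderivZc c v Oo H Oz) (cderivZc c (iC *: v) Oo H Oz) (cderivii v Oo H Oz).
rewrite [in RHS](CRe c); move: (ofR (re c)) (ofR (im c)) (cderiv v g z) (cderiv (iC *: v) g z) => a b x y.
transitivity (2^-1 * (a * x + b * y - a * (iC * y) + b * iC * x)); first ring.
have {1}-> : b * y = - (iC * iC) * (b * y) by rewrite iC2; ring.
ring.
Qed.
Lemma Wb_Z O g (c : C) v z : open O -> csm O g -> O z ->
  W iC (c *: v) g z = cj c * W iC v g z.
Proof.
move=> Oo H Oz; rewrite /W (_ : iC *: (c *: v) = c *: (iC *: v)); last by rewrite !scalerA mulrC.
rewrite (cderivZc c v Oo H Oz) (cderivZc c (iC *: v) Oo H Oz) (cderivii v Oo H Oz).
have -> : cj c = ofR (re c) - iC * ofR (im c) by apply: CP; rewrite !reimE; ring.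
move: (ofR (re c)) (ofR (im c)) (cderiv v g z) (cderiv (iC *: v) g z) => a b x y.
transitivity (2^-1 * (a * x + b * y + a * (iC * y) - b * iC * x)); first ring.
have {1}-> : b * y = - (iC * iC) * (b * y) by rewrite iC2; ring.
ring.
Qed.

Lemma cderivE g v z : cderiv v g z = W (- iC) v g z + W iC v g z.
Proof. by rewrite /W; field. Qed.

Lemma WC O g s t v w z : open O -> csm O g -> O z ->
  W s v (W t w g) z = W t w (W s v g) z.
Proof.
move=> Oo H Oz.
(* The second disjunct lets one statement serve for arbitrary [a] and [b]; it is excluded at each
   use by exhibiting smoothness. *)
have E a b r x y : W r y (fun u => 2^-1 * (a u + x * b u)) z = 2^-1 * (W r y a z + x * W r y b z) \/ ~ (csm O a /\ csm O b).
  have [[Ha Hb]|] := pselect (csm O a /\ csm O b); last by right.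
  left; rewrite (W_mul _ _ (csm_cst O _) _ Oz); last by apply: csmD => //; apply: csmM => //; exact: csm_cst.
  rewrite W_cst mul0r add0r (W_add _ _ Ha _ Oz); last by apply: csmM => //; exact: csm_cst.
  by rewrite (W_mul _ _ (csm_cst O _) Hb Oz) W_cst mul0r add0r.
have [e1|[]] := E (cderiv w g) (cderiv (iC *: w) g) s t v; last by split; exact: csm_cderiv.
have [e2|[]] := E (cderiv v g) (cderiv (iC *: v) g) t s w; last by split; exact: csm_cderiv.
rewrite [LHS]e1 [RHS]e2 /W.
rewrite (cderivC v w Oo H Oz) (cderivC (iC *: v) w Oo H Oz) (cderivC v (iC *: w) Oo H Oz).
rewrite (cderivC (iC *: v) (iC *: w) Oo H Oz).
by move: (cderiv _ _ _) (cderiv _ _ _) (cderiv _ _ _) (cderiv _ _ _) => a b c d; ring.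
Qed.

Lemma Wd_coord O g v z : open O -> csm O g -> O z ->
  W (- iC) v g z = \sum_j v 0 j * W (- iC) (delta_mx 0 j) g z.
Proof.
move=> Oo H Oz; rewrite {1}[v]row_sum_delta.
have D0 : W (- iC) 0 g z = 0 by rewrite -[X in W _ X](scale0r (0 : V)) (Wd_Z _ _ Oo H Oz) mul0r.
rewrite (big_morph (fun x => W (- iC) x g z) (fun x y => WD_dir _ x y Oo H Oz) D0).
by apply: eq_bigr => j _; rewrite (Wd_Z _ _ Oo H Oz).
Qed.
Lemma Wb_coord O g v z : open O -> csm O g -> O z ->
  W iC v g z = \sum_j cj (v 0 j) * W iC (delta_mx 0 j) g z.
Proof.
move=> Oo H Oz; rewrite {1}[v]row_sum_delta.
have D0 : W iC 0 g z = 0 by rewrite -[X in W _ X](scale0r (0 : V)) (Wb_Z _ _ Oo H Oz) rmorph0 mul0r.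
rewrite (big_morph (fun x => W iC x g z) (fun x y => WD_dir _ x y Oo H Oz) D0).
by apply: eq_bigr => j _; rewrite (Wb_Z _ _ Oo H Oz).
Qed.
End OneSpace.

Section ComplexChain.
Variables m n : nat.
Variables (O' : set 'rV[C]_m) (O : set 'rV[C]_n) (phi : 'rV[C]_m -> 'rV[C]_n).
Hypotheses (O'o : open O') (Oo : open O) (phiO : forall z, O' z -> O (phi z)).
Hypothesis phi_smooth : forall j, csm O' (fun z => phi z 0 j).

Lemma csm_smooth_map : smooth_map_on O' phi. Proof. by move=> j; case: (phi_smooth j). Qed.

Lemma csm_comp g : csm O g -> csm O' (g \o phi).
Proof.
move=> [/smoothP h1 /smoothP h2]; split; apply/smoothP => N.
  exact: (Ck_comp O'o Oo phiO csm_smooth_map (h1 N)).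
exact: (Ck_comp O'o Oo phiO csm_smooth_map (h2 N)).
Qed.

Lemma cderiv_comp g w z : csm O g -> O' z ->
  cderiv w (g \o phi) z = cderiv (dmap phi w z) g (phi z).
Proof.
move=> [/smooth_C1 h1 /smooth_C1 h2] Oz.
have H := smooth_map_rderivable csm_smooth_map w Oz.
apply: CP; rewrite !(re_cderiv, im_cderiv).
  by have [_ <-] := rderiv_chain Oo h1 (phiO Oz) H.
by have [_ <-] := rderiv_chain Oo h2 (phiO Oz) H.
Qed.

Hypothesis phi_hol : forall j v z, O' z -> W iC v (fun z => phi z 0 j) z = 0.

Lemma Wb_zero_cderiv g v z : W iC v g z = 0 -> cderiv (iC *: v) g z = iC * cderiv v (n := m) g z.
Proof.
rewrite /W => /eqP; rewrite mulf_eq0 invr_eq0 pnatr_eq0 /= => /eqP e.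
have : iC * (cderiv v g z + iC * cderiv (iC *: v) g z) = 0 by rewrite e mulr0.
rewrite mulrDr mulrA iC2 mulN1r => /eqP; rewrite subr_eq0 => /eqP //.
Qed.

Lemma dmap_hol v z : O' z -> dmap phi (iC *: v) z = iC *: dmap phi v z.
Proof.
by move=> Oz; apply/rowP => j; rewrite !mxE Wb_zero_cderiv ?phi_hol.
Qed.

(** The differential of a holomorphic map commutes with multiplication by [iC], hence pulling back
    preserves the type of a Wirtinger derivative. *)
Lemma W_comp g s w z : csm O g -> O' z ->
  W s w (g \o phi) z = W s (dmap phi w z) g (phi z).
Proof.
move=> H Oz; rewrite /W (cderiv_comp w H Oz) (cderiv_comp (iC *: w) H Oz).
by rewrite (dmap_hol w Oz).
Qed.

Lemma dmapE v z : O' z -> dmap phi v z = \row_j W (- iC) v (fun y => phi y 0 j) z.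
Proof. by move=> Oz; apply/rowP => j; rewrite !mxE cderivE phi_hol // addr0. Qed.
End ComplexChain.
End Wirtinger.

(** * Cauchy's theorem and smoothness of holomorphic maps *)

Section Integral.
Variable R : realType.
Local Notation C := (Cx R).
Local Notation mu := (@lebesgue_measure R).

Definition RI (g : R -> R) (a b : R) : R := (\int[mu]_(t in [set` `[a, b]]) g t)%R.

Lemma continuous_integrable (g : R -> R) (a b : R) : continuous g ->
  mu.-integrable `[a, b]%classic (EFin \o g).
Proof.
move=> cg; apply: continuous_compact_integrable; first exact: segment_compact.
exact: continuous_subspaceT.
Qed.

(** The algebra of integrals below is read off primitives: sums, multiples and subdivisions become
    identities between their values at the ends. *)
Lemma primitive_exists (g : R -> R) (a b : R) : continuous g ->
  exists F : R -> R, forall x, a <= x -> x <= b -> is_derive x 1 F (g x).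
Proof.
(* Starting at [a - 1] makes [a] an interior point, where the primitive has a two-sided
   derivative. *)
move=> cg; exists (fun x => (\int[mu]_(t in [set` `[a - 1, x]]) g t)%R) => x ax xb.
have x1 : x < x + 1 by lra.
have ax1 : a - 1 < x by lra.
have := @continuous_FTC1_closed R g (a - 1) x (x + 1) x1 (continuous_integrable _ _ cg) ax1 (cg x).
by move=> [h1]; rewrite derive1E => h2; apply: DeriveDef.
Qed.

Lemma RI_ftc (g F : R -> R) (a b : R) : a < b -> continuous g ->
  (forall x, a <= x -> x <= b -> is_derive x 1 F (g x)) -> RI g a b = F b - F a.
Proof.
move=> ab cg HF.
have dF x : a <= x -> x <= b -> derivable F x 1 by move=> ax xb; case: (HF x ax xb).
have cF x : a <= x -> x <= b -> {for x, continuous F}.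
  by move=> ax xb; apply: differentiable_continuous; apply/derivable1_diffP; exact: dF.
rewrite /RI /Rintegral (@continuous_FTC2 R g F a b ab) //.
- exact: continuous_subspaceT.
- split.
  + by move=> x; rewrite in_itv /= => /andP[? ?]; apply: dF; exact: ltW.
  + by apply: cvg_at_right_filter; exact: cF (lexx a) (ltW ab).
  + by apply: cvg_at_left_filter; exact: cF (ltW ab) (lexx b).
- move=> x; rewrite in_itv /= => /andP[/ltW ax /ltW xb].
  by rewrite derive1E; case: (HF x ax xb).
Qed.

Lemma RI_add (g h : R -> R) a b : a < b -> continuous g -> continuous h ->
  RI (fun x => g x + h x) a b = RI g a b + RI h a b.
Proof.
move=> ab cg ch; have [F HF] := primitive_exists a b cg; have [G HG] := primitive_exists a b ch.
have cgh : continuous (fun x => g x + h x) by move=> x; apply: continuousD; [exact: cg | exact: ch].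
have e1 := RI_ftc ab cg HF; have e2 := RI_ftc ab ch HG.
have HFG x : a <= x -> x <= b -> is_derive x 1 (F + G) (g x + h x).
  by move=> ax xb; exact: is_deriveD (HF x ax xb) (HG x ax xb).
rewrite e1 e2 (RI_ftc ab cgh HFG) -[(F + G) b]/(F b + G b) -[(F + G) a]/(F a + G a); ring.
Qed.

Lemma RI_scale (g : R -> R) c a b : a < b -> continuous g ->
  RI (fun x => c * g x) a b = c * RI g a b.
Proof.
move=> ab cg; have [F HF] := primitive_exists a b cg.
have ccg : continuous (fun x => c * g x) by move=> x; apply: continuousM; [exact: cst_continuous | exact: cg].
have e1 := RI_ftc ab cg HF.
have HcF x : a <= x -> x <= b -> is_derive x 1 (c \*: F) (c * g x).
  by move=> ax xb; exact: is_deriveZ (HF x ax xb).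
rewrite e1 (RI_ftc ab ccg HcF) -[(c \*: F) b]/(c * F b) -[(c \*: F) a]/(c * F a); ring.
Qed.

Lemma RI_split (g : R -> R) a m b : a < m -> m < b -> continuous g ->
  RI g a b = RI g a m + RI g m b.
Proof.
move=> am mb cg; have [F HF] := primitive_exists a b cg.
have H1 x : m <= x -> x <= b -> is_derive x 1 F (g x).
  by move=> mx xb; apply: HF => //; apply: le_trans mx; exact: ltW.
have H2 x : a <= x -> x <= m -> is_derive x 1 F (g x).
  by move=> ax xm; apply: HF => //; apply: le_trans xm _; exact: ltW.
have e := RI_ftc (lt_trans am mb) cg HF; have e1 := RI_ftc mb cg H1.
have e2 := RI_ftc am cg H2; rewrite e e1 e2; ring.
Qed.

Lemma RI_le (g h : R -> R) a b : a < b -> continuous g -> continuous h ->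
  (forall x, a <= x -> x <= b -> g x <= h x) -> RI g a b <= RI h a b.
Proof.
move=> ab cg ch gh; apply: le_Rintegral => //; try exact: continuous_integrable.
by move=> x; rewrite /= in_itv /= => /andP[? ?]; exact: gh.
Qed.

Lemma RI_cst c a b : a < b -> RI (fun=> c) a b = c * (b - a).
Proof.
move=> ab.
have H x : a <= x -> x <= b -> is_derive x 1 (fun y : R => c * y) c.
  move=> _ _; have h : is_derive x 1 (fun y : R => c * y) _ := is_deriveZ c (is_derive_id x (1 : R)).
  by apply: (is_derive_eq h); rewrite -[_ *: _]/(_ * _) mulr1.
have cc : continuous (fun _ : R => c) by move=> x; exact: cst_continuous.
rewrite (RI_ftc ab cc H); ring.
Qed.

Lemma RI_bound (g : R -> R) a b M : a < b -> continuous g ->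
  (forall x, a <= x -> x <= b -> `|g x| <= M) -> `|RI g a b| <= M * (b - a).
Proof.
move=> ab cg gM; rewrite ler_norml -mulNr -!RI_cst //; apply/andP; split.
  apply: RI_le => // [|x ax xb]; first by move=> x; exact: cst_continuous.
  by have := gM x ax xb; rewrite ler_norml => /andP[].
apply: RI_le => // [|x ax xb]; first by move=> x; exact: cst_continuous.
by have := gM x ax xb; rewrite ler_norml => /andP[].
Qed.

Lemma eq_RI (g h : R -> R) a b : (forall x, a <= x -> x <= b -> g x = h x) ->
  RI g a b = RI h a b.
Proof.
move=> gh; apply: eq_Rintegral => x; rewrite inE /= in_itv /= => /andP[? ?]; exact: gh.
Qed.

Lemma contD (f g : R -> R) : continuous f -> continuous g -> continuous (fun t => f t + g t).
Proof. by move=> cf cg x; apply: continuousD; [exact: cf | exact: cg]. Qed.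
Lemma contM (f g : R -> R) : continuous f -> continuous g -> continuous (fun t => f t * g t).
Proof. by move=> cf cg x; apply: continuousM; [exact: cf | exact: cg]. Qed.
Lemma contN (f : R -> R) : continuous f -> continuous (fun t => - f t).
Proof. by move=> cf x; apply: continuousN; exact: cf. Qed.

Definition ccont (g : R -> C) :=
  continuous (fun t : R => re (g t)) /\ continuous (fun t : R => im (g t)).
Definition cI (g : R -> C) (a b : R) : C :=
  Complex (RI (fun t => re (g t)) a b) (RI (fun t => im (g t)) a b).

Lemma ccontD g h : ccont g -> ccont h -> ccont (fun t => g t + h t).
Proof.
move=> [g1 g2] [h1 h2]; split.
  by rewrite (_ : (fun t : R => _) = (fun t => re (g t) + re (h t))); [exact: contD | apply/funext => s; rewrite reD].
by rewrite (_ : (fun t : R => _) = (fun t => im (g t) + im (h t))); [exact: contD | apply/funext => s; rewrite imD].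
Qed.
Lemma ccontM g h : ccont g -> ccont h -> ccont (fun t => g t * h t).
Proof.
move=> [g1 g2] [h1 h2]; split.
  rewrite (_ : (fun t : R => _) = (fun t => re (g t) * re (h t) + - (im (g t) * im (h t)))).
    by apply: contD; [exact: contM | apply: contN; exact: contM].
  by apply/funext => s; rewrite reM.
rewrite (_ : (fun t : R => _) = (fun t => re (g t) * im (h t) + im (g t) * re (h t))).
  by apply: contD; exact: contM.
by apply/funext => s; rewrite imM.
Qed.
Lemma ccont_cst c : ccont (fun=> c).
Proof. by split=> t; exact: cst_continuous. Qed.
Lemma ccontN g : ccont g -> ccont (fun t => - g t).
Proof.
move=> [g1 g2]; split.
  by rewrite (_ : (fun t : R => _) = (fun t => - re (g t))); [exact: contN | apply/funext => s; rewrite reN].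
by rewrite (_ : (fun t : R => _) = (fun t => - im (g t))); [exact: contN | apply/funext => s; rewrite imN].
Qed.

Lemma cI_add g h a b : a < b -> ccont g -> ccont h ->
  cI (fun t => g t + h t) a b = cI g a b + cI h a b.
Proof.
move=> ab [g1 g2] [h1 h2]; apply: CP; rewrite !reimE -RI_add //; apply: eq_RI => x _ _;
  by rewrite !reimE.
Qed.
Lemma cI_scale c g a b : a < b -> ccont g -> cI (fun t => c * g t) a b = c * cI g a b.
Proof.
move=> ab [g1 g2].
have s1 d (h : R -> R) : continuous h -> continuous (fun t => d * h t).
  by move=> ch t; apply: continuousM; [exact: cst_continuous | exact: ch].
apply: CP; rewrite !reimE.
  rewrite -mulNr -!RI_scale // -RI_add //; try exact: s1.
  by apply: eq_RI => x _ _; rewrite !reimE mulNr.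
rewrite -!RI_scale // -RI_add //; try exact: s1.
by apply: eq_RI => x _ _; rewrite !reimE.
Qed.
Lemma cI_opp g a b : a < b -> ccont g -> cI (fun t => - g t) a b = - cI g a b.
Proof.
move=> ab cg; rewrite -mulN1r -cI_scale //; congr (cI _ a b); apply/funext => t.
by rewrite mulN1r.
Qed.
Lemma cI_sub g h a b : a < b -> ccont g -> ccont h ->
  cI (fun t => g t - h t) a b = cI g a b - cI h a b.
Proof. by move=> ab cg ch; rewrite cI_add ?cI_opp //; exact: ccontN. Qed.
Lemma cI_split g a m b : a < m -> m < b -> ccont g -> cI g a b = cI g a m + cI g m b.
Proof. by move=> am mb [g1 g2]; apply: CP; rewrite !reimE; exact: RI_split. Qed.
(** The factor 2 is the price of bounding the real and imaginary parts separately. *)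
Lemma cI_bound g a b M : a < b -> ccont g ->
  (forall x, a <= x -> x <= b -> nr (g x) <= M) -> nr (cI g a b) <= 2 * M * (b - a).
Proof.
move=> ab [g1 g2] gM; apply: le_trans (nr_le_reim _) _; rewrite -mulrA mulr_natl mulr2n.
apply: lerD; apply: RI_bound => // x ax xb; apply: le_trans (gM x ax xb).
  exact: re_le_nr.
exact: im_le_nr.
Qed.
Lemma eq_cI g h a b : (forall x, a <= x -> x <= b -> g x = h x) -> cI g a b = cI h a b.
Proof. by move=> gh; apply: CP; apply: eq_RI => x ax xb; rewrite gh. Qed.
Lemma cI_ftc (g F : R -> C) a b : a < b -> ccont g ->
  (forall x : R, is_derive x 1 (fun t : R => re (F t)) (re (g x)) /\
             is_derive x 1 (fun t : R => im (F t)) (im (g x))) ->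
  cI g a b = F b - F a.
Proof.
move=> ab [g1 g2] H; apply: CP; rewrite !reimE.
  exact: (@RI_ftc _ (fun t => re (F t)) a b ab g1 (fun x _ _ => (H x).1)).
exact: (@RI_ftc _ (fun t => im (F t)) a b ab g2 (fun x _ _ => (H x).2)).
Qed.
Lemma cI_cst c a b : a < b -> cI (fun=> c) a b = c * ofR (b - a).
Proof. by move=> ab; apply: CP; rewrite !reimE RI_cst //; ring. Qed.
End Integral.

(** * Goursat's theorem on rectangles *)

Section Goursat.
Variable R : realType.
Local Notation C := (Cx R).
Variable k : R -> R -> C.
Hypothesis k1 : forall y, ccont (fun x => k x y).
Hypothesis k2 : forall x, ccont (k x).

(** The counterclockwise contour integral of [k] along the boundary of the rectangle with lower left
    corner [(x, y)]: bottom minus top, then [iC] times right minus left. *)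
Definition rect_int (x y l m : R) : C :=
  cI (fun s => k s y) x (x + l) - cI (fun s => k s (y + m)) x (x + l) +
  iC * (cI (k (x + l)) y (y + m) - cI (k x) y (y + m)).

Lemma rect_int_split x y l m : 0 < l -> 0 < m ->
  rect_int x y (l + l) (m + m) =
    rect_int x y l m + rect_int (x + l) y l m +
    rect_int x (y + m) l m + rect_int (x + l) (y + m) l m.
Proof.
move=> l0 m0; rewrite /rect_int !addrA.
have xl : x < x + l by rewrite ltrDl.
have xll : x + l < x + l + l by rewrite ltrDl.
have ym : y < y + m by rewrite ltrDl.
have ymm : y + m < y + m + m by rewrite ltrDl.
rewrite !(cI_split xl xll (k1 _)) !(cI_split ym ymm (k2 _)).
ring.
Qed.

(** Complex differentiability of [k] at [x + i y] with derivative [d], the two real coordinates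
    being kept apart. *)
Definition cr_point x y (d : C) := forall e : R, 0 < e ->
  exists2 r : R, 0 < r & forall s t, `|s - x| < r -> `|t - y| < r ->
    nr (k s t - k x y - d * Complex (s - x) (t - y)) <= e * (`|s - x| + `|t - y|).

End Goursat.

Section GoursatTheorem.
Variable R : realType.
Local Notation C := (Cx R).
Implicit Types k : R -> R -> C.

Lemma is_derive_square (x : R) : is_derive x 1 (fun t : R => t * t / 2) x.
Proof.
have h1 := is_derive_id x (1 : R).
have h2 : is_derive x 1 (fun t : R => t * t) _ := is_deriveM h1 h1.
have h3 : is_derive x 1 (fun t : R => 2^-1 * (t * t)) _ := is_deriveZ (2^-1 : R) h2.
rewrite (_ : (fun t : R => t * t / 2) = (fun t => 2^-1 * (t * t))); last by apply/funext => t; rewrite mulrC.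
by apply: (is_derive_eq h3); rewrite -![_ *: _]/(_ * _); field.
Qed.

Lemma is_derive_affine2 (a b x : R) :
  is_derive x 1 (fun t : R => a * t + b * (t * t / 2)) (a + b * x).
Proof.
have h1 : is_derive x 1 (fun t : R => a * t) _ := is_deriveZ a (is_derive_id x (1 : R)).
have h2 : is_derive x 1 (fun t : R => b * (t * t / 2)) _ := is_deriveZ b (is_derive_square x).
have h3 : is_derive x 1 (fun t : R => a * t + b * (t * t / 2)) _ := is_deriveD h1 h2.
by apply: (is_derive_eq h3); rewrite -![_ *: _]/(_ * _); ring.
Qed.

Lemma ccont_affine (a b : C) : ccont (fun t => a + b * ofR t).
Proof.
apply: ccontD; first exact: ccont_cst.
apply: ccontM; first exact: ccont_cst.
by split=> [t|]; [exact: cvg_id | move=> t; exact: cst_continuous].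
Qed.

Lemma cI_affine (a b : C) (x y : R) : x < y ->
  cI (fun t => a + b * ofR t) x y = a * ofR (y - x) + b * ofR ((y * y - x * x) / 2).
Proof.
move=> xy; rewrite (@cI_ftc _ _ (fun t => a * ofR t + b * ofR (t * t / 2)) x y xy).
- by rewrite !raddfB /= mulrBl raddfB /=; ring.
- exact: ccont_affine.
- move=> t; split.
    rewrite !reimE mulr0 subr0.
    rewrite (_ : (fun t : R => _) = (fun t => re a * t + re b * (t * t / 2))); first exact: is_derive_affine2.
    by apply/funext => s; rewrite !reimE !mulr0 !subr0.
  rewrite !reimE mulr0 add0r.
  rewrite (_ : (fun t : R => _) = (fun t => im a * t + im b * (t * t / 2))); first exact: is_derive_affine2.
  by apply/funext => s; rewrite !reimE !mulr0 !add0r.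
Qed.

Lemma rect_int_affine (a b : C) x y l m : 0 < l -> 0 < m ->
  rect_int (fun s t => a + b * Complex s t) x y l m = 0.
Proof.
move=> l0 m0.
have xl : x < x + l by rewrite ltrDl.
have ym : y < y + m by rewrite ltrDl.
have E1 t : (fun s : R => a + b * Complex s t) = (fun s => (a + b * (iC * ofR t)) + b * ofR s).
  by apply/funext => s; rewrite -addrA -mulrDr; congr (_ + _ * _); apply: CP; rewrite !reimE; ring.
have E2 s : (fun t : R => a + b * Complex s t) = (fun t => (a + b * ofR s) + (b * iC) * ofR t).
  by apply/funext => t; rewrite -addrA -mulrA -mulrDr; congr (_ + _ * _); apply: CP; rewrite !reimE; ring.
rewrite /rect_int !E1 !E2 !cI_affine //.
rewrite !(addrC x) !addrK (addrC y) !addrK.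
rewrite !rmorphD /=.
have -> : b * (iC * (ofR m + ofR y)) = b * (iC * ofR y) + b * iC * ofR m by ring.
move: (ofR (((l + x) * _ - _) / 2)) (ofR (((m + y) * _ - _) / 2)) => u v.
move: (ofR x) (ofR y) (ofR l) (ofR m) => x1 y1 l1 m1.
transitivity (- (b * iC * m1 * l1) + iC * (b * l1 * m1)); first by ring.
by ring.
Qed.

Lemma rect_int_sub k k' x y l m : 0 < l -> 0 < m ->
  (forall t, ccont (fun s => k s t)) -> (forall s, ccont (k s)) ->
  (forall t, ccont (fun s => k' s t)) -> (forall s, ccont (k' s)) ->
  rect_int (fun s t => k s t - k' s t) x y l m = rect_int k x y l m - rect_int k' x y l m.
Proof.
move=> l0 m0 k1 k2 k1' k2'.
have xl : x < x + l by rewrite ltrDl.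
have ym : y < y + m by rewrite ltrDl.
rewrite /rect_int !cI_sub //; ring.
Qed.

Lemma rect_int_bound k x y l m M : 0 < l -> 0 < m ->
  (forall t, ccont (fun s => k s t)) -> (forall s, ccont (k s)) ->
  (forall s t, x <= s -> s <= x + l -> y <= t -> t <= y + m -> nr (k s t) <= M) ->
  nr (rect_int k x y l m) <= 4 * M * (l + m).
Proof.
move=> l0 m0 k1 k2 kM.
have xl : x < x + l by rewrite ltrDl.
have ym : y < y + m by rewrite ltrDl.
rewrite /rect_int; apply: le_trans (nrD _ _) _.
have B1 t : y <= t -> t <= y + m -> nr (cI (fun s => k s t) x (x + l)) <= 2 * M * l.
  move=> yt tm; have := @cI_bound _ (fun s => k s t) x (x + l) M xl (k1 t).
  by rewrite (addrC x) addrK; apply=> s xs sx; apply: kM => //; rewrite addrC.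
have B2 s : x <= s -> s <= x + l -> nr (cI (k s) y (y + m)) <= 2 * M * m.
  move=> xs sl; have := @cI_bound _ (k s) y (y + m) M ym (k2 s).
  by rewrite (addrC y) addrK; apply=> t yt ty; apply: kM => //; rewrite addrC.
have := B1 y (lexx _) (ltW ym); have := B1 (y + m) (ltW ym) (lexx _).
have := B2 x (lexx _) (ltW xl); have := B2 (x + l) (ltW xl) (lexx _).
rewrite nrM nr_iC mul1r.
set a1 := cI _ _ _; set a2 := cI _ _ _; set a3 := cI _ _ _; set a4 := cI _ _ _.
move=> h1 h2 h3 h4.
have := nrD a4 (- a3); have := nrD a1 (- a2); rewrite !nrN.
move: (nr a1) (nr a2) (nr a3) (nr a4) (nr _) (nr _) h1 h2 h3 h4 => *; nra.
Qed.

(** Bisection: one of the four quarters keeps at least a quarter of the integral, so step [n]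
    retains [e / 4 ^+ n]. At the common limit point the affine approximation makes the integral an
    arbitrarily small multiple of [4 ^- n], a contradiction. *)
Theorem goursat k x0 y0 l m : 0 < l -> 0 < m ->
  (forall t, ccont (fun s => k s t)) -> (forall s, ccont (k s)) ->
  (forall x y, x0 <= x -> x <= x0 + l -> y0 <= y -> y <= y0 + m -> exists d, cr_point k x y d) ->
  rect_int k x0 y0 l m = 0.
Proof.
move=> l0 m0 k1 k2 kd; apply/eqP/negPn/negP; rewrite -nr_gt0 => E0.
set e := nr _ in E0.
pose L n : R := l / 2 ^+ n; pose M n : R := m / 2 ^+ n.
have L0 n : 0 < L n by rewrite divr_gt0 // exprn_gt0.
have M0 n : 0 < M n by rewrite divr_gt0 // exprn_gt0.
have LS n : L n = L n.+1 + L n.+1 by rewrite /L exprS; field; rewrite expf_neq0.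
have MS n : M n = M n.+1 + M n.+1 by rewrite /M exprS; field; rewrite expf_neq0.
pose P n (q : R * R) := e / 4 ^+ n <= nr (rect_int k q.1 q.2 (L n) (M n)).
have step (nq : nat * (R * R)) : exists q' : R * R,
   (nq.2.1 <= q'.1 <= nq.2.1 + L nq.1.+1) /\ (nq.2.2 <= q'.2 <= nq.2.2 + M nq.1.+1) /\
   (P nq.1 nq.2 -> P nq.1.+1 q').
  case: nq => n [x y] /=.
  have lx : x <= x <= x + L n.+1 by rewrite lexx lerDl ltW.
  have ly : y <= y <= y + M n.+1 by rewrite lexx lerDl ltW.
  have lx' : x <= x + L n.+1 <= x + L n.+1 by rewrite lexx lerDl ltW.
  have ly' : y <= y + M n.+1 <= y + M n.+1 by rewrite lexx lerDl ltW.
  have [p1|n1] := pselect (P n.+1 (x, y)); first by exists (x, y); split; [exact: lx | split; [exact: ly | move=> _; exact: p1]].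
  have [p2|n2] := pselect (P n.+1 (x + L n.+1, y)); first by exists (x + L n.+1, y); split; [exact: lx' | split; [exact: ly | move=> _; exact: p2]].
  have [p3|n3] := pselect (P n.+1 (x, y + M n.+1)); first by exists (x, y + M n.+1); split; [exact: lx | split; [exact: ly' | move=> _; exact: p3]].
  exists (x + L n.+1, y + M n.+1); split; first exact: lx'.
  split; first exact: ly'.
  rewrite /P /= (LS n) (MS n) rect_int_split // => H.
  move: n1 n2 n3; rewrite /P /= => /negP; rewrite -ltNge => n1 /negP; rewrite -ltNge => n2 /negP; rewrite -ltNge => n3.
  have := nrD (rect_int k x y (L n.+1) (M n.+1) + rect_int k (x + L n.+1) y (L n.+1) (M n.+1) + rect_int k x (y + M n.+1) (L n.+1) (M n.+1)) (rect_int k (x + L n.+1) (y + M n.+1) (L n.+1) (M n.+1)).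
  have := nrD (rect_int k x y (L n.+1) (M n.+1) + rect_int k (x + L n.+1) y (L n.+1) (M n.+1)) (rect_int k x (y + M n.+1) (L n.+1) (M n.+1)).
  have := nrD (rect_int k x y (L n.+1) (M n.+1)) (rect_int k (x + L n.+1) y (L n.+1) (M n.+1)).
  have e4 : e / 4 ^+ n = 4 * (e / 4 ^+ n.+1) by rewrite exprS; field; rewrite expf_neq0.
  move: H; rewrite e4; move: (nr _) (nr _) (nr _) (nr _) (nr _) (nr _) (nr _) n1 n2 n3 => *; lra.
have [f Hf] := choice step.
pose q := fix q n : R * R := if n is n'.+1 then f (n', q n') else (x0, y0).
have q1 n : (q n).1 <= (q n.+1).1 <= (q n).1 + L n.+1 by have [] := Hf (n, q n).
have q2 n : (q n).2 <= (q n.+1).2 <= (q n).2 + M n.+1 by have [_ []] := Hf (n, q n).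
have qP n : P n (q n).
  elim: n => [|n IH]; last by have [_ [_]] := Hf (n, q n); apply.
  by rewrite /P /= expr0 divr1 /L /M expr0 !divr1.
have nest (u N : nat -> R) : (forall n, u n <= u n.+1 <= u n + N n.+1) ->
   (forall n, N n = N n.+1 + N n.+1) -> (forall n, 0 < N n) ->
   exists X, forall n, u n <= X <= u n + N n.
  move=> hu hN N0.
  have mono i j : (i <= j)%N -> u i <= u j.
    elim: j => [|j IH]; first by rewrite leqn0 => /eqP ->.
    rewrite leq_eqVlt => /orP[/eqP -> //|]; rewrite ltnS => /IH h.
    by apply: le_trans h _; have /andP[] := hu j.
  have dec i j : (i <= j)%N -> u j + N j <= u i + N i.
    elim: j => [|j IH]; first by rewrite leqn0 => /eqP ->.
    rewrite leq_eqVlt => /orP[/eqP -> //|]; rewrite ltnS => /IH h.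
    by apply: le_trans h; have /andP[_] := hu j; rewrite (hN j); lra.
  have ub i j : u j <= u i + N i.
    have := mono j (maxn i j) (leq_maxr _ _); have := dec i (maxn i j) (leq_maxl _ _).
    have := N0 (maxn i j); lra.
  have hs : has_sup (range u) by split; [exists (u 0%N); exists 0%N | exists (u 0%N + N 0%N) => _ [j _ <-]].
  exists (sup (range u)) => n; apply/andP; split.
    by apply: ub_le_sup; [case: hs | exists n].
  by apply: ge_sup; [case: hs | move=> _ [j _ <-]].
have [X HX] := nest (fun n => (q n).1) L q1 LS L0.
have [Y HY] := nest (fun n => (q n).2) M q2 MS M0.
have [d Hd] : exists d, cr_point k X Y d.
  have := HX 0%N; have := HY 0%N; rewrite /= /L /M expr0 !divr1.
  by move=> /andP[? ?] /andP[? ?]; apply: kd.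
(* With error rate [e / (2 * c)], the bound of [rect_int_bound] becomes a quarter of
   [e / 4 ^+ n]. *)
pose c := 8 * (l + m) * (l + m).
have c0 : 0 < c by rewrite /c !mulr_gt0 ?addr_gt0.
have [r r0 Hr] := Hd (e / (2 * c)) (divr_gt0 E0 (mulr_gt0 (ltr0Sn R 1) c0)).
have [n [Ln Mn]] : exists n, L n < r /\ M n < r.
  pose B := (l + m) / r; have B0 : 0 <= B by rewrite divr_ge0 // ltW // addr_gt0.
  exists (Num.bound B).
  have hB : l + m < r * 2 ^+ Num.bound B.
    rewrite -ltr_pdivrMl // mulrC; apply: lt_le_trans (archi_boundP B0) _.
    by rewrite -natrX ler_nat ltnW // ltn_expl.
  by rewrite /L /M; split; rewrite ltr_pdivrMr ?exprn_gt0 //; lra.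
have qn := qP n; have /andP[Xn1 Xn2] := HX n; have /andP[Yn1 Yn2] := HY n.
move: qn; rewrite /P leNgt => /negP; apply.
(* The affine part of [k] at the limit point; it can be subtracted because its contour integral is
   zero. *)
pose A s t := (k X Y - d * Complex X Y) + d * Complex s t.
have A1 t : ccont (fun s => A s t).
  rewrite /A (_ : (fun s => _) = (fun s => (k X Y - d * Complex X Y + d * (iC * ofR t)) + d * ofR s)).
    exact: ccont_affine.
  by apply/funext => s; rewrite -[RHS]addrA -mulrDr; congr (_ + _ * _); apply: CP; rewrite !reimE; ring.
have A2 s : ccont (A s).
  rewrite /A (_ : (fun t => _) = (fun t => (k X Y - d * Complex X Y + d * ofR s) + (d * iC) * ofR t)).
    exact: ccont_affine.
  by apply/funext => t; rewrite -[RHS]addrA -mulrA -mulrDr; congr (_ + _ * _); apply: CP; rewrite !reimE; ring.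
have -> : rect_int k (q n).1 (q n).2 (L n) (M n) =
          rect_int (fun s t => k s t - A s t) (q n).1 (q n).2 (L n) (M n).
  by rewrite rect_int_sub // rect_int_affine // subr0.
have B1 t : ccont (fun s => k s t - A s t) by apply: ccontD => //; exact: ccontN.
have B2 s : ccont (fun t => k s t - A s t) by apply: ccontD => //; exact: ccontN.
apply: le_lt_trans (rect_int_bound (M := e / (2 * c) * (L n + M n)) (L0 n) (M0 n) B1 B2 _) _.
  move=> s t s1 s2 t1 t2.
  have sX : `|s - X| <= L n by rewrite ler_norml; apply/andP; split; lra.
  have tY : `|t - Y| <= M n by rewrite ler_norml; apply/andP; split; lra.
  have := Hr s t (le_lt_trans sX Ln) (le_lt_trans tY Mn).
  have -> : k s t - A s t = k s t - k X Y - d * Complex (s - X) (t - Y).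
    have -> : Complex (s - X) (t - Y) = Complex s t - Complex X Y :> C by apply: CP; rewrite !reimE.
    by rewrite /A; ring.
  move=> h; apply: le_trans h _; rewrite ler_wpM2l ?lerD //.
  by rewrite divr_ge0 ?(ltW E0) // mulr_ge0 // ltW.
have LM : (L n + M n) * (L n + M n) = (l + m) * (l + m) / 4 ^+ n.
  have -> : (4 : R) ^+ n = 2 ^+ n * 2 ^+ n by rewrite -exprMn -natrM.
  by rewrite /L /M; field; rewrite expf_neq0.
have -> : 4 * (e / (2 * c) * (L n + M n)) * (L n + M n) = 4 * (e / (2 * c)) * ((L n + M n) * (L n + M n)) by ring.
rewrite LM /c; set p4 := 4 ^+ n; have p40 : 0 < p4 by rewrite exprn_gt0.
have lm0 : 0 < l + m by rewrite addr_gt0.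
have -> : 4 * (e / (2 * (8 * (l + m) * (l + m)))) * ((l + m) * (l + m) / p4) = (e / p4) / 4.
  by field; rewrite !gt_eqF.
have : 0 < e / p4 by rewrite divr_gt0.
lra.
Qed.
End GoursatTheorem.

Lemma frac_le (R : realType) (a x : R) : 0 <= a -> 0 <= x -> x * (a / (x + 1)) <= a.
Proof.
move=> a0 x0; rewrite mulrA ler_pdivrMr; last lra.
nra.
Qed.

(** * The complex exponential and complex differentiability in one variable *)

Section ComplexExp.
Variable R : realType.
Local Notation C := (Cx R).

Lemma iC_neq0 : (iC : C) != 0. Proof. by rewrite -nr_gt0 nr_iC. Qed.

Definition cis (t : R) : C := Complex (cos t) (sin t).
Definition cexp (w : C) : C := ofR (expR (re w)) * cis (im w).

Lemma cisD s t : cis (s + t) = cis s * cis t.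
Proof. by apply: CP; rewrite /cis !reimE ?cosD ?sinD //; ring. Qed.
Lemma cj_cis t : cj (cis t) = cis (- t).
Proof. by apply: CP; rewrite /cis !reimE ?cosN ?sinN. Qed.
Lemma cis0 : cis 0 = 1.
Proof. by apply: CP; rewrite /cis !reimE ?cos0 ?sin0. Qed.
Lemma nr_cis t : nr (cis t) = 1.
Proof. by rewrite nr_sqrt !reimE cos2Dsin2 sqrtr1. Qed.
Lemma cis_period t : cis (t + pi *+ 2) = cis t.
Proof.
rewrite cisD (_ : cis (pi *+ 2) = 1) ?mulr1 //.
by apply: CP; rewrite /cis !reimE ?cos2pi ?sin2pi.
Qed.
Lemma cexpD w w' : cexp (w + w') = cexp w * cexp w'.
Proof. by rewrite /cexp !reimE expRD cisD rmorphM /=; ring. Qed.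
Lemma cexp0 : cexp 0 = 1.
Proof. by rewrite /cexp !reimE expR0 cis0 mulr1. Qed.
Lemma nr_cexp w : nr (cexp w) = expR (re w).
Proof. by rewrite nrM nr_cis mulr1 nr_ofR ger0_norm // expR_ge0. Qed.

Lemma cis_continuous (t : R) : cis s @[s --> t] --> cis t.
Proof.
apply: (@cvg_reim _ _ (nbhs t) cis); rewrite /=; first exact: continuous_cos.
exact: continuous_sin.
Qed.

Definition cdiff (K : C -> C) (w d : C) := forall e : R, 0 < e ->
  \forall h \near (0 : C), nr (K (w + h) - K w - d * h) <= e * nr h.

Lemma near_re (P : R -> Prop) : (\forall t \near (0 : R), P t) ->
  \forall h \near (0 : C), P (re h).
Proof. by move=> HP; have := @cvg_re R 0; rewrite re0; apply. Qed.
Lemma near_im (P : R -> Prop) : (\forall t \near (0 : R), P t) ->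
  \forall h \near (0 : C), P (im h).
Proof. by move=> HP; have := @cvg_im R 0; rewrite im0; apply. Qed.

Lemma exp_remainder (x y r1 r2 r3 a : R) : 0 <= a -> a <= 1 ->
  `|x| <= a -> `|r1| <= a * `|x| -> `|r2| <= a * `|y| -> `|r3| <= a * `|y| ->
  `|(1 + x + r1) * (1 + r3) - 1 - x| + `|(1 + x + r1) * (y + r2) - y| <=
  9 * a * (`|x| + `|y|).
Proof.
move=> a0 a1 xa h1 h2 h3.
have x0 := normr_ge0 x; have y0 := normr_ge0 y.
have r1a : `|r1| <= `|x| by apply: le_trans h1 _; rewrite ler_piMl.
have b : `|1 + x + r1| <= 3.
  apply: le_trans (ler_normD _ _) _; apply: le_trans (lerD (ler_normD _ _) (lexx _)) _.
  by rewrite normr1; lra.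
have b' : `|x + r1| <= 2 * `|x| by apply: le_trans (ler_normD _ _) _; lra.
have -> : (1 + x + r1) * (1 + r3) - 1 - x = r1 + (1 + x + r1) * r3 by ring.
have -> : (1 + x + r1) * (y + r2) - y = (x + r1) * y + (1 + x + r1) * r2 by ring.
have m1 : `|(1 + x + r1) * r3| <= 3 * (a * `|y|) by rewrite normrM ler_pM.
have m2 : `|(1 + x + r1) * r2| <= 3 * (a * `|y|) by rewrite normrM ler_pM.
have m3 : `|(x + r1) * y| <= 2 * (a * `|y|).
  rewrite normrM mulrA ler_wpM2r //; apply: le_trans b' _; lra.
have := ler_normD r1 ((1 + x + r1) * r3).
have := ler_normD ((x + r1) * y) ((1 + x + r1) * r2).
have := mulr_ge0 a0 y0; have := mulr_ge0 a0 x0.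
rewrite !mulrDr -!mulrA.
move: (a * `|y|) (a * `|x|) m1 m2 m3 h1 => ay ax m1 m2 m3 h1 ? ? ? ?; lra.
Qed.

Lemma cexp_cdiff0 : cdiff cexp 0 1.
Proof.
move=> e e0.
(* The remainder is at most [9 * a] times [|re h| + |im h|], which is at most [2 * nr h]; hence
   18. *)
pose a := Num.min 1 (e / 18).
have a0 : 0 < a by rewrite lt_min ltr01 divr_gt0.
have a1 : a <= 1 by rewrite ge_min lexx.
have ae : 18 * a <= e.
  have : a <= e / 18 by rewrite ge_min lexx orbT.
  lra.
have ie : is_derive (0 : R) 1 expR 1 by have := is_derive_expR (0 : R); rewrite expR0.
have is' : is_derive (0 : R) 1 sin 1 by have := is_derive_sin (0 : R); rewrite cos0.
have ic : is_derive (0 : R) 1 cos 0 by have := is_derive_cos (0 : R); rewrite sin0 oppr0.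
have /near_re h1 := (is_derive_eps _ _ _).1 ie _ a0.
have /near_im h2 := (is_derive_eps _ _ _).1 is' _ a0.
have /near_im h3 := (is_derive_eps _ _ _).1 ic _ a0.
have h4 := @near_nr R _ (0 : C) _ a0.
have FF := @nbhs_filter C (0 : C).
have := @filterI _ _ FF _ _ h1 (@filterI _ _ FF _ _ h2 (@filterI _ _ FF _ _ h3 h4)).
apply: (@filterS _ _ FF) => h [/= k1 [/= k2 [/= k3 /= k4]]].
move: k1 k2 k3 k4; rewrite !add0r expR0 sin0 cos0 mulr1 mulr0 !subr0 mulr1 => k1 k2 k3 k4.
rewrite cexp0 mul1r; apply: le_trans (nr_le_reim _) _.
rewrite /cexp /cis !reimE !mul0r subr0 addr0.
pose r1 := expR (re h) - 1 - re h; pose r2 := sin (im h) - im h; pose r3 := cos (im h) - 1.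
have -> : expR (re h) = 1 + re h + r1 by rewrite /r1; ring.
have -> : sin (im h) = im h + r2 by rewrite /r2; ring.
have -> : cos (im h) = 1 + r3 by rewrite /r3; ring.
have xa : `|re h| <= a by apply: le_trans (re_le_nr _) (ltW _).
rewrite subr0; apply: le_trans (exp_remainder (ltW a0) a1 xa k1 k2 k3) _.
have := re_le_nr h; have := im_le_nr h; have := nr_ge0 h => n0 n1 n2.
apply: le_trans (_ : 9 * a * (2 * nr h) <= _).
  by rewrite ler_wpM2l ?mulr_ge0 ?(ltW a0) //; lra.
rewrite mulrA ler_wpM2r //; lra.
Qed.

Lemma cexp_cdiff w : cdiff cexp w (cexp w).
Proof.
move=> e e0; have w0 : 0 < nr (cexp w) by rewrite nr_cexp expR_gt0.
have := cexp_cdiff0 (divr_gt0 e0 w0); apply: filterS => h.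
rewrite add0r cexp0 mul1r cexpD => H.
have -> : cexp w * cexp h - cexp w - cexp w * h = cexp w * (cexp h - 1 - h) by ring.
rewrite nrM mulrC -ler_pdivlMr // mulrAC; exact: H.
Qed.

Lemma cdiff_lip (K : C -> C) w d : cdiff K w d ->
  \forall h \near (0 : C), nr (K (w + h) - K w) <= (nr d + 1) * nr h.
Proof.
move=> H; have := H 1 ltr01; apply: filterS => h hh.
rewrite -[K (w + h) - K w](subrK (d * h)); apply: le_trans (nrD _ _) _.
by rewrite nrM mulrDl addrC lerD2l.
Qed.

Lemma cdiff_cvg (K : C -> C) w d : cdiff K w d ->
  forall e : R, 0 < e -> \forall h \near (0 : C), nr (K (w + h) - K w) < e.
Proof.
move=> H e e0; have d1 : 0 < nr d + 1 by rewrite ltr_wpDl // nr_ge0.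
have FF := @nbhs_filter C (0 : C).
have := @filterI _ _ FF _ _ (cdiff_lip H) (@near_nr R _ (0 : C) _ (divr_gt0 e0 d1)).
apply: (@filterS _ _ FF) => h [/= h1]; rewrite subr0 ltr_pdivlMr // mulrC => h2.
exact: le_lt_trans h1 h2.
Qed.

Lemma cdiff_comp (G K : C -> C) w d d' : cdiff K w d -> cdiff G (K w) d' ->
  cdiff (G \o K) w (d' * d).
Proof.
move=> HK HG e e0.
have d1 : 0 < nr d + 1 by rewrite ltr_wpDl // nr_ge0.
have d'1 : 0 < nr d' + 1 by rewrite ltr_wpDl // nr_ge0.
have e1 : 0 < e / 2 / (nr d + 1) by rewrite !divr_gt0.
have e2 : 0 < e / 2 / (nr d' + 1) by rewrite !divr_gt0.
have /nbhs_nr[r r0 Hr] := HG _ e1.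
have FF := @nbhs_filter C (0 : C).
have := @filterI _ _ FF _ _ (cdiff_lip HK) (@filterI _ _ FF _ _ (cdiff_cvg HK r0) (HK _ e2)).
apply: (@filterS _ _ FF) => h [/= h1 [/= h2 /= h3]].
set k := K (w + h) - K w in h1 h2 h3.
have := Hr k; rewrite subr0 => /(_ h2).
have -> : K w + k = K (w + h) by rewrite /k addrC subrK.
move=> h4.
have -> : G (K (w + h)) - G (K w) - d' * d * h =
  (G (K (w + h)) - G (K w) - d' * k) + d' * (k - d * h) by ring.
apply: le_trans (nrD _ _) _; rewrite [e]splitr mulrDl; apply: lerD.
  apply: le_trans h4 _; apply: le_trans (ler_wpM2l (ltW e1) h1) _.
  by rewrite mulrA divfK ?gt_eqF.
rewrite nrM; apply: le_trans (ler_wpM2l (nr_ge0 _) h3) _.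
by rewrite mulrA ler_wpM2r ?nr_ge0 // frac_le ?nr_ge0 // divr_ge0 // ltW.
Qed.

Lemma cdiff_mul (G K : C -> C) w d d' : cdiff K w d -> cdiff G w d' ->
  cdiff (fun x => K x * G x) w (d * G w + K w * d').
Proof.
move=> HK HG e e0.
have e3 : 0 < e / 3 by rewrite divr_gt0.
have g1 : 0 < nr (G w) + 1 by rewrite ltr_wpDl // nr_ge0.
have k1 : 0 < nr (K w) + 1 by rewrite ltr_wpDl // nr_ge0.
have d1 : 0 < nr d + 1 by rewrite ltr_wpDl // nr_ge0.
have FF := @nbhs_filter C (0 : C).
have := @filterI _ _ FF _ _ (HK _ (divr_gt0 e3 g1)) (@filterI _ _ FF _ _ (HG _ (divr_gt0 e3 k1))
  (@filterI _ _ FF _ _ (cdiff_cvg HG ltr01) (cdiff_cvg HG (divr_gt0 e3 d1)))).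
apply: (@filterS _ _ FF) => h [/= a1 [/= a2 [/= a3 /= a4]]].
have -> : K (w + h) * G (w + h) - K w * G w - (d * G w + K w * d') * h =
  (K (w + h) - K w - d * h) * G (w + h) + (K w * (G (w + h) - G w - d' * h) +
   d * h * (G (w + h) - G w)) by ring.
have E3 : e * nr h = e / 3 * nr h + (e / 3 * nr h + e / 3 * nr h) by field.
apply: le_trans (nrD _ _) _; rewrite E3 !nrM; apply: lerD; last (apply: le_trans (nrD _ _) _; rewrite !nrM; apply: lerD).
- have b : nr (G (w + h)) <= nr (G w) + 1.
    by rewrite -[G (w + h)](subrK (G w)) addrC; apply: le_trans (nrD _ _) _; rewrite lerD2l ltW.
  apply: le_trans (ler_pM (nr_ge0 _) (nr_ge0 _) a1 b) _.
  by rewrite mulrAC divfK ?gt_eqF.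
- apply: le_trans (ler_wpM2l (nr_ge0 _) a2) _.
  by rewrite mulrA ler_wpM2r ?nr_ge0 // frac_le ?nr_ge0 // ltW.
- apply: le_trans (ler_wpM2l _ (ltW a4)) _; first by rewrite mulr_ge0 ?nr_ge0.
  by rewrite mulrAC ler_wpM2r ?nr_ge0 // frac_le ?nr_ge0 // ltW.
Qed.

Lemma cdiff_opp (K : C -> C) w d : cdiff K (- w) d -> cdiff (fun x => K (- x)) w (- d).
Proof.
move=> H e e0; have /nbhs_nr[r r0 Hr] := H e e0.
apply/nbhs_nr; exists r => // h; rewrite subr0 => hr.
by have := Hr (- h); rewrite subr0 nrN => /(_ hr); rewrite opprD mulrN mulNr.
Qed.

Lemma cdiff_continuous (K : C -> C) w d : cdiff K w d -> K x @[x --> w] --> K w.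
Proof.
move=> H; apply/(@cvg_nr _ _ _ (nbhs w)) => e e0.
have /nbhs_nr[r r0 Hr] := cdiff_cvg H e0.
apply/nbhs_nr; exists r => // x xr; have := Hr (x - w).
by rewrite subr0 (addrC w) subrK; apply.
Qed.

Lemma cvg_ccont (f : R -> C) : (forall t, f s @[s --> t] --> f t) -> ccont f.
Proof.
by move=> H; split=> t; [apply: cvg_comp (H t) _; exact: cvg_re | apply: cvg_comp (H t) _; exact: cvg_im].
Qed.

Lemma ccont_cj (f : R -> C) : ccont f -> ccont (fun t => cj (f t)).
Proof.
move=> [f1 f2]; split.
  by rewrite (_ : (fun t : R => _) = (fun t => re (f t))) //; apply/funext => s; rewrite re_cj.
by rewrite (_ : (fun t : R => _) = (fun t => - im (f t))); [exact: contN | apply/funext => s; rewrite im_cj].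
Qed.

Lemma ccont_comp (K : C -> C) (c : R -> C) : (forall t, K x @[x --> c t] --> K (c t)) ->
  (forall t, c s @[s --> t] --> c t) -> ccont (fun t => K (c t)).
Proof.
move=> HK Hc; have Hkc (t : R) : K (c s) @[s --> t] --> K (c t).
  by apply: cvg_comp (HK t); exact: Hc.
by split=> t; [apply: cvg_comp (Hkc t) _; exact: cvg_re | apply: cvg_comp (Hkc t) _; exact: cvg_im].
Qed.

Lemma cvg_Complex (f g : R -> R) t : f s @[s --> t] --> f t -> g s @[s --> t] --> g t ->
  (Complex (f s) (g s) : C) @[s --> t] --> (Complex (f t) (g t) : C).
Proof. by move=> h1 h2; apply: (@cvg_reim _ _ (nbhs t) (fun s => Complex (f s) (g s))). Qed.

Lemma cvg_min (a t : R) : Num.min s a @[s --> t] --> Num.min t a.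
Proof. by apply: (@continuous_min _ _ id (fun=> a)); [exact: cvg_id | exact: cst_continuous]. Qed.
End ComplexExp.

(** * Cauchy's formula for the derivative at the centre of a disc *)

Section CauchyDisc.
Variable R : realType.
Local Notation C := (Cx R).
Variables (g g' : C -> C) (r rho : R).
Hypotheses (r0 : 0 < r) (rrho : r < rho).
Hypothesis gd : forall t, nr t < rho -> cdiff g t (g' t).

Let s1 := ln r.
Let s2 := (s1 + ln rho) / 2.
Let rho0 : 0 < rho. Proof. exact: lt_trans rrho. Qed.
Let s12 : s1 < s2.
Proof.
have h : s1 < ln rho by rewrite /s1 ltr_ln ?posrE.
rewrite /s2; lra.
Qed.
Let s2rho : expR s2 < rho.
Proof.
rewrite -[X in _ < X](lnK (x := rho)) ?posrE // ltr_expR /s2.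
have h : s1 < ln rho by rewrite /s1 ltr_ln ?posrE.
lra.
Qed.

(** With [zeta = cexp w], the form [K w dw] is [g zeta / zeta ^+ 2 dzeta], whose integral over
    circles is Cauchy's expression for [g' 0]. Punctured discs become half-planes and circles
    vertical segments, so rectangles suffice. *)
Let K (w : C) := g (cexp w) * cexp (- w).
(** [goursat] asks for continuity on the whole plane, while [g] is controlled only in the disc;
    cutting [s] at [s2] provides it and changes nothing for [s <= s2]. *)
Let k (s t : R) := K (Complex (Num.min s s2) t).

Let K_cdiff w : re w <= s2 -> exists d, cdiff K w d.
Proof.
move=> ws; have gw : nr (cexp w) < rho.
  by rewrite nr_cexp; apply: le_lt_trans s2rho; rewrite ler_expR.
eexists; apply: cdiff_mul; first exact: cdiff_comp (cexp_cdiff w) (gd gw).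
apply: cdiff_opp; exact: cexp_cdiff.
Qed.

Let K_cont w : re w <= s2 -> K x @[x --> w] --> K w.
Proof. by move=> /K_cdiff[d]; exact: cdiff_continuous. Qed.

Let k1 t : ccont (fun s => k s t).
Proof.
apply: ccont_comp => s; first by apply: K_cont; rewrite reimE ge_min lexx orbT.
by apply: cvg_Complex; [exact: cvg_min | exact: cvg_cst].
Qed.
Let k2 s : ccont (k s).
Proof.
apply: ccont_comp => t; first by apply: K_cont; rewrite reimE ge_min lexx orbT.
by apply: cvg_Complex; [exact: cvg_cst | exact: cvg_id].
Qed.

Let k_cr x y : x <= s1 -> exists d, cr_point k x y d.
Proof.
move=> xs; have xs2 : x < s2 by exact: le_lt_trans xs s12.
have [d Hd] : exists d, cdiff K (Complex x y) d by apply: K_cdiff; rewrite reimE ltW.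
exists d => e e0; have /nbhs_nr[q q0 Hq] := Hd e e0.
exists (Num.min (q / 2) (s2 - x)); first by rewrite lt_min divr_gt0 // subr_gt0.
move=> s t; rewrite !lt_min => /andP[sx sx2] /andP[ty _].
have ss : s <= s2 by move: sx2; rewrite ltr_norml => /andP[_]; lra.
have := Hq (Complex (s - x) (t - y)).
rewrite subr0 /k !min_l ?(ltW xs2) //.
have -> : Complex x y + Complex (s - x) (t - y) = Complex s t :> C.
  by apply: CP; rewrite !reimE; ring.
have nle : nr (Complex (s - x) (t - y) : C) <= `|s - x| + `|t - y|.
  by apply: le_trans (nr_le_reim _) _; rewrite !reimE.
move=> H; apply: le_trans (H _) _; first by apply: le_lt_trans nle _; lra.
by rewrite ler_wpM2l // ltW.
Qed.

Let pi2 : 0 < pi *+ 2 :> R. Proof. by rewrite pmulrn_lgt0 // pi_gt0. Qed.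

(** The vertical sides of the rectangle are the two circles, and the horizontal sides cancel by
    periodicity in the angle. *)
Let circle_const s : s < s1 -> cI (k s1) 0 (pi *+ 2) = cI (k s) 0 (pi *+ 2).
Proof.
move=> ss; have l0 : 0 < s1 - s by rewrite subr_gt0.
have := goursat l0 pi2 k1 k2 (x0 := s) (y0 := 0).
rewrite (addrC s) subrK => /(_ _)G.
have {}G := G (fun x y _ xs _ _ => k_cr y xs).
move: G; rewrite /rect_int (addrC s) subrK !add0r.
have -> : (fun u => k u (pi *+ 2)) = (fun u => k u 0).
  apply/funext => u; rewrite /k /K /cexp !reimE.
  rewrite -[X in cis X]add0r cis_period; congr (_ * (_ * _)).
  by have := cis_period (- (pi *+ 2) : R); rewrite addNr oppr0.
rewrite subrr add0r => /eqP; rewrite mulf_eq0 (negbTE (iC_neq0 R)) /= subr_eq0.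
by move/eqP.
Qed.

Let cI_cis : cI (fun t => cis (- t)) 0 (pi *+ 2) = 0 :> C.
Proof.
have cc : ccont (fun t => cis (- t) : C).
  by split=> t; rewrite /cis /=; [apply: continuous_comp; [exact: opp_continuous | exact: continuous_cos] | apply: continuous_comp; [exact: opp_continuous | exact: continuous_sin]].
rewrite (@cI_ftc _ _ (fun t => Complex (sin t) (cos t)) _ _ pi2 cc).
  by apply: CP; rewrite !reimE ?sin2pi ?sin0 ?cos2pi ?cos0 subrr.
move=> x; rewrite /cis !reimE cosN sinN; split; [exact: is_derive_sin | exact: is_derive_cos].
Qed.

(** The circle is shrunk towards the centre. There [g 0] integrates to zero against [cis (- t)], the
    linear term gives [g' 0] times the length, and the remainder is small relative to the radius. *)
Lemma cauchy_derivative :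
  cI (fun t => g (ofR r * cis t) * cj (cis t)) 0 (pi *+ 2) = ofR (pi *+ 2 * r) * g' 0.
Proof.
have kE s t : s <= s1 -> k s t = g (ofR (expR s) * cis t) * (ofR (expR (- s)) * cis (- t)).
  move=> ss; rewrite /k min_l ?(le_trans ss (ltW s12)) // /K /cexp !reimE //.
have -> : cI (fun t => g (ofR r * cis t) * cj (cis t)) 0 (pi *+ 2) = ofR r * cI (k s1) 0 (pi *+ 2).
  rewrite -cI_scale //; apply: eq_cI => t _ _.
  rewrite kE // expRN /s1 lnK ?posrE // cj_cis.
  have rn : ofR r != 0 :> C by rewrite fmorph_eq0 gt_eqF.
  by rewrite (fmorphV (@ofR R)) /=; field.
rewrite rmorphM /= (mulrC (ofR (pi *+ 2))) -mulrA; congr (_ * _).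
suff /eqP : nr (cI (k s1) 0 (pi *+ 2) - ofR (pi *+ 2) * g' 0) = 0.
  by rewrite nr_eq0 subr_eq0 => /eqP.
apply/eqP; rewrite eq_le nr_ge0 andbT; apply/ler_addgt0Pl => e e0; rewrite addr0.
have e1 : 0 < e / (2 * (pi *+ 2)) by rewrite divr_gt0 // mulr_gt0.
have r00 : nr (0 : C) < rho by rewrite nr0.
have /nbhs_nr[q q0 Hq] := gd r00 e1.
pose s := Num.min (s1 - 1) (ln q - 1).
have ss1 : s < s1 by rewrite gt_min ltrBlDr ltrDl ltr01.
have sq : expR s < q.
  rewrite -[X in _ < X](lnK (x := q)) ?posrE // ltr_expR gt_min orbC ltrBlDr ltrDl ltr01 //.
rewrite (circle_const ss1).
have c1 : ccont (fun t => g 0 * ofR (expR (- s)) * cis (- t)).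
  apply: ccontM; first exact: ccont_cst.
  by split=> t; rewrite /cis /=; [apply: continuous_comp; [exact: opp_continuous | exact: continuous_cos] | apply: continuous_comp; [exact: opp_continuous | exact: continuous_sin]].
have cc : ccont (fun t => cis (- t) : C).
  by split=> t; rewrite /cis /=; [apply: continuous_comp; [exact: opp_continuous | exact: continuous_cos] | apply: continuous_comp; [exact: opp_continuous | exact: continuous_sin]].
have z1 : cI (fun t => g 0 * ofR (expR (- s)) * cis (- t)) 0 (pi *+ 2) = 0.
  by rewrite cI_scale // cI_cis mulr0.
have z2 := @cI_cst R (g' 0) 0 (pi *+ 2) pi2.
rewrite subr0 in z2.
have -> : cI (k s) 0 (pi *+ 2) - ofR (pi *+ 2) * g' 0 =
  cI (fun t => k s t - (g 0 * ofR (expR (- s)) * cis (- t) + g' 0)) 0 (pi *+ 2).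
  rewrite cI_sub //; last by apply: ccontD => //; exact: ccont_cst.
  rewrite cI_add //; last exact: ccont_cst.
  by rewrite z1 z2 add0r (mulrC (ofR _)).
have c2 : ccont (fun t => k s t - (g 0 * ofR (expR (- s)) * cis (- t) + g' 0)).
  by apply: ccontD => //; apply: ccontN; apply: ccontD => //; exact: ccont_cst.
apply: le_trans (cI_bound (M := e / (2 * (pi *+ 2))) pi2 c2 _) _; last first.
  have E (p : R) : 0 < p -> 2 * (e / (2 * p)) * p = e by move=> p0; field; rewrite gt_eqF.
  by rewrite subr0 (E _ pi2).
move=> t _ _; rewrite (kE _ _ (ltW ss1)).
have es0 : 0 < expR s by exact: expR_gt0.
have := Hq (ofR (expR s) * cis t).
rewrite subr0 nrM nr_cis mulr1 nr_ofR (gtr0_norm es0) => /(_ sq); rewrite add0r => H.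
have en : ofR (expR s) != 0 :> C by rewrite fmorph_eq0 gt_eqF.
have -> : g (ofR (expR s) * cis t) * (ofR (expR (- s)) * cis (- t)) -
    (g 0 * ofR (expR (- s)) * cis (- t) + g' 0) =
   (g (ofR (expR s) * cis t) - g 0 - g' 0 * (ofR (expR s) * cis t)) * (ofR (expR (- s)) * cis (- t)).
  have : (ofR (expR s) * cis t) * (ofR (expR (- s)) * cis (- t)) = 1.
    by rewrite mulrACA -cisD subrr cis0 mulr1 -rmorphM -expRD subrr expR0.
  rewrite -(mulrA (g 0)); move: (ofR (expR s) * cis t) (ofR (expR (- s)) * cis (- t)) => a b ab.
  transitivity (g a * b - g 0 * b - g' 0 * (a * b)); last by ring.
  by rewrite ab; ring.
rewrite nrM (nrM (ofR _)) nr_cis mulr1 nr_ofR gtr0_norm ?expR_gt0 // expRN ler_pdivrMr //.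
Qed.
End CauchyDisc.

(** * Circle integrals depending on their centre *)

Section ParameterIntegral.
Variables (R : realType) (n : nat).
Local Notation C := (Cx R).
Local Notation V := 'rV[C]_n.
Variables (O : set V) (r : R) (v : V).
Hypothesis (Oo : open O).

Lemma sub_shift (W : zmodType) (y z a b : W) : y + a - (z + b) = (y - z) + ((z + a) - (z + b)).
Proof. by rewrite !opprD (addrACA y) (addrACA z) subrr add0r. Qed.

Lemma re_cderiv_sub w (h : V -> C) y y' :
  `|rderiv w (fun x => re (h x)) y - rderiv w (fun x => re (h x)) y'| <=
  nr (cderiv w h y - cderiv w h y').
Proof.
have := re_le_nr (cderiv w h y - cderiv w h y').
by rewrite reD reN (re_cderiv w h y) (re_cderiv w h y').
Qed.
Lemma im_cderiv_sub w (h : V -> C) y y' :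
  `|rderiv w (fun x => im (h x)) y - rderiv w (fun x => im (h x)) y'| <=
  nr (cderiv w h y - cderiv w h y').
Proof.
have := im_le_nr (cderiv w h y - cderiv w h y').
by rewrite imD imN (im_cderiv w h y) (im_cderiv w h y').
Qed.

Lemma line_remainder (h : V -> C) w p (s e : R) :
  (forall q : R, `|q| <= `|s| -> rderivable w (fun x => re (h x)) (p + ofR q *: w) /\
     rderivable w (fun x => im (h x)) (p + ofR q *: w)) ->
  (forall q : R, `|q| <= `|s| -> nr (cderiv w h (p + ofR q *: w) - cderiv w h p) <= e) ->
  nr (h (p + ofR s *: w) - h p - ofR s * cderiv w h p) <= 2 * (e * `|s|).
Proof.
move=> hd dif.
have [q q1|q1 hq1 E1] := @rderiv_mvt R n w (fun y => re (h y)) p s; first by have [] := hd q q1.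
have [q q2|q2 hq2 E2] := @rderiv_mvt R n w (fun y => im (h y)) p s; first by have [] := hd q q2.
have F1 := le_trans (re_cderiv_sub w h (p + ofR q1 *: w) p) (dif q1 hq1).
have F2 := le_trans (im_cderiv_sub w h (p + ofR q2 *: w) p) (dif q2 hq2).
apply: le_trans (nr_le_reim _) _; rewrite mulr_natl mulr2n; apply: lerD.
  rewrite !reD !reN (reM (ofR s)) re_ofR im_ofR mul0r subr0 re_cderiv E1 -mulrBr normrM mulrC.
  by rewrite ler_wpM2r.
rewrite !imD !imN (imM (ofR s)) re_ofR im_ofR mul0r addr0 im_cderiv E2 -mulrBr normrM mulrC.
by rewrite ler_wpM2r.
Qed.

Lemma sub_mid (W : zmodType) (a b c : W) : a - b = (a - c) - (b - c).
Proof. by rewrite opprB addrA subrK. Qed.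

Lemma cderiv_eps (g : V -> C) w z d :
  (forall e : R, 0 < e -> \forall t \near (0 : R),
     nr (g (z + ofR t *: w) - g z - ofR t * d) <= e * `|t|) ->
  (rderivable w (fun y => re (g y)) z /\ rderivable w (fun y => im (g y)) z) /\
  cderiv w g z = d.
Proof.
move=> key.
have k1 : rderivable w (fun y => re (g y)) z /\ rderiv w (fun y => re (g y)) z = re d.
  apply/rderiv_eps => e e0; apply: filterS (key e e0) => s hs.
  have q := re_le_nr (g (z + ofR s *: w) - g z - ofR s * d).
  rewrite !reD !reN (reM (ofR s)) re_ofR im_ofR mul0r subr0 in q; exact: le_trans q hs.
have k2 : rderivable w (fun y => im (g y)) z /\ rderiv w (fun y => im (g y)) z = im d.
  apply/rderiv_eps => e e0; apply: filterS (key e e0) => s hs.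
  have q := im_le_nr (g (z + ofR s *: w) - g z - ofR s * d).
  rewrite !imD !imN (imM (ofR s)) re_ofR im_ofR mul0r addr0 in q; exact: le_trans q hs.
split; first by split; [exact: k1.1 | exact: k2.1].
by apply: CP; rewrite ?re_cderiv ?im_cderiv ?k1.2 ?k2.2.
Qed.

Definition circ (y : V) (t : R) : V := y + (ofR r * cis t) *: v.
Definition circ_int (h : V -> C) (y : V) : C :=
  cI (fun t => h (circ y t) * cj (cis t)) 0 (pi *+ 2).

Lemma pi2_gt0 : 0 < pi *+ 2 :> R. Proof. by rewrite pmulrn_lgt0 // pi_gt0. Qed.

Lemma circ_cvg y (t : R) : circ y s @[s --> t] --> circ y t.
Proof.
apply: cvgD; first exact: cvg_cst.
apply: cvgZr_tmp; apply: cvgM; first exact: cvg_cst.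
exact: cis_continuous.
Qed.

Lemma circ_ccont (h : V -> C) y : (forall z, O z -> {for z, continuous h}) ->
  (forall t, O (circ y t)) -> ccont (fun t => h (circ y t) * cj (cis t)).
Proof.
move=> hc hO; apply: ccontM.
  have H (t : R) : h (circ y s) @[s --> t] --> h (circ y t).
    have k : h w @[w --> circ y t] --> h (circ y t) := hc _ (hO t).
    exact: (@cvg_comp _ _ _ (circ y) h _ _ _ (@circ_cvg y t) k).
  by split=> t; [apply: cvg_comp (H t) _; exact: cvg_re | apply: cvg_comp (H t) _; exact: cvg_im].
by apply: ccont_cj; apply: cvg_ccont; exact: cis_continuous.
Qed.

Variable z0 : V.
Hypothesis tube : exists2 d : R, 0 < d & forall y, nr (y - z0) < d -> forall t, O (circ y t).

(** Compactness of the interval of angles makes the continuity of [h] uniform along the circle. *)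
Lemma circ_unif (h : V -> C) : (forall z, O z -> {for z, continuous h}) -> forall e : R, 0 < e ->
  \forall y \near z0, forall t, 0 <= t -> t <= pi *+ 2 -> nr (h (circ y t) - h (circ z0 t)) < e.
Proof.
move=> hc e e0.
have /compact_near_coveringP := @segment_compact R 0 (pi *+ 2).
move=> /(_ V (nbhs z0) (fun y t => nr (h (circ y t) - h (circ z0 t)) < e)) H.
have {}H : \forall y \near z0, `[0, pi *+ 2]%classic `<=` (fun t => nr (h (circ y t) - h (circ z0 t)) < e).
  apply: H => t _.
  have [d d0 Hd] := tube.
  have Ot : O (circ z0 t) by apply: Hd; rewrite subrr nr0.
  have /cvg_nr /(_ (e / 2)) : h w @[w --> circ z0 t] --> h (circ z0 t) by exact: hc.
  rewrite divr_gt0 // => /(_ isT) /nbhs_nr[q q0 Hq].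
  have /cvg_nr /(_ (q / 2)) := @circ_cvg z0 t.
  rewrite divr_gt0 // => /(_ isT) Ht.
  have Hy := @near_nr R _ z0 (q / 2) (divr_gt0 q0 (ltr0Sn _ 1)).
  exists ([set s | nr (circ z0 s - circ z0 t) < q / 2], [set y | nr (y - z0) < q / 2]) => //.
  move=> [s y] /= [hs hy].
  have h1 : nr (h (circ z0 s) - h (circ z0 t)) < e / 2.
    by apply: Hq; apply: lt_le_trans hs _; lra.
  have h2 : nr (h (circ y s) - h (circ z0 t)) < e / 2.
    apply: Hq; have -> : circ y s - circ z0 t = (y - z0) + (circ z0 s - circ z0 t).
      exact: sub_shift.
    by apply: le_lt_trans (nrD _ _) _; rewrite [q]splitr ltrD.
  rewrite (sub_mid (h (circ y s)) (h (circ z0 s)) (h (circ z0 t))).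
  by apply: le_lt_trans (nrD _ _) _; rewrite nrN [e]splitr ltrD.
by apply: filterS H => y Hy t t0 t1; apply: Hy; rewrite /= in_itv /= t0.
Qed.

Lemma near_tube : \forall y \near z0, forall t, O (circ y t).
Proof. by have [d d0 Hd] := tube; apply: filterS (near_nr z0 d0). Qed.

Lemma circ_int_continuous (h : V -> C) : (forall z, O z -> {for z, continuous h}) ->
  {for z0, continuous (circ_int h)}.
Proof.
move=> hc; suff: circ_int h y @[y --> z0] --> circ_int h z0 by [].
apply/(@cvg_nr _ _ _ (nbhs z0)) => e e0.
have p0 := pi2_gt0.
have e1 : 0 < e / (4 * (pi *+ 2)) by rewrite divr_gt0 // mulr_gt0.
have := circ_unif hc e1; have := near_tube; apply: filterS2 => y yO hy.
have zO := nbhs_singleton near_tube.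
have c1 := circ_ccont hc yO; have c2 := circ_ccont hc zO.
rewrite /circ_int -cI_sub //.
apply: le_lt_trans (cI_bound (M := e / (4 * (pi *+ 2))) p0 _ _) _.
- by apply: ccontD => //; exact: ccontN.
- move=> t t0 t1; rewrite -mulrBl nrM nr_cj nr_cis mulr1 ltW //; exact: hy.
have E (p : R) : 0 < p -> 2 * (e / (4 * p)) * p = e / 2 by move=> p1; field; rewrite gt_eqF.
rewrite subr0 (E _ p0).
by rewrite ltr_pdivrMr //; lra.
Qed.

Lemma circ_int_rderiv (h : V -> C) w :
  (forall z, O z -> {for z, continuous h}) ->
  (forall z, O z -> rderivable w (fun y => re (h y)) z /\ rderivable w (fun y => im (h y)) z) ->
  (forall z, O z -> {for z, continuous (cderiv w h)}) ->
  (rderivable w (fun y => re (circ_int h y)) z0 /\ rderivable w (fun y => im (circ_int h y)) z0) /\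
  cderiv w (circ_int h) z0 = circ_int (cderiv w h) z0.
Proof.
move=> hc hd dc.
have p0 := pi2_gt0.
have key : forall e : R, 0 < e -> \forall s \near (0 : R),
    nr (circ_int h (z0 + ofR s *: w) - circ_int h z0 - ofR s * circ_int (cderiv w h) z0) <= e * `|s|.
  move=> e e0.
  (* One factor 2 is lost in [line_remainder], another in [cI_bound], and the interval has length
     [pi *+ 2]. *)
  have e1 : 0 < e / (4 * (pi *+ 2)) by rewrite divr_gt0 // mulr_gt0.
  have /nbhs_nr[d1 d10 H1] := circ_unif dc e1; have /nbhs_nr[d2 d20 H2] := near_tube.
  have w1 : 0 < nr w + 1 by rewrite ltr_wpDl // nr_ge0.
  have m0 : 0 < Num.min d1 d2 by rewrite lt_min d10.
  have := @near_real R 0 _ (divr_gt0 m0 w1); apply: filterS => s; rewrite subr0 => hs.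
  have near_s (q : R) : `|q| <= `|s| -> nr (z0 + ofR q *: w - z0) < d1 /\ nr (z0 + ofR q *: w - z0) < d2.
    move=> qs; rewrite addrC addKr nrZ nr_ofR.
    have : `|q| * nr w < Num.min d1 d2.
      apply: le_lt_trans (ler_wpM2r (nr_ge0 w) qs) _.
      move: hs; rewrite ltr_pdivlMr // => hs; apply: le_lt_trans hs.
      by rewrite ler_wpM2l // lerDl.
    by rewrite lt_min => /andP.
  have zO := nbhs_singleton near_tube.
  have [_ /H2 sO] := near_s s (lexx _).
  have c1 := circ_ccont hc sO; have c2 := circ_ccont hc zO; have c3 := circ_ccont dc zO.
  rewrite /circ_int -cI_sub // -cI_scale // -cI_sub //; last first.
  - by apply: ccontM => //; exact: ccont_cst.
  - by apply: ccontD => //; exact: ccontN.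
  apply: le_trans (cI_bound (M := 2 * (e / (4 * (pi *+ 2)) * `|s|)) p0 _ _) _; last first.
  - have E (p x : R) : 0 < p -> 2 * (2 * (e / (4 * p) * x)) * p = e * x.
      by move=> p1; field; rewrite gt_eqF.
    by rewrite subr0 (E _ _ p0).
  - move=> t t0 t1; rewrite mulrA -!mulrBl nrM nr_cj nr_cis mulr1.
    have inO q : `|q| <= `|s| -> O (circ z0 t + ofR q *: w).
      by move=> /near_s[_ /H2/(_ t)]; rewrite /circ addrAC.
    have dif q : `|q| <= `|s| -> nr (cderiv w h (circ z0 t + ofR q *: w) - cderiv w h (circ z0 t)) < e / (4 * (pi *+ 2)).
      by move=> /near_s[/H1/(_ t t0 t1)]; rewrite /circ addrAC.
    have -> : circ (z0 + ofR s *: w) t = circ z0 t + ofR s *: w by rewrite /circ addrAC.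
    apply: line_remainder => q qs; first exact: hd (inO q qs).
    exact: ltW (dif q qs).
  - by apply: ccontD; [apply: ccontD => //; exact: ccontN | apply: ccontN; apply: ccontM => //; exact: ccont_cst].
exact: cderiv_eps key.
Qed.
End ParameterIntegral.

Section DifferentiableNr.
Variables (R : realType) (V W : normedModType (Cx R)).

Lemma diff_eps (g : V -> W) z : differentiable g z ->
  forall e : R, 0 < e -> \forall h \near (0 : V), nr (g (z + h) - g z - 'd g z h) <= e * nr h.
Proof.
move=> dg e e0; have /eqaddoP /(_ (ofR e)) := diff_locally dg.
rewrite (ofR_lt 0 e) => /(_ e0); apply: filterS => h.
rewrite /= -[_ h]/(g (h + z) - (g z + 'd g z h)) !nrE -rmorphM ofR_le /=.
by rewrite (addrC h) opprD addrA.
Qed.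

Lemma eps_diff (g : V -> W) z (L : {linear V -> W}) (K : R) :
  (forall h, nr (L h) <= K * nr h) ->
  (forall e : R, 0 < e -> \forall h \near (0 : V), nr (g (z + h) - g z - L h) <= e * nr h) ->
  differentiable g z.
Proof.
move=> LK H.
have cL : continuous L.
  move=> x; suff: L y @[y --> x] --> L x by [].
  apply/(@cvg_nr _ _ _ (nbhs x)) => e e0.
  have K1 : 0 < `|K| + 1 by rewrite ltr_wpDl.
  have := @near_nr R _ x _ (divr_gt0 e0 K1); apply: filterS => y.
  rewrite ltr_pdivlMr // => xy; rewrite -linearB; apply: le_lt_trans (LK _) _.
  apply: le_lt_trans xy; rewrite mulrC ler_wpM2l ?nr_ge0 //.
  by have := ler_norm K; lra.
have E : g \o shift z = cst (g z) + L +o_ 0 id.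
  apply/eqaddoP => e e0; rewrite (ge0_ofR (ltW e0)).
  have re0' : 0 < re e by rewrite -ofR_lt -ge0_ofR // ltW.
  have := H _ re0'; apply: filterS => h.
  rewrite /= -[(_ - _) h]/(g (h + z) - (g z + L h)) !nrE -rmorphM ofR_le /=.
  by rewrite (addrC h) opprD addrA.
have dE := diff_unique cL E.
by apply/diff_locallyP; rewrite dE.
Qed.

End DifferentiableNr.

(** * Complex differentiable functions are smooth *)

Section Holomorphic.
Variables (R : realType) (n : nat).
Local Notation C := (Cx R).
Local Notation V := 'rV[C]_n.
Implicit Types (g : V -> C) (O : set V) (z v w y : V).

Lemma cderiv_remainder g z h (e x : R) :
  `|re (g (z + h)) - re (g z) - rderiv h (fun y => re (g y)) z| <= e / 2 * x ->
  `|im (g (z + h)) - im (g z) - rderiv h (fun y => im (g y)) z| <= e / 2 * x ->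
  nr (g (z + h) - g z - cderiv h g z) <= e * x.
Proof.
rewrite -(re_cderiv h g z) -(im_cderiv h g z).
move: (g (z + h)) (g z) (cderiv h g z) => a b c h1 h2.
apply: le_trans (nr_le_reim _) _; rewrite [e]splitr mulrDl !reD !reN !imD !imN.
exact: lerD.
Qed.

(** Pointwise complex differentiability, unpacked into real directional derivatives, complex
    linearity and a Fréchet estimate. No continuity of the derivatives is assumed; Cauchy's formula
    will supply it. *)
Definition hol O g := forall z, O z ->
  (forall v, rderivable v (fun y => re (g y)) z /\ rderivable v (fun y => im (g y)) z) /\
  (forall c v w, cderiv (c *: v + w) g z = c * cderiv v g z + cderiv w g z) /\
  (forall e : R, 0 < e -> \forall h \near (0 : V), nr (g (z + h) - g z - cderiv h g z) <= e * nr h).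

Lemma frechet_cderiv g z (L : V -> C) :
  (forall c v w, L (c *: v + w) = c * L v + L w) ->
  (forall e : R, 0 < e -> \forall h \near (0 : V), nr (g (z + h) - g z - L h) <= e * nr h) ->
  forall v, (rderivable v (fun y => re (g y)) z /\ rderivable v (fun y => im (g y)) z) /\
  cderiv v g z = L v.
Proof.
move=> linL H v.
have L0 : L 0 = 0.
  have := linL 1 0 0; rewrite scaler0 addr0 mul1r => /eqP.
  by rewrite -subr_eq0 opprD addNKr oppr_eq0 => /eqP.
have Lt (t : R) : L (ofR t *: v) = ofR t * L v by rewrite -[ofR t *: v]addr0 linL L0 addr0.
have key : forall e : R, 0 < e -> \forall t \near (0 : R),
   nr (g (z + ofR t *: v) - g z - ofR t * L v) <= e * `|t|.
  move=> e e0; have v1 : 0 < nr v + 1 by rewrite ltr_wpDl // nr_ge0.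
  have /nbhs_nr[d d0 Hd] := H _ (divr_gt0 e0 v1).
  have := @near_real R 0 _ (divr_gt0 d0 v1); apply: filterS => t.
  rewrite subr0 ltr_pdivlMr // => td; have := Hd (ofR t *: v).
  rewrite subr0 nrZ nr_ofR Lt => /(_ _)h; apply: le_trans (h _) _.
    by apply: le_lt_trans td; rewrite ler_wpM2l // lerDl.
  rewrite mulrCA mulrC ler_wpM2r // mulrC frac_le ?nr_ge0 //; exact: ltW.
exact: cderiv_eps key.
Qed.

Lemma hol_coord m (G : V -> 'rV[C]_m) O j : holomorphic_on O G -> hol O (fun z => G z 0 j).
Proof.
move=> HG z Oz; pose L (h : V) : C := ('d G z h) 0 j.
have linL c v w : L (c *: v + w) = c * L v + L w by rewrite /L linearP !mxE.
have H : forall e : R, 0 < e -> \forall h \near (0 : V),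
   nr (G (z + h) 0 j - G z 0 j - L h) <= e * nr h.
  move=> e e0; apply: filterS (diff_eps (HG z Oz) e0) => h; apply: le_trans.
  by have := nr_mx_entry (G (z + h) - G z - 'd G z h) 0 j; rewrite !mxE.
have F := @frechet_cderiv (fun z => G z 0 j) z L linL H; split; first by move=> v; have [] := F v.
split=> [c v w|e e0]; first by rewrite !(F _).2 linL.
by apply: filterS (H e e0) => h; rewrite (F h).2.
Qed.

Section OneFunction.
Variables (O : set V) (g : V -> C).
Hypotheses (Oo : open O) (Hg : hol O g).

Lemma hol_lin0 z : O z -> cderiv 0 g z = 0.
Proof.
move=> Oz; have [_ [lin _]] := Hg Oz.
have := lin 1 0 0; rewrite scaler0 addr0 mul1r => /eqP.
by rewrite -subr_eq0 opprD addNKr oppr_eq0 => /eqP.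
Qed.

Lemma hol_Z z c v : O z -> cderiv (c *: v) g z = c * cderiv v g z.
Proof.
move=> Oz; have [_ [lin _]] := Hg Oz.
by rewrite -[c *: v]addr0 lin (hol_lin0 Oz) addr0.
Qed.

Lemma hol_bound z : O z -> exists2 K : R, 0 <= K & forall v, nr (cderiv v g z) <= K * nr v.
Proof.
move=> Oz; exists (\sum_j nr (cderiv (delta_mx 0 j) g z)) => [|v].
  by apply: sumr_ge0 => j _; exact: nr_ge0.
have [_ [lin _]] := Hg Oz.
have linD x y : cderiv (x + y) g z = cderiv x g z + cderiv y g z.
  by rewrite -[x]scale1r lin mul1r scale1r.
rewrite {1}[v]row_sum_delta (big_morph (fun x => cderiv x g z) linD (hol_lin0 Oz)).
apply: le_trans (nr_sum _ _ _) _; rewrite mulr_suml; apply: ler_sum => j _.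
by rewrite hol_Z // nrM mulrC ler_wpM2l ?nr_ge0 // nr_mx_entry.
Qed.

Lemma hol_continuous z : O z -> {for z, continuous g}.
Proof.
move=> Oz; suff: g y @[y --> z] --> g z by [].
apply/(@cvg_nr _ _ _ (nbhs z)) => e e0.
have [K K0 HK] := hol_bound Oz; have [_ [_ H]] := Hg Oz.
have /nbhs_nr[d d0 Hd] := H 1 ltr01.
have K2 : 0 < K + 2 by lra.
have := @near_nr R _ z _ (divr_gt0 e0 K2); have := @near_nr R _ z _ d0.
apply: filterS2 => y y1; rewrite ltr_pdivlMr // => y2.
have := Hd (y - z); rewrite subr0 (addrC z) subrK mul1r => /(_ y1) h1.
rewrite -[g y - g z](subrK (cderiv (y - z) g z)); apply: le_lt_trans (nrD _ _) _.
have h2 := HK (y - z); have := nr_ge0 (y - z).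
move: (nr (y - z)) (nr _) (nr _) y2 h1 h2 => a b c *; nra.
Qed.

Lemma hol_line y v (t : C) : O (y + t *: v) ->
  cdiff (fun s => g (y + s *: v)) t (cderiv v g (y + t *: v)).
Proof.
move=> Ot e e0; have [_ [_ H]] := Hg Ot.
have v1 : 0 < nr v + 1 by rewrite ltr_wpDl // nr_ge0.
have /nbhs_nr[d d0 Hd] := H _ (divr_gt0 e0 v1).
apply: filterS (@near_nr R _ (0 : C) _ (divr_gt0 d0 v1)) => h.
rewrite subr0 ltr_pdivlMr // => hd; have := Hd (h *: v).
rewrite subr0 nrZ (hol_Z h v Ot) scalerDl addrA (mulrC h) => /(_ _)k; apply: le_trans (k _) _.
  by apply: le_lt_trans hd; rewrite ler_wpM2l ?nr_ge0 // lerDl.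
rewrite mulrCA mulrC ler_wpM2r ?nr_ge0 // mulrC frac_le ?nr_ge0 //; exact: ltW.
Qed.

Lemma disc_tube z v : O z -> exists d rho : R, [/\ 0 < d, 0 < rho &
  forall y, nr (y - z) < d -> forall t : C, nr t < rho -> O (y + t *: v)].
Proof.
move=> Oz; have /nbhs_nr[d d0 Hd] : nbhs z O by exact: open_nbhs_nbhs.
have v1 : 0 < nr v + 1 by rewrite ltr_wpDl // nr_ge0.
have d2 : 0 < d / 2 by rewrite divr_gt0.
exists (d / 2), (d / 2 / (nr v + 1)); split=> //; first by rewrite divr_gt0.
move=> y yz t tr; apply: Hd; rewrite addrAC; apply: le_lt_trans (nrD _ _) _.
rewrite [d]splitr; apply: ltrD => //; rewrite nrZ.
move: tr; rewrite ltr_pdivlMr //; apply: le_lt_trans.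
by rewrite ler_wpM2l ?nr_ge0 // lerDl.
Qed.

Lemma hol_cauchy y v r rho : 0 < r -> r < rho -> (forall t : C, nr t < rho -> O (y + t *: v)) ->
  cderiv v g y = (ofR (pi *+ 2 * r))^-1 * circ_int r v g y.
Proof.
move=> r0 rr H.
have := @cauchy_derivative R (fun t => g (y + t *: v)) (fun t => cderiv v g (y + t *: v)) r rho r0 rr
  (fun t tr => hol_line (H t tr)).
rewrite scale0r addr0 /circ_int /circ => ->.
rewrite mulrA mulVf ?mul1r // fmorph_eq0 mulf_neq0 // gt_eqF //.
exact: pi2_gt0.
Qed.

Lemma cont_re (h : V -> C) z : {for z, continuous h} -> {for z, continuous (fun y => re (h y))}.
Proof.
move=> ch; have k : h y @[y --> z] --> h z := ch.
suff: re (h y) @[y --> z] --> re (h z) by [].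
by apply: cvg_comp k _; exact: cvg_re.
Qed.
Lemma cont_im (h : V -> C) z : {for z, continuous h} -> {for z, continuous (fun y => im (h y))}.
Proof.
move=> ch; have k : h y @[y --> z] --> h z := ch.
suff: im (h y) @[y --> z] --> im (h z) by [].
by apply: cvg_comp k _; exact: cvg_im.
Qed.

Lemma near_ccontinuous (f h : V -> C) z : (\forall w \near z, f w = h w) ->
  {for z, continuous f} -> {for z, continuous h}.
Proof.
move=> fg cf; have e : f z = h z := nbhs_singleton fg.
suff: h w @[w --> z] --> h z by [].
by rewrite -e; apply: cvg_trans cf; exact: near_eq_cvg fg.
Qed.

Lemma circ_tube z v d rho : 0 < d -> 0 < rho ->
  (forall y, nr (y - z) < d -> forall t : C, nr t < rho -> O (y + t *: v)) ->
  forall y, nr (y - z) < d -> exists2 d' : R, 0 < d' &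
    forall y', nr (y' - y) < d' -> forall t, O (circ (rho / 2) v y' t).
Proof.
move=> d0 r0 H y yz; exists (d - nr (y - z)); first by rewrite subr_gt0.
move=> y' y'y t; apply: H.
  rewrite -[y'](subrK y) -addrA; apply: le_lt_trans (nrD _ _) _; lra.
by rewrite nrM nr_cis mulr1 nr_ofR gtr0_norm ?divr_gt0 //; lra.
Qed.

(** Cauchy's formula writes the derivative as a circle integral of [g] itself, which depends
    continuously on the centre. *)
Lemma hol_cderiv_continuous z v : O z -> {for z, continuous (cderiv v g)}.
Proof.
move=> Oz; have [d [rho [d0 r0 H]]] := disc_tube v Oz.
have r2 : 0 < rho / 2 by rewrite divr_gt0.
have rr : rho / 2 < rho by lra.
apply: (near_ccontinuous (f := fun y => (ofR (pi *+ 2 * (rho / 2)))^-1 * circ_int (rho / 2) v g y)).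
  by apply: filterS (near_nr z d0) => y yz; rewrite (hol_cauchy r2 rr (H y yz)).
have zz : nr (z - z) < d by rewrite subrr nr0.
apply: (@cvgM C V (nbhs z) _ (fun=> (ofR (pi *+ 2 * (rho / 2)))^-1) (circ_int (rho / 2) v g)); first exact: cvg_cst.
by apply: (circ_int_continuous (circ_tube d0 r0 H zz)) => y; exact: hol_continuous.
Qed.

Lemma hol_cderiv2 z v : O z -> exists (d : R) (c : C) (r : R), [/\ 0 < d,
  forall y, nr (y - z) < d -> forall t, O (circ r v y t) &
  forall y, nr (y - z) < d -> forall w,
  (rderivable w (fun x => re (cderiv v g x)) y /\ rderivable w (fun x => im (cderiv v g x)) y) /\
  cderiv w (cderiv v g) y = c * circ_int r v (cderiv w g) y].
Proof.
move=> Oz; have [d [rho [d0 r0 H]]] := disc_tube v Oz.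
have r2 : 0 < rho / 2 by rewrite divr_gt0.
have rr : rho / 2 < rho by lra.
set r := rho / 2 in r2 rr *; pose c : R := (pi *+ 2 * r)^-1.
have cE : (ofR (pi *+ 2 * r))^-1 = ofR c :> C by rewrite /c fmorphV.
exists d, (ofR c), r; split=> //.
  move=> y yz t; have [d' d'0 H'] := circ_tube d0 r0 H yz.
  by apply: H'; rewrite subrr nr0.
move=> y yz w; have T := circ_tube d0 r0 H yz.
have [[k1 k2] k3] := circ_int_rderiv T (w := w) hol_continuous
  (fun x Ox => (Hg Ox).1 w) (fun x Ox => @hol_cderiv_continuous x w Ox).
have nE : \forall x \near y, ofR c * circ_int r v g x = cderiv v g x.
  have yd : 0 < d - nr (y - z) by rewrite subr_gt0.
  apply: filterS (near_nr y yd) => x xy; rewrite -cE -(hol_cauchy r2 rr) //.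
  apply: H; rewrite -[x](subrK y) -addrA; apply: le_lt_trans (nrD _ _) _; lra.
have nE1 : \forall x \near y, c * re (circ_int r v g x) = re (cderiv v g x).
  by apply: filterS nE => x <-; rewrite !reimE mul0r subr0.
have nE2 : \forall x \near y, c * im (circ_int r v g x) = im (cderiv v g x).
  by apply: filterS nE => x <-; rewrite !reimE mul0r addr0.
have [cc1 cc2] := rderiv_cst w c y.
have [m1 e1] := rderivMf cc1 k1; have [m2 e2] := rderivMf cc1 k2.
have [n1 f1] := near_rderiv nE1 m1; have [n2 f2] := near_rderiv nE2 m2.
split; first by split.
rewrite -k3; apply: CP.
  rewrite (reM (ofR c)) re_ofR im_ofR mul0r subr0 (re_cderiv w) (re_cderiv w).
  by rewrite f1 e1 cc2 mul0r add0r.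
rewrite (imM (ofR c)) re_ofR im_ofR mul0r addr0 (im_cderiv w) (im_cderiv w).
by rewrite f2 e2 cc2 mul0r add0r.
Qed.

(** The bootstrap. Second derivatives are circle integrals of first ones, so they exist, are
    continuous and inherit complex linearity in the new direction; continuity then yields the
    Fréchet estimate through the real theory. *)
Lemma hol_cderiv v : hol O (cderiv v g).
Proof.
have cc w z : O z -> {for z, continuous (cderiv w (cderiv v g))}.
  move=> Oz; have [d [c [r [d0 T H]]]] := hol_cderiv2 v Oz.
  apply: (near_ccontinuous (f := fun y => c * circ_int r v (cderiv w g) y)).
    by apply: filterS (near_nr z d0) => y yz; have [_ ->] := H y yz w.
  apply: (@cvgM C V (nbhs z) _ (fun=> c) (circ_int r v (cderiv w g))); first exact: cvg_cst.
  have T' : exists2 d : R, 0 < d & forall y, nr (y - z) < d -> forall t, O (circ r v y t) by exists d.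
  exact: (circ_int_continuous T' (fun y Oy => @hol_cderiv_continuous y w Oy)).
have rd z w : O z -> rderivable w (fun x => re (cderiv v g x)) z /\
     rderivable w (fun x => im (cderiv v g x)) z.
  move=> Oz; have [d [c [r [d0 T H]]]] := hol_cderiv2 v Oz.
  by have [|] := H z _ w; first by rewrite subrr nr0.
have C1re : C1 O (fun x => re (cderiv v g x)).
  move=> z w Oz; split; first exact: (rd z w Oz).1.
  exact: (cont_re (cc w z Oz)).
have C1im : C1 O (fun x => im (cderiv v g x)).
  move=> z w Oz; split; first exact: (rd z w Oz).2.
  exact: (cont_im (cc w z Oz)).
move=> z Oz; split; first by move=> w; exact: rd.
split=> [a w w'|e e0].
  have [d [c [r [d0 T H]]]] := hol_cderiv2 v Oz.
  have zz : nr (z - z) < d by rewrite subrr nr0.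
  have [_ ->] := H z zz (a *: w + w'); have [_ ->] := H z zz w; have [_ ->] := H z zz w'.
  have ct u : ccont (fun t => cderiv u g (circ r v z t) * cj (cis t)).
    by apply: circ_ccont (T z zz) => y Oy; exact: hol_cderiv_continuous.
  have p0 := pi2_gt0 R.
  have ca : ccont (fun t => a * (cderiv w g (circ r v z t) * cj (cis t))).
    by apply: ccontM => //; exact: ccont_cst.
  rewrite (mulrCA a c) -(mulrDr c); congr (_ * _).
  rewrite /circ_int -(cI_scale a p0 (ct w)) -(cI_add p0 ca (ct w')).
  apply: eq_cI => t _ _.
  by have [_ [-> _]] := Hg (T z zz t); rewrite mulrDl mulrA.
have e2 : 0 < e / 2 by rewrite divr_gt0.
have := frechet Oo C1re Oz e2; have := frechet Oo C1im Oz e2; apply: filterS2 => h h1 h2.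
exact: (cderiv_remainder h2 h1).
Qed.
End OneFunction.

Lemma hol_csm O g : open O -> hol O g -> csm O g.
Proof.
move=> Oo H.
(* The induction removes the innermost derivative, which leaves a function that is again in
   [hol]. *)
have main vs : forall g, hol O g -> forall z, O z ->
   ({for z, continuous (iter_rderiv vs (fun y => re (g y)))} /\
     (forall v, rderivable v (iter_rderiv vs (fun y => re (g y))) z)) /\
   ({for z, continuous (iter_rderiv vs (fun y => im (g y)))} /\
     (forall v, rderivable v (iter_rderiv vs (fun y => im (g y))) z)).
  elim/last_ind: vs => [|vs v IH] h Hh z Oz.
    have ch := hol_continuous Hh Oz; have [rd _] := Hh z Oz.
    split; split=> [|v]; [exact: cont_re | exact: (rd v).1 | exact: cont_im | exact: (rd v).2].
  have := IH (cderiv v h) (hol_cderiv Oo Hh v) z Oz.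
  by rewrite /iter_rderiv !foldr_rcons.
split=> vs z Oz; first by have [] := main vs g H z Oz.
by have [] := main vs g H z Oz.
Qed.

Lemma hol_Wb O g v z : hol O g -> O z -> W iC v g z = 0.
Proof.
move=> H Oz; rewrite /W (hol_Z H iC v Oz) mulrA iC2 mulN1r subrr mulr0 //.
Qed.

Lemma lin_entry a b (c : C) (A B : 'M[C]_(a, b)) i j : (c *: A + B) i j = c * A i j + B i j.
Proof. by rewrite !mxE. Qed.
Lemma sub2_entry a b (A B D : 'M[C]_(a, b)) i j : (A - B - D) i j = A i j - B i j - D i j.
Proof. by rewrite !mxE. Qed.

(** The converse passage, by which the frame of the tangent distribution is recognised as
    holomorphic: when the (0,1)-derivatives vanish, the real differential is complex linear. *)
Lemma csm_hol_mx a b (G : V -> 'M[C]_(a, b)) O : open O ->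
  (forall i j, csm O (fun z => G z i j)) ->
  (forall i j v z, O z -> W iC v (fun y => G y i j) z = 0) -> holomorphic_on O G.
Proof.
move=> Oo cG hG z Oz.
have [Lf LfE] : exists Lf : V -> 'M[C]_(a, b),
    forall h i j, Lf h i j = W (- iC) h (fun y => G y i j) z.
  by exists (fun h => \matrix_(i, j) W (- iC) h (fun y => G y i j) z) => h i j; rewrite mxE.
have lin : linear Lf.
  move=> c v w; apply/matrixP => i j; rewrite lin_entry !LfE.
  by rewrite (WD_dir (- iC) (c *: v) w Oo (cG i j) Oz) (Wd_Z c v Oo (cG i j) Oz).
pose L : {linear V -> 'M[C]_(a, b)} := HB.pack Lf (GRing.isLinear.Build _ _ _ _ Lf lin).
have E h i j : L h i j = cderiv h (fun y => G y i j) z.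
  by rewrite cderivE hG // addr0 -LfE.
have Kb i j : exists2 K : R, 0 <= K & forall h, nr (L h i j) <= K * nr h.
  case: (cG i j) => /smooth_C1 c1 /smooth_C1 c2.
  have [K1 K10 H1] := rderiv_bound Oo c1 Oz; have [K2 K20 H2] := rderiv_bound Oo c2 Oz.
  exists (K1 + K2); first exact: addr_ge0.
  move=> h; rewrite E; apply: le_trans (nr_le_reim _) _; rewrite mulrDl.
  by apply: lerD; [exact: H1 | exact: H2].
pose K i j : R := projT1 (cid2 (Kb i j)).
have K0 i j : 0 <= K i j by rewrite /K; case: cid2.
have HK i j h : nr (L h i j) <= K i j * nr h by rewrite /K; case: cid2.
apply: (@eps_diff R V _ G z L (\sum_i \sum_j K i j)).
  move=> h; apply: nr_mx_le => [|i j].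
    by rewrite mulr_ge0 ?nr_ge0 //; apply: sumr_ge0 => i _; apply: sumr_ge0 => j _.
  apply: le_trans (HK i j h) _; rewrite ler_wpM2r ?nr_ge0 //.
  rewrite (bigD1 i) //= (bigD1 j) //= -addrA lerDl addr_ge0 //; first exact: sumr_ge0.
  by apply: sumr_ge0 => i' _; exact: sumr_ge0.
move=> e e0; have e2 : 0 < e / 2 by rewrite divr_gt0.
have /filter_forall H : forall ij : 'I_a * 'I_b, \forall h \near (0 : V),
    nr ((G (z + h) - G z - L h) ij.1 ij.2) <= e * nr h.
  move=> [i j] /=; case: (cG i j) => /smooth_C1 c1 /smooth_C1 c2.
  have := frechet Oo c1 Oz e2; have := frechet Oo c2 Oz e2; apply: filterS2 => h h1 h2.
  rewrite sub2_entry E.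
  exact: (@cderiv_remainder (fun z => G z i j) z h e (nr h) h2 h1).
apply: filterS H => h Hh; apply: nr_mx_le => [|i j]; first by rewrite mulr_ge0 ?nr_ge0 // ltW.
exact: Hh (i, j).
Qed.
End Holomorphic.

(** * Ahlfors' lemma *)

Section Ahlfors.
Variable R : realType.
Local Notation C := (Cx R).

(** If [c] were positive, [f'] would be positive just to the right of 0, and by the mean value
    theorem [f] would exceed its maximum there. *)
Lemma second_derivative_test (f f' : R -> R) (d c : R) : 0 < d ->
  (forall t : R, `|t| < d -> is_derive t 1 f (f' t)) -> is_derive (0 : R) 1 f' c ->
  (forall t, `|t| < d -> f t <= f 0) -> f' 0 = 0 /\ c <= 0.
Proof.
move=> d0 df df' fmax.
have f'0 : f' 0 = 0.
  have := @derive1_at_max R f (- d) d 0; rewrite !in_itv /= oppr_lt0 d0 => /(_ _ _ isT) H.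
  have [|t td|t td|_ e1] := H; first lra.
  - by have [] := df t; first by rewrite ltr_norml; move: td; rewrite in_itv.
  - by apply: fmax; rewrite ltr_norml; move: td; rewrite in_itv.
  have z : `|0 : R| < d by rewrite normr0.
  by have [_ e2] := df 0 z; rewrite -e2 e1.
split=> //; rewrite leNgt; apply/negP => c0.
have c2 : 0 < c / 2 by rewrite divr_gt0.
have /nbhs_ballP[e /= e0 He] := (is_derive_eps _ _ _).1 df' _ c2.
pose t := Num.min d e / 2.
have m0 : 0 < Num.min d e by rewrite lt_min d0.
have mt : Num.min d e = 2 * t by rewrite /t; field.
have t0 : 0 < t by rewrite /t divr_gt0.
have [td te] : t < d /\ t < e by apply/andP; rewrite -lt_min mt; lra.
have pos s : 0 < s -> s <= t -> 0 < f' s.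
  move=> s0 st; have := He s; rewrite /ball /= sub0r normrN gtr0_norm // add0r f'0 subr0.
  move=> /(_ (le_lt_trans st te)); rewrite ler_norml => /andP[h _].
  have : 0 < s * c by rewrite mulr_gt0.
  lra.
have [s| |s] := @MVT R f f' 0 t t0.
- rewrite in_itv /= => /andP[s0 st]; apply: df; rewrite gtr0_norm //; exact: lt_trans st td.
- apply: continuous_in_subspaceT => s; rewrite inE /= in_itv /= => /andP[s0 st].
  have [] := df s; first by rewrite ger0_norm //; exact: le_lt_trans st td.
  by move=> ds _; apply: differentiable_continuous; apply/derivable1_diffP.
rewrite in_itv /= subr0 => /andP[s0 st] E.
have tn : `|t| < d by rewrite gtr0_norm.
have := fmax t tn; have := mulr_gt0 (pos s s0 (ltW st)) t0; lra.
Qed.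

(** The algebra at a maximum of [w ^+ 2 * g], where [w] is the weight, [gv] and [gj] are the first
    derivatives of [g] and [L] is its Laplacian. The first-order conditions turn the gradient term
    into [16 (x ^+ 2 + y ^+ 2) g ^+ 2]; subtracting it from the 24 on the other side leaves 8, so
    the factor [8 * g ^+ 2] cancels throughout. *)
Lemma weighted_max_ineq (x y w g gv gj L p : R) : 0 < p -> 0 < w -> 0 < g ->
  w * gv = 4 * x * g -> w * gj = 4 * y * g ->
  w ^+ 2 * L <= 24 * (x ^+ 2 + y ^+ 2) * g + 8 * w * g ->
  gv ^+ 2 + gj ^+ 2 + 8 / p * g ^+ 3 <= g * L ->
  w ^+ 2 * g <= p * (x ^+ 2 + y ^+ 2 + w).
Proof.
move=> p0 w0 g0 ev ej hL hc.
have w2 : 0 < w ^+ 2 by rewrite exprn_gt0.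
have h1 : w ^+ 2 * (gv ^+ 2 + gj ^+ 2 + 8 / p * g ^+ 3) <= g * (24 * (x ^+ 2 + y ^+ 2) * g + 8 * w * g).
  apply: le_trans (ler_wpM2l (ltW w2) hc) _; rewrite mulrCA ler_wpM2l //; exact: ltW.
have e1 : w ^+ 2 * gv ^+ 2 = 16 * x ^+ 2 * g ^+ 2 by rewrite -exprMn ev; ring.
have e2 : w ^+ 2 * gj ^+ 2 = 16 * y ^+ 2 * g ^+ 2 by rewrite -exprMn ej; ring.
have h2 : 8 / p * (w ^+ 2 * g ^+ 3) <= 8 * (x ^+ 2 + y ^+ 2 + w) * g ^+ 2.
  have E1 : w ^+ 2 * (gv ^+ 2 + gj ^+ 2 + 8 / p * g ^+ 3) =
     16 * (x ^+ 2 * g ^+ 2) + 16 * (y ^+ 2 * g ^+ 2) + 8 / p * (w ^+ 2 * g ^+ 3).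
    by rewrite !mulrDr e1 e2; ring.
  have E2 : g * (24 * (x ^+ 2 + y ^+ 2) * g + 8 * w * g) =
     24 * (x ^+ 2 * g ^+ 2) + 24 * (y ^+ 2 * g ^+ 2) + 8 * (w * g ^+ 2) by ring.
  have -> : 8 * (x ^+ 2 + y ^+ 2 + w) * g ^+ 2 =
     8 * (x ^+ 2 * g ^+ 2) + 8 * (y ^+ 2 * g ^+ 2) + 8 * (w * g ^+ 2) by ring.
  rewrite E1 E2 in h1; move: h1.
  by move: (x ^+ 2 * _) (y ^+ 2 * _) (8 / p * _) (w * _) => a b c d h1; lra.
have g2 : 0 < 8 * g ^+ 2 by rewrite mulr_gt0 // exprn_gt0.
rewrite -(ler_pM2r g2) -(ler_pM2l (_ : 0 < p^-1)) ?invr_gt0 //.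
move: h2; congr (_ <= _); first by ring.
by field; rewrite gt_eqF.
Qed.

Lemma quadratic_near_pos (c w : R) : 0 < w ->
  exists2 d : R, 0 < d & forall t, `|t| < d -> 0 < w - 2 * c * t - t ^+ 2.
Proof.
move=> w0; have k1 : 0 < 2 * `|c| + 1 by rewrite ltr_wpDl // mulr_ge0.
exists (Num.min 1 (w / (2 * `|c| + 1))); first by rewrite lt_min ltr01 divr_gt0.
move=> t; rewrite lt_min ltr_pdivlMr // => /andP[t1 tw].
have := ler_norm (c * t); rewrite normrM => ct.
have : t ^+ 2 <= `|t|.
  by rewrite -(real_normK (num_real t)) expr2 ler_piMr // ltW.
have : `|t| * (2 * `|c| + 1) = 2 * (`|c| * `|t|) + `|t| by ring.
have : 2 * c * t = 2 * (c * t) by ring.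
move: (2 * c * t) (c * t) (`|c| * `|t|) (t ^+ 2) tw ct => a1 a2 a3 a4 tw ct e1 e2 e3; lra.
Qed.

Lemma weighted_sum_bound (x y w g a b : R) :
  w ^+ 2 * a <= 24 * x ^+ 2 * g + 4 * w * g -> w ^+ 2 * b <= 24 * y ^+ 2 * g + 4 * w * g ->
  w ^+ 2 * (a + b) <= 24 * (x ^+ 2 + y ^+ 2) * g + 8 * w * g.
Proof.
move=> h1 h2; rewrite mulrDr.
have -> : 24 * (x ^+ 2 + y ^+ 2) * g = 24 * x ^+ 2 * g + 24 * y ^+ 2 * g by ring.
have -> : 8 * w * g = 4 * w * g + 4 * w * g by ring.
move: h1 h2; move: (w ^+ 2 * a) (w ^+ 2 * b) (24 * x ^+ 2 * g) (24 * y ^+ 2 * g) (4 * w * g) => *; lra.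
Qed.

Lemma line_shift1 m (z v : 'rV[C]_m) (a b t : C) :
  z + (a + t + b) *: v = z + (a + b) *: v + t *: v.
Proof. by rewrite -(addrA z) -scalerDl addrAC. Qed.
Lemma line_shift2 m (z v : 'rV[C]_m) (a b c t : C) :
  z + (a + c * (b + t)) *: v = z + (a + c * b) *: v + t *: (c *: v).
Proof. by rewrite scalerA -(addrA z) -scalerDl mulrDr addrA (mulrC t). Qed.

Variables (m : nat) (h : 'rV[C]_m -> R) (v j : 'rV[C]_m) (p : R).
Hypotheses (p0 : 0 < p) (hs : smooth_on setT h).
Hypothesis jE : j = iC *: v.
Hypothesis curv : forall z, 0 < h z ->
  rderiv v h z ^+ 2 + rderiv j h z ^+ 2 + 8 / p * h z ^+ 3 <=
  h z * (rderiv v (rderiv v h) z + rderiv j (rderiv j h) z).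

Let hC1 : C1 setT h := smooth_C1 hs.
Let hC2 u : C1 setT (rderiv u h) := smooth_C1 (smooth_rderiv u hs).

(* First and second order conditions at an interior maximum of
   (rho^2 - |t|^2)^2 h along the real line in the direction u. *)
Lemma weighted_max_line (u z : 'rV[C]_m) (w x d : R) : 0 < d -> 0 < w ->
  (forall t, `|t| < d ->
     (w - 2 * x * t - t ^+ 2) ^+ 2 * h (z + ofR t *: u) <= w ^+ 2 * h z) ->
  w * rderiv u h z = 4 * x * h z /\
  w ^+ 2 * rderiv u (rderiv u h) z <= 24 * x ^+ 2 * h z + 4 * w * h z.
Proof.
move=> d0 w0 hmax.
pose W t := w - 2 * x * t - t ^+ 2.
pose g t := h (z + ofR t *: u); pose g' t := rderiv u h (z + ofR t *: u).
have g0 : g 0 = h z by rewrite /g raddf0 scale0r addr0.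
have g'0 : g' 0 = rderiv u h z by rewrite /g' raddf0 scale0r addr0.
have dg (t : R) : is_derive t 1 g (g' t) by apply: rderiv_line; exact: (hC1 u I).1.
have dg' : is_derive (0 : R) 1 g' (rderiv u (rderiv u h) z).
  have := @rderiv_line R m u (rderiv u h) z 0; rewrite raddf0 scale0r addr0.
  by apply; exact: (hC2 u u I).1.
have dW (t : R) : is_derive t 1 W (- (2 * x) - 2 * t).
  have h1 : is_derive t 1 (fun t : R => t ^+ 2) _ := is_deriveX 2 (is_derive_id t (1 : R)).
  have h2 : is_derive t 1 (fun t : R => 2 * x * t) _ := is_deriveZ (2 * x) (is_derive_id t (1 : R)).
  have h3 : is_derive t 1 (fun t : R => w - 2 * x * t) _ := is_deriveB (is_derive_cst w t (1 : R)) h2.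
  have h4 : is_derive t 1 W _ := is_deriveB h3 h1.
  apply: (is_derive_eq h4); rewrite -![_ *: _]/(_ * _) /= !mulr1 expr1 sub0r.
  by rewrite -mulr_natl.
have dW' : is_derive (0 : R) 1 (fun t : R => - (2 * x) - 2 * t) (- 2).
  have h2 : is_derive (0 : R) 1 (fun t : R => 2 * t) _ := is_deriveZ (2 : R) (is_derive_id 0 (1 : R)).
  have h3 : is_derive (0 : R) 1 (fun t : R => - (2 * x) - 2 * t) _ := is_deriveB (is_derive_cst (- (2 * x)) 0 (1 : R)) h2.
  by apply: (is_derive_eq h3); rewrite -![_ *: _]/(_ * _) mulr1 sub0r.
have dM A B (t a b : R) : is_derive t 1 A a -> is_derive t 1 B b ->
   is_derive t 1 (fun t : R => A t * B t) (a * B t + A t * b).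
  move=> hA hB; have hAB : is_derive t 1 (fun t : R => A t * B t) _ := is_deriveM hA hB.
  by apply: (is_derive_eq hAB); rewrite -![_ *: _]/(_ * _); ring.
have W0 : W 0 = w by rewrite /W; ring.
pose f t := W t * W t * g t.
pose f' t := ((- (2 * x) - 2 * t) * W t + W t * (- (2 * x) - 2 * t)) * g t + W t * W t * g' t.
have df (t : R) : `|t| < d -> is_derive t 1 f (f' t).
  by move=> _; exact: dM (dM _ _ _ _ _ (dW t) (dW t)) (dg t).
have dW'W := dM _ _ _ _ _ dW' (dW 0).
have dWW' := dM _ _ _ _ _ (dW 0) dW'.
have dsum : is_derive (0 : R) 1 (fun t : R => (- (2 * x) - 2 * t) * W t + W t * (- (2 * x) - 2 * t)) _ := is_deriveD dW'W dWW'.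
have df' : is_derive (0 : R) 1 f' _ := is_deriveD (dM _ _ _ _ _ dsum (dg 0)) (dM _ _ _ _ _ (dM _ _ _ _ _ (dW 0) (dW 0)) dg').
have fm t : `|t| < d -> f t <= f 0.
  by move=> td; rewrite /f W0 g0 -!expr2; exact: hmax.
have [e1 e2] := second_derivative_test d0 df df' fm.
rewrite /f' !W0 g0 g'0 in e1.
rewrite !W0 g0 g'0 !mulr0 !subr0 in e2.
move: (rderiv u h z) (rderiv u (rderiv u h) z) (h z) e1 e2 => a b c e1 e2.
have E : w * a = 4 * x * c.
  have : w * (w * a - 4 * x * c) = 0 by rewrite -[RHS]e1; ring.
  by move/eqP; rewrite mulf_eq0 gt_eqF //= subr_eq0 => /eqP.
split=> //.
have Ex : x * (w * a) = 4 * (x ^+ 2 * c) by rewrite E; ring.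
have : w ^+ 2 * b - 8 * (x * (w * a)) + 8 * (x ^+ 2 * c) - 4 * w * c <= 0.
  by move: e2; congr (_ <= _); ring.
rewrite Ex; have -> : 24 * x ^+ 2 * c = 24 * (x ^+ 2 * c) by ring.
by move: (w ^+ 2 * b) (x ^+ 2 * c) (4 * w * c) => A B D; lra.
Qed.

(** Maximum principle for [(rho ^+ 2 - |t| ^+ 2) ^+ 2] times [h] on the disc of radius [rho] in the
    complex line through [z]. At a maximum [x ^+ 2 + y ^+ 2 + w = rho ^+ 2], so the maximal value is
    at most [p * rho ^+ 2], while the value at the centre is [rho ^+ 4 * h z]. *)
Lemma ahlfors_bound (z : 'rV[C]_m) (rho : R) : 0 < rho -> 0 < h z -> rho ^+ 2 * h z <= p.
Proof.
move=> rho0 hz.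
pose wt (q : R * R) : R := rho ^+ 2 - q.1 ^+ 2 - q.2 ^+ 2.
pose pt (q : R * R) : 'rV[C]_m := z + (ofR q.1 + iC * ofR q.2) *: v.
(* Truncating the weight makes [F] vanish off the disc, so its maximum over the compact square lies
   in the open disc as soon as it is positive. *)
pose F (q : R * R) : R := Num.max 0 (wt q) ^+ 2 * h (pt q).
have c1 (q : R * R) : x.1 @[x --> q] --> q.1 by case: q => a b; exact: cvg_fst.
have c2 (q : R * R) : x.2 @[x --> q] --> q.2 by case: q => a b; exact: cvg_snd.
have cwt (q : R * R) : wt x @[x --> q] --> wt q.
  rewrite /wt; apply: cvgB; first apply: cvgB.
  - exact: cvg_cst.
  - by rewrite expr2; apply: cvgM; exact: c1.
  - by rewrite expr2; apply: cvgM; exact: c2.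
have cpt (q : R * R) : pt x @[x --> q] --> pt q.
  apply: cvgD; first exact: cvg_cst.
  apply: cvgZr_tmp; apply: cvgD.
    by apply: (@cvg_comp _ _ _ fst (@ofR R) _ _ _ (c1 q)); exact: cvg_ofR.
  apply: cvgM; first exact: cvg_cst.
  by apply: (@cvg_comp _ _ _ snd (@ofR R) _ _ _ (c2 q)); exact: cvg_ofR.
have ch (y : 'rV[C]_m) : h x @[x --> y] --> h y by exact: smooth_continuous hs I.
have cF : continuous F.
  move=> q; suff: F x @[x --> q] --> F q by [].
  have cm : Num.max 0 (wt x) @[x --> q] --> Num.max 0 (wt q).
    by apply: (@continuous_max _ _ (fun=> 0) wt); [exact: cst_continuous | exact: cwt].
  apply: cvgM; first by rewrite expr2; apply: cvgM; exact: cm.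
  exact: (@cvg_comp _ _ _ pt h _ _ _ (cpt q) (ch (pt q))).
pose S : set (R * R) := `[- rho, rho]%classic `*` `[- rho, rho]%classic.
have S0 : S !=set0 by exists (0, 0); split; rewrite /= in_itv /= oppr_le0 ltW.
have cS : compact S by apply: compact_setX; exact: segment_compact.
have [x [y Fmax]] : exists x y : R, forall t, t \in S -> F t <= F (x, y).
  by have [[x y] _ H] := compact_EVT_max S0 cS (continuous_subspaceT cF); exists x, y.
have F00 : F (0, 0) = rho ^+ 4 * h z.
  rewrite /F /wt /pt /= !raddf0 mulr0 addr0 scale0r addr0 expr0n /= !subr0.
  by rewrite max_r ?sqr_ge0 // -exprM.
have inS a b : a ^+ 2 + b ^+ 2 <= rho ^+ 2 -> (a, b) \in S.
  have sq (c : R) : c ^+ 2 <= rho ^+ 2 -> - rho <= c <= rho.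
    move=> H; rewrite -ler_norml -(ler_sqr (normr_ge0 c) (ltW rho0)).
    by rewrite real_normK ?num_real.
  move=> ab; apply: mem_set; split; rewrite /= in_itv /=; apply: sq.
    by have := sqr_ge0 b; lra.
  by have := sqr_ge0 a; lra.
have F0pos : 0 < F (0, 0) by rewrite F00 mulr_gt0 // exprn_gt0.
have Fxy : F (0, 0) <= F (x, y) by apply: Fmax; apply: inS; rewrite expr0n addr0 sqr_ge0.
have w0 : 0 < wt (x, y).
  rewrite ltNge; apply/negP => wn; have := lt_le_trans F0pos Fxy.
  by rewrite /F max_l // expr0n mul0r ltxx.
have [w wE] : {w | w = wt (x, y)} by exists (wt (x, y)).
have [z1 zE] : {z1 | z1 = pt (x, y)} by exists (pt (x, y)).
have FE : F (x, y) = w ^+ 2 * h z1 by rewrite wE zE /F max_r // ltW.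
rewrite -wE in w0.
have h1 : 0 < h z1.
  by have := lt_le_trans F0pos Fxy; rewrite FE pmulr_rgt0 // exprn_gt0.
have rbound a b : 0 < wt (a, b) -> wt (a, b) ^+ 2 * h (pt (a, b)) <= w ^+ 2 * h z1.
  move=> ab; have K : F (a, b) <= F (x, y).
    by apply: Fmax; apply: inS; rewrite -subr_ge0 opprD addrA; exact: ltW ab.
  have FEab : F (a, b) = wt (a, b) ^+ 2 * h (pt (a, b)) by rewrite /F (max_r (ltW ab)).
  by move: K; rewrite FEab FE.
have [d1 d10 H1] := quadratic_near_pos x w0; have [d2 d20 H2] := quadratic_near_pos y w0.
have [|ev lv] := @weighted_max_line v z1 w x d1 d10 w0.
  move=> t /H1 tp; have := rbound (x + t) y.
  have -> : wt (x + t, y) = w - 2 * x * t - t ^+ 2 by rewrite wE /wt /=; ring.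
  have -> : pt (x + t, y) = z1 + ofR t *: v; last exact.
  by rewrite zE /pt /= raddfD /=; exact: line_shift1.
have [|ej lj] := @weighted_max_line j z1 w y d2 d20 w0.
  move=> t /H2 tp; have := rbound x (y + t).
  have -> : wt (x, y + t) = w - 2 * y * t - t ^+ 2 by rewrite wE /wt /=; ring.
  have -> : pt (x, y + t) = z1 + ofR t *: j; last exact.
  by rewrite zE /pt jE /= raddfD /=; exact: line_shift2.
have := @weighted_max_ineq x y w (h z1) _ _ _ p p0 w0 h1 ev ej _ (curv h1).
move=> /(_ _)H; have {}H : w ^+ 2 * h z1 <= p * (x ^+ 2 + y ^+ 2 + w).
  by apply: H; exact: weighted_sum_bound lv lj.
have {}H : w ^+ 2 * h z1 <= p * rho ^+ 2.
  by move: H; rewrite wE /wt /=; have -> : x ^+ 2 + y ^+ 2 + (rho ^+ 2 - x ^+ 2 - y ^+ 2) = rho ^+ 2 by ring.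
have r2 : 0 < rho ^+ 2 by rewrite exprn_gt0.
rewrite -(ler_pM2r r2); apply: le_trans H; rewrite -FE; apply: le_trans Fxy.
rewrite F00 le_eqVlt; apply/orP; left; apply/eqP; ring.
Qed.

(** The bound holds for all radii, and the radius [p / h z + 1] has a square larger than
    [p / h z]. *)
Theorem ahlfors_vanishing (z : 'rV[C]_m) : 0 <= h z -> h z = 0.
Proof.
rewrite le_eqVlt => /orP[/eqP <- //|hz].
have r0 : 0 < p / h z + 1 by rewrite ltr_wpDl // divr_ge0 // ltW.
have := @ahlfors_bound z _ r0 hz.
have : p < (p / h z + 1) ^+ 2 * h z.
  have e : p = p / h z * h z by rewrite divfK // gt_eqF.
  rewrite {1}e ltr_pM2r //; move: (p / h z) r0 => q r0.
  nra.
lra.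
Qed.
End Ahlfors.

(** * Plurisubharmonic functions and the Levi form *)

Section Psh.
Variable R : realType.
Local Notation C := (Cx R).

(** No second derivative is asked for: [f1] need only be affine up to [e]. The mean value theorem is
    applied to [f] minus its quadratic model. *)
Lemma taylor2 (f f1 : R -> R) (c e : R) :
  (forall t : R, 0 <= t -> t <= 1 -> is_derive t 1 f (f1 t)) ->
  (forall t, 0 <= t -> t <= 1 -> `|f1 t - f1 0 - t * c| <= e) ->
  `|f 1 - f 0 - f1 0 - c / 2| <= e.
Proof.
move=> df fe; pose g (t : R) := f t - t * f1 0 - t * t * (c / 2).
have dg (t : R) : 0 <= t -> t <= 1 -> is_derive t 1 g (f1 t - f1 0 - t * c).
  move=> t0 t1; have d1 := df t t0 t1.
  have d2 : is_derive t 1 (fun s : R => s * f1 0) _ := is_deriveM (is_derive_id t (1 : R)) (is_derive_cst (f1 0) t (1 : R)).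
  have d3 : is_derive t 1 (fun s : R => s * s) _ := is_deriveM (is_derive_id t (1 : R)) (is_derive_id t (1 : R)).
  have d4 : is_derive t 1 (fun s : R => s * s * (c / 2)) _ := is_deriveM d3 (is_derive_cst (c / 2) t (1 : R)).
  have d5 := is_deriveB (is_deriveB d1 d2) d4.
  apply: is_derive_eq d5 _.
  by rewrite !scaler0 !add0r /GRing.scale /= !mulr1; field.
have [s| |s] := @MVT R g (fun t => f1 t - f1 0 - t * c) 0 1 ltr01.
- by rewrite in_itv /= => /andP[s0 s1]; apply: dg; exact: ltW.
- apply: continuous_in_subspaceT => s; rewrite inE /= in_itv /= => /andP[s0 s1].
  have [ds _] := dg s s0 s1.
  by apply: differentiable_continuous; apply/derivable1_diffP.
rewrite in_itv /= subr0 mulr1 => /andP[s0 s1] E.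
have -> : f 1 - f 0 - f1 0 - c / 2 = g 1 - g 0 by rewrite /g; ring.
rewrite E; apply: fe; exact: ltW.
Qed.

Variable n : nat.
Local Notation V := 'rV[C]_n.
Implicit Types (u : V -> R) (O : set V) (z v w y : V).

Lemma rderiv_plane O (f : V -> R) (a b : R) v j y : open O -> smooth_on O f -> O y ->
  rderiv (ofR a *: v + ofR b *: j) f y = a * rderiv v f y + b * rderiv j f y.
Proof.
move=> Oo /smooth_C1 H Oy; rewrite (rderivD_dir (ofR a *: v) (ofR b *: j) Oo H Oy).
by rewrite (rderivZ_dir a v Oo H Oy) (rderivZ_dir b j Oo H Oy).
Qed.

Lemma plane_error (a b r e x1 x2 x3 x4 : R) : `|a| <= r -> `|b| <= r ->
  `|x1| <= e -> `|x2| <= e -> `|x3| <= e -> `|x4| <= e ->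
  `|a * (a * x1 + b * x2) + b * (a * x3 + b * x4)| <= 4 * r ^+ 2 * e.
Proof.
move=> ar br h1 h2 h3 h4.
have k (p q x : R) : `|p| <= r -> `|q| <= r -> `|x| <= e -> `|p * (q * x)| <= r ^+ 2 * e.
  move=> pr qr xe; rewrite !normrM mulrA expr2.
  by apply: ler_pM => //; apply: ler_pM.
have -> : 4 * r ^+ 2 * e = (r ^+ 2 * e + r ^+ 2 * e) + (r ^+ 2 * e + r ^+ 2 * e) by ring.
rewrite !mulrDr; apply: le_trans (ler_normD _ _) _; apply: lerD;
  apply: le_trans (ler_normD _ _) _; apply: lerD; exact: k.
Qed.

Lemma near_close (f : V -> R) z (e : R) : {for z, continuous f} -> 0 < e ->
  \forall w \near z, `|f w - f z| <= e.
Proof.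
move=> h e0; have /(@cvgrPdist_lt _ _ _ (nbhs z)) /(_ e e0) : f w @[w --> z] --> f z := h.
by apply: filterS => w; rewrite distrC => /ltW.
Qed.

Lemma plane_taylor O u z v j : open O -> smooth_on O u -> O z ->
  forall e : R, 0 < e -> exists2 d : R, 0 < d & forall a b r : R,
  `|a| <= r -> `|b| <= r -> r < d ->
  O (z + (ofR a *: v + ofR b *: j)) /\
  `|u (z + (ofR a *: v + ofR b *: j)) - u z - (a * rderiv v u z + b * rderiv j u z)
    - (a * (a * rderiv v (rderiv v u) z + b * rderiv j (rderiv v u) z) +
       b * (a * rderiv v (rderiv j u) z + b * rderiv j (rderiv j u) z)) / 2|
  <= 4 * r ^+ 2 * e.
Proof.
move=> Oo Hu Oz e e0.
have Hv x : smooth_on O (rderiv x u) by exact: smooth_rderiv.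
have cont x y : \forall w \near z, `|rderiv x (rderiv y u) w - rderiv x (rderiv y u) z| <= e.
  by apply: near_close e0; exact: smooth_continuous (smooth_rderiv x (Hv y)) Oz.
have /nbhs_nr[d d0 Hd] : \forall w \near z, O w /\
   ((`|rderiv v (rderiv v u) w - rderiv v (rderiv v u) z| <= e /\
    `|rderiv j (rderiv v u) w - rderiv j (rderiv v u) z| <= e) /\
   (`|rderiv v (rderiv j u) w - rderiv v (rderiv j u) z| <= e /\
    `|rderiv j (rderiv j u) w - rderiv j (rderiv j u) z| <= e)).
  apply: filterI; first exact: open_nbhs_nbhs.
  by apply: filterI; apply: filterI; exact: cont.
have K0 : 0 < nr v + nr j + 1 by have := nr_ge0 v; have := nr_ge0 j; lra.
exists (d / (nr v + nr j + 1)); first by rewrite divr_gt0.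
move=> a b r ar br; rewrite ltr_pdivlMr // => rd.
have r0 : 0 <= r by apply: le_trans ar.
set w := ofR a *: v + ofR b *: j.
have near_w (t : R) : `|t| <= 1 -> nr (z + ofR t *: w - z) < d.
  move=> t1; rewrite addrC addKr nrZ nr_ofR; apply: le_lt_trans rd.
  apply: le_trans (ler_wpM2r (nr_ge0 _) t1) _; rewrite mul1r.
  apply: le_trans (nrD _ _) _; rewrite !nrZ !nr_ofR !mulrDr mulr1.
  have := ler_wpM2r (nr_ge0 v) ar; have := ler_wpM2r (nr_ge0 j) br; lra.
have one (t : R) : 0 <= t -> t <= 1 -> `|t| <= 1 by move=> t0 t1; rewrite ger0_norm.
have Ot (t : R) : `|t| <= 1 -> O (z + ofR t *: w) by move=> /near_w/Hd[].
split; first by have := Ot 1; rewrite normr1 rmorph1 scale1r; apply.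
pose f1 (t : R) := a * rderiv v u (z + ofR t *: w) + b * rderiv j u (z + ofR t *: w).
have := @taylor2 (fun t : R => u (z + ofR t *: w)) f1
  (a * (a * rderiv v (rderiv v u) z + b * rderiv j (rderiv v u) z) +
       b * (a * rderiv v (rderiv j u) z + b * rderiv j (rderiv j u) z)) (4 * r ^+ 2 * e).
rewrite /f1 rmorph1 rmorph0 scale1r scale0r addr0; apply=> t t0 t1.
  have Ow := Ot t (one t t0 t1).
  rewrite -(rderiv_plane _ _ _ _ Oo Hu Ow); apply: rderiv_line.
  exact: (smooth_C1 Hu w Ow).1.
have M x : exists2 s : R, `|s| <= 1 & rderiv x u (z + ofR t *: w) - rderiv x u z =
    t * (a * rderiv v (rderiv x u) (z + ofR s *: w) + b * rderiv j (rderiv x u) (z + ofR s *: w)).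
  have [s st|s st E] := @rderiv_mvt R n w (rderiv x u) z t.
    by apply: (smooth_C1 (Hv x) w _).1; apply: Ot; apply: le_trans st _; exact: one.
  have s1 := le_trans st (one t t0 t1).
  by exists s => //; rewrite E (rderiv_plane _ _ _ _ Oo (Hv x) (Ot s s1)).
have [s1 hs1 E1] := M v; have [s2 hs2 E2] := M j.
have [_ [[h1 h2] _]] := Hd _ (near_w s1 hs1).
have [_ [_ [h3 h4]]] := Hd _ (near_w s2 hs2).
have := plane_error ar br h1 h2 h3 h4.
have tt : `|t| <= 1 := one t t0 t1.
move: E1 E2; move: (rderiv v u _) (rderiv v u z) (rderiv j u _) (rderiv j u z) => p1 p2 p3 p4 E1 E2.
have -> : a * p1 + b * p3 - (a * p2 + b * p4) = a * (p1 - p2) + b * (p3 - p4) by ring.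
rewrite E1 E2.
move: (rderiv v _ _) (rderiv v _ z) (rderiv j _ _) (rderiv j _ z) (rderiv v _ _) (rderiv v _ z) (rderiv j _ _) (rderiv j _ z) => q5 q6 q7 q8 q1 q2 q3 q4.
move=> H; have -> : a * (t * (a * q1 + b * q3)) + b * (t * (a * q5 + b * q7)) -
   t * (a * (a * q2 + b * q4) + b * (a * q6 + b * q8)) =
   t * (a * (a * (q1 - q2) + b * (q3 - q4)) + b * (a * (q5 - q6) + b * (q7 - q8))) by ring.
rewrite normrM; apply: le_trans (ler_wpM2r (normr_ge0 _) tt) _.
by rewrite mul1r.
Qed.

Lemma trig_poly_continuous (k0 k1 k2 a b c : R) :
  continuous (fun t => k0 + k1 * cos t + k2 * sin t +
      (a * cos t * cos t + b * cos t * sin t + c * sin t * sin t)).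
Proof.
have ck (k : R) : continuous (fun _ : R => k) by move=> x; exact: cst_continuous.
have cc : continuous (@cos R) := @continuous_cos R.
have cs : continuous (@sin R) := @continuous_sin R.
have cM (k : R) f g (cf : continuous f) (cg : continuous g) := contM (contM (ck k) cf) cg.
apply: (contD (contD (contD (ck k0) (contM (ck k1) cc)) (contM (ck k2) cs))).
exact: (contD (contD (cM a _ _ cc cc) (cM b _ _ cc cs)) (cM c _ _ cs cs)).
Qed.

Lemma trig_poly_RI (k0 k1 k2 a b c : R) :
  RI (fun t => k0 + k1 * cos t + k2 * sin t +
      (a * cos t * cos t + b * cos t * sin t + c * sin t * sin t)) 0 (2 * pi) =
  2 * pi * k0 + pi * (a + c).
Proof.
have pi0 := @pi_gt0 R.
have D (x : R) : is_derive x 1 (fun t : R => k0 * t + k1 * sin t - k2 * cos t +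
   (a * (t + sin t * cos t) / 2 + b * (sin t * sin t) / 2 + c * (t - sin t * cos t) / 2))
   (k0 + k1 * cos x + k2 * sin x +
      (a * cos x * cos x + b * cos x * sin x + c * sin x * sin x)).
  have di : is_derive x 1 (fun t : R => t) 1 := is_derive_id x (1 : R).
  have ds : is_derive x 1 (@sin R) (cos x) := is_derive_sin x.
  have dc : is_derive x 1 (@cos R) (- sin x) := is_derive_cos x.
  have dsc : is_derive x 1 (fun t : R => sin t * cos t) _ := is_deriveM ds dc.
  have dss : is_derive x 1 (fun t : R => sin t * sin t) _ := is_deriveM ds ds.
  have dk (k : R) (f : R -> R) (f' : R) : is_derive x 1 f f' -> is_derive x 1 (fun t : R => k * f t) (k * f').
    by move=> h; exact: (is_deriveZ k h).
  have dk2 (k : R) (f : R -> R) (f' : R) : is_derive x 1 f f' -> is_derive x 1 (fun t : R => k * f t / 2) (k * f' / 2).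
    move=> h; have := dk (k / 2) f f' h.
    rewrite (_ : k / 2 * f' = k * f' / 2); last by ring.
    by congr (is_derive _ _ _ _); apply/funext => t; ring.
  have dD (f : R -> R) (f' : R) (g : R -> R) (g' : R) : is_derive x 1 f f' -> is_derive x 1 g g' ->
     is_derive x 1 (fun t : R => f t + g t) (f' + g') by move=> h1 h2; exact: (is_deriveD h1 h2).
  have dB (f : R -> R) (f' : R) (g : R -> R) (g' : R) : is_derive x 1 f f' -> is_derive x 1 g g' ->
     is_derive x 1 (fun t : R => f t - g t) (f' - g') by move=> h1 h2; exact: (is_deriveB h1 h2).
  have DD := dD _ _ _ _ (dB _ _ _ _ (dD _ _ _ _ (dk k0 _ _ di) (dk k1 _ _ ds)) (dk k2 _ _ dc))
    (dD _ _ _ _ (dD _ _ _ _ (dk2 a _ _ (dD _ _ _ _ di dsc)) (dk2 b _ _ dss)) (dk2 c _ _ (dB _ _ _ _ di dsc))).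
  apply: is_derive_eq DD _; rewrite /GRing.scale /=.
  have := cos2Dsin2 x; rewrite !expr2.
  move: (cos x) (sin x) => C S CS.
  transitivity (k0 + k1 * C + k2 * S + (a * ((C * C + S * S) + C * C - S * S) / 2 + b * C * S + c * ((C * C + S * S) - C * C + S * S) / 2)); last by field.
  by rewrite CS; field.
have pi2 : 0 < 2 * pi :> R by rewrite mulr_gt0.
rewrite (RI_ftc pi2 (@trig_poly_continuous k0 k1 k2 a b c) (fun x _ _ => D x)).
have E : 2 * pi = pi *+ 2 :> R by rewrite mulr_natl.
by rewrite !E sin2pi cos2pi sin0 cos0 -!E; field.
Qed.

Lemma cis_plane (r t : R) v : cis t *: (ofR r *: v) =
  ofR (r * cos t) *: v + ofR (r * sin t) *: (iC *: v).
Proof.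
rewrite !scalerA -scalerDl; congr (_ *: _); apply: CP; rewrite /cis !reimE; ring.
Qed.

Lemma circle_upper (x1 x2 x3 x4 x5 x6 A D r c s e : R) :
  `|x1 - x2 - (r * c * x3 + r * s * x4) -
    (r * c * (r * c * A + r * s * x5) + r * s * (r * c * x6 + r * s * D)) / 2| <=
  4 * r ^+ 2 * e ->
  x1 <= x2 + 4 * r ^+ 2 * e + r * x3 * c + r * x4 * s +
  (r ^+ 2 * A / 2 * c * c + r ^+ 2 * (x5 + x6) / 2 * c * s + r ^+ 2 * D / 2 * s * s).
Proof.
rewrite ler_norml => /andP[_].
have -> : r * c * (r * c * A + r * s * x5) + r * s * (r * c * x6 + r * s * D) =
  2 * (r ^+ 2 * A / 2 * c * c + r ^+ 2 * (x5 + x6) / 2 * c * s + r ^+ 2 * D / 2 * s * s) by field.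
have -> : r * c * x3 = r * x3 * c by ring.
have -> : r * s * x4 = r * x4 * s by ring.
move: (_ + _ + _ * s * s) (4 * _ * _) (_ * c) (_ * s) => a b d f; lra.
Qed.

Lemma circle_mean (x r A D e p : R) : p != 0 ->
  x + r ^+ 2 / 4 * (A + D + e) = (2 * p)^-1 *
     (2 * p * (x + 4 * r ^+ 2 * (e / 16)) + p * (r ^+ 2 * A / 2 + r ^+ 2 * D / 2)).
Proof. by move=> p0; field. Qed.

(** Averaging the second-order expansion over a small circle kills the linear and mixed terms and
    leaves [r ^+ 2 / 4] times the Laplacian on the complex line; the sub-mean value inequality gives
    its sign. *)
Lemma psh_laplacian_ge0 O u z v : open O -> smooth_psh_on O u -> O z ->
  0 <= rderiv v (rderiv v u) z + rderiv (iC *: v) (rderiv (iC *: v) u) z.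
Proof.
move=> Oo [Hu Hm] Oz; apply/ler_addgt0Pr => e' e'0.
(* The expansion error is [4 * r ^+ 2] times this, that is [r ^+ 2 / 4 * e'], on the scale of the
   Laplacian term. *)
have e0 : 0 < e' / 16 by rewrite divr_gt0.
have [d d0 H] := plane_taylor v (iC *: v) Oo Hu Oz e0.
have pi0 := @pi_gt0 R.
pose r := d / 2; have r0 : 0 < r by rewrite divr_gt0.
have rd : r < d by rewrite /r ltr_pdivrMr //; lra.
have rcos t : `|r * cos t| <= r by rewrite normrM gtr0_norm // ler_piMr ?(ltW r0) // ler_norml cos_geN1 cos_le1.
have rsin t : `|r * sin t| <= r by rewrite normrM gtr0_norm // ler_piMr ?(ltW r0) // ler_norml sin_geN1 sin_le1.
have disc (t : C) : `|t| <= 1 -> O (z + t *: (ofR r *: v)).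
  rewrite nrE -(rmorph1 (@ofR R)) ofR_le => t1.
  have -> : t *: (ofR r *: v) = ofR (re t * r) *: v + ofR (im t * r) *: (iC *: v).
    rewrite !scalerA -scalerDl; congr (_ *: _); apply: CP; rewrite !reimE; ring.
  have [] // := H (re t * r) (im t * r) r.
    by rewrite normrM (gtr0_norm r0) ler_piMl ?(ltW r0) // (le_trans (re_le_nr t)).
  by rewrite normrM (gtr0_norm r0) ler_piMl ?(ltW r0) // (le_trans (im_le_nr t)).
have := Hm z (ofR r *: v) disc.
set A := rderiv v (rderiv v u) z; set D := rderiv (iC *: v) (rderiv (iC *: v) u) z.
pose P t := u z + 4 * r ^+ 2 * (e' / 16) + (r * rderiv v u z) * cos t + (r * rderiv (iC *: v) u z) * sin t
  + ((r ^+ 2 * A / 2) * cos t * cos t +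
     (r ^+ 2 * (rderiv (iC *: v) (rderiv v u) z + rderiv v (rderiv (iC *: v) u) z) / 2) * cos t * sin t
     + (r ^+ 2 * D / 2) * sin t * sin t).
have cG : continuous (fun t : R => u (z + cis t *: (ofR r *: v))).
  move=> t.
  have k : u w @[w --> z + cis t *: (ofR r *: v)] --> u (z + cis t *: (ofR r *: v)).
    by apply: (@smooth_continuous _ _ O u) => //; apply: disc; rewrite nrE nr_cis.
  apply: (@cvg_comp _ _ _ (fun t : R => z + cis t *: (ofR r *: v)) u _ _ _ _ k).
  apply: cvgD; first exact: cvg_cst.
  by apply: cvgZr_tmp; exact: cis_continuous.
have cP : continuous P by exact: trig_poly_continuous.
have pi2 : 0 < 2 * pi :> R by rewrite mulr_gt0.
have L : RI (fun t : R => u (z + cis t *: (ofR r *: v))) 0 (2 * pi) <= RI P 0 (2 * pi).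
  apply: RI_le => // t _ _; rewrite cis_plane.
  have [_] := H _ _ _ (rcos t) (rsin t) rd.
  rewrite -/A -/D /P.
  move: (u (z + _)) (u z) (rderiv v u z) (rderiv (iC *: v) u z) (rderiv (iC *: v) (rderiv v u) z) (rderiv v (rderiv (iC *: v) u) z) => x1 x2 x3 x4 x5 x6.
  move: (cos t) (sin t) => c s.
  exact: circle_upper.
rewrite trig_poly_RI in L.
rewrite -[Rintegral _ _ _]/(RI (fun t : R => u (z + cis t *: (ofR r *: v))) 0 (2 * pi)) => h.
have {h L} h := le_trans h (ler_wpM2l (ltW (_ : 0 < (2 * pi)^-1)) L).
have : u z <= u z + r ^+ 2 / 4 * (A + D + e').
  have -> : u z + r ^+ 2 / 4 * (A + D + e') = (2 * pi)^-1 *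
     (2 * pi * (u z + 4 * r ^+ 2 * (e' / 16)) + pi * (r ^+ 2 * A / 2 + r ^+ 2 * D / 2)).
    by apply: circle_mean; exact: lt0r_neq0.
  by apply: h; rewrite invr_gt0.
by rewrite lerDl pmulr_rge0 // divr_gt0 // exprn_gt0.
Qed.
End Psh.

(** * Wirtinger calculus for matrix-valued functions *)

Section MatrixWirtinger.
Variables (R : realType) (n : nat).
Local Notation C := (Cx R).
Local Notation V := 'rV[C]_n.
Implicit Types (O : set V) (v w y z : V) (s : C).

Definition cmx m p (A : 'M[C]_(m, p)) : 'M[C]_(m, p) := map_mx (@cj R) A.
Definition adj m p (A : 'M[C]_(m, p)) : 'M[C]_(p, m) := (cmx A)^T.

Definition msm m p O (G : V -> 'M[C]_(m, p)) := forall i j, csm O (fun y => G y i j).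
Definition mW s v m p (G : V -> 'M[C]_(m, p)) z : 'M[C]_(m, p) :=
  \matrix_(i, j) W s v (fun y => G y i j) z.

Lemma csm_eq O (g h : V -> C) : g =1 h -> csm O g -> csm O h.
Proof. by move=> /funext ->. Qed.

Lemma msm_cst m p O (A : 'M[C]_(m, p)) : msm O (fun=> A).
Proof. by move=> i j; exact: csm_cst. Qed.
Lemma msm_sub m p O O' (G : V -> 'M[C]_(m, p)) : O' `<=` O -> msm O G -> msm O' G.
Proof. by move=> OO' H i j; apply: csm_sub OO' _. Qed.
Lemma msm_ext m p O (G G' : V -> 'M[C]_(m, p)) : open O ->
  (forall y, O y -> G y = G' y) -> msm O G -> msm O G'.
Proof. by move=> Oo e H i j; apply: csm_ext (H i j) => // y Oy; rewrite e. Qed.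

Lemma mWE s v m p (G : V -> 'M[C]_(m, p)) z i j : mW s v G z i j = W s v (fun y => G y i j) z.
Proof. by rewrite mxE. Qed.

Section OnO.
Variables (O : set V) (Oo : open O).

Lemma msmD m p (G G' : V -> 'M[C]_(m, p)) : msm O G -> msm O G' -> msm O (fun y => G y + G' y).
Proof. by move=> H H' i j; apply: csm_eq (csmD Oo (H i j) (H' i j)) => y; rewrite mxE. Qed.
Lemma msmN m p (G : V -> 'M[C]_(m, p)) : msm O G -> msm O (fun y => - G y).
Proof. by move=> H i j; apply: csm_eq (csmN Oo (H i j)) => y; rewrite mxE. Qed.
Lemma msmM m p q (G : V -> 'M[C]_(m, p)) (G' : V -> 'M[C]_(p, q)) : msm O G -> msm O G' ->
  msm O (fun y => G y *m G' y).
Proof.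
move=> H H' i j.
apply: csm_eq (csm_sum (index_enum 'I_p) (F := fun k y => G y i k * G' y k j) Oo _) => [y|k].
  by rewrite mxE.
exact: csmM.
Qed.
Lemma msm_cmx m p (G : V -> 'M[C]_(m, p)) : msm O G -> msm O (fun y => cmx (G y)).
Proof. by move=> H i j; apply: csm_eq (csm_cj Oo (H i j)) => y; rewrite mxE. Qed.
Lemma csm_trace m (G : V -> 'M[C]_m) : msm O G -> csm O (fun y => \tr (G y)).
Proof. by move=> H; apply: csm_sum => // i; exact: H. Qed.
Lemma csm_det m (G : V -> 'M[C]_m) : msm O G -> csm O (fun y => \det (G y)).
Proof.
move=> H; apply: csm_sum => // s; apply: csmM => //; first exact: csm_cst.
by apply: csm_prod => // i; exact: H.
Qed.
Lemma msm_inv m (G : V -> 'M[C]_m) : msm O G -> (forall y, O y -> G y \in unitmx) ->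
  msm O (fun y => invmx (G y)).
Proof.
move=> H U.
apply: (msm_ext (G := fun y => (\det (G y))^-1 *: \adj (G y))) => // [y Oy|i j].
  by rewrite /invmx U.
apply: csm_eq (csmM Oo (csmV Oo _ (csm_det H)) (_ : csm O (fun y => (\adj (G y)) i j))) => [y|y Oy|].
- by rewrite [RHS]mxE.
- by have := U y Oy; rewrite unitmxE unitfE.
apply: (csm_eq (g := fun y => (-1) ^+ (j + i) * \det (row' j (col' i (G y))))).
  by move=> y; rewrite mxE.
apply: csmM => //; first exact: csm_cst.
by apply: csm_det => a b; apply: csm_eq (H (lift j a) (lift i b)) => y; rewrite !mxE.
Qed.
Lemma msmW s v m p (G : V -> 'M[C]_(m, p)) : msm O G -> msm O (mW s v G).
Proof. by move=> H i j; apply: csm_eq (csmW s v Oo (H i j)) => y; rewrite mxE. Qed.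

Variables (z : V) (Oz : O z).

Lemma mW_near m p s v (G G' : V -> 'M[C]_(m, p)) : msm O G ->
  (forall y, O y -> G y = G' y) -> mW s v G' z = mW s v G z.
Proof.
move=> H e; apply/matrixP => i j; rewrite !mxE.
apply: (near_W _ _ (H i j) Oz).
have : nbhs z O by exact: open_nbhs_nbhs.
by apply: filterS => y Oy; rewrite e.
Qed.
Lemma mW_cst m p s v (A : 'M[C]_(m, p)) : mW s v (fun=> A) z = 0.
Proof. by apply/matrixP => i j; rewrite !mxE W_cst. Qed.
Lemma mW_add m p s v (G G' : V -> 'M[C]_(m, p)) : msm O G -> msm O G' ->
  mW s v (fun y => G y + G' y) z = mW s v G z + mW s v G' z.
Proof.
move=> H H'; apply/matrixP => i j; rewrite !mxE -(W_add s v (H i j) (H' i j) Oz).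
by congr (W s v _ z); apply/funext => y; rewrite mxE.
Qed.
Lemma mW_opp m p s v (G : V -> 'M[C]_(m, p)) : msm O G ->
  mW s v (fun y => - G y) z = - mW s v G z.
Proof.
move=> H; apply/matrixP => i j; rewrite !mxE -(W_opp s v (H i j) Oz).
by congr (W s v _ z); apply/funext => y; rewrite mxE.
Qed.
Lemma mW_mul m p q s v (G : V -> 'M[C]_(m, p)) (G' : V -> 'M[C]_(p, q)) : msm O G -> msm O G' ->
  mW s v (fun y => G y *m G' y) z = mW s v G z *m G' z + G z *m mW s v G' z.
Proof.
move=> H H'; apply/matrixP => i j; rewrite !mxE -big_split /=.
rewrite (_ : (fun y => _) = fun y => \sum_k G y i k * G' y k j); last by apply/funext => y; rewrite mxE.
rewrite (W_sum (index_enum 'I_p) (F := fun k y => G y i k * G' y k j) s v Oo _ Oz); last first.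
  by move=> k; exact: csmM.
by apply: eq_bigr => k _; rewrite (W_mul s v (H i k) (H' k j) Oz) !mxE.
Qed.
Lemma mW_cmx m p s v (G : V -> 'M[C]_(m, p)) : msm O G ->
  mW s v (fun y => cmx (G y)) z = cmx (mW (cj s) v G z).
Proof.
move=> H; apply/matrixP => i j; rewrite !mxE -(W_cj s v (H i j) Oz).
by congr (W s v _ z); apply/funext => y; rewrite mxE.
Qed.
Lemma mW_tr m p s v (G : V -> 'M[C]_(m, p)) : mW s v (fun y => (G y)^T) z = (mW s v G z)^T.
Proof.
apply/matrixP => i j; rewrite !mxE; congr (W s v _ z); by apply/funext => y; rewrite mxE.
Qed.
Lemma W_trace m s v (G : V -> 'M[C]_m) : msm O G ->
  W s v (fun y => \tr (G y)) z = \tr (mW s v G z).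
Proof.
move=> H; rewrite (W_sum (index_enum 'I_m) (F := fun i y => G y i i) s v Oo _ Oz) //.
by apply: eq_bigr => i _; rewrite mxE.
Qed.
Lemma mWC m p s t v w (G : V -> 'M[C]_(m, p)) : msm O G ->
  mW s v (mW t w G) z = mW t w (mW s v G) z.
Proof.
move=> H; apply/matrixP => i j; rewrite [LHS]mxE [RHS]mxE.
transitivity (W s v (W t w (fun y => G y i j)) z).
  by congr (W s v _ z); apply/funext => y; rewrite mWE.
rewrite (WC s t v w Oo (H i j) Oz).
by congr (W t w _ z); apply/funext => y; rewrite mWE.
Qed.
End OnO.

Lemma cmxM m p q (A : 'M[C]_(m, p)) (B : 'M[C]_(p, q)) : cmx (A *m B) = cmx A *m cmx B.
Proof. exact: map_mxM. Qed.
Lemma cmxD m p (A B : 'M[C]_(m, p)) : cmx (A + B) = cmx A + cmx B.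
Proof. exact: map_mxD. Qed.
Lemma cmxN m p (A : 'M[C]_(m, p)) : cmx (- A) = - cmx A.
Proof. exact: map_mxN. Qed.
Lemma cmxK m p (A : 'M[C]_(m, p)) : cmx (cmx A) = A.
Proof. by apply/matrixP => i j; rewrite !mxE cjK. Qed.
Lemma cmx0 m p : cmx (0 : 'M[C]_(m, p)) = 0.
Proof. exact: map_mx0. Qed.
Lemma adjM m p q (A : 'M[C]_(m, p)) (B : 'M[C]_(p, q)) : adj (A *m B) = adj B *m adj A.
Proof. by rewrite /adj cmxM trmx_mul. Qed.
Lemma adjK m p (A : 'M[C]_(m, p)) : adj (adj A) = A.
Proof. by apply/matrixP => i j; rewrite !mxE cjK. Qed.
Lemma adjD m p (A B : 'M[C]_(m, p)) : adj (A + B) = adj A + adj B.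
Proof. by rewrite /adj cmxD linearD. Qed.
Lemma adj0 m p : adj (0 : 'M[C]_(m, p)) = 0.
Proof. by rewrite /adj cmx0 trmx0. Qed.
End MatrixWirtinger.

Section RealDimension.
Variable R : realType.
Local Notation C := (Cx R).

Definition of_reals m (x : 'rV[R]_(m + m)) : 'rV[C]_m :=
  \row_j Complex (x 0 (lshift m j)) (x 0 (rshift m j)).
Definition to_reals m (z : 'rV[C]_m) : 'rV[R]_(m + m) :=
  row_mx (\row_j re (z 0 j)) (\row_j im (z 0 j)).

Lemma of_reals_inj0 m (x : 'rV[R]_(m + m)) : of_reals x = 0 -> x = 0.
Proof.
move=> /rowP H; apply/rowP => i; rewrite mxE.
case: (splitP i) => j ij.
  have := congr1 (@re R) (H j); rewrite !mxE /= => <-; congr (x 0 _); exact: val_inj.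
have := congr1 (@im R) (H j); rewrite !mxE /= => <-; congr (x 0 _); exact: val_inj.
Qed.
Lemma to_reals_inj0 m (z : 'rV[C]_m) : to_reals z = 0 -> z = 0.
Proof.
move=> /rowP H; apply/rowP => j; rewrite mxE; apply: CP.
  by have := H (lshift m j); rewrite row_mxEl !mxE.
by have := H (rshift m j); rewrite row_mxEr !mxE.
Qed.

(** An injective real-linear map gives [2 a <= 2 b]. Foliated charts are merely smooth, so their
    differentials are only real-linear and complex ranks cannot be compared through them
    directly. *)
Lemma real_linear_dim a b (L : 'rV[C]_a -> 'rV[C]_b) :
  (forall v w, L (v + w) = L v + L w) -> (forall (t : R) v, L (ofR t *: v) = ofR t *: L v) ->
  (forall v, L v = 0 -> v = 0) -> (a <= b)%N.
Proof.
move=> LD LZ L0.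
pose f (x : 'rV[R]_(a + a)) := to_reals (L (of_reals x)).
have fD x y : f (x + y) = f x + f y.
  rewrite /f; have -> : of_reals (x + y) = of_reals x + of_reals y.
    by apply/rowP => j; apply: CP; rewrite !mxE.
  rewrite LD; apply/rowP => i; rewrite [RHS]mxE.
  by case: (split_ordP i) => j ->; rewrite ?row_mxEl ?row_mxEr !mxE ?reD ?imD.
have fZ t x : f (t *: x) = t *: f x.
  rewrite /f; have -> : of_reals (t *: x) = ofR t *: of_reals x.
    by apply/rowP => j; apply: CP; rewrite !mxE ?reM ?imM re_ofR im_ofR mul0r ?subr0 ?addr0 ?re_Complex ?im_Complex.
  rewrite LZ; apply/rowP => i; rewrite [RHS]mxE.
  by case: (split_ordP i) => j ->; rewrite ?row_mxEl ?row_mxEr !mxE ?reM ?imM re_ofR im_ofR mul0r ?subr0 ?addr0.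
pose A : 'M[R]_(a + a, b + b) := \matrix_i f (delta_mx 0 i).
have f0 : f 0 = 0 by rewrite -[X in f X](scale0r 0) fZ scale0r.
have fA x : x *m A = f x.
  rewrite mulmx_sum_row [in RHS](row_sum_delta x) (big_morph f fD f0).
  by apply: eq_bigr => i _; rewrite rowK fZ.
have : row_free A.
  by apply: inj_row_free => x; rewrite fA => /to_reals_inj0/L0/of_reals_inj0.
by move=> /eqP e; have := rank_leq_col A; rewrite e !addnn leq_double.
Qed.
End RealDimension.

(** * Positive definite Hermitian matrices *)

Section Cholesky.
Variable R : realType.
Local Notation C := (Cx R).

Definition posdef p (H : 'M[C]_p) :=
  adj H = H /\ forall x : 'rV_p, x != 0 -> 0 < re ((x *m H *m adj x) 0 0).

Lemma adj_block (m1 m2 n1 n2 : nat) (A : 'M[C]_(m1, n1)) (B : 'M[C]_(m1, n2))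
  (D : 'M[C]_(m2, n1)) (E : 'M[C]_(m2, n2)) :
  adj (block_mx A B D E) = block_mx (adj A) (adj D) (adj B) (adj E).
Proof. by rewrite /adj /cmx map_block_mx tr_block_mx. Qed.

Lemma adj_row m n1 n2 (A : 'M[C]_(m, n1)) (B : 'M[C]_(m, n2)) :
  adj (row_mx A B) = col_mx (adj A) (adj B).
Proof. by rewrite /adj /cmx map_row_mx tr_row_mx. Qed.

(** Induction on the size: the first entry is a positive real, and its Schur complement is again
    positive definite. *)
Lemma cholesky p (H : 'M[C]_p) : posdef H -> exists2 G, G \in unitmx & H = G *m adj G.
Proof.
elim: p H => [|p IH] H [hH pH].
  by exists 1%:M; [exact: unitmx1 | apply/matrixP => -[]].
pose a := @ulsubmx _ 1 p 1 p H; pose b := @ursubmx _ 1 p 1 p H.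
pose c := @dlsubmx _ 1 p 1 p H; pose D := @drsubmx _ 1 p 1 p H.
have HE : H = block_mx a b c D by rewrite submxK.
move: hH; rewrite {1 2}HE (@adj_block 1 p 1 p) => /(@eq_block_mx _ 1 p 1 p)[ha hb hc hD].
have aE : a = (ofR (re (a 0 0)))%:M.
  apply/matrixP => i j; rewrite !ord1 [RHS]mxE eqxx mulr1n; apply: CP => //.
  have := congr1 (fun A : 'M[C]_1 => im (A 0 0)) ha; rewrite /adj !mxE im_cj im_ofR; lra.
set al := re (a 0 0) in aE.
have al0 : 0 < al.
  have := pH (row_mx 1%:M 0); rewrite HE (@mul_row_block _ 1 1 p 1 p) mul1mx !mul0mx !addr0 mul1mx.
  rewrite (@adj_row 1 1 p) (@mul_row_col _ 1 1 p) adj0 mulmx0 addr0.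
  rewrite /adj /cmx map_mx1 trmx1 mulmx1; apply.
  apply/eqP => /(congr1 (fun A : 'rV[C]_(1 + p) => lsubmx A 0 0)).
  by rewrite row_mxKl !mxE; apply/eqP; exact: oner_neq0.
have al1 : ofR al != 0 :> C by rewrite -(rmorph0 (@ofR R)); apply/eqP => /(congr1 (@re R)) /=; lra.
pose S := D - (ofR al)^-1 *: (c *m b).
have cj_al : cj (ofR al)^-1 = (ofR al)^-1 by rewrite cjV cj_ofR.
have adjZ m q (k : C) (X : 'M[C]_(m, q)) : adj (k *: X) = cj k *: adj X.
  by apply/matrixP => i j; rewrite !mxE cjM.
have adjN m q (X : 'M[C]_(m, q)) : adj (- X) = - adj X.
  by rewrite -scaleN1r adjZ cjN cj1 scaleN1r.
have [|G' uG' EG'] := IH S.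
  split; first by rewrite /S adjD adjN adjZ adjM cj_al hD hc hb.
  (* This [y] solves [y *m a + x *m c = 0], so the form of [H] at [(y, x)] reduces to the form of
     the Schur complement at [x]. *)
  move=> x x0; pose y := - (ofR al)^-1 *: (x *m c).
  have := pH (row_mx y x); rewrite HE (@mul_row_block _ 1 1 p 1 p).
  have -> : y *m a + x *m c = 0.
    by rewrite aE mul_mx_scalar /y scaleNr scalerN scalerA mulfV // scale1r addrC subrr.
  rewrite (@adj_row 1 1 p) (@mul_row_col _ 1 1 p) mul0mx add0r.
  have -> : y *m b + x *m D = x *m S.
    by rewrite /y /S mulmxBr -scalemxAr mulmxA -scalemxAl scaleNr addrC.
  apply; apply/eqP => /(congr1 (fun A : 'rV[C]_(1 + p) => rsubmx A)).
  by rewrite row_mxKr linear0; apply/eqP.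
pose g : C := ofR (Num.sqrt al).
have gg : g * g = ofR al by rewrite -rmorphM -expr2 sqr_sqrtr // ltW.
have g0 : g != 0 by apply: contraNneq al1 => e; rewrite -gg e mul0r.
have cg : cj g = g by rewrite cj_ofR.
exists (block_mx (g%:M : 'M[C]_1) 0 (g^-1 *: c) G').
  by rewrite unitmxE (@det_lblock _ 1 p) unitrM det_scalar1 unitfE g0 -unitmxE.
rewrite (@adj_block 1 p 1 p) HE (@mulmx_block _ 1 p 1 p 1 p) !(adj0, mul0mx, mulmx0, addr0).
have -> : adj (g%:M : 'M[C]_1) = g%:M.
  by apply/matrixP => i j; rewrite !ord1 !mxE eqxx !mulr1n.
rewrite adjZ cjV cg hb -EG' /S !mul_scalar_mx mul_mx_scalar !scalerA mulfV // !scale1r.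
rewrite -scalemxAl -scalemxAr scalerA -invfM gg addrC subrK.
by rewrite {1}aE -gg scale_scalar_mx.
Qed.
End Cholesky.

(** * Trace inequalities for antilinear endomorphisms *)

Section TraceInequalities.
Variable R : realType.
Local Notation C := (Cx R).

Lemma cauchy_schwarz I (r : seq I) (x y : I -> R) :
  (\sum_(i <- r) x i * y i) ^+ 2 <= (\sum_(i <- r) x i ^+ 2) * (\sum_(i <- r) y i ^+ 2).
Proof.
set S := \sum_(i <- r) x i * y i; set X := \sum_(i <- r) x i ^+ 2; set Y := \sum_(i <- r) y i ^+ 2.
have Y0 : 0 <= Y by apply: sumr_ge0 => i _; exact: sqr_ge0.
have key t : 0 <= X - 2 * t * S + t ^+ 2 * Y.
  have -> : X - 2 * t * S + t ^+ 2 * Y = \sum_(i <- r) (x i - t * y i) ^+ 2.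
    rewrite /X /S /Y !mulr_sumr -sumrN -!big_split /=; apply: eq_bigr => i _; ring.
  by apply: sumr_ge0 => i _; exact: sqr_ge0.
have [Y1|Y1] := eqVneq Y 0.
  have [->|S0] := eqVneq S 0; first by rewrite Y1 expr0n /= mulr0.
  have := key ((X + 1) / (2 * S)); rewrite Y1 mulr0 addr0.
  have -> : 2 * ((X + 1) / (2 * S)) * S = X + 1 by field.
  lra.
have Y2 : 0 < Y by rewrite lt_neqAle eq_sym Y1.
have := key (S / Y).
have -> : X - 2 * (S / Y) * S + (S / Y) ^+ 2 * Y = (X * Y - S ^+ 2) / Y by field.
by rewrite pmulr_lge0 ?invr_gt0 // subr_ge0.
Qed.

(** The square of the Frobenius norm. *)
Definition fro m q (A : 'M[C]_(m, q)) : R := \sum_i \sum_j nr (A i j) ^+ 2.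

Lemma fro_ge0 m q (A : 'M[C]_(m, q)) : 0 <= fro A.
Proof. by apply: sumr_ge0 => i _; apply: sumr_ge0 => j _; exact: sqr_ge0. Qed.
Lemma fro_eq0 m q (A : 'M[C]_(m, q)) : fro A = 0 -> A = 0.
Proof.
move=> /eqP; rewrite psumr_eq0 => [/allP H|i _]; last by apply: sumr_ge0 => j _; exact: sqr_ge0.
apply/matrixP => i j; have := H i (mem_index_enum i).
rewrite psumr_eq0 => [/allP H2|k _]; last exact: sqr_ge0.
by have := H2 j (mem_index_enum j); rewrite mxE expf_eq0 /= nr_eq0 => /eqP.
Qed.

Lemma tr_adj_mul m q (A B : 'M[C]_(m, q)) : \tr (adj A *m B) = \sum_i \sum_j cj (A i j) * B i j.
Proof.
rewrite exchange_big /=; apply: eq_bigr => j _; rewrite mxE.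
by apply: eq_bigr => i _; rewrite !mxE.
Qed.
Lemma tr_adj_self m q (A : 'M[C]_(m, q)) : \tr (adj A *m A) = ofR (fro A).
Proof.
rewrite tr_adj_mul rmorph_sum; apply: eq_bigr => i _; rewrite rmorph_sum; apply: eq_bigr => j _.
by rewrite /= nr_sqr; apply: CP; rewrite !reimE; ring.
Qed.
Lemma tr_adj_cs m q (A B : 'M[C]_(m, q)) : nr (\tr (adj A *m B)) ^+ 2 <= fro A * fro B.
Proof.
rewrite tr_adj_mul /fro !pair_bigA /=.
apply: le_trans (cauchy_schwarz (index_enum _) (fun p => nr (A p.1 p.2)) (fun p => nr (B p.1 p.2))).
rewrite ler_pXn2r ?nnegrE ?nr_ge0 //; last by apply: sumr_ge0 => i _; rewrite mulr_ge0 // nr_ge0.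
apply: le_trans (nr_sum _ _ _) _; apply: ler_sum => i _.
by rewrite nrM nr_cj.
Qed.
Lemma tr_sqr_le p (Y : 'M[C]_p) : nr (\tr Y) ^+ 2 <= p%:R * fro Y.
Proof.
have := tr_adj_cs (1%:M : 'M[C]_p) Y; rewrite {1}/adj /cmx map_mx1 trmx1 mul1mx.
suff -> : fro (1%:M : 'M[C]_p) = p%:R by [].
rewrite /fro (eq_bigr (fun=> 1)) => [|i _]; first by rewrite sumr_const card_ord.
rewrite (bigD1 i) //= big1 => [|j ji]; rewrite mxE ?eqxx ?addr0.
  by rewrite -(rmorph1 (@ofR R)) nr_ofR normr1 expr1n.
by rewrite eq_sym (negbTE ji) nr0 expr0n.
Qed.

(* Writing [H = G *m adj G], conjugation by [G] turns [N] and [P] into symmetric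
   matrices, for which the traces are Frobenius norms. *)
Lemma twist_inequalities p (H N P : 'M[C]_p) : posdef H ->
  (N *m H)^T = N *m H -> (P *m H)^T = P *m H ->
  exists l m' v : R,
  [/\ \tr (cmx N *m N) = ofR l, \tr (cmx P *m P) = ofR m',
      \tr ((cmx N *m N) *m (cmx N *m N)) = ofR v &
  [/\ 0 <= l, 0 <= m', nr (\tr (cmx N *m P)) ^+ 2 <= l * m',
      l ^+ 2 <= p%:R * v & (l = 0 -> N = 0)]].
Proof.
move=> /cholesky[G uG ->] sN sP.
have uG' : cmx G \in unitmx by rewrite /cmx map_unitmx.
(* The change of basis for an antilinear endomorphism: one of the two factors is conjugated. *)
pose tw A := invmx (cmx G) *m A *m G.
have symm (A : 'M[C]_p) : (A *m (G *m adj G))^T = A *m (G *m adj G) -> cmx (tw A) = adj (tw A).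
  move=> e; suff e' : (tw A)^T = tw A by rewrite /adj /cmx -[in LHS]e' map_trmx.
  have e2 : G^T *m A^T = invmx (cmx G) *m A *m G *m adj G.
    apply: (can_inj (mulKmx uG')); rewrite -!mulmxA (mulKVmx uG') -e !trmx_mul.
    by rewrite /adj trmxK mulmxA.
  rewrite /tw !trmx_mul trmx_inv -/(adj G) mulmxA e2 mulmxK //.
  by rewrite /adj unitmx_tr.
have twM A B : cmx (tw A) *m tw B = invmx G *m (cmx A *m B) *m G.
  rewrite /tw !cmxM {1}/cmx map_invmx -/(cmx _) cmxK -!mulmxA; congr (_ *m (_ *m _)).
  by rewrite !mulmxA mulmxV // mul1mx.
have trM A : \tr (invmx G *m A *m G) = \tr A by rewrite mxtrace_mulC mulmxA mulmxV // mul1mx.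
have eN := symm N sN; have eP := symm P sP.
exists (fro (tw N)), (fro (tw P)), (fro (adj (tw N) *m tw N)); split.
- by rewrite -tr_adj_self -eN twM trM.
- by rewrite -tr_adj_self -eP twM trM.
- rewrite -tr_adj_self adjM adjK -eN twM -trM; congr (\tr _).
  by move: (cmx N *m N) => X; rewrite !mulmxA mulmxK.
split; [exact: fro_ge0|exact: fro_ge0| | |].
- by rewrite -(trM (cmx N *m P)) -twM eN; exact: tr_adj_cs.
(* The matrix [adj (tw N) *m tw N] has trace [l] and squared Frobenius norm [v]; the dimension [p]
   enters here. *)
- have := tr_sqr_le (adj (tw N) *m tw N).
  by rewrite tr_adj_self nr_ofR real_normK // num_real.
move=> /fro_eq0/(congr1 (fun A => cmx G *m A *m invmx G)).
by rewrite /tw !mulmxA mulmxV // mul1mx -mulmxA mulmxV // mulmx1 mulmx0 mul0mx.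
Qed.
End TraceInequalities.

(** * The Levi form and the symmetries of its derivatives *)

Section LeviForm.
Variables (R : realType) (n : nat).
Local Notation C := (Cx R).
Local Notation V := 'rV[C]_n.
Implicit Types (u f : V -> R) (O : set V) (z v w x y : V) (s t : C).

Lemma cderiv_ofR f v z : cderiv v (fun y => ofR (f y)) z = ofR (rderiv v f z).
Proof.
apply: CP; first by rewrite re_cderiv.
by rewrite im_cderiv im_ofR; have [] := rderiv_cst v (0 : R) z.
Qed.
Lemma W_ofR f s v z : W s v (fun y => ofR (f y)) z =
  2^-1 * (ofR (rderiv v f z) + s * ofR (rderiv (iC *: v) f z)).
Proof. by rewrite /W !cderiv_ofR. Qed.

Lemma laplacian_algebra (a b c d : C) : b = c ->
  2^-1 * (2^-1 * (a + - iC * b) + iC * (2^-1 * (c + - iC * d))) = 4^-1 * (a + d).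
Proof.
move=> ->; transitivity (4^-1 * (a - iC * iC * d)); first by field.
by rewrite iC2; field.
Qed.

Definition cfun u : V -> C := fun y => ofR (u y).

Lemma laplacian_W O u v z : open O -> smooth_on O u -> O z ->
  W (- iC) v (W iC v (cfun u)) z =
  ofR (4^-1 * (rderiv v (rderiv v u) z + rderiv (iC *: v) (rderiv (iC *: v) u) z)).
Proof.
move=> Oo Hu Oz.
have H x : csm O (fun y => ofR (rderiv x u y)) by apply: csm_ofR; exact: smooth_rderiv.
transitivity (W (- iC) v (fun y => 2^-1 * (ofR (rderiv v u y) + iC * ofR (rderiv (iC *: v) u y))) z).
  by congr (W _ _ _ z); apply/funext => y; exact: W_ofR.
have H2 : csm O (fun y => iC * ofR (rderiv (iC *: v) u y)) := (csmM Oo (csm_cst O iC) (H (iC *: v))).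
rewrite (W_mul (- iC) v (csm_cst O 2^-1) (csmD Oo (H v) H2) Oz) W_cst mul0r add0r.
rewrite (W_add (- iC) v (H v) H2 Oz) (W_mul (- iC) v (csm_cst O iC) (H (iC *: v)) Oz) W_cst mul0r add0r.
rewrite !W_ofR.
have C1' x : C1 O (rderiv x u) by apply: smooth_C1; exact: smooth_rderiv.
rewrite laplacian_algebra; last by rewrite (clairaut (iC *: v) v Oo (smooth_C1 Hu) C1' Oz).
by rewrite rmorphM rmorphD fmorphV rmorph_nat.
Qed.

Definition hess u z : 'M[C]_n := \matrix_(j, k) levi u j k z.

Section OnO.
Variables (O : set V) (u : V -> R).
Hypotheses (Oo : open O) (Hu : smooth_on O u).
Let Hg : csm O (cfun u). Proof. exact: csm_ofR. Qed.

Lemma leviE j k z : levi u j k z = W (- iC) (delta_mx 0 j) (W iC (delta_mx 0 k) (cfun u)) z.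
Proof. by rewrite /levi dzE. Qed.

Lemma msm_hess : msm O (hess u).
Proof.
move=> j k; apply: csm_eq (csmW (- iC) (delta_mx 0 j) Oo (csmW iC (delta_mx 0 k) Oo Hg)) => y.
by rewrite mxE leviE.
Qed.

Lemma levi_form x y z : O z -> W (- iC) x (W iC y (cfun u)) z = (x *m hess u z *m adj y) 0 0.
Proof.
move=> Oz; rewrite (Wd_coord x Oo (csmW iC y Oo Hg) Oz) -mulmxA mxE.
apply: eq_bigr => j _; rewrite mxE; congr (_ * _).
have HF k : csm O (fun w => cj (y 0 k) * W iC (delta_mx 0 k) (cfun u) w).
  exact: (csmM Oo (csm_cst O (cj (y 0 k))) (csmW iC (delta_mx 0 k) Oo Hg)).
transitivity (W (- iC) (delta_mx 0 j) (fun w => \sum_k cj (y 0 k) * W iC (delta_mx 0 k) (cfun u) w) z); last first.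
  rewrite (W_sum _ _ _ Oo HF Oz); apply: eq_bigr => k _.
  rewrite (W_mul _ _ (csm_cst O (cj (y 0 k))) (csmW iC (delta_mx 0 k) Oo Hg) Oz) W_cst mul0r add0r.
  by rewrite [hess u z _ _]mxE leviE !mxE mulrC.
apply: (near_W (- iC) (delta_mx 0 j) (csm_sum (index_enum 'I_n) Oo HF) Oz).
have : nbhs z O by exact: open_nbhs_nbhs.
by apply: filterS => w Ow; rewrite (Wb_coord y Oo Hg Ow).
Qed.

Lemma adj_hess z : O z -> adj (hess u z) = hess u z.
Proof.
move=> Oz; apply/matrixP => j k; rewrite 4!mxE !leviE.
have e1 := W_cj iC (delta_mx 0 k) (csmW iC (delta_mx 0 j) Oo Hg) Oz.
rewrite cj_iC in e1; rewrite -e1 -(WC iC (- iC) (delta_mx 0 k) (delta_mx 0 j) Oo Hg Oz).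
apply: (near_W iC (delta_mx 0 k) (csmW (- iC) (delta_mx 0 j) Oo Hg) Oz).
have : nbhs z O by exact: open_nbhs_nbhs.
apply: filterS => w Ow.
have := W_cj (- iC) (delta_mx 0 j) Hg Ow; rewrite cjN cj_iC opprK => <-.
by congr (W _ _ _ w); apply/funext => y; rewrite /cfun cj_ofR.
Qed.

Lemma hess_psd z x : smooth_psh_on O u -> O z -> 0 <= re ((x *m hess u z *m adj x) 0 0).
Proof.
move=> Hp Oz; rewrite -(levi_form x x Oz) (laplacian_W x Oo Hu Oz) re_ofR.
by rewrite mulr_ge0 // (psh_laplacian_ge0 x Oo Hp Oz).
Qed.

Lemma hess_third t x y w z : O z ->
  x *m mW t w (hess u) z *m adj y = (W t w (W (- iC) x (W iC y (cfun u))) z)%:M.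
Proof.
move=> Oz; apply/matrixP => i j; rewrite !ord1 [RHS]mxE eqxx mulr1n.
have Hx : msm O (fun y => x *m hess u y).
  exact: (msmM Oo (msm_cst O x) msm_hess).
have -> : x *m mW t w (hess u) z *m adj y = mW t w (fun z => x *m hess u z *m adj y) z.
  rewrite (mW_mul Oo Oz t w Hx (msm_cst O (adj y))) mW_cst mulmx0 addr0.
  by rewrite (mW_mul Oo Oz t w (msm_cst O x) msm_hess) mW_cst mul0mx add0r.
rewrite mxE; symmetry.
apply: (near_W t w (msmM Oo Hx (msm_cst O (adj y)) 0 0) Oz).
have : nbhs z O by exact: open_nbhs_nbhs.
by apply: filterS => q Oq; rewrite levi_form.
Qed.

(** With [hess_swap], this is the form in which closedness of [dd^c u] is used: third derivatives
    are symmetric in the two antiholomorphic directions here, and in the two holomorphic ones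
    there. *)
Lemma hess_swap_bar x y w z : O z ->
  x *m mW iC w (hess u) z *m adj y = x *m mW iC y (hess u) z *m adj w.
Proof.
move=> Oz.
have e : W iC w (W (- iC) x (W iC y (cfun u))) z = W iC y (W (- iC) x (W iC w (cfun u))) z.
  rewrite (WC iC (- iC) w x Oo (csmW iC y Oo Hg) Oz) (WC iC (- iC) y x Oo (csmW iC w Oo Hg) Oz).
  apply: (near_W (- iC) x (csmW iC y Oo (csmW iC w Oo Hg)) Oz).
  have : nbhs z O by exact: open_nbhs_nbhs.
  by apply: filterS => q Oq; rewrite (WC iC iC w y Oo Hg Oq).
exact: (etrans (hess_third iC x y w Oz) (etrans (congr1 (fun c : C => c%:M) e) (esym (hess_third iC x w y Oz)))).
Qed.
Lemma hess_swap x y w z : O z ->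
  x *m mW (- iC) w (hess u) z *m adj y = w *m mW (- iC) x (hess u) z *m adj y.
Proof.
move=> Oz.
have e : W (- iC) w (W (- iC) x (W iC y (cfun u))) z = W (- iC) x (W (- iC) w (W iC y (cfun u))) z.
  by rewrite (WC (- iC) (- iC) w x Oo (csmW iC y Oo Hg) Oz).
exact: (etrans (hess_third (- iC) x y w Oz) (etrans (congr1 (fun c : C => c%:M) e) (esym (hess_third (- iC) w y x Oz)))).
Qed.
End OnO.
End LeviForm.

(** * The curvature inequality for the twist *)

(* The hypotheses are the structure equations satisfied along a leaf by the
   transverse Levi form [H], the twist [N] (the (0,1)-derivative of a leafwise
   holomorphic section, modulo the leaf) and its (1,0)-counterpart [A]. *)
Section TwistCurvature.
Variables (R : realType) (l p : nat).
Local Notation C := (Cx R).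
Local Notation V := 'rV[C]_l.
Variables (O : set V) (v : V) (H N A : V -> 'M[C]_p).
Hypotheses (Oo : open O) (p0 : (0 < p)%N).
Hypotheses (mH : msm O H) (mN : msm O N) (mA : msm O A).
Local Notation D := (mW (- iC) v).
Local Notation Db := (mW iC v).
Hypothesis posH : forall z, O z -> posdef (H z).
Hypothesis NH_sym : forall z, O z -> (N z *m H z)^T = N z *m H z.
Hypothesis DH : forall z, O z -> D H z = - (A z *m H z).
Hypothesis DbN : forall z, O z -> Db N z = - (cmx (A z) *m N z).
Hypothesis DbA : forall z, O z -> Db A z = - (cmx (N z) *m N z).

Let cjN_iC : cj (- iC) = iC :> C. Proof. by rewrite cjN cj_iC opprK. Qed.

(** The covariant derivative of the twist. [P *m H] is the derivative of the symmetric matrix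
    [N *m H], so [P] has the symmetry under which the trace inequalities hold. *)
Definition twistP z := D N z - N z *m A z.
Let P := twistP.
Definition twist_trace z : C := \tr (cmx (N z) *m N z).

Lemma msm_twistP : msm O twistP.
Proof. by apply: (msm_ext Oo _ (msmD Oo (msmW Oo (- iC) v mN) (msmN Oo (msmM Oo mN mA)))) => y _. Qed.
Let mP : msm O P := msm_twistP.
Let mcN : msm O (fun y => cmx (N y)) := msm_cmx Oo mN.
Let mcA : msm O (fun y => cmx (A y)) := msm_cmx Oo mA.

Lemma twistP_sym z : O z -> (P z *m H z)^T = P z *m H z.
Proof.
move=> Oz.
have e : P z *m H z = D (fun y => N y *m H y) z.
  rewrite (mW_mul Oo Oz (- iC) v mN mH) DH // /P /twistP mulmxBl mulmxN.
  by rewrite mulmxA.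
rewrite e -(mW_tr z (- iC) v); apply: (mW_near Oo Oz _ _ (msmM Oo mN mH)).
by move=> y Oy; rewrite NH_sym.
Qed.

(** The derivative of [cmx N] contributes a term in [A] which, by cyclicity of the trace, cancels
    the difference between [D N] and [P]. *)
Lemma D_twist_trace z : O z -> W (- iC) v twist_trace z = \tr (cmx (N z) *m P z).
Proof.
move=> Oz; rewrite (W_trace Oo Oz (- iC) v (msmM Oo mcN mN)).
rewrite (mW_mul Oo Oz (- iC) v mcN mN) (mW_cmx Oz (- iC) v mN) cjN_iC DbN //.
rewrite cmxN cmxM cmxK mulNmx -(subrK (N z *m A z) (D N z)) -/(twistP z) -/P.
rewrite mulmxDr !mxtraceD raddfN /= -mulmxA mxtrace_mulC -mulmxA.
by rewrite addrC addrK.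
Qed.

(** Each term of [twistP] yields one copy of [N conj(N) N]: the first after exchanging derivatives,
    through [D (cmx A)], the second through [Db A]. *)
Lemma Db_twistP z : O z ->
  Db P z = (N z *m (cmx (N z) *m N z)) *+ 2 - cmx (A z) *m P z.
Proof.
move=> Oz; have DbA' : D (fun y => cmx (A y)) z = - (N z *m cmx (N z)).
  by rewrite (mW_cmx Oz (- iC) v mA) cjN_iC DbA // cmxN cmxM cmxK.
have e1 : Db (D N) z = N z *m cmx (N z) *m N z - cmx (A z) *m D N z.
  rewrite (mWC Oo Oz iC (- iC) v v mN).
  transitivity (D (fun y => - (cmx (A y) *m N y)) z).
    apply: (mW_near Oo Oz _ _ (msmN Oo (msmM Oo mcA mN))) => y Oy.
    by rewrite DbN.
  rewrite (mW_opp Oz _ _ (msmM Oo mcA mN)) (mW_mul Oo Oz _ _ mcA mN) DbA'.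
  by rewrite mulNmx opprD opprK.
have e2 : Db (fun y => N y *m A y) z = - (cmx (A z) *m N z *m A z) - N z *m (cmx (N z) *m N z).
  rewrite (mW_mul Oo Oz iC v mN mA).
  rewrite (DbN Oz) (DbA Oz).
  by rewrite (mulNmx (cmx (A z) *m N z)) mulmxN.
transitivity (Db (D N) z - Db (fun y => N y *m A y) z).
  have mD := msmW Oo (- iC) v mN; have mNA := msmM Oo mN mA.
  by rewrite -(mW_opp Oz _ _ mNA) -(mW_add Oz _ _ mD (msmN Oo mNA)).
rewrite e1 e2 /P /twistP mulmxBr !mulmxA mulr2n.
move: (N z *m cmx (N z) *m N z) (cmx (A z) *m D N z) (cmx (A z) *m N z *m A z) => a b c.
by rewrite !opprD !opprK (addrC c) addrACA.
Qed.

Lemma trace_expand (Q B cQ cB cA : 'M[C]_p) :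
  \tr ((cQ + cB *m cA) *m Q + cB *m ((B *m (cB *m B)) *+ 2 - cA *m Q)) =
  \tr (cB *m B *m (cB *m B)) *+ 2 + \tr (cQ *m Q).
Proof.
rewrite mulmxDl mulmxBr mulr2n mulmxDr !mulmxA !mxtraceD raddfN /= ?mulr2n.
by move: (\tr (cQ *m Q)) (\tr (cB *m cA *m Q)) (\tr (_ *m B)) => a b c; ring.
Qed.

(** The first trace is the source of negative curvature; the second one dominates the gradient by
    Cauchy-Schwarz. *)
Lemma DbD_twist_trace z : O z -> W iC v (W (- iC) v twist_trace) z =
  \tr (cmx (N z) *m N z *m (cmx (N z) *m N z)) *+ 2 + \tr (cmx (P z) *m P z).
Proof.
move=> Oz; transitivity (W iC v (fun y => \tr (cmx (N y) *m P y)) z).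
  apply: (near_W _ _ (csm_trace Oo (msmM Oo mcN mP)) Oz).
  have : nbhs z O by exact: open_nbhs_nbhs.
  by apply: filterS => y Oy; rewrite D_twist_trace.
rewrite (W_trace Oo Oz _ _ (msmM Oo mcN mP)) (mW_mul Oo Oz _ _ mcN mP).
rewrite (mW_cmx Oz _ _ mN) cj_iC Db_twistP //.
have -> : cmx (D N z) = cmx (P z) + cmx (N z) *m cmx (A z).
  by rewrite -cmxM -cmxD /P /twistP subrK.
exact: trace_expand.
Qed.

Definition twist z : R := re (twist_trace z).

(** In [8 / q], the 8 is the 4 relating the Laplacian to Wirtinger derivatives times the coefficient
    2 of [nu], and [q] comes from [t ^+ 2 <= q * nu]. *)
Lemma curvature_real (a b c d e m' nu t q : R) : 0 < q -> 0 <= t -> t ^+ 2 <= q * nu ->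
  a ^+ 2 + b ^+ 2 <= 4 * (t * m') -> c + d = 4 * (nu *+ 2 + m') ->
  a ^+ 2 + b ^+ 2 + 8 / q * t ^+ 3 <= t * (c + d).
Proof.
move=> q0 t0 h1 h2 ->.
have h3 : 8 / q * t ^+ 3 <= 8 * (t * nu).
  have -> : 8 * (t * nu) = 8 / q * (t * (q * nu)) by field; exact: lt0r_neq0.
  apply: ler_wpM2l; first by rewrite divr_ge0 // ltW.
  by rewrite exprS ler_wpM2l.
have -> : t * (4 * (nu *+ 2 + m')) = 4 * (t * m') + 8 * (t * nu) by rewrite mulr2n; ring.
exact: lerD.
Qed.

Lemma half_norm (a b : R) :
  nr (2^-1 * (ofR a + - iC * ofR b) : C) ^+ 2 = 4^-1 * (a ^+ 2 + b ^+ 2).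
Proof.
have -> : 2^-1 = ofR 2^-1 :> C by rewrite fmorphV rmorph_nat.
by rewrite nr_sqr !reimE; field.
Qed.

Lemma twist_curvature z : O z ->
  [/\ 0 <= twist z, twist z = 0 -> N z = 0 &
  rderiv v twist z ^+ 2 + rderiv (iC *: v) twist z ^+ 2 + 8 / p%:R * twist z ^+ 3 <=
  twist z * (rderiv v (rderiv v twist) z + rderiv (iC *: v) (rderiv (iC *: v) twist) z)].
Proof.
move=> Oz; have mT : csm O twist_trace by apply: csm_trace => //; exact: msmM.
have sT : smooth_on O twist by case: mT.
have real y : O y -> ofR (twist y) = twist_trace y.
  move=> Oy; have [t [m' [nu [e _ _ _]]]] := twist_inequalities (posH Oy) (NH_sym Oy) (NH_sym Oy).
  by rewrite /twist /twist_trace e re_ofR.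
have [t [m' [nu [e1 e2 e3 [t0 _ h1 h2 h3]]]]] := twist_inequalities (posH Oz) (NH_sym Oz) (twistP_sym Oz).
have et : twist z = t by rewrite /twist /twist_trace e1 re_ofR.
rewrite et; split => //.
have nO : nbhs z O by exact: open_nbhs_nbhs.
have E1 : W (- iC) v (cfun twist) z = \tr (cmx (N z) *m P z).
  rewrite -(D_twist_trace Oz); apply: (near_W _ _ mT Oz).
  by apply: filterS nO => y Oy; rewrite /cfun real.
have E2 : W (- iC) v (W iC v (cfun twist)) z = ofR (nu *+ 2 + m').
  rewrite (WC _ _ v v Oo (csm_ofR sT) Oz) rmorphD rmorphMn /= -e3 -e2 -(DbD_twist_trace Oz).
  apply: (near_W _ _ (csmW (- iC) v Oo mT) Oz).
  apply: filterS nO => y Oy; symmetry; apply: (near_W _ _ mT Oy).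
  have : nbhs y O by exact: open_nbhs_nbhs.
  by apply: filterS => w Ow; rewrite /cfun real.
rewrite (laplacian_W v Oo sT Oz) in E2; have {}E2 := congr1 (@re R) E2; rewrite !re_ofR in E2.
apply: (@curvature_real _ _ _ _ 0 m' nu) => //; first by rewrite ltr0n.
- rewrite -E1 /cfun W_ofR half_norm in h1.
  by rewrite -ler_pdivrMl.
- by rewrite -E2 mulrA mulfV ?mul1r // pnatr_eq0.
Qed.
End TwistCurvature.

(** * Structure equations of the tangent distribution *)

Section LocalFrame.
Variables (R : realType) (n k p : nat).
Local Notation C := (Cx R).
Local Notation V := 'rV[C]_n.
Variables (B : 'M[C]_(k, n)) (E : 'M[C]_(p, n)).
Variables (s : V -> 'M[C]_(k, p)).

Definition frame z : 'M[C]_(k, n) := B + s z *m E.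
(* [tw iC c] and [tw (- iC) c] are the derivatives of types (0,1) and (1,0) of
   the leafwise section [c *m frame], in the directions of the rows of [E] and
   modulo the leaf direction. *)
Definition tw (t : C) (c : 'rV[C]_k) z : 'M[C]_p := \matrix_(b < p) (c *m mW t (row b E) s z).

Lemma adj_row_entry q (A : 'M[C]_(q, n)) i b : (A *m adj E) i b = (A *m adj (row b E)) i 0.
Proof. by rewrite !mxE; apply: eq_bigr => j _; rewrite !mxE. Qed.

Lemma row_frame (d : 'rV[C]_k) z : d *m frame z = d *m B + \sum_g (d *m s z) 0 g *: row g E.
Proof. by rewrite mulmxDr mulmxA -mulmx_sum_row. Qed.

Section OnO.
Variables (O : set V) (u : V -> R).
Hypotheses (Oo : open O) (Hu : smooth_on O u) (ms : msm O s).
Hypothesis FU : forall z, O z -> frame z *m hess u z = 0.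
Hypothesis posH : forall z, O z -> posdef (E *m hess u z *m adj E).

Let mU : msm O (hess u) := msm_hess Oo Hu.

Lemma hess_swap_bar_mx q (X : 'M[C]_(q, n)) y w z : O z ->
  X *m mW iC w (hess u) z *m adj y = X *m mW iC y (hess u) z *m adj w.
Proof.
move=> Oz; apply/row_matrixP => i; rewrite !row_mul.
exact: (hess_swap_bar Oo Hu _ _ _ Oz).
Qed.

(** The kernel relation [frame *m hess u = 0], differentiated: it trades derivatives of [s] for
    third derivatives of [u]. *)
Lemma d_frame_hess t w z : O z ->
  mW t w s z *m E *m hess u z = - (frame z *m mW t w (hess u) z).
Proof.
move=> Oz.
have mF : msm O frame.
  apply: (msm_ext Oo _ (msmD Oo (msm_cst O B) (msmM Oo ms (msm_cst O E)))) => y _.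
  by [].
have e : mW t w (fun y => frame y *m hess u y) z = 0.
  rewrite -(mW_cst z t w (0 : 'M[C]_(k, n))); apply: (mW_near Oo Oz _ _ (msm_cst O 0)) => y Oy.
  by rewrite FU.
move: e; rewrite (mW_mul Oo Oz t w mF mU).
have -> : mW t w frame z = mW t w s z *m E.
  rewrite (mW_add Oz t w (msm_cst O B) (msmM Oo ms (msm_cst O E))) mW_cst add0r.
  by rewrite (mW_mul Oo Oz t w ms (msm_cst O E)) mW_cst mulmx0 addr0.
by move/eqP; rewrite addr_eq0 => /eqP.
Qed.

Lemma hess_tangent (c : 'rV[C]_k) z : O z -> hess u z *m adj (c *m frame z) = 0.
Proof.
by move=> Oz; rewrite -{1}(adj_hess Oo Hu Oz) -adjM -mulmxA (FU Oz) mulmx0 adj0.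
Qed.

Lemma posdef_unit (H : 'M[C]_p) : posdef H -> H \in unitmx.
Proof. by move=> /cholesky[G uG ->]; rewrite unitmx_mul uG /adj unitmx_tr map_unitmx. Qed.

(** Third derivatives allow the tangent direction [x] to be exchanged with the test vector [y];
    after the exchange [hess u] is applied to [adj x], which is zero. Invertibility of the
    transverse form then removes [E *m hess u]. *)
Lemma leafwise_holomorphic (c : 'rV[C]_k) z : O z -> mW iC (c *m frame z) s z = 0.
Proof.
move=> Oz; set x := c *m frame z.
have key (y : V) : mW iC x s z *m E *m hess u z *m adj y = 0.
  rewrite (d_frame_hess iC x Oz) mulNmx (hess_swap_bar_mx _ y x Oz) -mulNmx -(d_frame_hess iC y Oz).
  have e := hess_tangent c Oz; rewrite -/x in e.
  by rewrite -(mulmxA _ (hess u z)) e mulmx0.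
have e : mW iC x s z *m (E *m hess u z *m adj E) = 0.
  apply/matrixP => i b; rewrite !mulmxA adj_row_entry key.
  by rewrite !mxE.
by rewrite -(mulmxK (posdef_unit (posH Oz)) (mW iC x s z)) e mul0mx.
Qed.

Lemma tw_hess t c z b g : O z ->
  (tw t c z *m (E *m hess u z *m adj E)) b g =
  - ((c *m frame z) *m mW t (row b E) (hess u) z *m adj (row g E)) 0 0.
Proof.
move=> Oz; transitivity (row b (tw t c z *m (E *m hess u z *m adj E)) 0 g); first by rewrite [RHS]mxE.
rewrite row_mul rowK !mulmxA adj_row_entry.
have -> : c *m mW t (row b E) s z *m E *m hess u z = - (c *m frame z *m mW t (row b E) (hess u) z).
  by rewrite -!mulmxA (mulmxA _ E) (d_frame_hess t (row b E) Oz) mulmxN.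
by rewrite mulNmx [LHS]mxE.
Qed.

(** The entries are third derivatives in which the rows of [E] fill both antiholomorphic slots,
    hence the symmetry. *)
Lemma tw_hess_sym c z : O z ->
  (tw iC c z *m (E *m hess u z *m adj E))^T = tw iC c z *m (E *m hess u z *m adj E).
Proof.
move=> Oz; apply/matrixP => b g; rewrite [LHS]mxE (tw_hess iC c g b Oz) (tw_hess iC c b g Oz).
exact: (congr1 (fun A : 'M[C]_1 => - A 0 0)
  (hess_swap_bar Oo Hu (c *m frame z) (row b E) (row g E) Oz)).
Qed.

(** The symmetry in the two holomorphic slots moves the derivative from the tangent direction to the
    rows of [E]. *)
Lemma D_transverse_hess c z : O z ->
  mW (- iC) (c *m frame z) (fun y => E *m hess u y *m adj E) z =
  - (tw (- iC) c z *m (E *m hess u z *m adj E)).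
Proof.
move=> Oz; set x := c *m frame z.
have mEU : msm O (fun y => E *m hess u y) := msmM Oo (msm_cst O E) mU.
rewrite (mW_mul Oo Oz _ x mEU (msm_cst O (adj E))) mW_cst mulmx0 addr0.
rewrite (mW_mul Oo Oz _ x (msm_cst O E) mU) mW_cst mul0mx add0r.
apply/matrixP => b g; rewrite [RHS]mxE tw_hess // opprK -(hess_swap Oo Hu _ _ _ Oz).
rewrite adj_row_entry; transitivity (row b (E *m mW (- iC) x (hess u) z *m adj (row g E)) 0 0).
  by rewrite [RHS]mxE.
by rewrite !row_mul.
Qed.

Lemma Wb_comb (f : V -> C) (b0 : V) (h : 'I_p -> C) z : csm O f -> O z ->
  W iC (b0 + \sum_g h g *: row g E) f z = W iC b0 f z + \sum_g cj (h g) * W iC (row g E) f z.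
Proof.
move=> Hf Oz; rewrite (WD_dir iC _ _ Oo Hf Oz); congr (_ + _).
have D0 : W iC 0 f z = 0 by rewrite -[X in W _ X](scale0r (0 : V)) (Wb_Z _ _ Oo Hf Oz) rmorph0 mul0r.
rewrite (big_morph (fun x => W iC x f z) (fun x y => WD_dir iC x y Oo Hf Oz) D0).
by apply: eq_bigr => g _; rewrite (Wb_Z _ _ Oo Hf Oz).
Qed.

(** Leafwise holomorphy is an identity along a tangent direction that moves with the point.
    Differentiating it leaves, besides the wanted term, the derivatives of the conjugated
    coefficients of that direction, and conjugation exchanges the type [t] with [cj t]. *)
Lemma d_leafwise (d : 'rV[C]_k) (t : C) w z i a : O z ->
  W iC (d *m frame z) (W t w (fun y => s y i a)) z =
  - \sum_g cj ((d *m mW (cj t) w s z) 0 g) * W iC (row g E) (fun y => s y i a) z.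
Proof.
move=> Oz; set f := fun y => s y i a; have Hf : csm O f by exact: ms.
have hs g : csm O (fun y => (d *m s y) 0 g) := msmM Oo (msm_cst O d) ms 0 g.
have Hg g : csm O (fun y => cj ((d *m s y) 0 g) * W iC (row g E) f y).
  exact: (csmM Oo (csm_cj Oo (hs g)) (csmW iC (row g E) Oo Hf)).
have HB := csmW iC (d *m B) Oo Hf.
have Hsum := csm_sum (index_enum 'I_p) Oo Hg.
have e0 : W t w (fun y => W iC (d *m B) f y + \sum_g cj ((d *m s y) 0 g) * W iC (row g E) f y) z = 0.
  transitivity (W t w (fun=> 0) z); last exact: W_cst.
  apply: (near_W t w (csm_cst O 0) Oz).
  have : nbhs z O by exact: open_nbhs_nbhs.
  apply: filterS => y Oy; have := Wb_comb (d *m B) (fun g => (d *m s y) 0 g) Hf Oy.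
  rewrite -row_frame => <-.
  by have := congr1 (fun A : 'M[C]_(k, p) => A i a) (leafwise_holomorphic d Oy); rewrite !mxE.
rewrite (W_add t w HB Hsum Oz) (W_sum (index_enum 'I_p) t w Oo Hg Oz) in e0.
rewrite row_frame (Wb_comb (d *m B) _ (csmW t w Oo Hf) Oz).
apply/eqP; rewrite -addr_eq0; apply/eqP; rewrite -[RHS]e0 -addrA -big_split /=.
rewrite (WC t iC w (d *m B) Oo Hf Oz); congr (_ + _); apply: eq_bigr => g _.
rewrite (W_mul t w (csm_cj Oo (hs g)) (csmW iC (row g E) Oo Hf) Oz).
rewrite (W_cj t w (hs g) Oz) (WC t iC w (row g E) Oo Hf Oz) addrC; congr (cj _ * _ + _).
have := mW_mul Oo Oz (cj t) w (msm_cst O d) ms; rewrite mW_cst mul0mx add0r => <-.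
exact: mWE.
Qed.

(** Both structure equations at once: [t = iC] is the equation for the twist and [t = - iC] the one
    for its (1,0)-counterpart. *)
Lemma d_tw (d : 'rV[C]_k) t z : O z ->
  \matrix_(b < p) (d *m mW iC (d *m frame z) (mW t (row b E) s) z) =
  - (cmx (tw (cj t) d z) *m tw iC d z).
Proof.
move=> Oz; apply/matrixP => b a; rewrite [LHS]mxE [LHS]mxE [RHS]mxE [X in _ = - X]mxE.
transitivity (\sum_i d 0 i * - \sum_g cj ((d *m mW (cj t) (row b E) s z) 0 g) * W iC (row g E) (fun y => s y i a) z).
  apply: eq_bigr => i _; congr (_ * _); rewrite mWE -(d_leafwise d t (row b E) i a Oz).
  by congr (W _ _ _ z); apply/funext => y; rewrite mWE.
under eq_bigr do rewrite mulrN mulr_sumr.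
rewrite sumrN exchange_big /=; congr (- _); apply: eq_bigr => g _.
rewrite [cmx _ _ _]mxE [tw (cj t) d z _ _]mxE [tw iC d z _ _]mxE [X in _ = _ * X]mxE mulr_sumr.
by apply: eq_bigr => i _; rewrite mWE mulrCA.
Qed.

Section AlongCurve.
Variables (l : nat) (O' : set 'rV[C]_l) (phi : 'rV[C]_l -> V) (v : 'rV[C]_l).
Hypotheses (O'o : open O') (phiO : forall z, O' z -> O (phi z)).
Hypothesis phi_smooth : forall j, csm O' (fun z => phi z 0 j).
Hypothesis phi_hol : forall j v z, O' z -> W iC v (fun z => phi z 0 j) z = 0.
Variable K : 'M[C]_(n, k).
Local Notation x := (dmap phi v).
Hypothesis tang : forall z, O' z -> x z = x z *m K *m frame (phi z).

Lemma csm_dmap j : csm O' (fun z => x z 0 j).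
Proof.
by apply: csm_eq (csm_cderiv v (phi_smooth j)) => y; rewrite mxE.
Qed.
Lemma hol_dmap j z : O' z -> W iC v (fun z => x z 0 j) z = 0.
Proof.
move=> Oz; transitivity (W iC v (W (- iC) v (fun y => phi y 0 j)) z).
  apply: (near_W _ _ (csmW (- iC) v O'o (phi_smooth j)) Oz).
  have : nbhs z O' by exact: open_nbhs_nbhs.
  by apply: filterS => y Oy; rewrite (dmapE phi_hol v Oy) mxE.
rewrite (WC iC (- iC) v v O'o (phi_smooth j) Oz).
transitivity (W (- iC) v (fun=> 0) z); last exact: W_cst.
apply: (near_W _ _ (csm_cst O' 0) Oz).
have : nbhs z O' by exact: open_nbhs_nbhs.
by apply: filterS => y Oy; rewrite phi_hol.
Qed.

Let mx : msm O' x. Proof. by move=> i j; rewrite ord1; exact: csm_dmap. Qed.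
(** By [tang], the coordinates of the velocity of [phi] in the moving frame. *)
Definition lcoef z := x z *m K.
Let mc : msm O' lcoef := msmM O'o mx (msm_cst O' K).

Lemma hol_lcoef z : O' z -> mW iC v lcoef z = 0.
Proof.
move=> Oz; rewrite (mW_mul O'o Oz _ _ mx (msm_cst O' K)) mW_cst mulmx0 addr0.
suff -> : mW iC v x z = 0 by rewrite mul0mx.
by apply/matrixP => i j; rewrite ord1 !mxE hol_dmap.
Qed.

Definition tw_along t z := tw t (lcoef z) (phi z).

Let tw_term t b a i : csm O' ((fun y => W t (row b E) (fun y => s y i a) y) \o phi).
Proof. exact: (csm_comp O'o Oo phiO phi_smooth (csmW t (row b E) Oo (ms i a))). Qed.

Lemma tw_alongE t z b a :
  tw_along t z b a = \sum_i lcoef z 0 i * W t (row b E) (fun y => s y i a) (phi z).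
Proof. by rewrite [LHS]mxE [LHS]mxE; apply: eq_bigr => i _; rewrite mWE. Qed.

Let tw_prod t b a i : csm O' (fun z => lcoef z 0 i * ((W t (row b E) (fun y => s y i a)) \o phi) z).
Proof. exact: (csmM O'o (mc 0 i) (tw_term t b a i)). Qed.

Lemma msm_tw_along t : msm O' (tw_along t).
Proof.
move=> b a; apply: csm_eq (csm_sum (index_enum 'I_k) O'o (tw_prod t b a)) => z.
by rewrite tw_alongE.
Qed.

(** The coordinates [lcoef] are holomorphic, so only the derivative of [s] in the leaf direction
    survives, and [d_tw] computes it. *)
Lemma Db_tw_along t z : O' z ->
  mW iC v (tw_along t) z = - (cmx (tw_along (cj t) z) *m tw_along iC z).
Proof.
move=> Oz; rewrite -(d_tw (lcoef z) t (phiO Oz)) -(tang Oz).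
apply/matrixP => b a; rewrite mWE [RHS]mxE [RHS]mxE.
transitivity (W iC v (fun z => \sum_i lcoef z 0 i * ((W t (row b E) (fun y => s y i a)) \o phi) z) z).
  by congr (W _ _ _ z); apply/funext => y; rewrite tw_alongE.
rewrite (W_sum (index_enum 'I_k) iC v O'o (tw_prod t b a) Oz); apply: eq_bigr => i _.
rewrite (W_mul iC v (mc 0 i) (tw_term t b a i) Oz).
have -> : W iC v (fun y => lcoef y 0 i) z = 0.
  by have := congr1 (fun A : 'rV[C]_k => A 0 i) (hol_lcoef Oz); rewrite mWE mxE.
rewrite mul0r add0r (W_comp Oo phiO phi_smooth phi_hol iC v (csmW t (row b E) Oo (ms i a)) Oz).
have e : (fun y => mW t (row b E) s y i a) = W t (row b E) (fun y => s y i a).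
  by apply/funext => y; rewrite mWE.
rewrite mWE; apply: (congr1 (fun q => lcoef z 0 i * q)).
exact: (congr1 (fun h => W iC (x z) h (phi z)) (esym e)).
Qed.

Definition hess_along z := E *m hess u (phi z) *m adj E.

Lemma D_hess_along z : O' z ->
  mW (- iC) v hess_along z = - (tw_along (- iC) z *m hess_along z).
Proof.
move=> Oz; rewrite /tw_along /hess_along -(D_transverse_hess (lcoef z) (phiO Oz)) -(tang Oz).
have mH := msmM Oo (msmM Oo (msm_cst O E) mU) (msm_cst O (adj E)).
apply/matrixP => b g; rewrite [LHS]mWE [RHS]mWE.
exact: (W_comp Oo phiO phi_smooth phi_hol (- iC) v (mH b g) Oz).
Qed.

Lemma msm_hess_along : msm O' hess_along.
Proof.
have mH := msmM Oo (msmM Oo (msm_cst O E) mU) (msm_cst O (adj E)).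
by move=> b g; exact: (csm_comp O'o Oo phiO phi_smooth (mH b g)).
Qed.

Lemma csm_twist_along : csm O' (twist_trace (tw_along iC)).
Proof.
exact: (csm_trace O'o (msmM O'o (msm_cmx O'o (msm_tw_along iC)) (msm_tw_along iC))).
Qed.

Lemma twist_along_curvature z : (0 < p)%N -> O' z ->
  let h := twist (tw_along iC) in
  [/\ 0 <= h z, h z = 0 -> tw_along iC z = 0 &
  rderiv v h z ^+ 2 + rderiv (iC *: v) h z ^+ 2 + 8 / p%:R * h z ^+ 3 <=
  h z * (rderiv v (rderiv v h) z + rderiv (iC *: v) (rderiv (iC *: v) h) z)].
Proof.
move=> p0 Oz.
apply: (@twist_curvature R l p O' v hess_along (tw_along iC) (tw_along (- iC)) O'o p0
  msm_hess_along (msm_tw_along iC) (msm_tw_along (- iC))) => // y Oy.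
- exact: posH (phiO Oy).
- exact: tw_hess_sym (phiO Oy).
- exact: D_hess_along.
- by rewrite (Db_tw_along iC Oy) cj_iC.
- by rewrite (Db_tw_along (- iC) Oy) cjN cj_iC opprK.
Qed.
End AlongCurve.
End OnO.
End LocalFrame.

(** * Injective holomorphic maps are immersive somewhere *)

Section StrictDifferential.
Variables (R : realType) (n : nat).
Local Notation C := (Cx R).
Local Notation V := 'rV[C]_n.

Variables (N : nat) (O : set V) (g : V -> 'rV[C]_N).
Hypotheses (Oo : open O) (gs : forall j, csm O (fun z => g z 0 j)).
Hypothesis gh : forall j v z, O z -> W iC v (fun z => g z 0 j) z = 0.

Definition jac z : 'M[C]_(n, N) := \matrix_(i, j) W (- iC) (delta_mx 0 i) (fun y => g y 0 j) z.

Lemma jac_cderiv w z j : O z -> cderiv w (fun y => g y 0 j) z = (w *m jac z) 0 j.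
Proof.
move=> Oz; rewrite cderivE (gh j w Oz) addr0 (Wd_coord w Oo (gs j) Oz) mxE.
by apply: eq_bigr => i _; rewrite mxE.
Qed.
Lemma dmap_jac w z : O z -> dmap g w z = w *m jac z.
Proof. by move=> Oz; apply/rowP => j; rewrite mxE (jac_cderiv w j Oz). Qed.

Lemma msm_jac : msm O jac.
Proof. by move=> i j; apply: csm_eq (csmW (- iC) (delta_mx 0 i) Oo (gs j)) => y; rewrite mxE. Qed.

Lemma csm_strict z j : O z -> forall e : R, 0 < e -> exists2 d : R, 0 < d &
  forall x y, nr (x - z) < d -> nr (y - z) < d ->
  nr (g x 0 j - g y 0 j - ((x - y) *m jac z) 0 j) <= e * nr (x - y).
Proof.
move=> Oz e e0; have [h1 h2] := gs j.
have e2 : 0 < e / 2 by rewrite divr_gt0.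
have [d1 d10 H1] := C1_strict_at Oo (smooth_C1 h1) Oz e2.
have [d2 d20 H2] := C1_strict_at Oo (smooth_C1 h2) Oz e2.
exists (Num.min d1 d2); first by rewrite lt_min d10.
move=> x y; rewrite !lt_min => /andP[x1 x2] /andP[y1 y2].
rewrite -(jac_cderiv (x - y) j Oz).
have := cderiv_remainder (g := fun z => g z 0 j) (z := y) (h := x - y) (e := e) (x := nr (x - y)).
move: (H1 x y x1 y1) (H2 x y x2 y2); rewrite -(re_cderiv (x - y) (fun y => g y 0 j)) -(im_cderiv (x - y) (fun y => g y 0 j)).
move: (cderiv _ _ z) => c k1 k2 _.
apply: le_trans (nr_le_reim _) _; rewrite [e]splitr mulrDl !reD !reN !imD !imN.
exact: lerD.
Qed.

Lemma strict_differential z : O z -> forall e : R, 0 < e -> exists2 d : R, 0 < d &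
  forall x y, nr (x - z) < d -> nr (y - z) < d ->
  nr (g x - g y - (x - y) *m jac z) <= e * nr (x - y).
Proof.
move=> Oz e e0.
have H j : \forall q \near (z, z),
    nr (g q.1 0 j - g q.2 0 j - ((q.1 - q.2) *m jac z) 0 j) <= e * nr (q.1 - q.2).
  have [d d0 Hd] := csm_strict j Oz e0.
  exists ([set x | nr (x - z) < d], [set x | nr (x - z) < d]).
    by split; exact: (near_nr z d0).
  by move=> [x y] /= [hx hy]; exact: Hd.
have /filter_forall [[A B] [/= /nbhs_nr[a a0 Ha] /nbhs_nr[b b0 Hb]] AB] := H.
exists (Num.min a b); first by rewrite lt_min a0.
move=> x y; rewrite !lt_min => /andP[xa _] /andP[_ yb].
apply: nr_mx_le; first by rewrite mulr_ge0 ?nr_ge0 // ltW.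
move=> i j; rewrite ord1 !mxE.
by have := AB (x, y) (conj (Ha _ xa) (Hb _ yb)) j; rewrite /= !mxE.
Qed.
End StrictDifferential.

(** * Zeros of small perturbations of the identity *)

Section NearIdentity.
Variables (R : realType) (r : nat).
Local Notation C := (Cx R).
Local Notation V := 'rV[C]_r.

Lemma disc_compact (D : R) : compact [set x : C | nr x <= D].
Proof.
pose f (q : R * R) : C := Complex q.1 q.2.
pose S : set (R * R) := `[- D, D]%classic `*` `[- D, D]%classic.
have cS : compact S by apply: compact_setX; exact: segment_compact.
have cf : continuous f.
  move=> [a b]; apply: (@cvg_reim _ _ (nbhs (a, b)) f (f (a, b))); first exact: cvg_fst.
  exact: cvg_snd.
have cfS : compact (f @` S) by apply: continuous_compact => //; exact: continuous_subspaceT.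
apply: subclosed_compact cfS _; last first.
  move=> x /= xD; exists (re x, im x); last by apply: CP.
  by split; rewrite /= in_itv /= -ler_norml; [apply: le_trans (re_le_nr x) _ | apply: le_trans (im_le_nr x) _].
rewrite -[X in closed X]setCK; apply: open_closedC.
rewrite openE => x /= /negP; rewrite -ltNge => xD; apply/nbhs_nr; exists (nr x - D); first by rewrite subr_gt0.
move=> y xy; apply/negP; rewrite -ltNge.
have := nrD (x - y) y; rewrite subrK nrB; lra.
Qed.

(** For the max norm a closed ball is a product of compact discs. *)
Lemma lipschitz_min (D L : R) (f : V -> R) : 0 <= D -> 0 <= L ->
  (forall x y, nr x <= D -> nr y <= D -> `|f x - f y| <= L * nr (x - y)) ->
  exists2 x, nr x <= D & forall y, nr y <= D -> f x <= f y.
Proof.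
move=> D0 L0 Hf.
have cK : compact [set v : V | forall i, [set x : C | nr x <= D] (v 0 i)].
  exact: (@rV_compact C r (fun=> [set x : C | nr x <= D]) (fun=> @disc_compact D)).
have KE : [set v : V | forall i, [set x : C | nr x <= D] (v 0 i)] = [set v : V | nr v <= D].
  apply/seteqP; split=> v /= h; first by apply: nr_mx_le => // i j; rewrite ord1; exact: h.
  by move=> i; apply: le_trans (nr_mx_entry v 0 i) h.
rewrite KE in cK.
have cf : {within [set v : V | nr v <= D], continuous f}.
  apply/subspace_continuousP => x xD; apply/cvgrPdist_lt => e e0.
  have L1 : 0 < L + 1 by lra.
  rewrite near_withinE; apply: filterS (@near_nr R _ x _ (divr_gt0 e0 L1)) => y.
  rewrite ltr_pdivlMr // => xy yD; have := Hf x y xD yD; rewrite nrB.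
  have := nr_ge0 (y - x); move: (nr (y - x)) xy => a xy a0 h.
  by apply: le_lt_trans h _; nra.
have K0 : [set v : V | nr v <= D] !=set0 by exists 0; rewrite /= nr0.
have [x xD Hx] := compact_EVT_min K0 cK cf.
rewrite inE in xD; exists x => // y yD; apply: Hx; by rewrite inE.
Qed.

(** At a minimum [x] of [nr (F x)] on the ball, the corrected point [x - F x] has a value at most
    half as large, so the minimum is zero. Since [nr x <= 4 * nr (F 0)] and [nr (F x) <= nr (F 0)],
    the corrected point stays in the ball; hence the 5. *)
Lemma near_identity_zero (D : R) (F : V -> V) : 0 <= D ->
  (forall x y, nr x <= D -> nr y <= D -> nr (F x - F y - (x - y)) <= 2^-1 * nr (x - y)) ->
  5 * nr (F 0) <= D -> exists2 x, nr x <= 4 * nr (F 0) & F x = 0.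
Proof.
move=> D0 HF F0.
have z0 : nr (0 : V) <= D by rewrite nr0.
have [x xD xmin] : exists2 x, nr x <= D & forall y, nr y <= D -> nr (F x) <= nr (F y).
  apply: (@lipschitz_min D 2) => // x y xD yD; have := HF x y xD yD.
  have h1 := nrD (F x - F y) (F y); have h2 := nrD (F y - F x) (F x).
  have h3 := nrD (F x - F y - (x - y)) (x - y).
  rewrite !subrK (nrB (F y)) in h1 h2 h3; have := nr_ge0 (x - y).
  move: (nr (x - y)) (nr (F x)) (nr (F y)) (nr (F x - F y)) (nr _) h1 h2 h3 => a b c d e h1 h2 h3 h4 h5.
  rewrite ler_norml; apply/andP; split; lra.
have xb : nr x <= 4 * nr (F 0).
  have h1 := HF x 0 xD z0; have h2 := xmin 0 z0; rewrite !subr0 in h1.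
  have h3 := nrD (x - (F x - F 0)) (F x - F 0); have h4 := nrD (F x) (- F 0).
  rewrite subrK in h3; rewrite nrN in h4; rewrite nrB in h1.
  move: (nr x) (nr (F x)) (nr (F 0)) (nr (F x - F 0)) (nr _) h1 h2 h3 h4 => a b c d e; lra.
exists x => //.
have yD : nr (x - F x) <= D.
  apply: le_trans (nrD _ _) _; rewrite nrN; have := xmin 0 z0.
  by move: (nr x) (nr (F x)) (nr (F 0)) F0 xb => a b c; lra.
have := HF (x - F x) x yD xD; have := xmin _ yD.
have -> : x - F x - x = - F x by rewrite addrAC subrr sub0r.
rewrite opprK subrK nrN => h1 h2.
apply/eqP; rewrite -nr_eq0; apply/eqP/le_anti; rewrite nr_ge0 andbT.
by move: (nr (F x)) (nr _) h1 h2 => a b; lra.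
Qed.
End NearIdentity.

(** * Rank arguments for injective holomorphic maps *)

Section InjectiveMap.
Variable R : realType.
Local Notation C := (Cx R).

Lemma nr_mulmx m n (x : 'rV[C]_m) (A : 'M[C]_(m, n)) : nr (x *m A) <= m%:R * nr A * nr x.
Proof.
apply: nr_mx_le => [|i j]; first by rewrite !mulr_ge0 ?nr_ge0.
rewrite ord1 mxE; apply: le_trans (nr_sum _ _ _) _.
have -> : m%:R * nr A * nr x = \sum_(a < m) nr x * nr A.
  by rewrite sumr_const card_ord -mulrA mulr_natl [nr A * _]mulrC.
apply: ler_sum => a _; rewrite nrM; apply: ler_pM; rewrite ?nr_ge0 //; exact: nr_mx_entry.
Qed.

Lemma nr_mulmx_bound m n (A : 'M[C]_(m, n)) :
  exists2 K : R, 0 < K & forall x : 'rV[C]_m, nr (x *m A) <= K * nr x.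
Proof.
exists (m%:R * nr A + 1); first by rewrite ltr_wpDl // mulr_ge0 ?nr_ge0.
by move=> x; apply: le_trans (nr_mulmx x A) _; rewrite ler_wpM2r ?nr_ge0 // lerDl.
Qed.

Lemma zero_derivative_const (f : R -> R) (d : R) :
  (forall t : R, `|t| < d -> forall e : R, 0 < e -> \forall s \near t, `|f s - f t| <= e * `|s - t|) ->
  forall t : R, 0 < t -> t < d -> f t = f 0.
Proof.
move=> Hf t t0 td.
have df (s : R) : `|s| < d -> is_derive s 1 f 0.
  move=> sd; apply/is_derive_eps => e e0.
  have /nbhs_ballP[q /= q0 Hq] := Hf s sd e e0.
  have := near_real (0 : R) q0; apply: filterS => h; rewrite subr0 => hq.
  have := Hq (s + h); rewrite /ball /= opprD addNKr normrN => /(_ hq).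
  by rewrite mulr0 subr0 (addrC s h) addrK.
have [s| |s] := @MVT R f (fun=> 0) 0 t t0.
- rewrite in_itv /= => /andP[s0 st]; apply: df; rewrite gtr0_norm //; exact: lt_trans st td.
- apply: continuous_in_subspaceT => s; rewrite inE /= in_itv /= => /andP[s0 st].
  have [|ds _] := df s; first by rewrite ger0_norm //; exact: le_lt_trans st td.
  by apply: differentiable_continuous; apply/derivable1_diffP.
by rewrite mul0r => _ /eqP; rewrite subr_eq0 => /eqP.
Qed.

(** The invertible compression forces [Q *m J] to have rank [r], hence to span the row space of [J],
    and then [J] is recovered from [J *m T]. Applied to differentials of maximal rank and later to
    the Levi form. *)
Lemma factor_through m n r (J : 'M[C]_(m, n)) (Q : 'M[C]_(r, m)) (T : 'M[C]_(n, r)) :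
  Q *m J *m T \in unitmx -> (\rank J <= r)%N -> exists S, J = J *m T *m S.
Proof.
move=> u rJ; set U := invmx (Q *m J *m T).
have rQJ : \rank (Q *m J) = r.
  apply/eqP; rewrite eqn_leq rank_leq_row /= -{1}(mxrank_unit u); exact: mxrankM_maxl.
have /submxP[Y EY] : (J <= Q *m J)%MS.
  by rewrite -(mxrank_leqif_sup (submxMl Q J)) rQJ eqn_leq -{1}rQJ mxrankM_maxr.
exists (U *m (Q *m J)).
rewrite {2}EY -!(mulmxA Y) -(mulmxA (Q *m J)) (mulmxA T) (mulmxA (Q *m J)).
by rewrite (mulmxA (Q *m J) T) mulmxV // mul1mx.
Qed.

Lemma unit_near n m (O : set 'rV[C]_n) (G : 'rV[C]_n -> 'M[C]_m) z : open O -> msm O G -> O z ->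
  G z \in unitmx -> exists2 d : R, 0 < d & forall y, nr (y - z) < d -> O y /\ G y \in unitmx.
Proof.
move=> Oo mG Oz; rewrite unitmxE unitfE -nr_gt0 => u.
have : \det (G y) @[y --> z] --> \det (G z) := csm_continuous (csm_det Oo mG) Oz.
move=> /(@cvg_nr _ _ _ (nbhs z)) /(_ _ u) n1.
have nO : nbhs z O by exact: open_nbhs_nbhs.
have nn := @filterI _ _ (nbhs_filter z) _ _ nO n1; have [d d0 H] := (nbhs_nr _ _).1 nn.
exists d => // y /H[Oy]; rewrite unitmxE unitfE; split=> //.
by apply: contraTneq b => ->; rewrite sub0r nrN ltxx.
Qed.

Lemma lipschitz_algebra (q a b : R) : 0 < q -> 0 <= a -> 0 <= b ->
  a <= (8 * q)^-1 * (b + q * a) -> b + q * a <= 2 * b.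
Proof.
move=> q0 a0 b0; rewrite mulrC ler_pdivlMr ?mulr_gt0 //.
have -> : a * (8 * q) = 8 * (q * a) by ring.
by move: (q * a) (mulr_ge0 (ltW q0) a0) => c c0; lra.
Qed.

Section Collapse.
Variables (n N r : nat) (O : set 'rV[C]_n) (g : 'rV[C]_n -> 'rV[C]_N).
Hypotheses (Oo : open O) (gs : forall j, csm O (fun z => g z 0 j)).
Hypothesis gh : forall j v z, O z -> W iC v (fun z => g z 0 j) z = 0.
Variables (z0 w : 'rV[C]_n) (Q : 'M[C]_(r, n)) (T : 'M[C]_(N, r)).
Hypotheses (Oz0 : O z0) (rk : forall z, O z -> (\rank (jac g z) <= r)%N).
Hypotheses (QJT : Q *m jac g z0 *m T = 1%:M) (w0 : w != 0) (wJ : w *m jac g z0 = 0).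

(** A displacement [t] in the kernel direction [w], corrected along the rows of [Q], on which the
    differential followed by [T] is the identity. *)
Definition slice (t : R) (y : 'rV[C]_r) : 'rV[C]_n := z0 + ofR t *: w + y *m Q.

Lemma slice_sub t t' y y' : slice t y - slice t' y' = ofR (t - t') *: w + (y - y') *m Q.
Proof.
rewrite /slice !opprD !addrA rmorphB /= scalerBl mulmxBl.
rewrite (addrAC _ _ (- z0)) (addrAC z0) subrr add0r -!addrA; congr (_ + _).
by rewrite addrCA.
Qed.

Lemma slice_norm t t' y y' (q : R) : (forall x : 'rV[C]_r, nr (x *m Q) <= q * nr x) ->
  nr (slice t y - slice t' y') <= `|t - t'| * nr w + q * nr (y - y').
Proof.
move=> Hq; rewrite slice_sub; apply: le_trans (nrD _ _) _; apply: lerD => //.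
by rewrite nrZ nr_ofR.
Qed.

Lemma slice_jac t t' y y' : (slice t y - slice t' y') *m jac g z0 *m T = y - y'.
Proof.
rewrite slice_sub mulmxDl -scalemxAl wJ scaler0 add0r -!mulmxA.
by rewrite (mulmxA Q) QJT mulmx1.
Qed.

(* For each small t the implicit equation in y is a perturbation of the identity. *)
Lemma implicit_slice : exists (d q : R) (y : R -> 'rV[C]_r),
  [/\ 0 < d, forall t, `|t| < d -> O (slice t (y t)) /\ Q *m jac g (slice t (y t)) *m T \in unitmx,
      forall t, `|t| < d -> g (slice t (y t)) *m T = g z0 *m T &
      [/\ 0 < q, forall x : 'rV[C]_r, nr (x *m Q) <= q * nr x,
      forall t, `|t| < d -> q * nr (y t) <= 2^-1 * (`|t| * nr w) &
      forall t t', `|t| < d -> `|t'| < d -> nr (slice t (y t) - slice t' (y t')) <= 2 * (`|t - t'| * nr w)]].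
Proof.
have [q q0 Hq] := nr_mulmx_bound Q; have [rho rho0 Hrho] := nr_mulmx_bound T.
(* After multiplication by [T], bounded by [rho], and by [Q], bounded by [q], the equation in [y]
   differs from the identity by a map of Lipschitz constant 1/8, within the 1/2 of
   [near_identity_zero]. *)
have e0 : 0 < (8 * rho * q)^-1 by rewrite invr_gt0 !mulr_gt0.
have [d1 d10 H1] := strict_differential Oo gs gh Oz0 e0.
have mQ : msm O (fun z => Q *m jac g z *m T).
  exact: (msmM Oo (msmM Oo (msm_cst O Q) (msm_jac Oo gs)) (msm_cst O T)).
have [d2 d20 H2] : exists2 d2 : R, 0 < d2 & forall z, nr (z - z0) < d2 ->
    O z /\ Q *m jac g z *m T \in unitmx.
  by apply: (unit_near Oo mQ Oz0); rewrite QJT unitmx1.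
pose d := Num.min d1 d2; have d0 : 0 < d by rewrite lt_min d10.
have w1 : 0 < nr w by rewrite nr_gt0.
pose D := d / (2 * q); have D0 : 0 < D by rewrite divr_gt0 // mulr_gt0.
have qD : q * D = d / 2 by rewrite /D; field; exact: lt0r_neq0.
pose s := d / (2 * nr w); have s0 : 0 < s by rewrite divr_gt0 // mulr_gt0.
have ts (t : R) : `|t| < s -> `|t| * nr w < d / 2.
  rewrite /s -ltr_pdivlMr // invfM mulrA mulrAC; by [].
have inD t y : `|t| < s -> nr y <= D -> nr (slice t y - z0) < d.
  move=> /ts h yD; have := slice_norm t 0 y 0 Hq.
  have -> : slice 0 0 = z0 by rewrite /slice rmorph0 scale0r mul0mx !addr0.
  rewrite !subr0 => k; apply: le_lt_trans k _.
  have := ler_wpM2l (ltW q0) yD; rewrite qD; move: (q * nr y) h => a h h2.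
  rewrite [d]splitr; exact: ltr_leD.
have key t t' y y' : `|t| < s -> `|t'| < s -> nr y <= D -> nr y' <= D ->
    nr (g (slice t y) *m T - g (slice t' y') *m T - (y - y')) <= 
    (8 * q)^-1 * (`|t - t'| * nr w + q * nr (y - y')).
  move=> ht ht' hy hy'.
  rewrite -{1}(slice_jac t t' y y') -mulmxBl -mulmxBl.
  apply: le_trans (Hrho _) _.
  have a1 : nr (slice t y - z0) < d1 by apply: lt_le_trans (inD t y ht hy) _; rewrite ge_min lexx.
  have a2 : nr (slice t' y' - z0) < d1 by apply: lt_le_trans (inD t' y' ht' hy') _; rewrite ge_min lexx.
  apply: le_trans (ler_wpM2l (ltW rho0) (H1 _ _ a1 a2)) _.
  have -> : rho * ((8 * rho * q)^-1 * nr (slice t y - slice t' y')) = (8 * q)^-1 * nr (slice t y - slice t' y').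
    by field; rewrite !lt0r_neq0.
  rewrite ler_wpM2l ?invr_ge0 ?mulr_ge0 ?(ltW q0) //; exact: slice_norm.
have D1 : nr (0 : 'rV[C]_r) <= D by rewrite nr0 ltW.
have zero : slice 0 0 = z0 by rewrite /slice rmorph0 scale0r mul0mx !addr0.
have sol t : {y : 'rV[C]_r | `|t| < s ->
    [/\ nr y <= D, q * nr y <= 2^-1 * (`|t| * nr w) & g (slice t y) *m T = g z0 *m T]}.
  apply: cid; have [ht|] := pselect (`|t| < s); last by move=> h; exists 0.
  pose F y := g (slice t y) *m T - g z0 *m T.
  have n0 : `|0 : R| < s by rewrite normr0.
  have F0 : nr (F 0) <= (8 * q)^-1 * (`|t| * nr w).
    by have := key t 0 0 0 ht n0 D1 D1; rewrite zero !subr0 nr0 mulr0 addr0.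
  have FD : 5 * nr (F 0) <= D.
    have := ler_wpM2l (ltW (mulr_gt0 (ltr0Sn _ 7) q0)) F0.
    rewrite mulrA mulfV ?mul1r; last by rewrite lt0r_neq0 ?mulr_gt0.
    have := ts t ht; move: (`|t| * nr w) (nr (F 0)) => a b h1 h2.
    rewrite /D ler_pdivlMr ?mulr_gt0 //; have := nr_ge0 (F 0); nra.
  have [|y yF Fy] := @near_identity_zero R r D F (ltW D0) _ FD.
    move=> y y' yD yD'; have := key t t y y' ht ht yD yD'.
    rewrite (subrr t) normr0 mul0r add0r /F => k.
    have -> : forall a b c : 'rV[C]_r, a - c - (b - c) = a - b.
      by move=> a b c; rewrite opprB addrA subrK.
    apply: le_trans k _; rewrite mulrA ler_wpM2r ?nr_ge0 //.
    have -> : (8 * q)^-1 * q = 8^-1 by field; exact: lt0r_neq0.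
    by rewrite lef_pV2 ?posrE // ler_nat.
  exists y => _; split.
  - by apply: le_trans yF _; apply: le_trans FD; rewrite ler_wpM2r ?nr_ge0 // ler_nat.
  - apply: le_trans (ler_wpM2l (ltW q0) (le_trans yF (ler_wpM2l _ F0))) _ => //.
    rewrite le_eqVlt; apply/orP; left; apply/eqP; field; exact: lt0r_neq0.
  - by apply/eqP; rewrite -subr_eq0; apply/eqP.
pose y t := sval (sol t); have yP t : `|t| < s -> _ := svalP (sol t).
exists s, q, y; split=> // [t ht|t ht|].
- apply: H2; have [yD _ _] := yP t ht; apply: lt_le_trans (inD _ _ ht yD) _.
  by rewrite ge_min lexx orbT.
- by have [] := yP t ht.
split=> // [t ht|t t' ht ht']; first by have [] := yP t ht.
have [yD _ E] := yP t ht; have [yD' _ E'] := yP t' ht'.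
apply: le_trans (slice_norm _ _ _ _ Hq) _.
have := key t t' (y t) (y t') ht ht' yD yD'.
rewrite -/(y t) in E; rewrite -/(y t') in E'; rewrite E E' subrr sub0r nrN => k.
by apply: lipschitz_algebra k => //; rewrite ?mulr_ge0 ?nr_ge0.
Qed.

(* If the rank of the differential is maximal at [z0] and [w] is in its kernel,
   then [g] has derivative zero along the curve given by [implicit_slice]. *)
Lemma collapse : exists2 z, O z & z != z0 /\ g z = g z0.
Proof.
have [d [q [y [d0 yO yT [q0 Hq ysmall ylip]]]]] := implicit_slice.
have w1 : 0 < nr w by rewrite nr_gt0.
pose x t := slice t (y t).
have dx t : `|t| < d -> forall e : R, 0 < e -> \forall s \near t, nr (g (x s) - g (x t)) <= e * `|s - t|.
  move=> td e e0; have [Ot ut] := yO t td.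
  have [S ES] := factor_through ut (rk Ot).
  have [K K0 HK] := nr_mulmx_bound (1%:M - T *m S).
  have e1 : 0 < e / (K * (2 * nr w)) by rewrite divr_gt0 // !mulr_gt0.
  have [d1 d10 H1] := strict_differential Oo gs gh Ot e1.
  have td' : 0 < d - `|t| by rewrite subr_gt0.
  have d1' : 0 < d1 / (2 * nr w) by rewrite divr_gt0 // mulr_gt0.
  have := near_real t td'; have := near_real t d1'; apply: filterS2 => s s1 s2.
  have sd : `|s| < d by have := ler_normD (s - t) t; rewrite subrK; lra.
  have lip := ylip s t sd td; rewrite -/(x s) -/(x t) in lip.
  have xd : nr (x s - x t) < d1.
    by apply: le_lt_trans lip _; rewrite mulrCA -ltr_pdivlMr // mulr_gt0.
  have := H1 (x s) (x t) xd; rewrite subrr nr0 => /(_ d10).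
  set err := g (x s) - g (x t) - _ => herr.
  have E1 : err *m T = - ((x s - x t) *m jac g (x t) *m T).
    by rewrite /err mulmxBl mulmxBl (yT s sd) (yT t td) subrr sub0r.
  (* Along the curve [g] followed by [T] is constant, and the differential factors through [T], so
     the increment of [g] consists of linearization error alone. *)
  have -> : g (x s) - g (x t) = err *m (1%:M - T *m S).
    rewrite mulmxBr mulmx1 mulmxA E1 mulNmx opprK -!mulmxA (mulmxA (jac _ _)) -ES.
    by rewrite /err subrK.
  apply: le_trans (HK _) _; apply: le_trans (ler_wpM2l (ltW K0) (le_trans herr (ler_wpM2l (ltW e1) lip))) _.
  rewrite le_eqVlt; apply/orP; left; apply/eqP; field.
  by rewrite !lt0r_neq0.
have cst t : 0 < t -> t < d -> g (x t) = g (x 0).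
  move=> t0 td; apply/rowP => j; apply: CP.
    apply: (@zero_derivative_const (fun t => re (g (x t) 0 j)) d) => // s sd e e0.
    apply: filterS (dx s sd e e0) => a; apply: le_trans.
    apply: le_trans (nr_mx_entry (g (x a) - g (x s)) 0 j).
    by rewrite !mxE -reN -reD; exact: re_le_nr.
  apply: (@zero_derivative_const (fun t => im (g (x t) 0 j)) d) => // s sd e e0.
  apply: filterS (dx s sd e e0) => a; apply: le_trans.
  apply: le_trans (nr_mx_entry (g (x a) - g (x s)) 0 j).
  by rewrite !mxE -imN -imD; exact: im_le_nr.
have x0 : x 0 = z0.
  have := ysmall 0; rewrite normr0 mul0r mulr0 => /(_ d0); rewrite pmulr_rle0 // => h.
  have y0 : y 0 = 0 by apply/eqP; rewrite -nr_eq0; apply/eqP/le_anti; rewrite h nr_ge0.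
  by rewrite /x /slice y0 rmorph0 scale0r mul0mx !addr0.
have t0 : 0 < d / 2 by rewrite divr_gt0.
have td : d / 2 < d by rewrite ltr_pdivrMr // ltr_pMr // ltr1n.
have td' : `|d / 2| < d by rewrite gtr0_norm.
exists (x (d / 2)); first by have [] := yO _ td'.
split; last by rewrite cst // x0.
(* If the curve had returned to [z0], the correction would cancel the displacement, but it is at
   most half as long. *)
apply/eqP => e; have := ysmall _ td'; have := Hq (y (d / 2)).
have : ofR (d / 2) *: w = - (y (d / 2) *m Q).
  by move: e; rewrite /x /slice -addrA -[RHS]addr0 => /addrI/eqP; rewrite addr_eq0 => /eqP.
move/(congr1 (@nr R _)); rewrite nrN nrZ nr_ofR gtr0_norm // => <-.
have := mulr_gt0 t0 w1; move: (_ * nr w) (_ * nr (y _)) => a b; lra.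
Qed.
End Collapse.

(** At a point where the rank of the differential is maximal over [O], a nonzero kernel vector would
    produce, by [collapse], a second point with the same image. *)
Lemma injective_immersion n N (O : set 'rV[C]_n) (g : 'rV[C]_n -> 'rV[C]_N) (x : 'rV[C]_n) :
  open O -> O x -> (forall j, csm O (fun z => g z 0 j)) ->
  (forall j v z, O z -> W iC v (fun z => g z 0 j) z = 0) ->
  (forall y z, O y -> O z -> g y = g z -> y = z) ->
  exists2 z, O z & row_free (jac g z).
Proof.
move=> Oo Ox gs gh ginj.
pose P m := `[< exists2 z, O z & \rank (jac g z) = m >].
have exP : exists m, P m by exists (\rank (jac g x)); apply/asboolP; exists x.
have ubP m : P m -> (m <= n)%N by move=> /asboolP[z _ <-]; exact: rank_leq_row.
case: (ex_maxnP exP ubP) => r /asboolP[z0 Oz0 rz0] rmax.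
have rk z : O z -> (\rank (jac g z) <= r)%N by move=> Oz; apply: rmax; apply/asboolP; exists z.
exists z0 => //; apply/negP => /negP nf; exfalso.
have [w w0 wJ] : exists2 w : 'rV[C]_n, w != 0 & w *m jac g z0 = 0.
  apply: contrapT => H; move/negP: nf; apply; apply: inj_row_free => v vJ.
  by apply/eqP/negPn/negP => v0; apply: H; exists v.
subst r; set J := jac g z0.
(* In the rank factorization [J = col_base J *m row_base J], one-sided inverses of the factors
   provide [Q] and [T]. *)
have QJT : pinvmx (col_base J) *m J *m pinvmx (row_base J) = 1%:M.
  rewrite -[in X in _ *m X *m _](mulmx_base J) mulmxA -mulmxA mulmxVp ?row_base_free // mulmx1.
  by rewrite mulVpmx // col_base_full.
have [z Oz [zz0 e]] := collapse Oo gs gh Oz0 rk QJT w0 wJ.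
by move/eqP: zz0; apply; exact: ginj.
Qed.
End InjectiveMap.

(** * Charts, leaves and tangent spaces *)

Section SmoothMaps.
Variable R : realType.
Local Notation C := (Cx R).

Definition smap m n (O : set 'rV[C]_m) (f : 'rV[C]_m -> 'rV[C]_n) :=
  forall j, csm O (fun z => f z 0 j).

Lemma smap_sub m n (O O' : set 'rV[C]_m) (f : 'rV[C]_m -> 'rV[C]_n) :
  O' `<=` O -> smap O f -> smap O' f.
Proof. by move=> OO' H j; exact: csm_sub OO' (H j). Qed.

Lemma smooth_smap m n (O : set 'rV[C]_m) (f : 'rV[C]_m -> 'rV[C]_n) :
  smooth_map_on O f -> smap O f.
Proof. by move=> H j; have [h1 h2] := H j. Qed.

Lemma hol_smap m n (O : set 'rV[C]_m) (f : 'rV[C]_m -> 'rV[C]_n) : open O ->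
  holomorphic_on O f -> smap O f /\ (forall j v z, O z -> W iC v (fun z => f z 0 j) z = 0).
Proof.
move=> Oo H; split=> [j|j v z Oz]; first by apply: hol_csm => //; exact: hol_coord.
by apply: hol_Wb Oz; exact: hol_coord.
Qed.

Lemma coord_holomorphic n (O : set 'rV[C]_n) : holomorphic_on O (fun z : 'rV[C]_n => z).
Proof. by move=> z _; exact: ex_diff. Qed.

Lemma smap_id n (O : set 'rV[C]_n) : open O -> smap O (fun z : 'rV[C]_n => z).
Proof. by move=> Oo; have [] := hol_smap Oo (@coord_holomorphic n O). Qed.

Lemma dmap_id n v (z : 'rV[C]_n) : dmap (fun y => y) v z = v.
Proof.
apply/rowP => j; rewrite mxE.
have [|e e0|_ //] := @frechet_cderiv R n (fun y => y 0 j) z (fun h => h 0 j) _ _ v.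
  by move=> c x y; rewrite !mxE.
apply: filterS (@near_nr R _ (0 : 'rV[C]_n) 1 ltr01) => h _.
rewrite [(z + h) 0 j]mxE (addrC (z 0 j)) addrK subrr nr0.
by rewrite mulr_ge0 ?nr_ge0 // ltW.
Qed.

Lemma line_cvg0 n (z v : 'rV[C]_n) : (z + ofR t *: v) @[t --> (0 : R)] --> z.
Proof.
have e : z + ofR 0 *: v = z by rewrite rmorph0 scale0r addr0.
rewrite -[X in _ --> X]e; exact: line_continuous.
Qed.

Lemma line_near n (z v : 'rV[C]_n) (P : set 'rV[C]_n) : nbhs z P ->
  \forall t \near (0 : R), P (z + ofR t *: v).
Proof. exact: line_cvg0. Qed.

Lemma smap_rd m n (O : set 'rV[C]_m) (f : 'rV[C]_m -> 'rV[C]_n) w z : smap O f -> O z ->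
  forall j, rderivable w (fun y => re (f y 0 j)) z /\ rderivable w (fun y => im (f y 0 j)) z.
Proof. by move=> H Oz j; exact: csm_rd (H j) Oz. Qed.

Lemma dmap_near m n (O : set 'rV[C]_m) (f g : 'rV[C]_m -> 'rV[C]_n) w z : smap O f -> O z ->
  (\forall y \near z, f y = g y) -> dmap g w z = dmap f w z.
Proof.
move=> H Oz fg; apply/rowP => j; rewrite !mxE; apply: (near_cderiv w (H j) Oz).
by apply: filterS fg => y ->.
Qed.

Lemma dmap_comp m n l (O' : set 'rV[C]_m) (O : set 'rV[C]_n) (f : 'rV[C]_m -> 'rV[C]_n)
    (g : 'rV[C]_n -> 'rV[C]_l) w z : open O' -> open O -> (forall y, O' y -> O (f y)) ->
  smap O' f -> smap O g -> O' z ->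
  dmap (fun y => g (f y)) w z = dmap g (dmap f w z) (f z).
Proof.
move=> O'o Oo fO Hf Hg Oz; apply/rowP => j; rewrite [LHS]mxE [RHS]mxE.
exact: (cderiv_comp Oo fO Hf w (Hg j) Oz).
Qed.

Lemma smap_comp m n l (O' : set 'rV[C]_m) (O : set 'rV[C]_n) (f : 'rV[C]_m -> 'rV[C]_n)
    (g : 'rV[C]_n -> 'rV[C]_l) : open O' -> open O -> (forall y, O' y -> O (f y)) ->
  smap O' f -> smap O g -> smap O' (fun y => g (f y)).
Proof. by move=> O'o Oo fO Hf Hg j; exact: (csm_comp O'o Oo fO Hf (Hg j)). Qed.

Lemma dmapD m n (O : set 'rV[C]_m) (f : 'rV[C]_m -> 'rV[C]_n) v w z : open O -> smap O f -> O z ->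
  dmap f (v + w) z = dmap f v z + dmap f w z.
Proof. by move=> Oo H Oz; apply/rowP => j; rewrite !mxE (cderivD_dir v w Oo (H j) Oz). Qed.
Lemma dmapZ m n (O : set 'rV[C]_m) (f : 'rV[C]_m -> 'rV[C]_n) (t : R) v z : open O -> smap O f -> O z ->
  dmap f (ofR t *: v) z = ofR t *: dmap f v z.
Proof. by move=> Oo H Oz; apply/rowP => j; rewrite !mxE (cderivZ_dir t v Oo (H j) Oz). Qed.

Lemma is_derive_near_const (f : R -> R) d : is_derive (0 : R) 1 f d ->
  (\forall t \near (0 : R), f t = f 0) -> d = 0.
Proof.
move=> [_ <-] H; suff [_ e] : is_derive (0 : R) 1 f 0 by [].
apply/is_derive_eps => e e0; apply: filterS H => t ht.
by rewrite add0r ht mulr0 subr0 subrr normr0 mulr_ge0 // ltW.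
Qed.

Lemma curve_coord_const m n (O : set 'rV[C]_m) (f : 'rV[C]_m -> 'rV[C]_n) (c : R -> 'rV[C]_m) a j :
  open O -> smap O f -> O (c 0) -> curve_d c 0 a ->
  (\forall t \near (0 : R), f (c t) 0 j = f (c 0) 0 j) -> dmap f a (c 0) 0 j = 0.
Proof.
move=> Oo H Oc ca Hc; rewrite mxE; have [/smooth_C1 h1 /smooth_C1 h2] := H j.
apply: CP; rewrite ?re_cderiv ?im_cderiv.
  apply: (is_derive_near_const (curve_chain Oo h1 Oc ca)).
  by apply: filterS Hc => t /= ->.
apply: (is_derive_near_const (curve_chain Oo h2 Oc ca)).
by apply: filterS Hc => t /= ->.
Qed.
End SmoothMaps.

Section ChartTopology.
Variables (R : realType) (M : topologicalType) (n : nat).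
Local Notation C := (Cx R).
Implicit Types (c : chart R M n).

Lemma chart_inj c x y : is_chart c -> cdom c x -> cdom c y -> cmap c x = cmap c y -> x = y.
Proof. by move=> [_ _ K _ _] cx cy e; rewrite -(K x cx) e K. Qed.

Lemma chart_open_image c (A : set M) : is_chart c -> open A -> open (cmap c @` (cdom c `&` A)).
Proof.
move=> [d o K _ ci] Ao; rewrite openE => _ [y [cy Ay] <-].
have im : (cmap c @` cdom c) (cmap c y) by exists y.
have nA : nbhs (cinv c (cmap c y)) A by rewrite K //; exact: open_nbhs_nbhs.
have n1 : nbhs (cmap c y) (cmap c @` cdom c) by exact: open_nbhs_nbhs.
have n2 : nbhs (cmap c y) (cinv c @^-1` A) := ci _ im _ nA.
apply: filterS (@filterI _ _ (nbhs_filter (cmap c y)) _ _ n1 n2) => _ [[x cx <-]] /=.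
by rewrite K // => Ax; exists x.
Qed.

Lemma chart_open_preimage c (O : set 'rV[C]_n) : is_chart c -> open O ->
  open (cdom c `&` cmap c @^-1` O).
Proof.
move=> [d o K cc ci] Oo; rewrite openE => y [cy Oy].
have n1 : nbhs y (cdom c) by exact: open_nbhs_nbhs.
have nO : nbhs (cmap c y) O by exact: open_nbhs_nbhs.
have n2 : nbhs y (cmap c @^-1` O) := cc _ cy _ nO.
exact: (@filterI _ _ (nbhs_filter y) _ _ n1 n2).
Qed.

Lemma open_overlap c c' : is_chart c -> is_chart c' -> open (overlap c c').
Proof. by move=> h [d _ _ _ _]; exact: chart_open_image. Qed.

Lemma overlap_near c y (P : set M) : is_chart c -> open P -> P y -> cdom c y ->
  \forall z \near cmap c y, (cdom c `&` P) (cinv c z) /\ cmap c (cinv c z) = z.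
Proof.
move=> hc Po Py cy; have o := chart_open_image hc Po.
have : nbhs (cmap c y) (cmap c @` (cdom c `&` P)).
  by apply: open_nbhs_nbhs; split=> //; exists y.
by have [_ _ K _ _] := hc; apply: filterS => _ [x [h1 h2] <-]; rewrite K.
Qed.
End ChartTopology.

(** * Changes of charts and their differentials *)

Section Transitions.
Variables (R : realType) (M : topologicalType) (n : nat).
Local Notation C := (Cx R).
Local Notation V := 'rV[C]_n.
Implicit Types (c : chart R M n).

Definition trans c c' (z : V) : V := cmap c' (cinv c z).

Lemma transE c c' q : is_chart c -> cdom c q -> trans c c' (cmap c q) = cmap c' q.
Proof. by move=> [_ _ K _ _] cq; rewrite /trans K. Qed.

Lemma trans_comp c1 c2 c3 q v : is_chart c1 -> is_chart c2 -> is_chart c3 ->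
  smap (overlap c1 c2) (trans c1 c2) -> smap (overlap c2 c3) (trans c2 c3) ->
  cdom c1 q -> cdom c2 q -> cdom c3 q ->
  dmap (trans c1 c3) v (cmap c1 q) =
  dmap (trans c2 c3) (dmap (trans c1 c2) v (cmap c1 q)) (cmap c2 q).
Proof.
move=> h1 h2 h3 s12 s23 q1 q2 q3.
have o2 : open (cdom c2) by case: h2.
have o3 : open (cdom c3) by case: h3.
pose O' := cmap c1 @` (cdom c1 `&` (cdom c2 `&` cdom c3)).
have O'o : open O' by apply: chart_open_image => //; exact: openI.
have O'q : O' (cmap c1 q) by exists q.
have O'12 : O' `<=` overlap c1 c2 by move=> _ [x [x1 [x2 _]] <-]; exists x.
have fO z : O' z -> overlap c2 c3 (trans c1 c2 z).
  by move=> [x [x1 [x2 x3]] <-]; rewrite transE //; exists x.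
have s12' : smap O' (trans c1 c2) := smap_sub O'12 s12.
have o23 := open_overlap h2 h3.
rewrite -(transE c2 h1 q1) -(dmap_comp v O'o o23 fO s12' s23 O'q).
apply: (dmap_near v (smap_comp O'o o23 fO s12' s23) O'q).
have : nbhs (cmap c1 q) O' by exact: open_nbhs_nbhs.
by apply: filterS => _ [x [x1 [x2 x3]] <-]; rewrite !transE.
Qed.

Lemma trans_self c q v : is_chart c -> cdom c q -> dmap (trans c c) v (cmap c q) = v.
Proof.
move=> hc cq; have o := open_overlap hc hc.
rewrite -[RHS](dmap_id v (cmap c q)); apply: (dmap_near v (smap_id o)); first by exists q.
have : nbhs (cmap c q) (overlap c c) by apply: open_nbhs_nbhs; split=> //; exists q.
by apply: filterS => _ [x [x1 _] <-]; rewrite transE.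
Qed.

Lemma trans_back c c' q v : is_chart c -> is_chart c' ->
  smap (overlap c c') (trans c c') -> smap (overlap c' c) (trans c' c) ->
  cdom c q -> cdom c' q ->
  dmap (trans c' c) (dmap (trans c c') v (cmap c q)) (cmap c' q) = v.
Proof. by move=> h h' s s' q1 q2; rewrite -(trans_comp v h h' h s s' q1 q2 q1) trans_self. Qed.
End Transitions.

Section Tangent.
Variables (R : realType) (n : nat) (M : complexManifold R n) (k : nat) (F : complexFoliation M k).
Local Notation C := (Cx R).
Local Notation V := 'rV[C]_n.
Implicit Types (c e : chart R M n) (q : M) (a v : V).

Lemma atlas_trans c c' : atlas c -> atlas c' ->
  smap (overlap c c') (trans c c') /\
  (forall j v z, overlap c c' z -> W iC v (fun z => trans c c' z 0 j) z = 0).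
Proof.
move=> ac ac'; have [h _] := atlas_compatible ac ac'.
by apply: hol_smap h; apply: open_overlap; exact: atlas_chart.
Qed.

Lemma fatlas_trans e c : fatlas F e -> atlas c ->
  smap (overlap e c) (trans e c) /\ smap (overlap c e) (trans c e).
Proof.
move=> fe ac; have [h1 h2] := fatlas_smooth fe ac.
by split; apply: smooth_smap.
Qed.

Lemma tangentP c q a : tangent F c q a <-> exists e v,
  [/\ fatlas F e, cdom e q, same_transverse k v 0 & a = dmap (trans e c) v (cmap e q)].
Proof.
split=> -[e [v [h1 h2 h3 h4]]]; exists e, v; split=> //.
  by apply/rowP => j; rewrite h4 mxE.
by move=> j; rewrite h4 mxE.
Qed.

Lemma tangent_trans c c' q a : atlas c -> atlas c' -> cdom c q -> cdom c' q ->
  tangent F c q a -> tangent F c' q (dmap (trans c c') a (cmap c q)).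
Proof.
move=> ac ac' cq cq' /tangentP[e [v [fe eq tv ->]]]; apply/tangentP.
exists e, v; split=> //.
by rewrite (trans_comp v (fatlas_chart fe) (atlas_chart ac) (atlas_chart ac')
  (fatlas_trans fe ac).1 (atlas_trans ac ac').1 eq cq cq').
Qed.

(** Transverse coordinates are constant along a curve inside a plaque, so its velocity read in [e]
    is parallel to the plaques. *)
Lemma plaque_curve_tangent c e q (g : R -> M) a : atlas c -> fatlas F e -> cdom c q -> cdom e q ->
  g 0 = q -> (\forall t \near (0 : R), cdom c (g t) /\ plaque k e q (g t)) ->
  curve_d (fun t => cmap c (g t)) 0 a ->
  exists2 v, same_transverse k v 0 & a = dmap (trans e c) v (cmap e q).
Proof.
move=> ac fe cq eq g0 gp ga; have [s1 s2] := fatlas_trans fe ac.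
have hc := atlas_chart ac; have he := fatlas_chart fe.
exists (dmap (trans c e) a (cmap c q)); last by rewrite trans_back.
move=> j kj; rewrite [RHS]mxE -g0.
apply: (curve_coord_const (open_overlap hc he) s2 _ ga); first by rewrite g0; exists q.
apply: filterS gp => t [ct [et st]]; rewrite g0 !transE //.
by rewrite -(st j kj).
Qed.

(** [tangent] may be witnessed by any foliated chart. A line in a plaque of that chart stays, near
    [q], in the plaque of the prescribed chart [e], which can then serve as witness. *)
Lemma tangent_chart c e q a : atlas c -> fatlas F e -> cdom c q -> cdom e q -> tangent F c q a ->
  exists2 v, same_transverse k v 0 & a = dmap (trans e c) v (cmap e q).
Proof.
move=> ac fe cq eq /tangentP[e' [v [fe' eq' tv ->]]].
have he' := fatlas_chart fe'; have [d' o' K' cc' ci'] := he'.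
have hc := atlas_chart ac; have [s1 _] := fatlas_trans fe' ac.
have [W [Wo Wq WW HW]] := fatlas_compatible fe' fe eq' eq.
pose g (t : R) : M := cinv e' (cmap e' q + ofR t *: v).
have g0 : g 0 = q by rewrite /g rmorph0 scale0r addr0 K'.
have Oq : overlap e' c (cmap e' q) by exists q.
apply: (plaque_curve_tangent (g := g) ac fe cq eq g0); last first.
  by have := curve_dmap (smap_rd v s1 Oq).
have WC : open (W `&` cdom c) by apply: openI => //; case: hc.
have n0 := overlap_near he' WC (conj Wq cq) eq'.
apply: filterS (line_near v n0); move=> t /= [[et [Wt ct]] Et].
split=> //; split; first by have [] := WW _ Wt.
apply: HW => // j kj; rewrite Et !mxE (tv j kj) mxE mulr0 addr0 //.
Qed.

Lemma plaque_leaf_open e q : fatlas F e -> cdom e q -> leaf_open F (plaque k e q).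
Proof.
move=> fe eq c y fc cy [ey sy].
have [W [Wo Wy WW HW]] := fatlas_compatible fc fe cy ey.
exists W; split=> // x [Wx [cx sx]]; have [_ ex] := WW _ Wx; split=> // j kj.
by rewrite (sy j kj); exact: HW.
Qed.

Lemma open_leaf_open (U : set M) : open U -> leaf_open F U.
Proof. by move=> Uo c y _ _ Uy; exists U; split=> // x []. Qed.

Section LeafMap.
Variables (l : nat) (f : 'rV[C]_l -> M).
Hypothesis f_cont : forall U, leaf_open F U -> open (f @^-1` U).
Hypothesis f_hol : forall c, atlas c -> holomorphic_on (f @^-1` cdom c) (cmap c \o f).

Lemma leaf_map_open (U : set M) : open U -> open (f @^-1` U).
Proof. by move=> Uo; apply: f_cont; exact: open_leaf_open. Qed.

Lemma leaf_map_smap c : atlas c ->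
  smap (f @^-1` cdom c) (fun x => cmap c (f x)) /\
  (forall j (v z : 'rV[C]_l), (f @^-1` cdom c) z -> W iC v (fun z => cmap c (f z) 0 j) z = 0).
Proof.
move=> ac; apply: (hol_smap _ (f_hol ac)); apply: leaf_map_open.
by have [] := atlas_chart ac.
Qed.

(** Continuity for the leaf topology keeps the image of a short segment inside one plaque. *)
Lemma leaf_map_tangent c (x v : 'rV[C]_l) : atlas c -> cdom c (f x) ->
  tangent F c (f x) (dmap (fun x => cmap c (f x)) v x).
Proof.
move=> ac cx; have [e fe ex] := fatlas_cover F (f x); have [s _] := leaf_map_smap ac.
have co : open (cdom c) by have [] := atlas_chart ac.
pose g (t : R) := f (x + ofR t *: v).
have g0 : g 0 = f x by rewrite /g rmorph0 scale0r addr0.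
have [w tw ->] : exists2 w, same_transverse k w 0 & dmap (fun x => cmap c (f x)) v x = dmap (trans e c) w (cmap e (f x)).
  apply: (plaque_curve_tangent (g := g) ac fe cx ex g0); last exact: curve_dmap (smap_rd v s cx).
  have n1 : nbhs x (f @^-1` (cdom c)) by apply: open_nbhs_nbhs; split=> //; exact: leaf_map_open.
  have n2 : nbhs x (f @^-1` (plaque k e (f x))).
    by apply: open_nbhs_nbhs; split; [apply: f_cont; exact: plaque_leaf_open | split].
  exact: (line_near v (@filterI _ _ (nbhs_filter x) _ _ n1 n2)).
by apply/tangentP; exists e, w.
Qed.
End LeafMap.

Lemma same_transverse_pid v : (k <= n)%N -> same_transverse k v 0 ->
  v = v *m (pid_mx k : 'M[C]_(n, k)) *m (pid_mx k : 'M[C]_(k, n)).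
Proof.
move=> kn tv; rewrite -mulmxA mul_pid_mx !minnn.
apply/rowP => j; rewrite mxE (bigD1 j) //= big1 => [|i ij].
  rewrite !mxE eqxx /= addr0; case: ltnP => jk; first by rewrite mulr1.
  by rewrite (tv j jk) mxE mul0r.
by rewrite !mxE (inj_eq val_inj) (negbTE ij) mulr0.
Qed.

Lemma pid_same_transverse (v : 'rV[C]_k) : same_transverse k (v *m (pid_mx k : 'M[C]_(k, n))) 0.
Proof.
move=> j kj; rewrite !mxE big1 // => i _; rewrite !mxE.
case: eqP => [ij|]; last by rewrite mulr0.
by rewrite ij ltnNge kj /= mulr0.
Qed.

(* A foliated chart identifies the tangent space with C^k real-linearly, and
   the tangent space is a complex subspace. *)
Lemma tangent_rank c q (U : 'M[C]_n) : (k <= n)%N -> atlas c -> cdom c q ->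
  (forall a, tangent F c q a <-> a *m U = 0) -> \rank (kermx U) = k.
Proof.
move=> kn ac cq TU; have [e fe eq] := fatlas_cover F q.
have hc := atlas_chart ac; have he := fatlas_chart fe.
have [s1 s2] := fatlas_trans fe ac.
have o1 := open_overlap he hc; have o2 := open_overlap hc he.
have O1 : overlap e c (cmap e q) by exists q.
have O2 : overlap c e (cmap c q) by exists q.
pose X := row_base (kermx U); pose I : 'M[C]_(k, n) := pid_mx k; pose J : 'M[C]_(n, k) := pid_mx k.
have IJ : I *m J = 1%:M by rewrite /I /J mul_pid_mx minnn (minn_idPr kn) pid_mx_1.
have TX a : tangent F c q a -> a = a *m pinvmx X *m X.
  move=> /TU ta; rewrite mulmxKpV // eq_row_base; exact/sub_kermxP.
(* Each inequality comes from an injective real-linear map: from coordinates in the kernel to plaque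
   directions, and back. *)
apply/eqP; rewrite eqn_leq; apply/andP; split.
  apply: (@real_linear_dim R _ _ (fun b => dmap (trans c e) (b *m X) (cmap c q) *m J)).
  - by move=> v w; rewrite mulmxDl (dmapD _ _ o2 s2 O2) mulmxDl.
  - by move=> t v; rewrite -scalemxAl (dmapZ _ _ o2 s2 O2) scalemxAl.
  move=> b bJ; have /(tangent_chart ac fe cq eq)[v tv E] : tangent F c q (b *m X).
    apply/TU; apply/sub_kermxP; apply: submx_trans (submxMl _ _) _; by rewrite eq_row_base.
  move: bJ; rewrite E trans_back // => vJ.
  have v0 : v = 0 by rewrite (same_transverse_pid kn tv) vJ mul0mx.
  have d0 : dmap (trans e c) 0 (cmap e q) = 0.
    have := dmapZ 0 0 o1 s1 O1; rewrite rmorph0 !scale0r; exact.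
  apply: (row_free_inj (row_base_free (kermx U))).
  by rewrite mul0mx E v0 d0.
apply: (@real_linear_dim R k (\rank (kermx U)) (fun v : 'rV[C]_k => dmap (trans e c) (v *m I) (cmap e q) *m pinvmx X)).
- by move=> v w; rewrite mulmxDl (dmapD _ _ o1 s1 O1) mulmxDl.
- by move=> t v; rewrite -scalemxAl (dmapZ _ _ o1 s1 O1) scalemxAl.
move=> v v0.
have : tangent F c q (dmap (trans e c) (v *m I) (cmap e q)).
  by apply/tangentP; exists e, (v *m I); split=> //; exact: pid_same_transverse.
move=> /TX; rewrite v0 mul0mx => E.
have := trans_back (v *m I) he hc s1 s2 eq cq; rewrite E.
have -> : dmap (trans c e) 0 (cmap c q) = 0.
  have := dmapZ 0 0 o2 s2 O2; rewrite rmorph0 !scale0r; exact.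
by move=> e0; rewrite -[v]mulmx1 -IJ mulmxA -e0 mul0mx.
Qed.
End Tangent.

(** * Local frames of the tangent distribution *)

Section ComplementFrame.
Variable R : realType.
Local Notation C := (Cx R).

Lemma complement_frame n k p (T : 'M[C]_n) : (k + p)%N = n -> \rank T = k ->
  exists (B : 'M[C]_(k, n)) (E : 'M[C]_(p, n)) (K : 'M[C]_(n, k)) (Pi : 'M[C]_(n, p)),
  [/\ (B <= T)%MS, B *m K = 1%:M /\ B *m Pi = 0, E *m K = 0 /\ E *m Pi = 1%:M,
      K *m B + Pi *m E = 1%:M & forall a : 'rV_n, (a <= T)%MS -> (a <= B)%MS].
Proof.
move=> kp rT.
have [B [fB BT]] : exists B : 'M[C]_(k, n), row_free B /\ (B :=: T)%MS.
  by rewrite -rT; exists (row_base T); split; [exact: row_base_free | exact: eq_row_base].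
have rC : \rank (T^C)%MS = p by rewrite mxrank_compl rT -kp addKn.
have [E [fE ET]] : exists E : 'M[C]_(p, n), row_free E /\ (E :=: T^C)%MS.
  by rewrite -rC; exists (row_base (T^C)%MS); split; [exact: row_base_free | exact: eq_row_base].
pose G := col_mx B E.
have fG : row_full G.
  by rewrite /row_full /G -addsmxE (adds_eqmx BT ET); exact: addsmx_compl_full.
have gG : row_free G by rewrite /row_free (eqP fG) kp.
pose K := lsubmx (pinvmx G); pose Pi := rsubmx (pinvmx G).
have KP : pinvmx G = row_mx K Pi by rewrite hsubmxK.
have := mulmxVp gG; rewrite KP /G mul_col_row (scalar_mx_block k p).
move=> /eq_block_mx[h1 h2 h3 h4].
have := mulVpmx fG; rewrite KP /G mul_row_col => h5.
by exists B, E, K, Pi; split=> // [|a]; rewrite BT.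
Qed.

Definition psd n (U : 'M[C]_n) := adj U = U /\ forall x : 'rV_n, 0 <= re ((x *m U *m adj x) 0 0).

(** For [w = y *m U], the form at [y - t w] is [- 2 t |w| ^+ 2 + O(t ^+ 2)]; nonnegativity for small
    positive [t] forces [w = 0]. *)
Lemma psd_kernel n (U : 'M[C]_n) (y : 'rV[C]_n) : psd U -> re ((y *m U *m adj y) 0 0) = 0 -> y *m U = 0.
Proof.
move=> [hU pU] y0; set w := y *m U.
have wy : (w *m adj w) 0 0 = ofR (fro w).
  rewrite mxE /fro big_ord1 rmorph_sum; apply: eq_bigr => j _.
  by rewrite !mxE /= nr_sqr; apply: CP; rewrite !reimE; ring.
have wUy : w *m U *m adj y = w *m adj w by rewrite -mulmxA {2}/w adjM hU.
have yUw : y *m U *m adj w = w *m adj w by [].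
have key (t : R) : 0 <= - 2 * t * fro w + t ^+ 2 * re ((w *m U *m adj w) 0 0).
  have := pU (y - ofR t *: w).
  have -> : (y - ofR t *: w) *m U *m adj (y - ofR t *: w) =
    y *m U *m adj y - ofR (2 * t) *: (w *m adj w) + ofR (t ^+ 2) *: (w *m U *m adj w).
    have -> : adj (y - ofR t *: w) = adj y - ofR t *: adj w.
      by apply/matrixP => i j; rewrite !mxE cjD cjN cjM cj_ofR.
    rewrite !mulmxBl !mulmxBr -!scalemxAl -!scalemxAr wUy -/w.
    move: (w *m adj w) (w *m adj y) (w *m U *m adj w) => a b c.
    rewrite scalerA -rmorphM -expr2 mulr_natl mulr2n rmorphD scalerDl.
    by rewrite !opprD !opprK !addrA.
  have re3 (X1 X2 X3 : 'M[C]_1) (a b : R) : re ((X1 - ofR a *: X2 + ofR b *: X3) 0 0) =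
      re (X1 0 0) - a * re (X2 0 0) + b * re (X3 0 0).
    by rewrite !mxE !reD reN !reM !re_ofR !im_ofR !mul0r !subr0.
  by rewrite re3 y0 add0r wy re_ofR !mulNr.
apply: fro_eq0; set m := fro w in key *; set Q := re _ in key.
have m0 : 0 <= m := fro_ge0 w.
apply/eqP/negPn/negP => m1; have m2 : 0 < m by rewrite lt_neqAle eq_sym m1.
have q1 : 0 < `|Q| + 1 by rewrite ltr_wpDl.
have := key (m / (`|Q| + 1)).
have -> : - 2 * (m / (`|Q| + 1)) * m + (m / (`|Q| + 1)) ^+ 2 * Q =
  (m ^+ 2 / (`|Q| + 1) ^+ 2) * (Q - 2 * (`|Q| + 1)) by field; exact: lt0r_neq0.
rewrite pmulr_rge0; last by rewrite divr_gt0 // exprn_gt0.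
have := ler_norm Q; have := normr_ge0 Q; move: (`|Q|) (Q) => a b; lra.
Qed.

Lemma psd_sub n p (U : 'M[C]_n) (E : 'M[C]_(p, n)) : psd U -> psd (E *m U *m adj E).
Proof.
move=> [hU pU]; split; first by rewrite !adjM adjK hU mulmxA.
by move=> x; have := pU (x *m E); rewrite adjM !mulmxA.
Qed.

Lemma psd_unit_posdef p (H : 'M[C]_p) : psd H -> H \in unitmx -> posdef H.
Proof.
move=> pH uH; split=> [|x x0]; first by case: pH.
rewrite lt_neqAle (pH.2 x) andbT eq_sym; apply: contra x0 => /eqP/(psd_kernel pH) xH.
by rewrite -(mulmxK uH x) xH mul0mx.
Qed.
End ComplementFrame.

(** * Construction of the local frames *)

Section LocalData.
Variables (R : realType) (n k p : nat) (M : complexManifold R n) (F : complexFoliation M k).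
Local Notation C := (Cx R).
Local Notation V := 'rV[C]_n.
Hypothesis kp : (k + p)%N = n.

(* On [ld_dom] the tangent spaces are the row spaces of [B + s z *m E]; the
   matrix [(K | Pi)] is the inverse of [(B / E)]. *)
Record local_data (c : chart R M n) := LocalData {
  ld_dom : set V;
  ld_pot : V -> R;
  ld_B : 'M[C]_(k, n); ld_E : 'M[C]_(p, n); ld_K : 'M[C]_(n, k); ld_Pi : 'M[C]_(n, p);
  ld_s : V -> 'M[C]_(k, p);
  ld_open : open ld_dom;
  ld_sub : ld_dom `<=` cmap c @` cdom c;
  ld_pot_smooth : smooth_on ld_dom ld_pot;
  ld_s_smooth : msm ld_dom ld_s;
  ld_hess : forall z, ld_dom z -> frame ld_B ld_E ld_s z *m hess ld_pot z = 0;
  ld_posdef : forall z, ld_dom z -> posdef (ld_E *m hess ld_pot z *m adj ld_E);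
  ld_BK : ld_B *m ld_K = 1%:M; ld_BPi : ld_B *m ld_Pi = 0;
  ld_EK : ld_E *m ld_K = 0; ld_EPi : ld_E *m ld_Pi = 1%:M;
  ld_KB : ld_K *m ld_B + ld_Pi *m ld_E = 1%:M;
  ld_tangent : forall z a, ld_dom z ->
    tangent F c (cinv c z) a <-> a = a *m ld_K *m frame ld_B ld_E ld_s z }.

Lemma open_nr_ball m (z : 'rV[C]_m) (d : R) : open [set y | nr (y - z) < d].
Proof.
rewrite openE => y /= yd; apply/nbhs_nr; exists (d - nr (y - z)); first by rewrite subr_gt0.
move=> x xy /=; have := nrD (x - y) (y - z); rewrite addrA subrK; lra.
Qed.

(** Near [q] the tangent spaces are graphs over the one at [q]. The frame is made orthogonal to [E]
    for the Levi form, and the rank of the Levi form upgrades this to membership in its kernel. *)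
Lemma local_data_exists (c : chart R M n) (q : M) (U : set M) (u : M -> R) :
  atlas c -> cdom c q -> open U -> U q ->
  smooth_psh_on (cmap c @` (U `&` cdom c)) (u \o cinv c) ->
  (forall y, U y -> cdom c y -> forall a : V, tangent F c y a <->
                 (forall l : 'I_n, \sum_j a 0 j * levi (u \o cinv c) j l (cmap c y) = 0)) ->
  exists D : local_data c, ld_dom D (cmap c q).
Proof.
move=> ac cq Uo Uq Hpsh HT; have hc := atlas_chart ac.
set O0 := cmap c @` (U `&` cdom c) in Hpsh *; set w := u \o cinv c in Hpsh HT.
have O0o : open O0 by rewrite /O0 setIC; exact: chart_open_image.
have Hu : smooth_on O0 w by case: Hpsh.
have tgU y a : U y -> cdom c y -> tangent F c y a <-> a *m hess w (cmap c y) = 0.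
  move=> Uy cy; split=> [/(HT y Uy cy a) H|/rowP H].
    apply/rowP => l; rewrite [RHS]mxE; apply: etrans (H l); rewrite mxE.
    by apply: eq_bigr => j _; rewrite [hess _ _ _ _]mxE.
  apply/(HT y Uy cy a) => l; have e := H l; rewrite [RHS]mxE in e; apply: etrans e.
  by rewrite [RHS]mxE; apply: eq_bigr => j _; rewrite [hess _ _ _ _]mxE.
have kn : (k <= n)%N by rewrite -kp leq_addr.
have psdU z : O0 z -> psd (hess w z).
  move=> Oz; split=> [|x]; first exact: (adj_hess O0o Hu Oz).
  exact: (hess_psd O0o Hu x Hpsh Oz).
set z0 := cmap c q; have Oz0 : O0 z0 by exists q.
have rk0 := tangent_rank kn ac cq (fun a => tgU q a Uq cq).
have [B [E [K [Pi [BT [BK BPi] [EK EPi] KB TB]]]]] := complement_frame kp rk0.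
pose H z := E *m hess w z *m adj E.
have mU := msm_hess O0o Hu.
have mH : msm O0 H := msmM O0o (msmM O0o (msm_cst O0 E) mU) (msm_cst O0 (adj E)).
(* A null vector of the semidefinite form is in its kernel; an [x *m E] in the kernel would lie in
   the row space of [B], to which [E] is complementary. *)
have uH0 : H z0 \in unitmx.
  rewrite -row_free_unit; apply: inj_row_free => x xH.
  have xE : x *m E *m hess w z0 = 0.
    apply: (psd_kernel (psdU z0 Oz0)).
    have -> : x *m E *m hess w z0 *m adj (x *m E) = x *m H z0 *m adj x by rewrite adjM /H !mulmxA.
    by rewrite xH mul0mx mxE.
  have /TB/submxP[d dB] : (x *m E <= kermx (hess w z0))%MS by apply/sub_kermxP.
  by rewrite -[x]mulmx1 -EPi mulmxA dB -mulmxA BPi mulmx0.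
have [d d0 Hd] := unit_near O0o mH Oz0 uH0.
pose O := [set z : V | nr (z - z0) < d].
have Oo : open O by exact: open_nr_ball.
have OO0 : O `<=` O0 by move=> z /Hd[].
have uH z : O z -> H z \in unitmx by move=> /Hd[].
(* The solution of [(B + s *m E) *m hess w *m adj E = 0]. *)
pose s z := - (B *m hess w z *m adj E *m invmx (H z)).
have ms : msm O s.
  apply: (msmN Oo (msmM Oo (msmM Oo (msmM Oo (msm_cst O B) (msm_sub OO0 mU)) (msm_cst O (adj E))) _)).
  exact: (msm_inv Oo (msm_sub OO0 mH) uH).
have posH z : O z -> posdef (H z).
  by move=> Oz; apply: psd_unit_posdef (uH z Oz); apply: psd_sub; apply: psdU; exact: OO0.
have fU z : O z -> frame B E s z *m hess w z = 0.
  move=> Oz; have [y [Uy cy] yz] := OO0 z Oz.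
  (* The foliated charts give the kernel dimension [k] at every point of [U], not only at [q]. *)
  have rkU : (\rank (hess w z) <= p)%N.
    have := tangent_rank kn ac cy (fun a => tgU y a Uy cy); rewrite yz mxrank_ker => rkk.
    by rewrite -(leq_add2l k) kp -rkk subnK // rank_leq_row.
  have [S ES] := factor_through (uH z Oz) rkU.
  have e : frame B E s z *m hess w z *m adj E = 0.
    rewrite /frame /s mulNmx !mulmxBl.
    have -> : B *m hess w z *m adj E *m invmx (H z) *m E *m hess w z *m adj E =
       B *m hess w z *m adj E *m invmx (H z) *m H z by rewrite /H !mulmxA.
    by rewrite mulmxKV ?uH // subrr.
  by rewrite ES !mulmxA e mul0mx.
have tg z a : O z -> tangent F c (cinv c z) a <-> a = a *m K *m frame B E s z.
  move=> Oz; have [y [Uy cy] yz] := OO0 z Oz.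
  have -> : cinv c z = y by rewrite -yz; have [_ _ ->] := hc.
  have tgy := tgU y a Uy cy; rewrite yz in tgy.
  split=> [/tgy aU|e]; last by apply/tgy; rewrite e -mulmxA fU // mulmx0.
  (* The transverse component of [a] relative to the frame at [z]. For [a] in the kernel, [x *m E]
     is in the kernel too, and invertibility of [H z] gives [x = 0]. *)
  pose x := a *m Pi - a *m K *m s z.
  have ax : a - a *m K *m frame B E s z = x *m E.
    rewrite /frame /x mulmxBl mulmxDr -[X in X - _](mulmx1 a) -KB mulmxDr !mulmxA opprD addrA.
    by rewrite (addrC (a *m K *m B)) addrK.
  have xH : x *m H z = 0.
    by rewrite /H !mulmxA -ax mulmxBl -(mulmxA _ (frame _ _ _ _)) fU // aU mulmx0 subrr mul0mx.
  have x0 : x = 0 by rewrite -(mulmxK (uH z Oz) x) xH mul0mx.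
  by apply/eqP; rewrite -subr_eq0 ax x0 mul0mx.
have Osub : O `<=` cmap c @` cdom c by move=> z /OO0[y [_ cy] <-]; exists y.
have Hu' : smooth_on O w := smooth_sub OO0 Hu.
exists (LocalData Oo Osub Hu' ms fU posH BK BPi EK EPi KB tg).
by rewrite /= /O /= subrr nr0.
Qed.
End LocalData.
Arguments ld_open {R n k p M F c} l.
Arguments ld_s_smooth {R n k p M F c} l.
Arguments ld_pot_smooth {R n k p M F c} l.
Arguments ld_hess {R n k p M F c} l [z].
Arguments ld_posdef {R n k p M F c} l [z].
Arguments ld_tangent {R n k p M F c} l [z] a.

(** * Independence of the twist trace from charts and frames *)

Section Invariance.
Variables (R : realType) (n k p : nat) (M : complexManifold R n) (F : complexFoliation M k).
Local Notation C := (Cx R).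
Local Notation V := 'rV[C]_n.
Implicit Types (c : chart R M n).

Definition ld_frame c (D : local_data p F c) z := frame (ld_B D) (ld_E D) (ld_s D) z.
(** The projection along the tangent space at [z], in the coordinates of [E]: it kills the frame and
    is inverse to [E]. *)
Definition ld_rho c (D : local_data p F c) z := ld_Pi D - ld_K D *m ld_s D z.
Definition ld_tw c (D : local_data p F c) (a z : V) : 'M[C]_p :=
  tw (ld_E D) (ld_s D) iC (a *m ld_K D) z.

Section OneChart.
Variables (c : chart R M n) (D : local_data p F c).
Local Notation B := (ld_B D).
Local Notation E := (ld_E D).
Local Notation K := (ld_K D).
Local Notation s := (ld_s D).

Lemma ld_frame_K z : ld_frame D z *m K = 1%:M.
Proof. by rewrite /ld_frame /frame mulmxDl ld_BK -mulmxA ld_EK mulmx0 addr0. Qed.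

Lemma ld_frame_tangent z (a : 'rV[C]_k) : ld_dom D z -> tangent F c (cinv c z) (a *m ld_frame D z).
Proof.
by move=> Dz; apply/(ld_tangent D _ Dz); rewrite -/(ld_frame D z) -(mulmxA a) ld_frame_K mulmx1.
Qed.
Lemma ld_frame_rho z : ld_frame D z *m ld_rho D z = 0.
Proof.
rewrite /ld_rho mulmxBr mulmxA ld_frame_K mul1mx.
by rewrite /ld_frame /frame mulmxDl ld_BPi add0r -mulmxA ld_EPi mulmx1 subrr.
Qed.
Lemma ld_E_rho z : E *m ld_rho D z = 1%:M.
Proof. by rewrite /ld_rho mulmxBr ld_EPi mulmxA ld_EK mul0mx subr0. Qed.
Lemma ld_rho_E z : ld_rho D z *m E = 1%:M - K *m ld_frame D z.
Proof.
rewrite /ld_rho /ld_frame /frame -(ld_KB D) mulmxBl mulmxDr opprD addrA mulmxA.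
by rewrite (addrC (K *m B)) addrK.
Qed.
Lemma msm_ld_frame : msm (ld_dom D) (ld_frame D).
Proof.
have Oo := ld_open D.
apply: (msm_ext Oo _ (msmD Oo (msm_cst _ B) (msmM Oo (ld_s_smooth D) (msm_cst _ E)))) => y _.
by [].
Qed.

Lemma ld_leafwise (d : 'rV[C]_k) z : ld_dom D z -> mW iC (d *m ld_frame D z) s z = 0.
Proof.
move=> Oz; exact: (leafwise_holomorphic (ld_open D) (ld_pot_smooth D) (ld_s_smooth D)
  (ld_hess D) (ld_posdef D) d Oz).
Qed.

(* The (0,1)-derivative of a leafwise section is antilinear and vanishes in
   leaf directions, so it only depends on the direction modulo the leaf. *)
Lemma tw_direction (d : 'rV[C]_k) y z : ld_dom D z ->
  d *m mW iC y s z = cmx (y *m ld_rho D z) *m tw E s iC d z.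
Proof.
move=> Oz; set h := y *m ld_rho D z.
have ey : y = (y *m K) *m ld_frame D z + \sum_g h 0 g *: row g E.
  rewrite -mulmx_sum_row /h -!mulmxA ld_rho_E mulmxBr mulmx1.
  by rewrite (addrC _ (y - _)) subrK.
apply/rowP => a; rewrite mxE [RHS]mxE.
transitivity (\sum_i d 0 i * \sum_g cj (h 0 g) * W iC (row g E) (fun x => s x i a) z).
  apply: eq_bigr => i _; congr (_ * _); rewrite mWE {1}ey.
  rewrite (Wb_comb E (ld_open D) ((y *m K) *m ld_frame D z) (fun g => h 0 g) (ld_s_smooth D i a) Oz).
  have := congr1 (fun A : 'M[C]_(k, p) => A i a) (ld_leafwise (y *m K) Oz).
  by rewrite /= mWE [X in _ = X -> _]mxE => ->; rewrite add0r.
under eq_bigr do rewrite mulr_sumr.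
rewrite exchange_big /=; apply: eq_bigr => g _.
rewrite [cmx _ _ _]mxE [tw _ _ _ _ _ _ _]mxE [X in _ = _ * X]mxE mulr_sumr.
by apply: eq_bigr => i _; rewrite mWE mulrCA.
Qed.
End OneChart.

Lemma jac_hol m (O : set V) (g : V -> 'rV[C]_m) w z : open O -> smap O g ->
  (forall j v z, O z -> W iC v (fun z => g z 0 j) z = 0) -> O z -> mW iC w (jac g) z = 0.
Proof.
move=> Oo gs gh Oz; apply/matrixP => i j; rewrite mWE [RHS]mxE.
transitivity (W iC w (W (- iC) (delta_mx 0 i) (fun y => g y 0 j)) z).
  by congr (W _ _ _ z); apply/funext => y; rewrite mxE.
rewrite (WC iC (- iC) w (delta_mx 0 i) Oo (gs j) Oz).
transitivity (W (- iC) (delta_mx 0 i) (fun=> 0) z); last exact: W_cst.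
apply: (near_W _ _ (csm_cst O 0) Oz).
have : nbhs z O by exact: open_nbhs_nbhs.
by apply: filterS => y Oy; rewrite gh.
Qed.

Section TwoCharts.
Variables (c1 c2 : chart R M n) (D1 : local_data p F c1) (D2 : local_data p F c2) (q : M).
Hypotheses (a1 : atlas c1) (a2 : atlas c2) (q1 : cdom c1 q) (q2 : cdom c2 q).
Hypotheses (d1 : ld_dom D1 (cmap c1 q)) (d2 : ld_dom D2 (cmap c2 q)).
Local Notation psi := (trans c1 c2).
Local Notation J := (jac psi (cmap c1 q)).

(** The differential of the change of charts induced on the normal spaces of the foliation, in the
    two frames [E]. *)
Definition transverse_jac := ld_E D1 *m J *m ld_rho D2 (cmap c2 q).

(** A section pushed to the second chart stays tangent, so it is a combination of the second frame.
    In its (0,1)-derivative the Jacobian is holomorphic, and the derivatives of the coefficients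
    multiply the frame, which [ld_rho] kills. The direction of differentiation enters antilinearly,
    hence the conjugate on one side. *)
Lemma tw_transform (x : V) : x = x *m ld_K D1 *m ld_frame D1 (cmap c1 q) ->
  ld_tw D1 x (cmap c1 q) *m transverse_jac = cmx transverse_jac *m ld_tw D2 (x *m J) (cmap c2 q).
Proof.
move=> ex; set d := x *m ld_K D1 in ex; set z1 := cmap c1 q; set z2 := cmap c2 q.
have h1 := atlas_chart a1; have h2 := atlas_chart a2.
have [s12 hol12] := atlas_trans a1 a2.
have o12 := open_overlap h1 h2.
pose A := (cdom c1 `&` cmap c1 @^-1` (ld_dom D1)) `&` (cdom c2 `&` cmap c2 @^-1` (ld_dom D2)).
have Ao : open A by apply: openI; apply: chart_open_preimage => //; exact: ld_open.
pose O' := cmap c1 @` (cdom c1 `&` A).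
have O'o : open O' by exact: chart_open_image.
have O'z : O' z1 by exists q.
have O'12 : O' `<=` overlap c1 c2 by move=> _ [y [y1 [_ [y2 _]]] <-]; exists y.
have O'1 : O' `<=` ld_dom D1 by move=> _ [y [y1 [[_ y3] _]] <-].
have O'2 z : O' z -> ld_dom D2 (psi z).
  by move=> [y [y1 [_ [y2 y3]]] <-]; rewrite transE.
have psiz : psi z1 = z2 by rewrite transE.
have mf1 : msm O' (ld_frame D1) := msm_sub O'1 (msm_ld_frame D1).
have mdf1 : msm O' (fun z => d *m ld_frame D1 z) := msmM O'o (msm_cst O' d) mf1.
have mj : msm O' (jac psi) := msm_sub O'12 (msm_jac o12 s12).
have mY : msm O' (fun z => d *m ld_frame D1 z *m jac psi z) := msmM O'o mdf1 mj.
have s12' : smap O' psi := smap_sub O'12 s12.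
have hol12' j v z : O' z -> W iC v (fun z => psi z 0 j) z = 0 by move=> /O'12; exact: hol12.
have ms2 : msm O' (fun z => ld_s D2 (psi z)).
  by move=> i j; exact: (csm_comp O'o (ld_open D2) O'2 s12' (ld_s_smooth D2 i j)).
have msE2 : msm O' (fun z => ld_s D2 (psi z) *m ld_E D2) := msmM O'o ms2 (msm_cst O' (ld_E D2)).
have mf2 : msm O' (fun z => ld_frame D2 (psi z)).
  apply: (msm_ext O'o _ (msmD O'o (msm_cst O' (ld_B D2)) msE2)) => y _.
  by [].
have mG : msm O' (fun z => d *m ld_frame D1 z *m jac psi z *m ld_K D2) := msmM O'o mY (msm_cst O' (ld_K D2)).
have key z : O' z -> d *m ld_frame D1 z *m jac psi z *m ld_K D2 *m ld_frame D2 (psi z) =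
   d *m ld_frame D1 z *m jac psi z.
  move=> [y [y1 [[_ y3] [y2 y4]]] <-]; rewrite transE //.
  have yO : overlap c1 c2 (cmap c1 y) by exists y.
  have t1 : tangent F c1 y (d *m ld_frame D1 (cmap c1 y)).
    have [_ _ K1 _ _] := h1; rewrite -{1}(K1 y y1).
    exact: ld_frame_tangent.
  have := tangent_trans a1 a2 y1 y2 t1; rewrite (dmap_jac o12 s12 hol12 _ yO).
  have [_ _ K2 _ _] := h2; rewrite -{1}(K2 y y2) => /(ld_tangent D2 _ y4) e.
  by rewrite -/(ld_frame D2 _) in e; rewrite -e.
have main w : d *m mW iC w (ld_s D1) z1 *m ld_E D1 *m J *m ld_rho D2 z2 =
    x *m J *m ld_K D2 *m mW iC (w *m J) (ld_s D2) z2.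
  have L : mW iC w (fun z => d *m ld_frame D1 z *m jac psi z) z1 =
      d *m mW iC w (ld_s D1) z1 *m ld_E D1 *m J.
    rewrite (mW_mul O'o O'z iC w mdf1 mj) (jac_hol w o12 s12 hol12 (O'12 _ O'z)) mulmx0 addr0.
    rewrite (mW_mul O'o O'z iC w (msm_cst O' d) mf1) mW_cst mul0mx add0r.
    have ms1 : msm O' (ld_s D1) := msm_sub O'1 (ld_s_smooth D1).
    rewrite (mW_add O'z iC w (msm_cst O' (ld_B D1)) (msmM O'o ms1 (msm_cst O' (ld_E D1)))) mW_cst add0r.
    by rewrite (mW_mul O'o O'z iC w ms1 (msm_cst O' (ld_E D1))) mW_cst mulmx0 addr0 !mulmxA.
  have Rr : mW iC w (fun z => d *m ld_frame D1 z *m jac psi z *m ld_K D2 *m ld_frame D2 (psi z)) z1 *m ld_rho D2 z2 =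
     x *m J *m ld_K D2 *m mW iC (w *m J) (ld_s D2) z2.
    rewrite (mW_mul O'o O'z iC w mG mf2) mulmxDl psiz -(mulmxA _ (ld_frame D2 z2)) ld_frame_rho mulmx0 add0r.
    rewrite -ex (mW_add O'z iC w (msm_cst O' (ld_B D2)) msE2) mW_cst add0r.
    rewrite (mW_mul O'o O'z iC w ms2 (msm_cst O' (ld_E D2))) mW_cst mulmx0 addr0.
    rewrite -!mulmxA ld_E_rho mulmx1; congr (_ *m (_ *m (_ *m _))).
    apply/matrixP => i j; rewrite !mWE -(dmap_jac o12 s12 hol12 w (O'12 _ O'z)) -psiz.
    exact: (W_comp (ld_open D2) O'2 s12' hol12' iC w (ld_s_smooth D2 i j) O'z).
  have e := mW_near O'o O'z iC w mY (fun y Oy => esym (key y Oy)).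
  by rewrite -L -e; exact: Rr.
apply/row_matrixP => b; rewrite !row_mul rowK.
have e := etrans (main (row b (ld_E D1))) (tw_direction (D := D2) (x *m J *m ld_K D2) (row b (ld_E D1) *m J) d2).
rewrite /transverse_jac !mulmxA e; congr (_ *m _).
by rewrite -!row_mul; apply/matrixP => i j; rewrite !mxE.
Qed.
End TwoCharts.

Lemma transverse_jac_unit c1 c2 (D1 : local_data p F c1) (D2 : local_data p F c2) q :
  atlas c1 -> atlas c2 -> cdom c1 q -> cdom c2 q ->
  ld_dom D1 (cmap c1 q) -> ld_dom D2 (cmap c2 q) -> transverse_jac D1 D2 q \in unitmx.
Proof.
move=> a1 a2 q1 q2 d1 d2; have h1 := atlas_chart a1; have h2 := atlas_chart a2.
have [s12 hol12] := atlas_trans a1 a2; have [s21 hol21] := atlas_trans a2 a1.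
have o12 := open_overlap h1 h2; have o21 := open_overlap h2 h1.
have O1 : overlap c1 c2 (cmap c1 q) by exists q.
have O2 : overlap c2 c1 (cmap c2 q) by exists q.
have JJ : jac (trans c1 c2) (cmap c1 q) *m jac (trans c2 c1) (cmap c2 q) = 1%:M.
  apply/row_matrixP => i; rewrite row_mul rowE row1.
  rewrite -(dmap_jac o12 s12 hol12 _ O1) -(dmap_jac o21 s21 hol21 _ O2).
  by rewrite trans_back.
suff : transverse_jac D1 D2 q *m transverse_jac D2 D1 q = 1%:M by move=> JJ'; exact: (proj1 (mulmx1_unit JJ')).
set J1 := jac (trans c1 c2) _ in JJ; set J2 := jac (trans c2 c1) _ in JJ.
have e1 : J1 *m (J2 *m ld_rho D1 (cmap c1 q)) = ld_rho D1 (cmap c1 q) by rewrite mulmxA JJ mul1mx.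
suff e2 : ld_frame D2 (cmap c2 q) *m (J2 *m ld_rho D1 (cmap c1 q)) = 0.
  rewrite /transverse_jac -/J1 -/J2 -!mulmxA (mulmxA (ld_rho D2 _)) ld_rho_E mulmxBl mul1mx.
  by rewrite -(mulmxA (ld_K D2)) e2 mulmx0 subr0 e1 ld_E_rho.
apply/row_matrixP => i; rewrite row_mul row0 rowE mulmxA.
set a := delta_mx 0 i *m ld_frame D2 (cmap c2 q).
have [_ _ K1 _ _] := h1; have [_ _ K2 _ _] := h2.
have t2 : tangent F c2 q a.
  by rewrite -{1}(K2 q q2); exact: ld_frame_tangent.
have := tangent_trans a2 a1 q2 q1 t2; rewrite (dmap_jac o21 s21 hol21 _ O2).
rewrite -{1}(K1 q q1) => /(ld_tangent D1 _ d1) ->.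
by rewrite -(mulmxA _ (frame _ _ _ _)) ld_frame_rho mulmx0.
Qed.

(** [conj(N) N] is the square of an antilinear endomorphism, hence linear, and changes by ordinary
    similarity. *)
Lemma trace_twisted_similar (g N1 N2 : 'M[C]_p) : g \in unitmx ->
  N1 *m g = cmx g *m N2 -> \tr (cmx N1 *m N1) = \tr (cmx N2 *m N2).
Proof.
move=> ug e; have e2 : cmx N1 *m N1 *m g = g *m (cmx N2 *m N2).
  by rewrite -mulmxA e mulmxA -cmxM e cmxM cmxK mulmxA.
by rewrite -(mulmxK ug (cmx N1 *m N1)) e2 mxtrace_mulC mulKmx.
Qed.
End Invariance.

(** * Vanishing of the twist *)

Section LocalEquality.
Variables (R : realType) (n : nat).
Local Notation V := 'rV[Cx R]_n.

Lemma rderiv_eq_on (O : set V) (f g : V -> R) v z : open O -> smooth_on O f ->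
  (forall y, O y -> f y = g y) -> O z -> rderiv v g z = rderiv v f z.
Proof.
move=> Oo sf fg Oz; have c1 : C1 O f := smooth_C1 sf.
have nf : \forall w \near z, f w = g w.
  have : nbhs z O by exact: open_nbhs_nbhs.
  by apply: filterS => y /fg.
by have [_ e] := near_rderiv nf (c1 z v Oz).1.
Qed.

Lemma curvature_local (O : set V) (f g : V -> R) v z (q : R) : open O -> smooth_on O f ->
  (forall y, O y -> f y = g y) -> O z ->
  rderiv v f z ^+ 2 + rderiv (iC *: v) f z ^+ 2 + q * f z ^+ 3 <=
  f z * (rderiv v (rderiv v f) z + rderiv (iC *: v) (rderiv (iC *: v) f) z) ->
  rderiv v g z ^+ 2 + rderiv (iC *: v) g z ^+ 2 + q * g z ^+ 3 <=
  g z * (rderiv v (rderiv v g) z + rderiv (iC *: v) (rderiv (iC *: v) g) z).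
Proof.
move=> Oo sf fg Oz.
have e1 w y : O y -> rderiv w f y = rderiv w g y.
  by move=> Oy; rewrite (rderiv_eq_on w Oo sf fg Oy).
have e2 w := rderiv_eq_on w Oo (smooth_rderiv w sf) (e1 w) Oz.
by rewrite (e1 v z Oz) (e1 (iC *: v) z Oz) (fg z Oz) (e2 v) (e2 (iC *: v)).
Qed.

Lemma smooth_on_local (h : V -> R) :
  (forall z, exists (O : set V) (g : V -> R),
    [/\ open O, O z, smooth_on O g & forall y, O y -> g y = h y]) -> smooth_on setT h.
Proof.
move=> H vs z _; have [A [g [Ao Az sg' gh]]] := H z; have sg := (smoothP _ _).1 sg'.
suff : smooth_on A h by move/(_ vs z Az).
by apply/smoothP => N; apply: Ck_ext (sg N).
Qed.
End LocalEquality.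

(** * The twist along a parametrized leaf, and the conclusion *)

Section Main.
Variables (R : realType) (n k p : nat) (M : complexManifold R n) (F : complexFoliation M k).
Local Notation C := (Cx R).
Local Notation V := 'rV[C]_n.
Hypotheses (p0 : (0 < p)%N).
Hypothesis hD : forall (c : chart R M n) q, atlas c -> cdom c q ->
  exists D : local_data p F c, ld_dom D (cmap c q).

Section AlongLeaf.
Variables (l : nat) (f : 'rV[C]_l -> M).
Hypothesis f_cont : forall U, leaf_open F U -> open (f @^-1` U).
Hypothesis f_hol : forall c, atlas c -> holomorphic_on (f @^-1` cdom c) (cmap c \o f).
Variable v : 'rV[C]_l.

Definition leaf_coord (c : chart R M n) (z : 'rV[C]_l) : V := cmap c (f z).
Definition leaf_tw (c : chart R M n) (D : local_data p F c) :=
  tw_along (ld_E D) (ld_s D) (leaf_coord c) v (ld_K D) iC.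
Definition ld_at (c : chart R M n) (D : local_data p F c) z :=
  [/\ atlas c, cdom c (f z) & ld_dom D (leaf_coord c z)].

Lemma open_ld_at c (D : local_data p F c) : atlas c -> open [set z | ld_at D z].
Proof.
move=> ac; have -> : [set z | ld_at D z] = f @^-1` (cdom c `&` cmap c @^-1` ld_dom D).
  by apply/seteqP; split=> z; [move=> [_ h1 h2] | move=> [h1 h2]].
apply: (leaf_map_open f_cont); apply: chart_open_preimage; last exact: ld_open.
exact: atlas_chart.
Qed.

Lemma leaf_coord_smap c (D : local_data p F c) : atlas c ->
  smap [set z | ld_at D z] (leaf_coord c) /\
  (forall j (w z : 'rV[C]_l), ld_at D z -> W iC w (fun z => leaf_coord c z 0 j) z = 0).
Proof.
move=> ac; have [h1 h2] := leaf_map_smap f_cont f_hol ac; split.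
  by apply: smap_sub h1 => z [].
by move=> j w z [_ cz _]; exact: h2.
Qed.

Lemma leaf_coord_tangent c (D : local_data p F c) w z : ld_at D z ->
  dmap (leaf_coord c) w z = dmap (leaf_coord c) w z *m ld_K D *m ld_frame D (leaf_coord c z).
Proof.
move=> [ac cz dz]; apply/(ld_tangent D _ dz).
have [_ _ K _ _] := atlas_chart ac; rewrite /leaf_coord K //.
exact: (leaf_map_tangent f_cont f_hol w ac cz).
Qed.

Lemma leaf_tw_curvature c (D : local_data p F c) z : ld_at D z ->
  let h := twist (leaf_tw D) in
  [/\ 0 <= h z, h z = 0 -> leaf_tw D z = 0 &
  rderiv v h z ^+ 2 + rderiv (iC *: v) h z ^+ 2 + 8 / p%:R * h z ^+ 3 <=
  h z * (rderiv v (rderiv v h) z + rderiv (iC *: v) (rderiv (iC *: v) h) z)].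
Proof.
move=> Dz; have [ac cz dz] := Dz; have [h1 h2] := leaf_coord_smap D ac.
have h3 w : ld_at D w -> ld_dom D (leaf_coord c w) by case.
exact: (twist_along_curvature (ld_open D) (ld_pot_smooth D) (ld_s_smooth D) (ld_hess D)
  (ld_posdef D) (@open_ld_at c D ac) h3 h1 h2 (fun w Dw => leaf_coord_tangent v Dw) p0 Dz).
Qed.

Lemma smooth_leaf_twist c (D : local_data p F c) : atlas c ->
  smooth_on [set z | ld_at D z] (twist (leaf_tw D)).
Proof.
move=> ac; have [h1 h2] := leaf_coord_smap D ac.
have h3 w : ld_at D w -> ld_dom D (leaf_coord c w) by case.
have [h _] := csm_twist_along (ld_E D) (ld_open D) (ld_s_smooth D) v (@open_ld_at c D ac) h3 h1 (ld_K D).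
exact: h.
Qed.

Lemma leaf_twist_indep c1 c2 (D1 : local_data p F c1) (D2 : local_data p F c2) z :
  ld_at D1 z -> ld_at D2 z -> twist (leaf_tw D1) z = twist (leaf_tw D2) z.
Proof.
move=> Dz1 Dz2; have [a1 q1 d1] := Dz1; have [a2 q2 d2] := Dz2.
have u := transverse_jac_unit a1 a2 q1 q2 d1 d2.
have e := tw_transform a1 a2 q1 q2 d1 d2 (leaf_coord_tangent v Dz1).
have E : dmap (leaf_coord c1) v z *m jac (trans c1 c2) (cmap c1 (f z)) = dmap (leaf_coord c2) v z.
  have h1 := atlas_chart a1; have h2 := atlas_chart a2.
  have [s12 hol12] := atlas_trans a1 a2; have o12 := open_overlap h1 h2.
  have Oz : overlap c1 c2 (cmap c1 (f z)) by exists (f z).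
  rewrite -(dmap_jac o12 s12 hol12 _ Oz).
  pose O' := f @^-1` (cdom c1 `&` cdom c2).
  have O'o : open O'.
    by apply: (leaf_map_open f_cont); apply: openI; [case: h1 | case: h2].
  have O'z : O' z by split.
  have [s1 _] := leaf_map_smap f_cont f_hol a1.
  have s1' : smap O' (leaf_coord c1) by apply: smap_sub s1 => w [].
  have fO w : O' w -> overlap c1 c2 (leaf_coord c1 w) by move=> [w1 w2]; exists (f w).
  rewrite -(dmap_comp v O'o o12 fO s1' s12 O'z); symmetry.
  apply: (dmap_near v (smap_comp O'o o12 fO s1' s12) O'z).
  have : nbhs z O' by exact: open_nbhs_nbhs.
  by apply: filterS => w [w1 w2]; rewrite /leaf_coord transE.
rewrite E in e.
exact: (congr1 (@re R) (trace_twisted_similar u e)).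
Qed.

Lemma leaf_twist_zero c (D : local_data p F c) z : ld_at D z -> leaf_tw D z = 0.
Proof.
move=> Dz.
(* Local data are chosen at each point without any coherence; independence of the choice makes the
   resulting function agree near each point with a single smooth local twist. *)
have sel w : {cD : {c : chart R M n & local_data p F c} | ld_at (projT2 cD) w}.
  apply: cid; have [c' ac' cw] := atlas_cover (f w).
  by have [D' D'w] := hD ac' cw; exists (existT _ c' D').
pose h w := twist (leaf_tw (projT2 (sval (sel w)))) w.
have hE c' (D' : local_data p F c') w : ld_at D' w -> twist (leaf_tw D') w = h w.
  by move=> D'w; apply: leaf_twist_indep => //; exact: svalP (sel w).
have hs : smooth_on setT h.
  apply: smooth_on_local => w; have Dw := svalP (sel w).
  set D' := projT2 _ in Dw; have [ac _ _] := Dw.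
  exists [set y | ld_at D' y], (twist (leaf_tw D')).
  split; [exact: open_ld_at | exact: Dw | exact: smooth_leaf_twist |].
  by move=> y Dy; exact: (hE _ _ _ Dy).
have h0 w : h w = 0.
  have Dw := svalP (sel w); have [hw _ _] := leaf_tw_curvature Dw.
  apply: (ahlfors_vanishing (v := v) (_ : 0 < p%:R) hs erefl _ hw); first by rewrite ltr0n.
  move=> y _; have Dy := svalP (sel y); set D' := projT2 _ in Dy.
  have [ac _ _] := Dy; have [_ _] := leaf_tw_curvature Dy.
  have Oo : open [set y | ld_at D' y] := open_ld_at ac; have sg : smooth_on [set y | ld_at D' y] (twist (leaf_tw D')) := smooth_leaf_twist ac.
  exact: (curvature_local Oo sg (fun a Da => hE _ D' a Da) Dy).
have [_ + _] := leaf_tw_curvature Dz; apply.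
by rewrite hE.
Qed.
End AlongLeaf.

Hypothesis hpar : forall q : M, parabolic_leaf F q.

(** A nonzero entry at [q] would stay nonzero near a preimage [z0]. On a small ball inside a sheet
    the parametrization is injective, so somewhere in that ball its differential is injective; there
    every tangent vector is a velocity and the twist vanishes. *)
Lemma tw_zero c (D : local_data p F c) q (d : 'rV[C]_k) : atlas c -> cdom c q ->
  ld_dom D (cmap c q) -> tw (ld_E D) (ld_s D) iC d (cmap c q) = 0.
Proof.
move=> ac cq Dq; have [f [f_im f_cont f_hol f_cov]] := hpar q.
have lq : leaf F q q by exact: Relation_Operators.rt_refl.
have [U [sheets [_ Uq _ Ush [_ shP]]]] := f_cov q lq.
have [z0 _ fz0] : (f @` setT) q by rewrite f_im.
have [S hS Sz0] : (\bigcup_(S in sheets) S) z0 by rewrite -Ush /= fz0.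
have [So Sinj _ _] := shP S hS.
have Dz0 : ld_at f D z0 by split; rewrite /leaf_coord ?fz0.
have [cs ch] := leaf_coord_smap f_cont f_hol D ac.
have O1 : open [set z | ld_at f D z] := open_ld_at f_cont ac.
apply/matrixP => b a; rewrite [RHS]mxE; apply/eqP/negPn/negP => t0.
have mtw : csm (ld_dom D) (fun y => tw (ld_E D) (ld_s D) iC d y b a).
  have mm := msmM (ld_open D) (msm_cst _ d) (msmW (ld_open D) iC (row b (ld_E D)) (ld_s_smooth D)).
  by apply: csm_eq (mm 0 a) => y; rewrite [RHS]mxE.
have mtf : csm [set z | ld_at f D z] ((fun y => tw (ld_E D) (ld_s D) iC d y b a) \o leaf_coord f c).
  by apply: (csm_comp O1 (ld_open D) _ cs mtw) => z [].
have tc := csm_continuous mtf Dz0.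
have tz0 : 0 < nr (tw (ld_E D) (ld_s D) iC d (leaf_coord f c z0) b a).
  by rewrite nr_gt0 /leaf_coord fz0.
have n1 := (@cvg_nr _ _ _ (nbhs z0) _ _ (nbhs_filter z0)).1 tc _ tz0.
have n2 : nbhs z0 S by exact: open_nbhs_nbhs.
have n3 : nbhs z0 [set z | ld_at f D z] by exact: open_nbhs_nbhs.
have nn := @filterI _ _ (nbhs_filter z0) _ _ n1 (@filterI _ _ (nbhs_filter z0) _ _ n2 n3).
have [r r0 Hr] := (nbhs_nr _ _).1 nn.
pose O' := [set z : 'rV[C]_k | nr (z - z0) < r].
have O'o : open O' by exact: open_nr_ball.
have O'z : O' z0 by rewrite /O' /= subrr nr0.
have O'D : O' `<=` [set z | ld_at f D z] by move=> z /Hr[_ []].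
have cinj y z : O' y -> O' z -> leaf_coord f c y = leaf_coord f c z -> y = z.
  move=> Oy Oz e; have [_ [Sy [_ cy _]]] := Hr y Oy; have [_ [Sz [_ cz _]]] := Hr z Oz.
  apply: Sinj; rewrite ?inE //.
  exact: chart_inj (atlas_chart ac) cy cz e.
have ch' j w z : O' z -> W iC w (fun z => leaf_coord f c z 0 j) z = 0.
  by move=> /O'D; exact: ch.
have [z Oz rf] := injective_immersion O'o O'z (smap_sub O'D cs) ch' cinj.
have Dz := O'D z Oz; set J := jac (leaf_coord f c) z in rf.
have JE : J = J *m ld_K D *m ld_frame D (leaf_coord f c z).
  apply/row_matrixP => i; rewrite !row_mul [row i J]rowE.
  by rewrite -(dmap_jac O'o (smap_sub O'D cs) ch' _ Oz); exact: (leaf_coord_tangent f_cont f_hol).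
have uJ : J *m ld_K D \in unitmx.
  rewrite -row_free_unit; apply: inj_row_free => x xJ; apply: (row_free_inj rf).
  by rewrite mul0mx JE mulmxA xJ mul0mx.
(* The direction in [C^k] whose velocity has coordinates [d] in the frame. *)
have := leaf_twist_zero f_cont f_hol (d *m invmx (J *m ld_K D)) Dz.
have -> : leaf_tw f (d *m invmx (J *m ld_K D)) D z = tw (ld_E D) (ld_s D) iC d (leaf_coord f c z).
  rewrite /leaf_tw /tw_along /lcoef (dmap_jac O'o (smap_sub O'D cs) ch' _ Oz) -/J.
  by rewrite -mulmxA mulmxKV.
move=> tz; have [h _] := Hr z Oz; move: h; rewrite /= tz mxE sub0r nrN.
by rewrite ltxx.
Qed.

(** By [tw_direction] the twist determines the (0,1)-derivative of [s] in every direction, the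
    tangent ones contributing zero. *)
Lemma ld_s_holomorphic c (D : local_data p F c) q w : atlas c -> cdom c q ->
  ld_dom D (cmap c q) -> mW iC w (ld_s D) (cmap c q) = 0.
Proof.
move=> ac cq Dq; apply/row_matrixP => i; rewrite row0 rowE.
by rewrite (tw_direction _ _ Dq) tw_zero // mulmx0.
Qed.

Lemma foliation_holomorphic : holomorphic_foliation F.
Proof.
move=> q c ac cq; have [D Dq] := hD ac cq.
exists (cdom c `&` cmap c @^-1` ld_dom D), (ld_frame D); split.
- apply: chart_open_preimage; [exact: atlas_chart | exact: ld_open].
- by [].
- by move=> y [].
- have hol : holomorphic_on (ld_dom D) (ld_frame D).
    apply: (csm_hol_mx (ld_open D) (msm_ld_frame D)) => i j v z Dz.
    have [y cy yz] := ld_sub Dz.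
    have : mW iC v (ld_frame D) z = 0.
      have Oo := ld_open D; have ms := ld_s_smooth D.
      have e := ld_s_holomorphic (D := D) v ac cy; rewrite yz in e.
      rewrite (mW_add Dz iC v (msm_cst _ (ld_B D)) (msmM Oo ms (msm_cst _ (ld_E D)))) mW_cst add0r.
      by rewrite (mW_mul Oo Dz iC v ms (msm_cst _ (ld_E D))) mW_cst mulmx0 addr0 e // mul0mx.
    by move/matrixP/(_ i j); rewrite mWE mxE.
  by move=> _ [y [_ Dy] <-]; exact: hol.
move=> y [cy Dy]; split.
  by apply/row_freeP; exists (ld_K D); exact: ld_frame_K.
move=> a; have [_ _ K _ _] := atlas_chart ac; rewrite -{1}(K y cy).
split=> [/(ld_tangent D _ Dy) ->|/submxP[b ->]]; first exact: submxMl.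
exact: ld_frame_tangent.
Qed.
End Main.

Theorem theorem4p6 (R : realType) (n p : nat) (hn : (1 < n)%N)
  (hp : (1 <= p)%N) (hpn : (p < n)%N)
  (M : complexManifold R n) (F : complexFoliation M (n - p))
  (hMA : locally_monge_ampere F p)
  (hpar : forall q : M, parabolic_leaf F q) :
  holomorphic_foliation F.
Proof.
apply: (foliation_holomorphic hp _ hpar) => c q ac cq.
have [U [u [Uo Uq H]]] := hMA q; have [Hpsh HU] := H c ac.
apply: (local_data_exists (subnK (ltnW hpn)) ac cq Uo Uq Hpsh) => y Uy cy a.
by have [_ _ h] := HU y Uy cy; exact: h.
Qed.
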